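(* Let $n\ge0$ be an integer. As an identity of meromorphic functions on the set of $(t_0,\dots,t_{2n+3},p,q)$ with $0<|p|,|q|<1$ and $\prod_{0\le r\le 2n+3}t_r=pq$, $$I^{(0)}_{BC_n}(t_0,t_1,\dots,t_{2n+3};p,q)=\prod_{0\le r<s\le 2n+3}\Gamma(t_rt_s;p,q).$$
   Context: Notation: for $0<|p|,|q|<1$, $(p;p)=\prod_{k\ge1}(1-p^k)$ and $\Gamma(x;p,q)=\prod_{j,k\ge0}(1-p^{j+1}q^{k+1}/x)(1-p^jq^kx)^{-1}$. Signs $\pm$ in an argument denote a product over all choices of signs. For $\prod_{0\le r\le 2n+3}t_r=pq$ and $|p|,|q|,|t_r|<1$, $$I^{(0)}_{BC_n}(t_0,\dots,t_{2n+3};p,q)=\frac{(p;p)^n(q;q)^n}{2^nn!}\int_{T^n}\frac{\prod_{1\le i\le n}\prod_{0\le r\le 2n+3}\Gamma(t_rz_i^{\pm1};p,q)}{\prod_{1\le i<j\le n}\Gamma(z_i^{\pm1}z_j^{\pm1};p,q)\prod_{1\le i\le n}\Gamma(z_i^{\pm2};p,q)}\prod_{1\le i\le n}\frac{dz_i}{2\pi\sqrt{-1}z_i},$$ with $T^n$ the unit torus; it is extended to a meromorphic function of all parameters satisfying the product condition by replacing $T^n$ by $C^n$, where $C$ is any (possibly disconnected) contour containing all points $p^iq^jt_r$, $i,j\ge0$, and excluding their reciprocals. For $n=0$ the integral is $1$. *)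

(* Defs.v *)
From HB Require Import structures.
From mathcomp Require Import all_boot all_order all_algebra.
From mathcomp Require Import complex.
From mathcomp Require Import all_classical all_reals all_analysis.

Set Implicit Arguments.
Unset Strict Implicit.
Unset Printing Implicit Defensive.

Import Order.TTheory GRing.Theory Num.Theory.
Import numFieldNormedType.Exports.

Local Open Scope classical_set_scope.
Local Open Scope ring_scope.
Local Open Scope complex_scope.

(* The topology and the normed module structure of the complex numbers live   *)
(* on the regular module R[i]^o, hence the casts to it below.                 *)

Section SpecialFunctions.
Variable R : realType.
Implicit Types x p q : R[i].

(* (p;p) *)
Definition qpoch p : R[i] :=
  limn (fun N => \prod_(1 <= k < N.+1) (1 - p ^+ k) : R[i]^o).

(* The double product converges absolutely (x != 0, |p|, |q| < 1), so square  *)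
(* partial products may be used. At a pole one denominator is 0, and the      *)
(* value is then 0 because of the convention 0^-1 = 0.                        *)
Definition ellGamma x p q : R[i] :=
  limn (fun N => \prod_(j < N) \prod_(k < N)
     ((1 - p ^+ j.+1 * q ^+ k.+1 / x) / (1 - p ^+ j * q ^+ k * x)) : R[i]^o).

(* Gamma(x^{+-1} y^{+-1}; p, q) *)
Definition ellGamma4 x y p q : R[i] :=
  ellGamma (x * y) p q * ellGamma (x / y) p q *
  ellGamma (x^-1 * y) p q * ellGamma (x^-1 * y^-1) p q.

End SpecialFunctions.

Section Contours.
Variable R : realType.

(* A C^1 arc [0, 1] -> C; since every C^1 function on [0, 1] extends to a C^1 *)
(* function on the line, we ask for C^1 regularity on the whole of R.         *)
Record C1arc := C1Arc {
  arc_fun :> R -> R[i];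
  arc_derivable : forall s : R,
    derivable (fun u => complex.Re (arc_fun u)) s 1 /\
    derivable (fun u => complex.Im (arc_fun u)) s 1;
  arc_C1 : continuous (derive1 (fun u => complex.Re (arc_fun u))) /\
           continuous (derive1 (fun u => complex.Im (arc_fun u))) }.

Definition arc_deriv (g : C1arc) (s : R) : R[i] :=
  derive1 (fun u => complex.Re (g u)) s +i* derive1 (fun u => complex.Im (g u)) s.

(* A piecewise C^1 closed curve: each arc ends where the next one starts,     *)
(* cyclically.                                                                *)
Record closed_curve := ClosedCurve {
  curve_arcs :> seq C1arc;
  curve_closed : cycle (fun g h : C1arc => g 1 == h 0) curve_arcs }.

Definition contour := seq closed_curve.

Definition contour_support (C : contour) : set R[i] :=
  \big[setU/set0]_(c <- C) \big[setU/set0]_(g <- curve_arcs c)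
     (arc_fun g @` `[0, 1]).

Definition cRintegral (f : R -> R[i]) : R[i] :=
  Rintegral lebesgue_measure `[0, 1] (fun s => complex.Re (f s)) +i*
  Rintegral lebesgue_measure `[0, 1] (fun s => complex.Im (f s)).

Definition contour_integral (C : contour) (f : R[i] -> R[i]) : R[i] :=
  \sum_(c <- C) \sum_(g <- curve_arcs c)
     cRintegral (fun s => f (g s) * arc_deriv g s).

Definition two_pi_i : R[i] := 0 +i* (2 * pi).

Definition winding (C : contour) (a : R[i]) : R[i] :=
  two_pi_i^-1 * contour_integral C (fun z => (z - a)^-1).

Definition contour_contains (C : contour) (a : R[i]) : Prop :=
  ~ contour_support C a /\ winding C a = 1.

Definition contour_excludes (C : contour) (a : R[i]) : Prop :=
  ~ contour_support C a /\ winding C a = 0.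

(* The integral over C^n, as an iterated integral. *)
Fixpoint contour_integral_n (C : contour) (n : nat) :
    (n.-tuple R[i] -> R[i]) -> R[i] :=
  match n with
  | 0 => fun f => f [tuple]
  | m.+1 => fun f => contour_integral C (fun z =>
              contour_integral_n C (fun zs : m.-tuple R[i] => f [tuple of z :: zs]))
  end.

End Contours.

Section SelbergIntegral.
Variables (R : realType) (n : nat).

(* Points ((t, p), q) with t = (t_0, ..., t_{2n+3}). *)
Definition params : normedModType R[i] :=
  ('rV[R[i]]_(2 * n + 4) * R[i]^o * R[i]^o)%type.

Definition par_t (x : params) (r : 'I_(2 * n + 4)) : R[i] := x.1.1 ord0 r.
Definition par_p (x : params) : R[i] := x.1.2.
Definition par_q (x : params) : R[i] := x.2.

Definition param_set : set params := [set x |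
  [/\ 0 < `|par_p x| < 1, 0 < `|par_q x| < 1 &
      \prod_(r < 2 * n + 4) par_t x r = par_p x * par_q x]].

(* The contour has to avoid 0, where the integrand is not defined. If some    *)
(* p^i q^j t_r t_s equals 1, there is no such contour; if all |t_r| < 1, the  *)
(* unit circle is one.                                                        *)
Definition admissible (x : params) (C : contour R) : Prop :=
  ~ contour_support C 0 /\
  forall (r : 'I_(2 * n + 4)) (i j : nat),
    let a := par_p x ^+ i * par_q x ^+ j * par_t x r in
    contour_contains C a /\ contour_excludes C a^-1.

(* Where Gamma(z_i^{+-1} z_j^{+-1}) or Gamma(z_i^{+-2}) has a pole, its       *)
(* inverse is 0 here. This differs from the analytic continuation only at     *)
(* points which, for z_j resp. z_i on a contour and the other variables       *)
(* fixed, do not contribute to the integral.                                  *)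
Definition BC_integrand (x : params) (z : n.-tuple R[i]) : R[i] :=
  let p := par_p x in let q := par_q x in
  (\prod_(i < n) \prod_(r < 2 * n + 4)
     (ellGamma (par_t x r * tnth z i) p q * ellGamma (par_t x r / tnth z i) p q))
  / ((\prod_(i < n) \prod_(j < n | (i < j)%N)
        ellGamma4 (tnth z i) (tnth z j) p q) *
     \prod_(i < n) (ellGamma (tnth z i ^+ 2) p q * ellGamma (tnth z i ^- 2) p q))
  * \prod_(i < n) (two_pi_i R * tnth z i)^-1.

Definition BC_contour_integral (x : params) (C : contour R) : R[i] :=
  qpoch (par_p x) ^+ n * qpoch (par_q x) ^+ n / (2 ^+ n * n`!%:R) *
  contour_integral_n C (BC_integrand x).

(* The value does not depend on the admissible contour; it is the default 0   *)
(* where there is none.                                                       *)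
Definition I_BC (x : params) : R[i] :=
  if n == 0%N then 1
  else xget 0 [set v | exists2 C, admissible x C & v = BC_contour_integral x C].

End SelbergIntegral.

(* F and G are meromorphic on the submanifold X of V, and are equal as        *)
(* meromorphic functions: locally, both are the same quotient g / h of        *)
(* holomorphic functions off the zeros of h, where h is not the zero germ     *)
(* on X. Holomorphic functions on X are locally restrictions of holomorphic   *)
(* functions on V, and the values of F and G on the zeros of h are irrelevant.*)
Definition meromorphic_identity (R : realType) (V : normedModType R[i])
    (X : set V) (F G : V -> R[i]) : Prop :=
  forall x, X x -> exists g h : V -> R[i]^o,
    closure (X `&` [set y | h y != 0]) x /\
    \forall y \near x,
      [/\ differentiable g y, differentiable h y &
          X y -> h y != 0 -> F y = g y / h y /\ G y = g y / h y].

(* Main.v *)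
(** The reciprocal of Gamma(z^(+-1) w^(+-1)) is a product Th_p(z,w) Th_q(z,w) of theta functions,
    and Th_p(z,w) = A(z) B(w) - B(z) A(w) for two theta functions A, B, likewise A', B' for q. By
    Andreief's identity the integral is then a determinant of moments of A^j B^(n-1-j) A'^k B'^(n-1-k)
    against a weight in one variable.
    If prod_r tau_r = p, the odd theta function z^(n+1) prod_r th(tau_r/z) - z^(-n-1) prod_r th(tau_r z)
    is a combination of the A^j B^(n-j), and its moments vanish by the symmetry z -> q/z. This linear
    relation between rows, with A and B vanishing at tau_0 and tau_1, compares the determinants for
    (q tau_0, tau_1, ...) and (tau_0, q tau_1, ...): the quotient of the integral by
    prod_(r<s) Gamma(t_r t_s) does not change under (t_0, t_1) -> (q t_0, t_1/q), nor under the
    analogous shift by p. Approximating q by solutions q_m of q_m^m = w p^(k_m) gives invariance under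
    (t_0, t_1) -> (w t_0, t_1/w) for every w. When w t_0 tends to 1/t_2 the contour is pinched; if A
    vanishes at w t_0 only the moment with j = k = 0 diverges, and its residue multiplies the
    determinant for n - 1, where the parameters t_0, t_1, t_2 are replaced by t_0 t_1 t_2.
    The functions to be integrated are locally uniform limits of rational functions with the same
    poles, so their integrals depend only on winding numbers, as is clear for partial fractions.
    The common numerator and denominator are products of entire functions prod_(j,k) (1 - p^j q^k x). *)

Require Import Defs.
From HB Require Import structures.
From mathcomp Require Import all_boot all_order all_algebra.
From mathcomp Require Import complex ring lra zify perm.
From mathcomp Require Import all_classical all_reals all_analysis.
Set Implicit Arguments.
Unset Strict Implicit.
Unset Printing Implicit Defensive.
Import Order.TTheory GRing.Theory Num.Theory.
Import numFieldNormedType.Exports.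
Local Open Scope classical_set_scope.
Local Open Scope ring_scope.
Local Open Scope complex_scope.

(** * Complex numbers and contour integrals *)

(** No identity theorem enters: parameters move by exact shifts, and the rest is continuity along a
    fixed contour. This is why [q] itself has to move. For fixed [p] and [q] the numbers p^a q^b
    need not be dense; but if q_m^m = w p^k, then m shifts by q_m and k inverse shifts by [p]
    multiply t_0 by exactly w. The divisions on the way require that no t_r t_s, nor t_0 / t_1, lies
    in the group generated by [p] and [q]. The parameters are therefore multiplied by integer powers
    of a real number 1 + d. The exponents have sum 0, which preserves the product of the parameters,
    but no two of them add up to 0, so that only countably many d are bad. The recursion at the
    pinch carries the factor 2 n / ((p;p) (q;q)): the 2 counts the poles at x and 1 / x, and n is a
    quotient of the factorials in Andreief's identity. The product of these factors is the
    reciprocal of the normalization of the integral. At the start, n = 0, the six gamma factors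
    cancel in pairs. *)

Section ComplexBasics.
Variable R : realType.
Notation C := (R[i])^o.
Implicit Types (u v z : R[i]).

(** The norm of [R[i]] takes its values in [R[i]]; estimates are made with this real-valued modulus
    instead. *)
Definition cabs z : R := ComplexField.Normc.normc z.

Arguments cabs : simpl never.

Lemma normcE_cabs z : `|z| = (cabs z)%:C.
Proof. by rewrite normc_def /cabs; case: z => a b. Qed.

Lemma cabs0 : cabs 0 = 0. Proof. exact: ComplexField.Normc.normc0. Qed.
Lemma cabs1 : cabs 1 = 1. Proof. exact: ComplexField.Normc.normc1. Qed.
Lemma cabsM (x y : R[i]) : cabs (x * y) = cabs x * cabs y.
Proof. exact: ComplexField.Normc.normcM. Qed.
Lemma cabsV (x : R[i]) : cabs x^-1 = (cabs x)^-1.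
Proof. exact: ComplexField.Normc.normcV. Qed.
Lemma cabs_ge0 z : 0 <= cabs z.
Proof. by rewrite /cabs; case: z => a b; exact: sqrtr_ge0. Qed.
Lemma cabs_eq0 z : (cabs z == 0) = (z == 0).
Proof.
apply/eqP/eqP => [|->]; [exact: ComplexField.Normc.eq0_normc|exact: cabs0].
Qed.
Lemma cabs_gt0 z : (0 < cabs z) = (z != 0).
Proof. by rewrite lt_def cabs_ge0 andbT cabs_eq0. Qed.
Lemma cabsD (x y : R[i]) : cabs (x + y) <= cabs x + cabs y.
Proof. by have := ler_normD x y; rewrite !normcE_cabs -rmorphD lecR. Qed.
Lemma cabsN z : cabs (- z) = cabs z.
Proof. by apply: complexI; rewrite -!normcE_cabs normrN. Qed.
Lemma cabsB (x y : R[i]) : cabs (x - y) = cabs (y - x).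
Proof. by rewrite -cabsN opprB. Qed.
Lemma cabs_sub_le (x y : R[i]) : cabs x - cabs y <= cabs (x - y).
Proof. by have := cabsD (x - y) y; rewrite subrK; lra. Qed.
Lemma cabsX z n : cabs (z ^+ n) = cabs z ^+ n.
Proof. by elim: n => [|n IH]; rewrite ?expr0 ?cabs1// !exprS cabsM IH. Qed.
Lemma cabs_real (r : R) : cabs r%:C = `|r|.
Proof. by rewrite /cabs /= expr0n /= addr0 sqrtr_sqr. Qed.
Lemma Re_le_cabs z : `|complex.Re z| <= cabs z.
Proof.
case: z => a b; rewrite /cabs /= -(sqrtr_sqr a) ler_wsqrtr//.
by rewrite lerDl sqr_ge0.
Qed.
Lemma Im_le_cabs z : `|complex.Im z| <= cabs z.
Proof.
case: z => a b; rewrite /cabs /= -(sqrtr_sqr b) ler_wsqrtr//.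
by rewrite lerDr sqr_ge0.
Qed.
Lemma cabs_le_ReIm z : cabs z <= `|complex.Re z| + `|complex.Im z|.
Proof.
case: z => a b.
have e : a +i* b = a%:C + 'i%C * b%:C :> R[i].
  by apply/eqP; rewrite eq_complex /=; apply/andP; split; apply/eqP; ring.
rewrite {1}e; apply: (le_trans (cabsD _ _)).
have i1 : cabs 'i%C = 1 :> R by rewrite /cabs /= expr0n add0r expr1n sqrtr1.
by rewrite cabsM !cabs_real i1 mul1r /= lexx.
Qed.
Lemma cabs_sqr z : ((cabs z) ^+ 2)%:C = z * z^*.
Proof. by rewrite -sqr_normc normcE_cabs rmorphXn. Qed.

Definition ccvg (T : Type) (F : set_system T) (f : T -> R[i]) (l : R[i]) : Prop :=
  (f : T -> C) @ F --> (l : C).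

Lemma ccvg_cst (T : Type) (F : set_system T) {FF : Filter F} (a : R[i]) :
  ccvg F (fun _ => a) a.
Proof. exact: cvg_cst. Qed.

Lemma ccvg_id (a : R[i]) : ccvg (nbhs (a : C)) id a.
Proof. exact: cvg_id. Qed.

Lemma ccvg_eq (T : Type) (F : set_system T) {FF : Filter F} (f g : T -> R[i]) (a : R[i]) :
  (\forall x \near F, f x = g x) -> ccvg F f a -> ccvg F g a.
Proof. by move=> h hf; apply: cvg_trans hf; exact: near_eq_cvg. Qed.

Lemma ccvg_comp (T U : Type) (F : set_system T) (G : set_system U) (f : U -> R[i])
    (u : T -> U) (l : R[i]) : u @ F --> G -> ccvg G f l -> ccvg F (fun x => f (u x)) l.
Proof. by move=> hu hf; exact: (@cvg_comp T U C u f F G). Qed.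

Lemma ccvgP (T : Type) (F : set_system T) {FF : Filter F} (f : T -> R[i]) (l : R[i]) :
  ccvg F f l <-> forall e : R, 0 < e -> \forall x \near F, cabs (l - f x) < e.
Proof.
split=> [h e e0|h].
  have /cvgrPdist_lt/(_ e%:C) := h; rewrite ltcR => /(_ e0).
  by apply: filterS => x; rewrite normcE_cabs ltcR.
apply/cvgrPdist_lt => e e0.
have ere : e = (complex.Re e)%:C.
  by have /ger0_Im := ltW e0; case: (e) => a b /= ->.
have e0' : 0 < complex.Re e by move: e0; rewrite ere ltcR.
have := h _ e0'; apply: filterS => x.
by rewrite normcE_cabs ere ltcR.
Qed.

Lemma ccvg_cabs (T : Type) (F : set_system T) {FF : Filter F} (f : T -> R[i]) (l : R[i]) :
  ccvg F f l -> (fun x => cabs (f x)) @ F --> cabs l.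
Proof.
move=> /ccvgP h; apply/cvgrPdist_lt => e e0.
have := h e e0; apply: filterS => x hx.
rewrite ltr_norml; apply/andP; split.
  by have := cabs_sub_le (f x) l; rewrite cabsB; lra.
by have := cabs_sub_le l (f x); lra.
Qed.

Lemma ccvg_Re (T : Type) (F : set_system T) {FF : Filter F} (f : T -> R[i]) (l : R[i]) :
  ccvg F f l -> (fun x => complex.Re (f x)) @ F --> complex.Re l.
Proof.
move=> /ccvgP h; apply/cvgrPdist_lt => e e0.
have := h e e0; apply: filterS => x; apply: le_lt_trans.
by rewrite -raddfB; exact: Re_le_cabs.
Qed.

Lemma ccvg_Im (T : Type) (F : set_system T) {FF : Filter F} (f : T -> R[i]) (l : R[i]) :
  ccvg F f l -> (fun x => complex.Im (f x)) @ F --> complex.Im l.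
Proof.
move=> /ccvgP h; apply/cvgrPdist_lt => e e0.
have := h e e0; apply: filterS => x; apply: le_lt_trans.
by rewrite -raddfB; exact: Im_le_cabs.
Qed.

Lemma ccvg_ReIm (T : Type) (F : set_system T) {FF : Filter F} (f g : T -> R) (a b : R) :
  f @ F --> a -> g @ F --> b -> ccvg F (fun x => f x +i* g x) (a +i* b).
Proof.
move=> /cvgrPdist_lt hf /cvgrPdist_lt hg; apply/ccvgP => e e0.
have e2 : 0 < e / 2 by rewrite divr_gt0.
have := hf _ e2; have := hg _ e2; apply: filterS2 => x h1 h2.
by apply: (le_lt_trans (cabs_le_ReIm _)) => /=; lra.
Qed.

Lemma ccvg_real (T : Type) (F : set_system T) {FF : Filter F} (f : T -> R) (a : R) :
  f @ F --> a -> ccvg F (fun x => (f x)%:C) a%:C.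
Proof. by move=> h; apply: ccvg_ReIm => //; exact: cvg_cst. Qed.

Lemma ccvg_squeeze (T : Type) (F : set_system T) {FF : Filter F} (f : T -> R[i]) (l : R[i])
    (b : T -> R) :
  (\forall x \near F, cabs (l - f x) <= b x) -> b @ F --> 0 -> ccvg F f l.
Proof.
move=> h /cvgrPdist_lt hb; apply/ccvgP => e e0.
have := hb _ e0; apply: filterS2 h => x h1.
rewrite sub0r normrN => h2; apply: (le_lt_trans h1).
by apply: le_lt_trans h2; exact: ler_norm.
Qed.

Lemma ccvgM (T : Type) (F : set_system T) {FF : Filter F} (f g : T -> R[i]) (a b : R[i]) :
  ccvg F f a -> ccvg F g b -> ccvg F (fun x => f x * g x) (a * b).
Proof. move=> ha hb; exact: (@cvgZ (R[i]) C T F FF f g a b ha hb). Qed.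

Lemma ccvgV (T : Type) (F : set_system T) {FF : Filter F} (f : T -> R[i]) (a : R[i]) :
  a != 0 -> ccvg F f a -> ccvg F (fun x => (f x)^-1) a^-1.
Proof. move=> a0 ha; exact: (@cvgV (R[i]) T F FF f a a0 ha). Qed.

Lemma ccvgD (T : Type) (F : set_system T) {FF : Filter F} (f g : T -> R[i]) (a b : R[i]) :
  ccvg F f a -> ccvg F g b -> ccvg F (fun x => f x + g x) (a + b).
Proof. move=> ha hb; exact: (@cvgD (R[i]) C T F FF f g a b ha hb). Qed.

Lemma ccvgN (T : Type) (F : set_system T) {FF : Filter F} (f : T -> R[i]) (a : R[i]) :
  ccvg F f a -> ccvg F (fun x => - f x) (- a).
Proof. move=> ha; exact: (@cvgN (R[i]) C T F FF f a ha). Qed.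

Lemma ccvgB (T : Type) (F : set_system T) {FF : Filter F} (f g : T -> R[i]) (a b : R[i]) :
  ccvg F f a -> ccvg F g b -> ccvg F (fun x => f x - g x) (a - b).
Proof. move=> ha hb; exact: (@cvgB (R[i]) C T F FF f g a b ha hb). Qed.

Lemma ccvg_prod (T I : Type) (F : set_system T) {FF : Filter F} (r : seq I) (P : pred I)
    (f : I -> T -> R[i]) (l : I -> R[i]) : (forall i, P i -> ccvg F (f i) (l i)) ->
  ccvg F (fun x => \prod_(i <- r | P i) f i x) (\prod_(i <- r | P i) l i).
Proof.
move=> h; elim: r => [|i r IH].
  rewrite big_nil; under eq_fun do rewrite big_nil.
  exact: ccvg_cst.
rewrite big_cons; under eq_fun do rewrite big_cons.
have := h i; case: (P i) => [hi|_]; last exact: IH.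
apply: ccvgM; [exact: hi|exact: IH].
Qed.

Lemma ccvg_sum (T I : Type) (F : set_system T) {FF : Filter F} (r : seq I) (P : pred I)
    (f : I -> T -> R[i]) (l : I -> R[i]) : (forall i, P i -> ccvg F (f i) (l i)) ->
  ccvg F (fun x => \sum_(i <- r | P i) f i x) (\sum_(i <- r | P i) l i).
Proof.
move=> h; elim: r => [|i r IH].
  rewrite big_nil; under eq_fun do rewrite big_nil.
  exact: ccvg_cst.
rewrite big_cons; under eq_fun do rewrite big_cons.
have := h i; case: (P i) => [hi|_]; last exact: IH.
apply: ccvgD; [exact: hi|exact: IH].
Qed.

Lemma ccvgX (T : Type) (F : set_system T) {FF : Filter F} (f : T -> R[i]) (l : R[i]) n :
  ccvg F f l -> ccvg F (fun x => f x ^+ n) (l ^+ n).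
Proof.
move=> h; elim: n => [|n IH].
  rewrite expr0; under eq_fun do rewrite expr0.
  exact: ccvg_cst.
rewrite exprS; under eq_fun do rewrite exprS.
apply: ccvgM; [exact: h|exact: IH].
Qed.

Lemma ccvg_uniq (T : Type) (F : set_system T) {FF : ProperFilter F} (f : T -> R[i]) (a b : R[i]) :
  ccvg F f a -> ccvg F f b -> a = b.
Proof. by apply: cvg_unique; exact: norm_hausdorff. Qed.

End ComplexBasics.
Arguments cabs : simpl never.

(** * Complex-valued integrals over the unit interval *)

Section Integral01.
Variable R : realType.
Notation C := (R[i])^o.
Notation mu := (@lebesgue_measure R).

Definition cont01 (f : R -> R[i]) : Prop :=
  forall s : R, 0 <= s <= 1 -> ccvg (within `[0, 1] (nbhs s)) f (f s).

Lemma cont01_withinP (f : R -> R) :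
  (forall s : R, 0 <= s <= 1 -> f @ within `[0, 1] (nbhs s) --> f s) ->
  {within `[0, 1], continuous f}.
Proof.
by move=> h; apply/subspace_continuousP => x /=; rewrite in_itv /=; exact: h.
Qed.

Lemma cont01_Re f : cont01 f -> {within `[0, 1], continuous (fun s => complex.Re (f s))}.
Proof. by move=> h; apply: cont01_withinP => s hs; apply: ccvg_Re; exact: h. Qed.

Lemma cont01_Im f : cont01 f -> {within `[0, 1], continuous (fun s => complex.Im (f s))}.
Proof. by move=> h; apply: cont01_withinP => s hs; apply: ccvg_Im; exact: h. Qed.

Lemma int01 (f : R -> R) : {within `[0, 1], continuous f} ->
  mu.-integrable `[0, 1] (EFin \o f).
Proof. by move=> h; apply: continuous_compact_integrable => //; exact: segment_compact. Qed.

Lemma cRintegralD (f g : R -> R[i]) : cont01 f -> cont01 g ->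
  cRintegral (fun s => f s + g s) = cRintegral f + cRintegral g.
Proof.
move=> cf cg; rewrite /cRintegral.
under eq_Rintegral do rewrite raddfD /=.
under [X in _ +i* X]eq_Rintegral do rewrite raddfD /=.
rewrite !RintegralD//; try by apply: int01; [exact: cont01_Re|..].
all: by apply: int01; first [exact: cont01_Re | exact: cont01_Im].
Qed.

Lemma cRintegralZ (a : R[i]) (f : R -> R[i]) : cont01 f ->
  cRintegral (fun s => a * f s) = a * cRintegral f.
Proof.
case: a => a b cf; rewrite /cRintegral.
have eR s : complex.Re ((a +i* b) * f s) = a * complex.Re (f s) - b * complex.Im (f s).
  by case: (f s).
have eI s : complex.Im ((a +i* b) * f s) = a * complex.Im (f s) + b * complex.Re (f s).
  by case: (f s).
have iR := int01 (cont01_Re cf); have iI := int01 (cont01_Im cf).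
under eq_Rintegral do rewrite eR.
under [X in _ +i* X]eq_Rintegral do rewrite eI.
have iZ (r : R) (k : R -> R) : mu.-integrable `[0, 1] (EFin \o k) ->
    mu.-integrable `[0, 1] (EFin \o (fun s => r * k s)).
  move=> ik; have := @integrableZl _ _ _ mu `[0, 1] _ r _ ik.
  by apply => //.
rewrite RintegralB ?RintegralD ?RintegralZl//; try exact: iZ.
Qed.

(** The factor 2 comes from bounding the real and imaginary parts separately; any constant would
    do. *)
Lemma cRintegral_bound (f : R -> R[i]) (M : R) : cont01 f ->
  (forall s : R, 0 <= s <= 1 -> cabs (f s) <= M) -> cabs (cRintegral f) <= 2 * M.
Proof.
move=> cf fM; apply: (le_trans (cabs_le_ReIm _)); rewrite /cRintegral /=.
have bd (k : R -> R) : {within `[0, 1], continuous k} ->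
    (forall s : R, 0 <= s <= 1 -> `|k s| <= M) -> `|Rintegral mu `[0, 1] k| <= M.
  move=> ck kM; have ik := int01 ck.
  apply: (le_trans (le_normr_Rintegral _ ik)) => //.
  have cM : mu.-integrable `[0, 1] (EFin \o (fun _ : R => M)).
    by apply: int01; apply: cont01_withinP => s _; exact: cvg_cst.
  have := @le_Rintegral _ _ _ mu `[0, 1] (fun s => `|k s|) (fun _ => M) _ _ cM.
  rewrite Rintegral_cst// [X in fine X]lebesgue_measure_itv /= lte_fin ltr01 oppr0 adde0 mulr1.
  apply => //; first exact: integrable_norm.
rewrite mulr2n mulrDl mul1r lerD//; apply: bd.
- exact: cont01_Re.
- by move=> s /fM; apply: le_trans; exact: Re_le_cabs.
- exact: cont01_Im.
- by move=> s /fM; apply: le_trans; exact: Im_le_cabs.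
Qed.

Lemma Rintegral_FTC01 (f F : R -> R) : {within `[0, 1], continuous f} ->
  (forall s : R, 0 <= s <= 1 -> is_derive s 1 F (f s)) ->
  Rintegral mu `[0, 1] f = F 1 - F 0.
Proof.
move=> cf dF.
have dd (s : R) : 0 <= s <= 1 -> derivable F s 1 by move=> /dF[].
have cF (s : R) : 0 <= s <= 1 -> {for s, continuous F}.
  by move=> /dd h; apply: differentiable_continuous; apply/derivable1_diffP.
rewrite /Rintegral (@continuous_FTC2 _ f F 0 1)//.
- split.
  + by move=> x; rewrite in_itv /= => /andP[? ?]; apply: dd; rewrite !ltW.
  + by apply: cvg_at_right_filter; apply: cF; rewrite lexx ler01.
  + by apply: cvg_at_left_filter; apply: cF; rewrite lexx ler01.
- move=> x; rewrite in_itv /= => /andP[h1 h2].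
  have hd : is_derive x 1 F (f x) by apply: dF; rewrite !ltW.
  by rewrite derive1E derive_val.
Qed.

Lemma cRintegral_FTC (f F : R -> R[i]) : cont01 f ->
  (forall s : R, 0 <= s <= 1 -> is_derive s 1 (fun u => complex.Re (F u)) (complex.Re (f s)) /\
     is_derive s 1 (fun u => complex.Im (F u)) (complex.Im (f s))) ->
  cRintegral f = F 1 - F 0.
Proof.
move=> cf dF; rewrite /cRintegral.
have -> := @Rintegral_FTC01 _ (fun u => complex.Re (F u)) (cont01_Re cf) (fun s hs => (dF s hs).1).
have -> := @Rintegral_FTC01 _ (fun u => complex.Im (F u)) (cont01_Im cf) (fun s hs => (dF s hs).2).
by case: (F 1) (F 0) => a b [c d].
Qed.

(** [f] is not assumed measurable: it inherits this from [g], because all subsets of a countable set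
    are measurable. *)
Lemma Rintegral_countable (f g : R -> R) (N : set R) : {within `[0, 1], continuous g} ->
  countable N -> (forall s : R, 0 <= s <= 1 -> ~ N s -> f s = g s) ->
  Rintegral mu `[0, 1] f = Rintegral mu `[0, 1] g.
Proof.
move=> cg cN fg; congr fine.
have /integrableP[mg _] := int01 cg.
have mc (A : set (measurableTypeR R)) : A `<=` N -> measurable A.
  move=> AN; apply: countable_measurable; first exact: measurable_set1.
  exact: sub_countable (subset_card_le AN) cN.
apply: (@ae_eq_integral _ _ _ mu `[0, 1] (EFin \o g) (EFin \o f)) => //.
  move=> _ Y mY.
  have -> : `[0, 1] `&` (EFin \o f) @^-1` Y =
     (((`[0, 1] : set (measurableTypeR R)) `&` (EFin \o g) @^-1` Y) `\` N) `|` (`[0, 1] `&` (EFin \o f) @^-1` Y `&` N).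
    apply/seteqP; split=> s /=.
      move=> [h1 h2]; have [Ns|Ns] := pselect (N s); first by right.
      by left; split => //; split => //; rewrite -(fg s)//; move: h1; rewrite in_itv.
    move=> [[[h1 h2] Ns]|[[]]//]; split => //.
    by rewrite (fg s)//; move: h1; rewrite in_itv.
  apply: measurableU.
    by apply: measurableD; [exact: mg|exact: mc].
  by apply: mc => s [].
exists N; split; [exact: mc|exact: countable_lebesgue_measure0|].
move=> s /= h; apply: contrapT => Ns; apply: h => hs.
by rewrite /= fg//; move: hs; rewrite in_itv.
Qed.

Lemma cRintegral_countable (f g : R -> R[i]) (N : set R) : cont01 g ->
  countable N -> (forall s : R, 0 <= s <= 1 -> ~ N s -> f s = g s) ->
  cRintegral f = cRintegral g.
Proof.
move=> cg cN fg; rewrite /cRintegral; congr (_ +i* _); apply: (Rintegral_countable _ cN).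
- exact: cont01_Re.
- by move=> s hs Ns; rewrite fg.
- exact: cont01_Im.
- by move=> s hs Ns; rewrite fg.
Qed.

End Integral01.

(** * Contour integrals as sums over arcs *)

Section ContourIntegral.
Variable R : realType.
Notation C := (R[i])^o.
Implicit Types (Ct : contour R) (g : C1arc R).

Lemma is_deriveP (k : R -> R) (s d : R) :
  is_derive s 1 k d <-> (fun h => h^-1 * (k (h + s) - k s)) @ 0^' --> d.
Proof.
have e : (fun h : R => h^-1 *: (k (h *: 1 + s) - k s)) =
         (fun h : R => h^-1 * (k (h + s) - k s)).
  by apply: funext => h; rewrite /GRing.scale /= mulr1.
split=> [[dk dv]|h].
  by rewrite -dv -e; exact: dk.
have dk : derivable k s 1.
  by apply: (cvgP d); rewrite e.
split=> //; apply: cvg_lim; first exact: norm_hausdorff.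
by rewrite e.
Qed.

Lemma arc_cont (g : C1arc R) (s : R) : ccvg (nbhs s) g (g s).
Proof.
have [d1 d2] := arc_derivable g s.
have e : (g : R -> R[i]) = (fun u => complex.Re (g u) +i* complex.Im (g u)).
  by apply: funext => u; case: (g u).
rewrite e; apply: ccvg_ReIm.
  by move: d1 => /derivable1_diffP/differentiable_continuous.
by move: d2 => /derivable1_diffP/differentiable_continuous.
Qed.

Lemma arc_deriv_cont (g : C1arc R) (s : R) : ccvg (nbhs s) (arc_deriv g) (arc_deriv g s).
Proof.
have [d1 d2] := arc_C1 g.
by apply: ccvg_ReIm; [exact: d1|exact: d2].
Qed.

Lemma arc_diff (g : C1arc R) (s : R) :
  ccvg (0 : R)^' (fun h : R => (h^-1)%:C * (g (h + s) - g s)) (arc_deriv g s).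
Proof.
have [d1 d2] := arc_derivable g s.
have h1 : is_derive s 1 (fun u => complex.Re (g u)) (derive1 (fun u => complex.Re (g u)) s).
  by rewrite derive1E; apply: DeriveDef.
have h2 : is_derive s 1 (fun u => complex.Im (g u)) (derive1 (fun u => complex.Im (g u)) s).
  by rewrite derive1E; apply: DeriveDef.
move/is_deriveP in h1; move/is_deriveP in h2.
suff hh : ccvg (0 : R)^' (fun h : R => (h^-1 * (complex.Re (g (h + s)) - complex.Re (g s)))
    +i* (h^-1 * (complex.Im (g (h + s)) - complex.Im (g s)))) (arc_deriv g s).
  apply: ccvg_eq hh; apply: nearW => h.
  case: (g (h + s)) (g s) => a b [c d].
  by apply/eqP; rewrite eq_complex /= !mul0r subr0 addr0 !eqxx.
exact: ccvg_ReIm.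
Qed.

Definition arcs (Ct : contour R) : seq (C1arc R) := flatten (map (@curve_arcs R) Ct).
Definition arc_supp (g : C1arc R) : set R[i] := arc_fun g @` `[0, 1].
Definition arcint (g : C1arc R) (f : R[i] -> R[i]) :=
  cRintegral (fun s => f (g s) * arc_deriv g s).

Lemma contour_integralE Ct f : contour_integral Ct f = \sum_(g <- arcs Ct) arcint g f.
Proof. by rewrite /arcs big_flatten big_map. Qed.

Lemma contour_supportE Ct : contour_support Ct = \big[setU/set0]_(g <- arcs Ct) arc_supp g.
Proof. by rewrite /arcs big_flatten big_map. Qed.

(** Full neighbourhoods in the plane are used, not neighbourhoods within [S]: joint limits in the
    point and in a parameter, as in [contour_integral_cvg], require them. *)
Definition contat (S : set R[i]) (f : R[i] -> R[i]) : Prop :=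
  forall z, S z -> ccvg (nbhs (z : C)) f (f z).

Lemma contatS (S S' : set R[i]) f : S `<=` S' -> contat S' f -> contat S f.
Proof. by move=> h c z /h; exact: c. Qed.
Lemma contat_cst S a : contat S (fun _ => a).
Proof. by move=> z _; exact: ccvg_cst. Qed.
Lemma contat_id S : contat S id.
Proof. by move=> z _; exact: ccvg_id. Qed.
Lemma contatM S (f g : R[i] -> R[i]) : contat S f -> contat S g -> contat S (fun z => f z * g z).
Proof. by move=> hf hg z hz; apply: ccvgM; [exact: hf|exact: hg]. Qed.
Lemma contatD S (f g : R[i] -> R[i]) : contat S f -> contat S g -> contat S (fun z => f z + g z).
Proof. by move=> hf hg z hz; apply: ccvgD; [exact: hf|exact: hg]. Qed.
Lemma contatB S (f g : R[i] -> R[i]) : contat S f -> contat S g -> contat S (fun z => f z - g z).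
Proof. by move=> hf hg z hz; apply: ccvgB; [exact: hf|exact: hg]. Qed.
Lemma contatV S f : (forall z, S z -> f z != 0) -> contat S f -> contat S (fun z => (f z)^-1).
Proof. by move=> h0 hf z hz; apply: ccvgV; [exact: h0|exact: hf]. Qed.
Lemma contat_sum (I : Type) (r : seq I) (P : pred I) (S : set R[i]) (f : I -> R[i] -> R[i]) :
  (forall i, P i -> contat S (f i)) -> contat S (fun z => \sum_(i <- r | P i) f i z).
Proof. by move=> h z hz; apply: ccvg_sum => i Pi; exact: h. Qed.
Lemma contatX S f n : contat S f -> contat S (fun z => f z ^+ n).
Proof. by move=> hf z hz; apply: ccvgX; exact: hf. Qed.

Lemma arc_suppP (g : C1arc R) (s : R) : 0 <= s <= 1 -> arc_supp g (g s).
Proof. by move=> hs; exists s => //=; rewrite in_itv. Qed.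

Lemma arc_cont01 g f : contat (arc_supp g) f -> cont01 (fun s => f (g s) * arc_deriv g s).
Proof.
move=> hf s hs.
have wn : within `[0, 1] (nbhs s) --> nbhs s by exact: cvg_within.
apply: ccvgM.
  have cg : ccvg (within `[0, 1] (nbhs s)) g (g s).
    exact: cvg_trans (cvg_app _ wn) (@arc_cont g s).
  apply: (@ccvg_comp _ _ _ _ _ f (g : R -> C) (f (g s)) cg).
  by apply: hf; exact: arc_suppP.
exact: cvg_trans (cvg_app _ wn) (@arc_deriv_cont g s).
Qed.

Lemma arcintD g f1 f2 : contat (arc_supp g) f1 -> contat (arc_supp g) f2 ->
  arcint g (fun z => f1 z + f2 z) = arcint g f1 + arcint g f2.
Proof.
move=> h1 h2; rewrite /arcint -cRintegralD; try exact: arc_cont01.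
by congr cRintegral; apply: funext => s; rewrite mulrDl.
Qed.

Lemma arcintZ g a f : contat (arc_supp g) f ->
  arcint g (fun z => a * f z) = a * arcint g f.
Proof.
move=> h1; rewrite /arcint -cRintegralZ; try exact: arc_cont01.
by congr cRintegral; apply: funext => s; rewrite mulrA.
Qed.

Lemma contatU (A B : set R[i]) f : contat (A `|` B) f -> contat A f /\ contat B f.
Proof. by move=> h; split=> z hz; apply: h; [left|right]. Qed.

Lemma contour_integralD Ct f1 f2 : contat (contour_support Ct) f1 ->
  contat (contour_support Ct) f2 ->
  contour_integral Ct (fun z => f1 z + f2 z) = contour_integral Ct f1 + contour_integral Ct f2.
Proof.
rewrite contour_supportE !contour_integralE; elim: (arcs Ct) => [|g l IH].
  by rewrite !big_nil addr0.
rewrite !big_cons => /contatU[h1 h1'] /contatU[h2 h2'].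
by rewrite (arcintD h1 h2) (IH h1' h2') addrACA.
Qed.

Lemma contour_integralZ Ct a f : contat (contour_support Ct) f ->
  contour_integral Ct (fun z => a * f z) = a * contour_integral Ct f.
Proof.
rewrite contour_supportE !contour_integralE; elim: (arcs Ct) => [|g l IH].
  by rewrite !big_nil mulr0.
rewrite !big_cons => /contatU[h1 h1'].
by rewrite (arcintZ _ h1) (IH h1') mulrDr.
Qed.

Lemma contour_integralN Ct f : contat (contour_support Ct) f ->
  contour_integral Ct (fun z => - f z) = - contour_integral Ct f.
Proof.
move=> h; rewrite -mulN1r -(contour_integralZ _ h); congr contour_integral.
by apply: funext => z; rewrite mulN1r.
Qed.

Lemma contour_integralB Ct f1 f2 : contat (contour_support Ct) f1 ->
  contat (contour_support Ct) f2 ->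
  contour_integral Ct (fun z => f1 z - f2 z) = contour_integral Ct f1 - contour_integral Ct f2.
Proof.
move=> h1 h2; rewrite -(contour_integralN h2) -(contour_integralD h1).
  by [].
by move=> z hz; apply: ccvgN; exact: h2.
Qed.

Lemma contour_integral0 Ct : contour_integral Ct (fun _ => 0) = 0.
Proof.
have := @contour_integralZ Ct 0 (fun _ => 0) (@contat_cst _ _).
by rewrite !mul0r.
Qed.

Lemma contour_integral_sum (I : Type) (r : seq I) (P : pred I) Ct (f : I -> R[i] -> R[i]) :
  (forall i, P i -> contat (contour_support Ct) (f i)) ->
  contour_integral Ct (fun z => \sum_(i <- r | P i) f i z) =
  \sum_(i <- r | P i) contour_integral Ct (f i).
Proof.
move=> h; elim: r => [|i r IH].
  rewrite big_nil -[RHS](contour_integral0 Ct); congr contour_integral.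
  by apply: funext => z; rewrite big_nil.
rewrite big_cons -IH; case: ifPn => Pi.
  rewrite -contour_integralD; [|exact: h|exact: contat_sum].
  by congr contour_integral; apply: funext => z; rewrite big_cons Pi.
by congr contour_integral; apply: funext => z; rewrite big_cons (negbTE Pi).
Qed.

Lemma eq_contour_integral Ct f1 f2 : (forall z, contour_support Ct z -> f1 z = f2 z) ->
  contour_integral Ct f1 = contour_integral Ct f2.
Proof.
rewrite contour_supportE !contour_integralE; elim: (arcs Ct) => [|g l IH].
  by rewrite !big_nil.
rewrite !big_cons => h; congr (_ + _); last by apply: IH => z hz; apply: h; right.
rewrite /arcint /cRintegral.
have e (s : R) : s \in (`[0, 1]%classic : set R) -> f1 (g s) * arc_deriv g s = f2 (g s) * arc_deriv g s.
  by rewrite inE /= in_itv /= => hs; rewrite h//; left; exact: arc_suppP.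
by congr (_ +i* _); apply: eq_Rintegral => s hs; rewrite e.
Qed.

Lemma contour_integral_cat (C1 C2 : contour R) f :
  contour_integral (C1 ++ C2) f = contour_integral C1 f + contour_integral C2 f.
Proof. by rewrite /contour_integral big_cat. Qed.

Lemma contour_support_cat (C1 C2 : contour R) :
  contour_support (C1 ++ C2) = contour_support C1 `|` contour_support C2.
Proof. by rewrite /contour_support big_cat. Qed.

Lemma arc_deriv_bound g : exists2 K : R, 0 <= K & forall s : R, 0 <= s <= 1 -> cabs (arc_deriv g s) <= K.
Proof.
have ck : {within `[0, 1], continuous (fun s => cabs (arc_deriv g s))}.
  apply: cont01_withinP => s hs.
  apply: ccvg_cabs; exact: cvg_trans (cvg_app _ (cvg_within _)) (@arc_deriv_cont g s).
have [c _ hc] := EVT_max ler01 ck.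
exists (cabs (arc_deriv g c)); first exact: cabs_ge0.
by move=> s hs; apply: hc; rewrite in_itv.
Qed.

(** The constant is chosen before the integrand, so that uniform limits pass through the
    integral. *)
Lemma contour_integral_bound Ct : exists2 K : R, 0 <= K &
  forall f M, 0 <= M -> contat (contour_support Ct) f ->
   (forall z, contour_support Ct z -> cabs (f z) <= M) ->
   cabs (contour_integral Ct f) <= K * M.
Proof.
rewrite contour_supportE.
suff [K K0 hK] : exists2 K : R, 0 <= K & forall f M, 0 <= M ->
    contat (\big[setU/set0]_(g <- arcs Ct) arc_supp g) f ->
    (forall z, (\big[setU/set0]_(g <- arcs Ct) arc_supp g) z -> cabs (f z) <= M) ->
    cabs (\sum_(g <- arcs Ct) arcint g f) <= K * M.
  by exists K => // f M; rewrite contour_integralE; exact: hK.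
elim: (arcs Ct) => [|g l [K K0 IH]].
  by exists 0 => // f M M0 _ _; rewrite big_nil cabs0 mul0r.
have [D D0 hD] := arc_deriv_bound g.
exists (2 * D + K); first by rewrite addr_ge0// mulr_ge0.
move=> f M M0; rewrite !big_cons => /contatU[hf hf'] bf.
apply: (le_trans (cabsD _ _)); rewrite mulrDl lerD//.
  rewrite -mulrA; apply: cRintegral_bound.
    exact: arc_cont01.
  move=> s hs; rewrite cabsM mulrC ler_pM ?cabs_ge0//; first exact: hD.
  by apply: bf; left; exact: arc_suppP.
apply: IH => //.
by move=> z hz; apply: bf; right.
Qed.

End ContourIntegral.

(** * Primitives, exceptional points and limits under the integral sign *)

Section ContourPrimitive.
Variable R : realType.
Notation C := (R[i])^o.
Implicit Types (Ct : contour R) (g : C1arc R).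

(** Caratheodory's form of complex differentiability: [phi] is the difference quotient. It can be
    composed with an arc that returns to the value [z], since nothing is divided by w - z. *)
Definition cderiv (F : R[i] -> R[i]) (z d : R[i]) : Prop :=
  exists phi : R[i] -> R[i], ccvg (nbhs (z : C)) phi d /\
    \forall w \near nbhs (z : C), F w = F z + (w - z) * phi w.

Lemma arcint_prim g F f : (forall z, arc_supp g z -> cderiv F z (f z)) ->
  contat (arc_supp g) f -> arcint g f = F (g 1) - F (g 0).
Proof.
move=> dF cf.
apply: (@cRintegral_FTC _ _ (fun s => F (g s))); first exact: arc_cont01.
move=> s hs.
have [phi [cphi hphi]] := dF _ (arc_suppP g hs).
have cs : (fun h : R => h + s) @ (0 : R)^' --> (s : R).
  rewrite -[X in _ --> X]add0r; apply: cvgD; last exact: cvg_cst.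
  exact: (@nbhs_dnbhs _ (0 : R)).
have cg : (fun h : R => (g (h + s) : C)) @ (0 : R)^' --> (g s : C).
  exact: (@ccvg_comp _ _ _ _ (nbhs s) g (fun h => h + s) _ cs (@arc_cont _ g s)).
have H : ccvg (0 : R)^' (fun h : R => (h^-1)%:C * (F (g (h + s)) - F (g s)))
    (arc_deriv g s * f (g s)).
  have H1 : ccvg (0 : R)^' (fun h : R => (h^-1)%:C * (g (h + s) - g s) * phi (g (h + s)))
      (arc_deriv g s * f (g s)).
    apply: ccvgM; first exact: arc_diff.
    exact: (@ccvg_comp _ _ _ _ (nbhs (g s : C)) phi (fun h => g (h + s)) _ cg cphi).
  apply: ccvg_eq H1.
  refine (@filterS _ (0 : R)^' _ _ _ _ (cg _ hphi)) => h /= ->.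
  by rewrite addrAC subrr add0r mulrA.
rewrite mulrC; split; apply/is_deriveP.
- rewrite (_ : (fun h => _) = fun h => complex.Re ((h^-1)%:C * (F (g (h + s)) - F (g s)))).
    exact: ccvg_Re H.
  apply: funext => h /=.
  by rewrite -raddfB; case: (F _ - F _) => a b /=; rewrite mul0r subr0.
- rewrite (_ : (fun h => _) = fun h => complex.Im ((h^-1)%:C * (F (g (h + s)) - F (g s)))).
    exact: ccvg_Im H.
  apply: funext => h /=.
  by rewrite -raddfB; case: (F _ - F _) => a b /=; rewrite mul0r addr0.
Qed.

Lemma path_sum_telescope (F : R[i] -> R[i]) (p : seq (C1arc R)) (x : C1arc R) :
  path (fun g h : C1arc R => g 1 == h 0) x p ->
  \sum_(h <- p) F (h 0) = \sum_(h <- belast x p) F (h 1).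
Proof.
elim: p x => [|y p IH] x /=; first by rewrite !big_nil.
by move=> /andP[/eqP e /IH h]; rewrite !big_cons h e.
Qed.

(** Around the cycle, the starting points of the arcs are the end points of the arcs in another
    order. *)
Lemma curve_telescope (F : R[i] -> R[i]) (c : closed_curve R) :
  \sum_(g <- curve_arcs c) (F (g 1) - F (g 0)) = 0.
Proof.
case: c => [[|x p] /= h]; first by rewrite big_nil.
have := path_sum_telescope F h; rewrite belast_rcons => e.
rewrite sumrB -e; apply/eqP; rewrite subr_eq0; apply/eqP.
by rewrite -cats1 big_cat /= !big_cons big_nil addr0 addrC.
Qed.

Lemma contour_integral_prim Ct F f : (forall z, contour_support Ct z -> cderiv F z (f z)) ->
  contat (contour_support Ct) f -> contour_integral Ct f = 0.
Proof.
rewrite /contour_support /contour_integral; elim: Ct => [|c Ct IH].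
  by rewrite !big_nil.
rewrite !big_cons => dF /contatU[cf1 cf2].
rewrite (IH _ cf2) ?addr0; last by move=> z hz; apply: dF; right.
rewrite -[RHS](curve_telescope F c).
have {dF} dF z : (\big[setU/set0]_(g <- c) (arc_fun g @` `[0, 1])) z -> cderiv F z (f z).
  by move=> hz; apply: dF; left.
elim: (curve_arcs c) dF cf1 => [|g l IHl]; first by rewrite !big_nil.
rewrite !big_cons => dF /contatU[h1 h2].
rewrite -IHl //; last by move=> z hz; apply: dF; right.
congr (_ + _); apply: arcint_prim h1 => z hz.
by apply: dF; left.
Qed.

(** At a time of nonzero velocity the difference quotients of the arc stay away from 0, so the same
    value is not taken again nearby. *)
Lemma arc_level_isolated g (e : R[i]) (s : R) : g s = e -> arc_deriv g s != 0 ->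
  exists2 d : R, 0 < d & forall u : R, `|u - s| < d -> u != s -> g u != e.
Proof.
move=> gs ds.
have H : (fun h : R => cabs ((h^-1)%:C * (g (h + s) - g s))) @ (0 : R)^' --> cabs (arc_deriv g s).
  by apply: ccvg_cabs; exact: arc_diff.
move/cvgrPdist_lt/(_ (cabs (arc_deriv g s))): H.
rewrite cabs_gt0 => /(_ ds); rewrite /dnbhs /within /= => /nbhs_ballP[d d0 hd].
exists d => // u us une; apply/eqP => gu.
have := hd (u - s); rewrite /ball /= sub0r normrN => /(_ us).
rewrite subr_eq0 => /(_ une).
by rewrite subrK gu gs subrr mulr0 cabs0 subr0 ger0_norm ?cabs_ge0// ltxx.
Qed.

(** These times are isolated from each other, so each is the only one in some interval with rational
    end points. *)
Lemma arc_level_countable g (e : R[i]) :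
  countable [set s : R | g s = e /\ arc_deriv g s != 0].
Proof.
set N := [set s | _].
pose I (ab : rat * rat) : set R := [set s | N s /\ (ratr ab.1 < s < ratr ab.2) /\
   forall u, N u -> ratr ab.1 < u < ratr ab.2 -> u = s].
have : countable (\bigcup_(ab in [set: rat * rat]) I ab).
  apply: bigcup_countable => //= ab _.
  have [->|/set0P[s0 hs0]] := eqVneq (I ab) set0; first exact: countable0.
  apply: (@sub_countable _ _ _ [set s0]); last exact: countable1.
  apply: subset_card_le => s [Ns [hs us]] /=.
  by case: hs0 => N0 [h0 u0]; apply: u0.
apply: sub_countable; apply: subset_card_le => s [gs ds].
have [d d0 hd] := arc_level_isolated gs ds.
have [a] := @rat_in_itvoo R (s - d) s ltac:(lra).
have [b] := @rat_in_itvoo R s (s + d) ltac:(lra).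
rewrite !in_itv /= => /andP[b1 b2] /andP[a1 a2].
exists (a, b) => //=; split=> //; split; first by rewrite a2 b1.
move=> u [gu du] /andP[/= u1 u2]; apply: contrapT => /eqP une.
have := hd u _ une; rewrite gu eqxx; move=> H.
by have : false by apply: H; rewrite ltr_norml; apply/andP; split; lra.
Qed.

(** An arc may rest at a point of [E] during a whole interval, but then its velocity is 0 and so are
    both integrands. The times of nonzero velocity at which a given point is visited are countable
    in number. This disposes of the default values that an integrand takes at poles. *)
Lemma contour_integral_countable Ct f1 f2 (E : set R[i]) :
  contat (contour_support Ct) f2 -> countable E ->
  (forall z, contour_support Ct z -> ~ E z -> f1 z = f2 z) ->
  contour_integral Ct f1 = contour_integral Ct f2.
Proof.
rewrite contour_supportE !contour_integralE => cf cE.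
elim: (arcs Ct) cf => [|g l IH]; first by rewrite !big_nil.
rewrite !big_cons => /contatU[c1 c2] h.
congr (_ + _); last by apply: IH => // z hz; apply: h; right.
apply: (@cRintegral_countable _ _ _
  (\bigcup_(e in E) [set s : R | g s = e /\ arc_deriv g s != 0])).
- exact: arc_cont01.
- by apply: bigcup_countable => // e _; exact: arc_level_countable.
move=> s hs Ns; have [->|ds] := eqVneq (arc_deriv g s) 0; first by rewrite !mulr0.
congr (_ * _); apply: h; first by left; exact: arc_suppP.
by move=> Es; apply: Ns; exists (g s).
Qed.

Lemma arc_supp_compact g : compact (arc_supp g : set C).
Proof.
apply: (@continuous_compact R C g); last exact: segment_compact.
by apply/subspace_continuousP => s _; apply: cvg_trans (@arc_cont _ g s);
   apply: cvg_app; exact: cvg_within.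
Qed.

Lemma contour_support_compact Ct : compact (contour_support Ct : set C).
Proof.
rewrite contour_supportE; elim: (arcs Ct) => [|g l IH].
  by rewrite big_nil; exact: compact0.
by rewrite big_cons; apply: compactU => //; exact: arc_supp_compact.
Qed.

(** Joint convergence at each point of a compact set is uniform. The filter [F] is arbitrary because
    it stands for orders of truncation as well as for parameters. *)
Lemma compact_unif (T : Type) (F : set_system T) {FF : Filter F} (K : set R[i])
    (f : T -> R[i] -> R[i]) (f0 : R[i] -> R[i]) (e : R) : compact (K : set C) -> 0 < e ->
  contat K f0 ->
  (forall z, K z -> ccvg (filter_prod (nbhs (z : C)) F) (fun zt => f zt.2 zt.1) (f0 z)) ->
  \forall t \near F, forall z, K z -> cabs (f0 z - f t z) < e.
Proof.
move=> /compact_near_coveringP cK e0 c0 cf.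
apply: (cK T F (fun t z => cabs (f0 z - f t z) < e) FF) => z Kz.
have e2 : 0 < e / 2 by rewrite divr_gt0.
have /ccvgP/(_ _ e2) h1 := cf z Kz.
have /ccvgP/(_ _ e2) h2 := c0 z Kz.
have h2' : \forall x \near nbhs (z : C) & t \near F, cabs (f0 z - f0 x) < e / 2.
  exists ([set x | cabs (f0 z - f0 x) < e / 2], setT) => /=; last by move=> [x t] [].
  by split => //; exact: filterT.
refine (@filterS _ (filter_prod (nbhs (z : C)) F) _ _ _ _ (filterI h1 h2')) => -[x t] /= [a b].
have := cabsD (f0 x - f0 z) (f0 z - f t x); rewrite addrA subrK (cabsB (f0 x)); lra.
Qed.

Lemma contour_integral_cvg (T : Type) (F : set_system T) {FF : Filter F} Ct
    (f : T -> R[i] -> R[i]) (f0 : R[i] -> R[i]) :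
  contat (contour_support Ct) f0 -> (\forall t \near F, contat (contour_support Ct) (f t)) ->
  (forall z, contour_support Ct z ->
     ccvg (filter_prod (nbhs (z : C)) F) (fun zt => f zt.2 zt.1) (f0 z)) ->
  ccvg F (fun t => contour_integral Ct (f t)) (contour_integral Ct f0).
Proof.
move=> c0 cf jf; apply/ccvgP => e e0.
have [K K0 hK] := contour_integral_bound Ct.
have e1 : 0 < e / (K + 1) by rewrite divr_gt0//; lra.
have := compact_unif (@contour_support_compact Ct) e1 c0 jf.
move=> /(_ FF); apply: filterS2 cf => t ct ht.
rewrite -(contour_integralB c0 ct).
apply: (le_lt_trans (hK _ _ (ltW e1) (contatB c0 ct) (fun z hz => ltW (ht z hz)))).
rewrite mulrA ltr_pdivrMr; last lra.
by rewrite mulrC ltr_pM2l//; lra.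
Qed.

End ContourPrimitive.

(** * Limits of rational functions and winding numbers *)

Section Rational.
Variable R : realType.
Notation C := (R[i])^o.
Implicit Types (Ct : contour R) (E : set R[i]).

Lemma cnear_ne (a z : R[i]) : z != a -> \forall w \near nbhs (z : C), w != a.
Proof.
move=> za; have d0 : 0 < cabs (z - a) by rewrite cabs_gt0 subr_eq0.
have /ccvgP/(_ _ d0) := @ccvg_id _ z; apply: filterS => w hw.
by apply/eqP => e; move: hw; rewrite e ltxx.
Qed.

Lemma cderivX (n : nat) (z : R[i]) : cderiv (fun w => w ^+ n.+1) z (z ^+ n *+ n.+1).
Proof.
exists (fun w => \sum_(i < n.+1) w ^+ (n.+1.-1 - i) * z ^+ i); split.
  rewrite -[in X in ccvg _ _ X](card_ord n.+1) -sumr_const; apply: ccvg_sum => i _.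
  have -> : z ^+ n = z ^+ (n - i) * z ^+ i by rewrite -exprD subnK// -ltnS.
  apply: ccvgM; last exact: ccvg_cst.
  by apply: ccvgX; exact: ccvg_id.
by apply: nearW => w; rewrite -subrXX addrC subrK.
Qed.

Lemma cderivV (n : nat) (a z : R[i]) : z != a ->
  cderiv (fun w => (w - a)^-1 ^+ n.+1) z (- ((z - a)^-1 ^+ n.+2 *+ n.+1)).
Proof.
move=> za.
have za0 : z - a != 0 by rewrite subr_eq0.
exists (fun w => - ((w - a)^-1 * (z - a)^-1) *
   \sum_(i < n.+1) (w - a)^-1 ^+ (n.+1.-1 - i) * (z - a)^-1 ^+ i); split.
  have -> : - ((z - a)^-1 ^+ n.+2 *+ n.+1) = - ((z - a)^-1 * (z - a)^-1) *
      \sum_(i < n.+1) (z - a)^-1 ^+ (n.+1.-1 - i) * (z - a)^-1 ^+ i.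
    rewrite (eq_bigr (fun _ => (z - a)^-1 ^+ n)).
      by rewrite sumr_const card_ord mulNr mulrnAr !exprS mulrA.
    by move=> i _; rewrite -exprD subnK// -ltnS.
  have cv : ccvg (nbhs (z : C)) (fun w => (w - a)^-1) (z - a)^-1.
    apply: ccvgV => //; apply: ccvgB; [exact: ccvg_id|exact: ccvg_cst].
  apply: ccvgM.
    by apply: ccvgN; apply: ccvgM; [exact: cv|exact: ccvg_cst].
  apply: ccvg_sum => i _; apply: ccvgM; last exact: ccvg_cst.
  by apply: ccvgX; exact: cv.
have := cnear_ne za; apply: filterS => w wa.
have wa0 : w - a != 0 by rewrite subr_eq0.
have e : (w - z) * - ((w - a)^-1 * (z - a)^-1) = (w - a)^-1 - (z - a)^-1.
  by field; rewrite wa0 za0.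
by rewrite mulrA e -subrXX addrCA subrr addr0.
Qed.

Lemma contour_integralX Ct n : contour_integral Ct (fun z => z ^+ n) = 0.
Proof.
have n0 : (n.+1%:R : R[i]) != 0 by rewrite pnatr_eq0.
apply: (mulfI n0); rewrite mulr0 -contour_integralZ; last by apply: contatX; exact: contat_id.
apply: (@contour_integral_prim _ _ (fun z => z ^+ n.+1)).
  by move=> z _; rewrite mulr_natl; exact: cderivX.
by apply: contatM; [exact: contat_cst|apply: contatX; exact: contat_id].
Qed.

Lemma contat_inv (S : set R[i]) a : ~ S a -> contat S (fun z => (z - a)^-1).
Proof.
move=> Sa; apply: contatV.
  by move=> z Sz; rewrite subr_eq0; apply/eqP => e; apply: Sa; rewrite -e.
by apply: contatB; [exact: contat_id|exact: contat_cst].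
Qed.

Lemma contour_integralVX Ct a n : ~ contour_support Ct a ->
  contour_integral Ct (fun z => (z - a)^-1 ^+ n.+2) = 0.
Proof.
move=> Sa.
have n0 : (- n.+1%:R : R[i]) != 0 by rewrite oppr_eq0 pnatr_eq0.
have cv := @contatX _ _ _ n.+2 (contat_inv Sa).
apply: (mulfI n0); rewrite mulr0 -(contour_integralZ _ cv).
apply: (@contour_integral_prim _ _ (fun z => (z - a)^-1 ^+ n.+1)).
  move=> z Sz; rewrite mulNr mulr_natl; apply: cderivV.
  by apply/eqP => e; apply: Sa; rewrite -e.
by apply: contatM; [exact: contat_cst|exact: cv].
Qed.

Lemma two_pi_i_neq0 : two_pi_i R != 0.
Proof.
by rewrite /two_pi_i eq_complex /= eqxx /= mulf_neq0 ?pnatr_eq0// gt_eqF// pi_gt0.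
Qed.

Lemma contour_integral_inv Ct a :
  contour_integral Ct (fun z => (z - a)^-1) = two_pi_i R * winding Ct a.
Proof. by rewrite /winding mulrA divff ?two_pi_i_neq0// mul1r. Qed.

Lemma contour_integral_inv0 Ct :
  contour_integral Ct (fun z => z^-1) = two_pi_i R * winding Ct 0.
Proof.
by rewrite -contour_integral_inv; congr contour_integral; apply: funext => z; rewrite subr0.
Qed.

(* Rational functions with poles in [E], as linear combinations of partial fractions. *)
Inductive ratl E : (R[i] -> R[i]) -> Prop :=
| ratl_X k : ratl E (fun z => z ^+ k)
| ratl_VX a k : E a -> ratl E (fun z => (z - a)^-1 ^+ k.+1)
| ratl_D f g : ratl E f -> ratl E g -> ratl E (fun z => f z + g z)
| ratl_Z c f : ratl E f -> ratl E (fun z => c * f z)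
| ratl_eq (s : seq R[i]) f g : (forall a, a \in s -> E a) ->
    (forall z, z \notin s -> f z = g z) -> ratl E f -> ratl E g.

Lemma ratl_eq0 E f g : (forall z, f z = g z) -> ratl E f -> ratl E g.
Proof. by move=> h; apply: (@ratl_eq E [::]) => // z _. Qed.

Lemma ratl_cst E c : ratl E (fun _ => c).
Proof.
apply: (@ratl_eq0 _ (fun z => c * z ^+ 0)); last by apply: ratl_Z; exact: ratl_X.
by move=> z; rewrite expr0 mulr1.
Qed.

Lemma ratl_id E : ratl E id.
Proof. by apply: ratl_eq0 (ratl_X E 1) => z; rewrite expr1. Qed.

Lemma ratl_inv E a : E a -> ratl E (fun z => (z - a)^-1).
Proof. by move=> Ea; apply: ratl_eq0 (ratl_VX 0 Ea) => z; rewrite expr1. Qed.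

Lemma ratl_sub E E' f : E `<=` E' -> ratl E f -> ratl E' f.
Proof.
move=> EE'; elim=> {f} [k|a k Ea|f g _ hf _ hg|c f _ hf|s f g hs fg _ hf].
- exact: ratl_X.
- by apply: ratl_VX; exact: EE'.
- exact: ratl_D.
- exact: ratl_Z.
- by apply: (ratl_eq _ fg) => // a /hs /EE'.
Qed.

Lemma ratl_mulX E f : ratl E f -> ratl E (fun z => z * f z).
Proof.
elim=> {f} [k|a k Ea|f g _ hf _ hg|c f _ hf|s f g hs fg _ hf].
- by apply: ratl_eq0 (ratl_X E k.+1) => z; rewrite exprS.
- have h1 : ratl E (fun z => (z - a)^-1 ^+ k).
    case: k => [|k]; last exact: ratl_VX.
    by apply: ratl_eq0 (ratl_X E 0) => z; rewrite !expr0.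
  (* The identity may fail at the pole [a], where the inverse is 0 by convention; hence the list of
     exceptional points. *)
  apply: (@ratl_eq _ [:: a] _ _ _ _ (ratl_D h1 (ratl_Z a (ratl_VX k Ea)))).
    by move=> b; rewrite inE => /eqP->.
  move=> z; rewrite inE => za; rewrite exprS !mulrA.
  by rewrite -[X in X + _]mul1r -mulrDl; congr (_ * _); field; rewrite subr_eq0.
- by apply: ratl_eq0 (ratl_D hf hg) => z; rewrite mulrDr.
- by apply: ratl_eq0 (ratl_Z c hf) => z; rewrite mulrCA.
- by apply: (ratl_eq hs _ hf) => z zs; rewrite fg.
Qed.

(** Everything rests on (z - a)^-1 (z - b)^-1 = (a - b)^-1 ((z - a)^-1 - (z - b)^-1), applied
    repeatedly to lower the order of the pole at b. *)
Lemma ratl_mulV E a f : E a -> ratl E f -> ratl E (fun z => (z - a)^-1 * f z).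
Proof.
move=> Ea; elim=> {f} [k|b k Eb|f g _ hf _ hg|c f _ hf|s f g hs fg _ hf].
- elim: k => [|k IH].
    by apply: ratl_eq0 (ratl_inv Ea) => z; rewrite expr0 mulr1.
  apply: (@ratl_eq _ [:: a] _ _ _ _ (ratl_D (ratl_X E k) (ratl_Z a IH))).
    by move=> b; rewrite inE => /eqP->.
  move=> z; rewrite inE => za; rewrite exprS !mulrA.
  by rewrite -[X in X + _]mul1r -mulrDl; congr (_ * _); field; rewrite subr_eq0.
- have [<-|ab] := eqVneq a b.
    by apply: ratl_eq0 (ratl_VX k.+1 Ea) => z; rewrite exprS.
  have ab0 : a - b != 0 by rewrite subr_eq0.
  have E2 c : c \in [:: a; b] -> E c by rewrite !inE => /orP[]/eqP->.
  elim: k => [|k IH].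
    apply: (@ratl_eq _ [:: a; b] _ _ E2 _
      (ratl_Z (a - b)^-1 (ratl_D (ratl_inv Ea) (ratl_Z (-1) (ratl_inv Eb))))).
    move=> z; rewrite !inE negb_or => /andP[za zb]; rewrite expr1.
    by field; rewrite !subr_eq0 za zb ab.
  apply: (@ratl_eq _ [:: a; b] _ _ E2 _
      (ratl_Z (a - b)^-1 (ratl_D IH (ratl_Z (-1) (ratl_VX k.+1 Eb))))).
  move=> z; rewrite !inE negb_or => /andP[za zb]; rewrite !(exprS _ k.+1).
  set u := _ ^+ k.+1; by field; rewrite !subr_eq0 za zb ab.
- by apply: ratl_eq0 (ratl_D hf hg) => z; rewrite mulrDr.
- by apply: ratl_eq0 (ratl_Z c hf) => z; rewrite mulrCA.
- by apply: (ratl_eq hs _ hf) => z zs; rewrite fg.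
Qed.

Lemma ratl_M E f g : ratl E f -> ratl E g -> ratl E (fun z => f z * g z).
Proof.
move=> hf hg; elim: hf => {f} [k|a k Ea|f f' _ hf _ hf'|c f _ hf|s f f' hs ff _ hf].
- elim: k => [|k /ratl_mulX]; first by apply: ratl_eq0 hg => z; rewrite mul1r.
  by apply: ratl_eq0 => z; rewrite exprS mulrA.
- elim: k => [|k /(ratl_mulV Ea)].
    by apply: ratl_eq0 (ratl_mulV Ea hg) => z; rewrite expr1.
  by apply: ratl_eq0 => z; rewrite [in RHS]exprS mulrA.
- by apply: ratl_eq0 (ratl_D hf hf') => z; rewrite mulrDl.
- by apply: ratl_eq0 (ratl_Z c hf) => z; rewrite mulrA.
- by apply: (ratl_eq hs _ hf) => z zs; rewrite ff.
Qed.

Lemma ratl_prod E (I : Type) (r : seq I) (P : pred I) (f : I -> R[i] -> R[i]) :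
  (forall i, P i -> ratl E (f i)) -> ratl E (fun z => \prod_(i <- r | P i) f i z).
Proof.
move=> h; elim: r => [|i r IH].
  by apply: ratl_eq0 (ratl_cst E 1) => z; rewrite big_nil.
case Pi : (P i).
  by apply: ratl_eq0 (ratl_M (h i Pi) IH) => z; rewrite big_cons Pi.
by apply: ratl_eq0 IH => z; rewrite big_cons Pi.
Qed.

Lemma ratl_exp E f n : ratl E f -> ratl E (fun z => f z ^+ n).
Proof.
move=> hf; elim: n => [|n IH]; first by apply: ratl_eq0 (ratl_cst E 1) => z.
by apply: ratl_eq0 (ratl_M hf IH) => z; rewrite exprS.
Qed.

Lemma ratl_contat E f : ratl E f -> contat (~` E) f.
Proof.
elim=> {f} [k|a k Ea|f g _ hf _ hg|c f _ hf|s f g hs fg _ hf].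
- by apply: contatX; exact: contat_id.
- by apply: contatX; apply: contat_inv => /(_ Ea).
- exact: contatD.
- by apply: contatM; [exact: contat_cst|exact: hf].
- move=> z Ez.
  have zs : z \notin s by apply/negP => /hs.
  rewrite -fg//; apply: ccvg_eq (hf z Ez).
  have : \forall w \near nbhs (z : C), w \notin s.
    elim: s hs zs {fg} => [|a s IH] hs; first by move=> _; apply: nearW.
    rewrite inE negb_or => /andP[za zs].
    have := IH _ zs; move=> /(_ (fun b hb => hs b ltac:(by rewrite inE hb orbT))).
    have := cnear_ne za; apply: filterS2 => w wa ws.
    by rewrite inE negb_or wa.
  by apply: filterS => w /fg.
Qed.

End Rational.

(** * Integrals of rational functions *)

Section RationalIntegrals.
Variable R : realType.
Notation C := (R[i])^o.
Implicit Types (Ct : contour R) (E : set R[i]).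

Definition avoids Ct E : Prop := forall a, E a -> ~ contour_support Ct a.

Lemma avoids_contat Ct E f : avoids Ct E -> contat (~` E) f -> contat (contour_support Ct) f.
Proof. by move=> h; apply: contatS => z hz /h. Qed.

Lemma ratl_supp Ct E f : avoids Ct E -> ratl E f -> contat (contour_support Ct) f.
Proof. by move=> h /ratl_contat; exact: avoids_contat. Qed.

(** Polynomials and poles of order at least 2 have primitives. What remains are simple fractions,
    whose integrals are winding numbers by definition, up to the factor 2 pi i. *)
Lemma ratl_int_eq (C1 C2 : contour R) E f : avoids C1 E -> avoids C2 E ->
  (forall a, E a -> winding C1 a = winding C2 a) -> ratl E f ->
  contour_integral C1 f = contour_integral C2 f.
Proof.
move=> a1 a2 w; elim=> {f} [k|a k Ea|f g rf hf rg hg|c f rf hf|s f g hs fg rf hf].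
- by rewrite !contour_integralX.
- case: k => [|k]; last by rewrite !contour_integralVX//; [exact: a2|exact: a1].
  under eq_contour_integral do rewrite expr1.
  under [RHS]eq_contour_integral do rewrite expr1.
  by rewrite !contour_integral_inv w.
- by rewrite !contour_integralD ?hf ?hg//; apply: ratl_supp; eassumption.
- by rewrite !contour_integralZ ?hf//; apply: ratl_supp; eassumption.
- have e Ct z : avoids Ct E -> contour_support Ct z -> f z = g z.
    by move=> aC zC; apply: fg; apply/negP => /hs/aC.
  rewrite -(eq_contour_integral (fun z => e C1 z a1)) hf.
  exact: (eq_contour_integral (fun z => e C2 z a2)).
Qed.

Lemma contour_integralVS Ct a k : ~ contour_support Ct a ->
  contour_integral Ct (fun z => (z - a)^-1 ^+ k.+1) =
  two_pi_i R * winding Ct a *+ (k == 0)%N.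
Proof.
case: k => [|k] Sa /=; last by rewrite contour_integralVX.
by under eq_contour_integral do rewrite expr1; rewrite contour_integral_inv.
Qed.

(** With z / (z - c) = 1 + c / (z - c) the integrand expands into powers of (z - c)^-1, of which
    only the first has a nonzero integral. *)
Lemma contour_integral_XVS Ct c k : ~ contour_support Ct c ->
  contour_integral Ct (fun z => z ^+ k * (z - c)^-1 ^+ k.+1) = two_pi_i R * winding Ct c.
Proof.
move=> Sc; have cv := contat_inv Sc.
rewrite (@eq_contour_integral _ _ _
  (fun z => \sum_(j < k.+1) (c ^+ j *+ 'C(k, j)) * (z - c)^-1 ^+ j.+1)); last first.
  move=> z Sz; have zc : z - c != 0 by rewrite subr_eq0; apply/eqP => e; apply: Sc; rewrite -e.
  have -> : z ^+ k * (z - c)^-1 ^+ k.+1 = (1 + c * (z - c)^-1) ^+ k * (z - c)^-1.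
    by rewrite exprSr mulrA -exprMn; congr (_ ^+ _ * _); field.
  rewrite exprDn mulr_suml; apply: eq_bigr => j _.
  by rewrite expr1n mul1r exprMn exprSr -!mulrnAl mulrA.
rewrite contour_integral_sum; last first.
  by move=> j _; apply: contatM; [exact: contat_cst|apply: contatX; exact: cv].
rewrite (eq_bigr (fun j : 'I_k.+1 => c ^+ j *+ 'C(k, j) *
   (two_pi_i R * winding Ct c *+ (j == 0 :> nat)%N))); last first.
  move=> j _; rewrite contour_integralZ; last by apply: contatX; exact: cv.
  by rewrite (contour_integralVS _ Sc).
rewrite big_ord_recl big1 ?addr0; first by rewrite /= expr0 bin0 mulr1n mul1r.
by move=> j _; rewrite mulr0.
Qed.

Lemma contour_integral_VVS Ct a k : a != 0 -> ~ contour_support Ct 0 -> ~ contour_support Ct a ->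
  contour_integral Ct (fun z => (z - a)^-1 ^+ k.+1 * z^-1) =
  (- a)^-1 ^+ k.+1 * (two_pi_i R * (winding Ct 0 - winding Ct a)).
Proof.
move=> a0 S0 Sa; have ca := contat_inv Sa.
have c0 : contat (contour_support Ct) (fun z => z^-1).
  by have := contat_inv S0; under eq_fun do rewrite subr0.
have dec z j : contour_support Ct z -> (z - a)^-1 ^+ j.+1 * z^-1 =
    a^-1 * ((z - a)^-1 ^+ j.+1 - (z - a)^-1 ^+ j * z^-1).
  move=> Sz.
  have za : z - a != 0 by rewrite subr_eq0; apply/eqP => e; apply: Sa; rewrite -e.
  have z0 : z != 0 by apply/eqP => e; apply: S0; rewrite -e.
  by rewrite exprSr; field; rewrite a0 z0 za.
have cj j : contat (contour_support Ct) (fun z => (z - a)^-1 ^+ j) by apply: contatX; exact: ca.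
have cjz j : contat (contour_support Ct) (fun z => (z - a)^-1 ^+ j * z^-1).
  by apply: contatM; [exact: cj|exact: c0].
have step j : contour_integral Ct (fun z => (z - a)^-1 ^+ j.+1 * z^-1) = a^-1 *
    (contour_integral Ct (fun z => (z - a)^-1 ^+ j.+1) -
     contour_integral Ct (fun z => (z - a)^-1 ^+ j * z^-1)).
  rewrite (eq_contour_integral (fun z hz => dec z j hz)) contour_integralZ.
    by rewrite contour_integralB; [|exact: cj|exact: cjz].
  by apply: contatB; [exact: cj|exact: cjz].
elim: k => [|k IH]; rewrite step contour_integralVS//.
  under [X in _ - X]eq_contour_integral do rewrite expr0 mul1r.
  by rewrite contour_integral_inv0 /= expr1 invrN; ring.
by rewrite IH /= mulr0n [in RHS]exprS invrN; ring.
Qed.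

Lemma contat_comp_div (S : set R[i]) (q : R[i]) f : ~ S 0 ->
  (forall z, S z -> ccvg (nbhs (q / z : C)) f (f (q / z))) ->
  contat S (fun z => f (q / z)).
Proof.
move=> S0 h z Sz.
have z0 : z != 0 by apply/eqP => e; apply: S0; rewrite -e.
have cq : ccvg (nbhs (z : C)) (fun w => q / w) (q / z).
  by apply: ccvgM; [exact: ccvg_cst|apply: ccvgV => //; exact: ccvg_id].
exact: (@ccvg_comp _ C C _ (nbhs (q / z : C)) f (fun w => q / w) _ cq (h z Sz)).
Qed.

Section Inversion.
Variables (Ct : contour R) (E : set R[i]) (q : R[i]).
Hypotheses (q0 : q != 0) (S0 : ~ contour_support Ct 0) (aE : avoids Ct E).
Hypothesis aqE : forall a, E a -> a != 0 -> ~ contour_support Ct (q / a).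
Hypothesis wE : forall a, E a -> a != 0 ->
  winding Ct a + winding Ct (q / a) = winding Ct 0.

Let inv_notin z : contour_support Ct z -> ~ E (q / z).
Proof.
move=> Sz Ez; have z0 : z != 0 by apply/eqP => e; apply: S0; rewrite -e.
have qz0 : q / z != 0 by rewrite mulf_neq0// invr_eq0.
by apply: (aqE Ez qz0); rewrite invf_div mulrCA divff// mulr1.
Qed.

Let c0 : contat (contour_support Ct) (fun z => z^-1).
Proof. by have := contat_inv S0; under eq_fun do rewrite subr0. Qed.

Lemma contat_inversion f : contat (~` E) f ->
  contat (contour_support Ct) (fun z => f (q / z) * z^-1).
Proof.
move=> cf; apply: contatM; last exact: c0.
apply: contat_comp_div; first exact: S0.
by move=> z Sz; apply: cf; exact: inv_notin.
Qed.

Lemma contat_divz f : contat (~` E) f -> contat (contour_support Ct) (fun z => f z * z^-1).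
Proof. by move=> cf; apply: contatM; [exact: avoids_contat cf|exact: c0]. Qed.

(** The hypothesis [wE] means that the image of the contour under z -> q / z, traversed backwards,
    winds around the nonzero points of [E] as the contour itself does. No image contour is formed:
    the identity is verified on partial fractions. For powers of z both sides are 0, except for the
    constant term, which the substitution does not change. *)
Lemma ratl_inversion f : ratl E f ->
  contour_integral Ct (fun z => f z * z^-1) = contour_integral Ct (fun z => f (q / z) * z^-1).
Proof.
have nz z : contour_support Ct z -> z != 0 by move=> Sz; apply/eqP => e; apply: S0; rewrite -e.
have VX0 k : contour_integral Ct (fun z => z^-1 ^+ k.+2) = 0.
  rewrite -[RHS](contour_integralVX k S0); apply: eq_contour_integral => z _.
  by rewrite subr0.
have cVX0 k : contat (contour_support Ct) (fun z => z^-1 ^+ k) by apply: contatX; exact: c0.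
elim=> {f} [k|a k Ea|f g rf hf rg hg|c f rf hf|s f g hs fg rf hf].
- case: k => [|k]; first by apply: eq_contour_integral => z _; rewrite !expr0.
  transitivity (0 : R[i]).
    rewrite -[RHS](contour_integralX Ct k); apply: eq_contour_integral => z Sz.
    by rewrite exprSr mulfK// nz.
  rewrite -[LHS](mulr0 (q ^+ k.+1)) -(VX0 k) -contour_integralZ; last exact: cVX0.
  by apply: eq_contour_integral => z Sz; rewrite exprMn (exprSr _ k.+1) mulrA.
- have [a0|a0] := eqVneq a 0.
    transitivity (0 : R[i]).
      rewrite -[RHS](VX0 k); apply: eq_contour_integral => z Sz.
      by rewrite a0 subr0 -exprSr.
    rewrite -[LHS](mulr0 (q^-1 ^+ k.+1)) -(contour_integralX Ct k) -contour_integralZ.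
      apply: eq_contour_integral => z Sz; rewrite a0 subr0 invf_div exprMn.
      by rewrite (exprSr z) mulrAC mulfK ?nz// mulrC.
    by apply: contatX; exact: contat_id.
  have Sqa := aqE Ea a0.
  rewrite (contour_integral_VVS k a0 S0 (aE Ea)) -(wE Ea a0) addrAC subrr add0r.
  rewrite -(contour_integral_XVS k Sqa) -contour_integralZ; last first.
    by apply: contatM; apply: contatX; [exact: contat_id|exact: contat_inv].
  apply: eq_contour_integral => z Sz; have z0 := nz _ Sz.
  have e : q / z - a = - a * (z - q / a) / z by field; rewrite z0 a0.
  have zqa : z - q / a != 0.
    by rewrite subr_eq0; apply/eqP => ez; apply: Sqa; rewrite -ez.
  rewrite e !invfM invrK !exprMn -!mulrA; congr (_ * _).
  by rewrite [LHS]mulrC; congr (_ * _); rewrite exprSr mulfK.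
- have cf := ratl_contat rf; have cg := ratl_contat rg.
  rewrite (@eq_contour_integral _ _ _ (fun z => f z * z^-1 + g z * z^-1)); last first.
    by move=> z _; rewrite mulrDl.
  rewrite contour_integralD; try exact: contat_divz.
  rewrite [RHS](@eq_contour_integral _ _ _ (fun z => f (q / z) * z^-1 + g (q / z) * z^-1)); last first.
    by move=> z _; rewrite mulrDl.
  rewrite contour_integralD; try exact: contat_inversion.
  by rewrite hf hg.
- have cf := ratl_contat rf.
  rewrite (@eq_contour_integral _ _ _ (fun z => c * (f z * z^-1))); last by move=> z _; rewrite mulrA.
  rewrite contour_integralZ; try exact: contat_divz.
  rewrite [RHS](@eq_contour_integral _ _ _ (fun z => c * (f (q / z) * z^-1))); last by move=> z _; rewrite mulrA.
  by rewrite contour_integralZ; [rewrite hf|exact: contat_inversion].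
- rewrite -(@eq_contour_integral _ _ (fun z => f z * z^-1)); last first.
    by move=> z Sz; rewrite fg//; apply/negP => /hs/aE.
  rewrite hf; apply: eq_contour_integral => z Sz; rewrite fg//.
  by apply/negP => /hs; exact: inv_notin.
Qed.

End Inversion.

(** Cauchy's formula for a contour that may enclose [b] but does not wind around the poles of [f],
    so that these contribute nothing. *)
Lemma ratl_residue Ct E b f : avoids Ct E -> ~ E b -> ~ contour_support Ct b ->
  (forall a, E a -> winding Ct a = 0) -> ratl E f ->
  contour_integral Ct (fun z => f z * (z - b)^-1) = two_pi_i R * winding Ct b * f b.
Proof.
move=> aC Eb Sb w; have cb := contat_inv Sb.
elim=> {f} [k|a k Ea|f g rf hf rg hg|c f rf hf|s f g hs fg rf hf].
- elim: k => [|k IH].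
    under eq_contour_integral do rewrite expr0 mul1r.
    by rewrite contour_integral_inv expr0 mulr1.
  have ck : contat (contour_support Ct) (fun z => z ^+ k) by apply: contatX; exact: contat_id.
  rewrite (@eq_contour_integral _ _ _ (fun z => z ^+ k + b * (z ^+ k * (z - b)^-1))); last first.
    move=> z Sz; have zb : z - b != 0 by rewrite subr_eq0; apply/eqP => e; apply: Sb; rewrite -e.
    by rewrite exprSr; field.
  rewrite (contour_integralD ck); last first.
    by apply: contatM; [exact: contat_cst|apply: contatM; [exact: ck|exact: cb]].
  rewrite contour_integralZ ?IH; last by apply: contatM; [exact: ck|exact: cb].
  by rewrite contour_integralX add0r exprS; ring.
- have Sa := aC _ Ea; have ca := contat_inv Sa.
  have cj j : contat (contour_support Ct) (fun z => (z - a)^-1 ^+ j) by apply: contatX; exact: ca.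
  have ba : b - a != 0 by rewrite subr_eq0; apply/eqP => e; apply: Eb; rewrite e.
  have step j : contour_integral Ct (fun z => (z - a)^-1 ^+ j.+1 * (z - b)^-1) =
     (b - a)^-1 * contour_integral Ct (fun z => (z - a)^-1 ^+ j * (z - b)^-1).
    rewrite (@eq_contour_integral _ _ _
      (fun z => (b - a)^-1 * ((z - a)^-1 ^+ j * (z - b)^-1 - (z - a)^-1 ^+ j.+1))); last first.
      move=> z Sz; have zb : z - b != 0 by rewrite subr_eq0; apply/eqP => e; apply: Sb; rewrite -e.
      have za : z - a != 0 by rewrite subr_eq0; apply/eqP => e; apply: Sa; rewrite -e.
      by rewrite exprSr; field; rewrite ba zb za.
    rewrite contour_integralZ; last first.
      by apply: contatB; [apply: contatM; [exact: cj|exact: cb]|exact: cj].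
    rewrite contour_integralB; [|apply: contatM; [exact: cj|exact: cb]|exact: cj].
    by rewrite contour_integralVS// w// mulr0 mul0rn subr0.
  elim: k => [|k IH]; rewrite step ?IH; last by rewrite [in RHS]exprS; ring.
  under eq_contour_integral do rewrite expr0 mul1r.
  by rewrite contour_integral_inv expr1 mulrC.
- have cf := ratl_supp aC rf; have cg := ratl_supp aC rg.
  rewrite (@eq_contour_integral _ _ _ (fun z => f z * (z - b)^-1 + g z * (z - b)^-1)); last first.
    by move=> z _; rewrite mulrDl.
  rewrite contour_integralD; [|apply: contatM; [exact: cf|exact: cb]|apply: contatM; [exact: cg|exact: cb]].
  by rewrite hf hg mulrDr.
- have cf := ratl_supp aC rf.
  rewrite (@eq_contour_integral _ _ _ (fun z => c * (f z * (z - b)^-1))); last by move=> z _; rewrite mulrA.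
  rewrite contour_integralZ; last by apply: contatM; [exact: cf|exact: cb].
  by rewrite hf mulrCA.
- rewrite -(fg b); last by apply/negP => /hs.
  rewrite -hf; apply: eq_contour_integral => z Sz; rewrite fg//.
  by apply/negP => /hs/aC.
Qed.

End RationalIntegrals.

(** * Locally uniform limits of rational functions *)

Section HolClass.
Variable R : realType.
Notation C := (R[i])^o.
Implicit Types (Ct : contour R) (E : set R[i]).

(** The point and the index tend jointly to their limits. Required at every point, this amounts to
    locally uniform convergence to a continuous function. *)
Definition jcvg (f_ : nat -> R[i] -> R[i]) (z l : R[i]) : Prop :=
  ccvg (filter_prod (nbhs (z : C)) \oo) (fun zn : C * nat => f_ zn.2 zn.1) l.

(* Locally uniform limits, off [E], of rational functions with poles in [E]. *)
Definition hol E (f : R[i] -> R[i]) : Prop := contat (~` E) f /\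
  exists2 f_ : nat -> R[i] -> R[i], (forall N, ratl E (f_ N)) &
    forall z, ~ E z -> jcvg f_ z (f z).

Lemma jcvg_fst (f : R[i] -> R[i]) z l : ccvg (nbhs (z : C)) f l -> jcvg (fun _ => f) z l.
Proof.
move=> h; rewrite /jcvg.
exact: (@ccvg_comp R (C * nat) C _ (nbhs (z : C)) f (fun zn => zn.1) l cvg_fst h).
Qed.

Lemma jcvgM f_ g_ z a b : jcvg f_ z a -> jcvg g_ z b -> jcvg (fun N z => f_ N z * g_ N z) z (a * b).
Proof. exact: ccvgM. Qed.

Lemma jcvgD f_ g_ z a b : jcvg f_ z a -> jcvg g_ z b -> jcvg (fun N z => f_ N z + g_ N z) z (a + b).
Proof. exact: ccvgD. Qed.

Lemma cvg_filter_prod (T U V : Type) (F : set_system T) (G : set_system U) (H : set_system V)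
    {FF : Filter F} {FG : Filter G} {FH : Filter H} (f : T -> U) (g : T -> V) :
  f @ F --> G -> g @ F --> H -> (fun x => (f x, g x)) @ F --> filter_prod G H.
Proof. by move=> hf hg; exact: (@cvg_pair T U V F G H FF FG FH f g hf hg). Qed.

Lemma jcvg_comp (u : R[i] -> R[i]) f_ z l : ccvg (nbhs (z : C)) u (u z) ->
  jcvg f_ (u z) l -> jcvg (fun N w => f_ N (u w)) z l.
Proof.
move=> cu h.
have hu : (fun zn : C * nat => ((u zn.1 : C), zn.2)) @ filter_prod (nbhs (z : C)) \oo -->
    filter_prod (nbhs (u z : C)) \oo.
  apply: (@cvg_filter_prod _ C nat); last exact: cvg_snd.
  exact: (@ccvg_comp R (C * nat) C _ (nbhs (z : C)) u (fun zn => zn.1) _ cvg_fst cu).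
exact: (@ccvg_comp R (C * nat) (C * nat) _ (filter_prod (nbhs (u z : C)) \oo)
  (fun zn => f_ zn.2 zn.1) _ l hu h).
Qed.

Lemma hol_contat E f : hol E f -> contat (~` E) f. Proof. by case. Qed.

Lemma hol_supp Ct E f : avoids Ct E -> hol E f -> contat (contour_support Ct) f.
Proof. by move=> a /hol_contat; exact: avoids_contat. Qed.

Lemma hol_ratl E f : ratl E f -> hol E f.
Proof.
move=> h; split; first exact: ratl_contat.
by exists (fun _ => f) => [N //|z Ez]; apply: jcvg_fst; exact: (ratl_contat h).
Qed.

Lemma holM E f g : hol E f -> hol E g -> hol E (fun z => f z * g z).
Proof.
move=> [cf [f_ rf jf]] [cg [g_ rg jg]]; split; first exact: contatM.
exists (fun N z => f_ N z * g_ N z); first by move=> N; exact: ratl_M.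
by move=> z Ez; apply: jcvgM; [exact: jf|exact: jg].
Qed.

Lemma holD E f g : hol E f -> hol E g -> hol E (fun z => f z + g z).
Proof.
move=> [cf [f_ rf jf]] [cg [g_ rg jg]]; split; first exact: contatD.
exists (fun N z => f_ N z + g_ N z); first by move=> N; exact: ratl_D.
by move=> z Ez; apply: jcvgD; [exact: jf|exact: jg].
Qed.

Lemma hol_cst E c : hol E (fun _ => c).
Proof. by apply: hol_ratl; exact: ratl_cst. Qed.

Lemma hol_id E : hol E id.
Proof. by apply: hol_ratl; exact: ratl_id. Qed.

Lemma holZ E c f : hol E f -> hol E (fun z => c * f z).
Proof. by apply: holM; exact: hol_cst. Qed.

Lemma hol_prod E (I : Type) (r : seq I) (P : pred I) (f : I -> R[i] -> R[i]) :
  (forall i, P i -> hol E (f i)) -> hol E (fun z => \prod_(i <- r | P i) f i z).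
Proof.
move=> h; elim: r => [|i r IH].
  by under eq_fun do rewrite big_nil; exact: hol_cst.
case Pi : (P i).
  by under eq_fun do rewrite big_cons Pi; apply: holM; [exact: h|exact: IH].
by under eq_fun do rewrite big_cons Pi.
Qed.

Lemma hol_sum E (I : Type) (r : seq I) (P : pred I) (f : I -> R[i] -> R[i]) :
  (forall i, P i -> hol E (f i)) -> hol E (fun z => \sum_(i <- r | P i) f i z).
Proof.
move=> h; elim: r => [|i r IH].
  by under eq_fun do rewrite big_nil; exact: hol_cst.
case Pi : (P i).
  by under eq_fun do rewrite big_cons Pi; apply: holD; [exact: h|exact: IH].
by under eq_fun do rewrite big_cons Pi.
Qed.

Lemma holX E f n : hol E f -> hol E (fun z => f z ^+ n).
Proof.
move=> hf; elim: n => [|n IH]; first by under eq_fun do rewrite expr0; exact: hol_cst.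
by under eq_fun do rewrite exprS; exact: holM.
Qed.

Lemma hol_inv E : E 0 -> hol E (fun z => z^-1).
Proof.
move=> E0; apply: hol_ratl; apply: ratl_eq0 (ratl_inv E0) => z; by rewrite subr0.
Qed.

Lemma hol_sub E E' f : E `<=` E' -> hol E f -> hol E' f.
Proof.
move=> EE' [cf [f_ rf jf]]; split; first by apply: contatS cf => z Ez /EE'.
by exists f_ => [N|z Ez]; [exact: (ratl_sub EE')|apply: jf => /EE'].
Qed.

Lemma hol_eq E f g : (forall z, f z = g z) -> hol E f -> hol E g.
Proof. by move=> /funext ->. Qed.

(** The substitution [u] and the factor [c] make this serve for f(z) / z, for f(q / z) / z and for
    f(z) / (z - b). *)
Lemma hol_integral_cvg Ct E f (f_ : nat -> R[i] -> R[i]) (u c : R[i] -> R[i]) :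
  (forall z, contour_support Ct z -> ccvg (nbhs (z : C)) u (u z) /\ ~ E (u z)) ->
  contat (contour_support Ct) c -> contat (~` E) f -> (forall N, ratl E (f_ N)) ->
  (forall z, ~ E z -> jcvg f_ z (f z)) ->
  ccvg \oo (fun N => contour_integral Ct (fun z => f_ N (u z) * c z))
    (contour_integral Ct (fun z => f (u z) * c z)).
Proof.
move=> hu cc cf rf jf.
have cu (g : R[i] -> R[i]) : contat (~` E) g -> contat (contour_support Ct) (fun z => g (u z)).
  move=> cg z Sz; have [cuz Euz] := hu z Sz.
  exact: (@ccvg_comp R C C _ (nbhs (u z : C)) g u _ cuz (cg _ Euz)).
apply: contour_integral_cvg.
- by apply: contatM; [exact: cu|exact: cc].
- by apply: nearW => N; apply: contatM; [apply: cu; exact: ratl_contat|exact: cc].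
- move=> z Sz; have [cuz Euz] := hu z Sz.
  apply: (@jcvgM (fun N w => f_ N (u w)) (fun _ => c)).
    by apply: jcvg_comp; [exact: cuz|exact: jf].
  by apply: jcvg_fst; exact: cc.
Qed.

Lemma hol_integral_cvg1 Ct E f (f_ : nat -> R[i] -> R[i]) :
  avoids Ct E -> contat (~` E) f -> (forall N, ratl E (f_ N)) ->
  (forall z, ~ E z -> jcvg f_ z (f z)) ->
  ccvg \oo (fun N => contour_integral Ct (f_ N)) (contour_integral Ct f).
Proof.
move=> aE cf rf jf.
have := @hol_integral_cvg Ct E f f_ id (fun _ => 1) _ (@contat_cst _ _ 1) cf rf jf.
have e (g : R[i] -> R[i]) : (fun z => g z * 1) = g by apply: funext => z; rewrite mulr1.
rewrite e (_ : (fun N => _) = fun N => contour_integral Ct (f_ N)); last first.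
  by apply: funext => N; rewrite e.
by apply => z Sz; split; [exact: ccvg_id|move=> /aE].
Qed.

(** This takes the place of Cauchy's theorem. The approximants have their poles in the same set [E],
    so that the equality for them passes to the limit. *)
Lemma hol_int_eq (C1 C2 : contour R) E f : avoids C1 E -> avoids C2 E ->
  (forall a, E a -> winding C1 a = winding C2 a) -> hol E f ->
  contour_integral C1 f = contour_integral C2 f.
Proof.
move=> a1 a2 w [cf [f_ rf jf]].
have h1 := hol_integral_cvg1 a1 cf rf jf.
have h2 := hol_integral_cvg1 a2 cf rf jf.
apply: (ccvg_uniq h1).
by under eq_fun do rewrite (ratl_int_eq a1 a2 w (rf _)).
Qed.

Lemma hol_inversion Ct E q f : q != 0 -> ~ contour_support Ct 0 -> avoids Ct E ->
  (forall a, E a -> a != 0 -> ~ contour_support Ct (q / a)) ->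
  (forall a, E a -> a != 0 -> winding Ct a + winding Ct (q / a) = winding Ct 0) ->
  hol E f ->
  contour_integral Ct (fun z => f z * z^-1) = contour_integral Ct (fun z => f (q / z) * z^-1).
Proof.
move=> q0 S0 aE aqE w [cf [f_ rf jf]].
have nz z : contour_support Ct z -> z != 0 by move=> Sz; apply/eqP => e; apply: S0; rewrite -e.
have c0 : contat (contour_support Ct) (fun z => z^-1).
  by have := contat_inv S0; under eq_fun do rewrite subr0.
have h1 : ccvg \oo _ _ := @hol_integral_cvg Ct E f f_ id (fun z => z^-1) _ c0 cf rf jf.
have h2 : ccvg \oo _ _ := @hol_integral_cvg Ct E f f_ (fun z => q / z) (fun z => z^-1) _ c0 cf rf jf.
apply: (@ccvg_uniq _ _ \oo _ _ _ _ (h1 _)).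
  by move=> z Sz; split; [exact: ccvg_id|move=> /aE].
under eq_fun do rewrite (ratl_inversion q0 S0 aE aqE w (rf _)).
apply: h2 => z Sz; split.
  apply: ccvgM; [exact: ccvg_cst|apply: ccvgV; [exact: nz|exact: ccvg_id]].
move=> Ez; have qz0 : q / z != 0 by rewrite mulf_neq0// invr_eq0 nz.
by apply: (aqE _ Ez qz0); rewrite invf_div mulrCA divff// mulr1.
Qed.

Lemma hol_residue Ct E b f : avoids Ct E -> ~ E b -> ~ contour_support Ct b ->
  (forall a, E a -> winding Ct a = 0) -> hol E f ->
  contour_integral Ct (fun z => f z * (z - b)^-1) = two_pi_i R * winding Ct b * f b.
Proof.
move=> aE Eb Sb w [cf [f_ rf jf]].
have h1 : ccvg \oo _ _ := @hol_integral_cvg Ct E f f_ id (fun z => (z - b)^-1) _ (contat_inv Sb) cf rf jf.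
apply: (@ccvg_uniq _ _ \oo _ _ _ _ (h1 _)).
  by move=> z Sz; split; [exact: ccvg_id|move=> /aE].
under eq_fun do rewrite (ratl_residue aE Eb Sb w (rf _)).
apply: ccvgM; first exact: ccvg_cst.
have hb : (fun N : nat => ((b : C), N)) @ \oo --> filter_prod (nbhs (b : C)) \oo.
  by apply: (@cvg_filter_prod _ C nat); [exact: cvg_cst|exact: cvg_id].
exact: (@ccvg_comp R nat (C * nat) _ (filter_prod (nbhs (b : C)) \oo)
  (fun zn => f_ zn.2 zn.1) _ _ hb (jf b Eb)).
Qed.

End HolClass.

(** * Winding numbers *)

Section Winding.
Variable R : realType.
Notation C := (R[i])^o.
Implicit Types (Ct : contour R) (E : set R[i]).

Lemma ccvg_near_cst (T : Type) (F : set_system T) {FF : Filter F} (f : T -> R[i]) (l : R[i]) :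
  (\forall x \near F, f x = l) -> ccvg F f l.
Proof.
move=> h; apply: (@ccvg_eq R T F FF (fun _ => l)); last exact: ccvg_cst.
by apply: filterS h => x ->.
Qed.

Lemma jcvg_geom (r : R[i] -> R[i]) (z : R[i]) : ccvg (nbhs (z : C)) r (r z) -> cabs (r z) < 1 ->
  jcvg (fun N w => r w ^+ N) z 0.
Proof.
move=> cr r1; set m := (cabs (r z) + 1) / 2.
have m0 : 0 <= m by rewrite divr_ge0// addr_ge0// cabs_ge0.
have m1 : m < 1 by rewrite /m; lra.
apply: (@ccvg_squeeze _ _ _ _ _ _ (fun zn : C * nat => m ^+ zn.2)).
  have hm : \forall w \near nbhs (z : C), cabs (r w) <= m.
    have d0 : 0 < m - cabs (r z) by rewrite /m; lra.
    have /ccvgP/(_ _ d0) := cr; apply: filterS => w.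
    by have := cabs_sub_le (r w) (r z); rewrite cabsB; lra.
  exists ([set w | cabs (r w) <= m], setT) => /=.
    by split; [exact: hm|exact: filterT].
  move=> [w n] /= [hw _]; rewrite sub0r cabsN cabsX.
  by rewrite lerXn2r// nnegrE cabs_ge0.
have h : (fun n : nat => m ^+ n) @ \oo --> (0 : R) by apply: cvg_expr; rewrite ger0_norm.
exact: (@cvg_comp _ _ _ (fun zn : C * nat => zn.2) (fun n => m ^+ n) _ _ _ cvg_snd h).
Qed.

(** The ratio need not be bounded away from 1 explicitly: the series converges jointly near each
    point of the contour, and compactness does the rest. *)
Lemma geom_int Ct (s r : R[i] -> R[i]) : contat (contour_support Ct) s ->
  contat (contour_support Ct) r -> (forall z, contour_support Ct z -> cabs (r z) < 1) ->
  ccvg \oo (fun N => \sum_(0 <= k < N) contour_integral Ct (fun z => s z * r z ^+ k))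
    (contour_integral Ct (fun z => s z / (1 - r z))).
Proof.
move=> cs cr r1.
have r0 z : contour_support Ct z -> 1 - r z != 0.
  move=> /r1 h; rewrite subr_eq0; apply/eqP => e; move: h; rewrite -e cabs1 ltxx//.
have ck k : contat (contour_support Ct) (fun z => s z * r z ^+ k).
  by apply: contatM; [exact: cs|apply: contatX; exact: cr].
have c1 : contat (contour_support Ct) (fun z => (1 - r z)^-1).
  by apply: contatV; [exact: r0|apply: contatB; [exact: contat_cst|exact: cr]].
rewrite (_ : (fun N => _) = fun N => contour_integral Ct (fun z => \sum_(0 <= k < N) s z * r z ^+ k));
  last first.
  apply: funext => N; rewrite contour_integral_sum; first by [].
  by move=> k _; exact: ck.
apply: contour_integral_cvg.
- by apply: contatM; [exact: cs|exact: c1].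
- by apply: nearW => N; apply: contat_sum => k _; exact: ck.
move=> z Sz.
have e N w : r w != 1 -> \sum_(0 <= k < N) s w * r w ^+ k = s w / (1 - r w) * (1 - r w ^+ N).
  move=> rw; rewrite -mulr_sumr -mulrA; congr (_ * _).
  have rw0 : 1 - r w != 0 by rewrite subr_eq0 eq_sym.
  apply: (mulfI rw0); rewrite mulrA divff// mul1r.
  by rewrite big_mkord -opprB mulNr -subrX1 opprB.
have H : jcvg (fun N w => s w / (1 - r w) * (1 - r w ^+ N)) z (s z / (1 - r z) * (1 - 0)).
  apply: (@jcvgM _ (fun _ w => s w / (1 - r w)) (fun N w => 1 - r w ^+ N)).
    by apply: jcvg_fst; apply: ccvgM; [exact: cs|exact: c1].
  by apply: ccvgB; [exact: ccvg_cst|apply: jcvg_geom; [exact: cr|exact: r1]].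
rewrite subr0 mulr1 in H; apply: ccvg_eq H.
have rz1 : r z != 1 by have := r0 z Sz; rewrite subr_eq0 eq_sym.
have hn : \forall w \near nbhs (z : C), r w != 1.
  exact: (cr z Sz [set w | w != 1] (cnear_ne rz1)).
exists ([set w | r w != 1], setT) => /=; first by split; [exact: hn|exact: filterT].
by move=> [w n] /= [hw _]; rewrite e.
Qed.

(** In the expansion of (z - b)^-1 in powers of (b - a) / (z - a) all terms but the first have
    primitives. *)
Lemma winding_lt Ct a b : ~ contour_support Ct a ->
  (forall z, contour_support Ct z -> cabs (b - a) < cabs (z - a)) ->
  winding Ct b = winding Ct a.
Proof.
move=> Sa h; have ca := contat_inv Sa.
have za z : contour_support Ct z -> z - a != 0.
  by move=> Sz; rewrite subr_eq0; apply/eqP => e; apply: Sa; rewrite -e.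
apply: (mulfI (two_pi_i_neq0 R)); rewrite -!contour_integral_inv.
have r1 z : contour_support Ct z -> cabs ((b - a) * (z - a)^-1) < 1.
  by move=> Sz; rewrite cabsM cabsV ltr_pdivrMr ?mul1r ?h// cabs_gt0 za.
have cr : contat (contour_support Ct) (fun z => (b - a) * (z - a)^-1).
  by apply: contatM; [exact: contat_cst|exact: ca].
have H : ccvg \oo _ _ := geom_int ca cr r1.
rewrite (@eq_contour_integral _ _ (fun z => (z - b)^-1)
  (fun z => (z - a)^-1 / (1 - (b - a) * (z - a)^-1))); last first.
  move=> z Sz; have z0 := za z Sz; rewrite -invfM; congr (_^-1); field.
  exact: z0.
apply/esym; apply: (@ccvg_uniq _ _ \oo _ _ _ _ _ H).
apply: ccvg_near_cst.
exists 1%N => [//|[|N] //= _].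
rewrite big_nat_recl; last by [].
rewrite big_nat big1 ?addr0.
  by apply: eq_contour_integral => z _; rewrite expr0 mulr1.
move=> k _.
rewrite (@eq_contour_integral _ _ _ (fun z => (b - a) ^+ k.+1 * (z - a)^-1 ^+ k.+2)); last first.
  by move=> z _; rewrite exprMn mulrCA -exprS.
rewrite contour_integralZ; last by apply: contatX; exact: ca.
by rewrite contour_integralVX// mulr0.
Qed.

Lemma contour_integral_ratl0 Ct f : ratl set0 f -> contour_integral Ct f = 0.
Proof.
move=> h; rewrite (@ratl_int_eq _ Ct [::] _ _ _ _ _ h)//.
by rewrite /contour_integral big_nil.
Qed.

(** Here (z - b)^-1 is expanded in powers of (z - c) / (b - c), and every term is a polynomial in
    z. *)
Lemma winding_gt Ct c b :
  (forall z, contour_support Ct z -> cabs (z - c) < cabs (b - c)) -> winding Ct b = 0.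
Proof.
move=> h; apply: (mulfI (two_pi_i_neq0 R)); rewrite mulr0 -contour_integral_inv.
have [bc|bc] := eqVneq (b - c) 0.
  rewrite (@eq_contour_integral _ _ _ (fun _ => 0)) ?contour_integral0// => z Sz.
  by have := h z Sz; rewrite bc cabs0 ltNge cabs_ge0.
have cr : contat (contour_support Ct) (fun z => (z - c) / (b - c)).
  by apply: contatM; [apply: contatB; [exact: contat_id|]|]; exact: contat_cst.
have r1 z : contour_support Ct z -> cabs ((z - c) / (b - c)) < 1.
  by move=> Sz; rewrite cabsM cabsV ltr_pdivrMr ?mul1r ?h// cabs_gt0.
have cs : contat (contour_support Ct) (fun _ => - (b - c)^-1) by exact: contat_cst.
have H : ccvg \oo _ _ := geom_int cs cr r1.
rewrite (@eq_contour_integral _ _ (fun z => (z - b)^-1)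
  (fun z => - (b - c)^-1 / (1 - (z - c) / (b - c)))); last first.
  move=> z Sz.
  have zb : z - b != 0.
    rewrite subr_eq0; apply/eqP => e; have := h z Sz; by rewrite e ltxx.
  have e : 1 - (z - c) / (b - c) = (b - z) / (b - c) by field.
  by rewrite e invf_div mulNr mulrA mulVf// mul1r -invrN opprB.
apply/esym; apply: (@ccvg_uniq _ _ \oo _ _ _ _ _ H).
apply: ccvg_near_cst.
apply: nearW => N; rewrite big1// => k _.
apply: contour_integral_ratl0; apply: ratl_M; first exact: ratl_cst.
apply: ratl_exp; apply: ratl_M; last exact: ratl_cst.
by apply: ratl_D; [exact: ratl_id|exact: ratl_cst].
Qed.

Lemma support_dist Ct a : ~ contour_support Ct a ->
  exists2 d : R, 0 < d & forall z, contour_support Ct z -> d < cabs (z - a).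
Proof.
move=> Sa; have /compact_near_coveringP cK := @contour_support_compact _ Ct.
have : \forall N \near \oo, contour_support Ct `<=` [set z | N.+1%:R^-1 < cabs (z - a) :> R].
  apply: (cK nat \oo (fun N z => N.+1%:R^-1 < cabs (z - a) :> R)) => z Sz.
  have d0 : 0 < cabs (z - a) / 2.
    rewrite divr_gt0// cabs_gt0 subr_eq0; apply/eqP => e; apply: Sa; rewrite -e//.
  have h1 := near_infty_natSinv_lt (PosNum d0).
  have /ccvgP/(_ _ d0) h2 := @ccvg_id R z.
  exists ([set w : C | cabs (z - w) < cabs (z - a) / 2], [set N | N.+1%:R^-1 < cabs (z - a) / 2]) => /=.
    by split; [exact: h2|exact: h1].
  move=> [w N] /= [hw hN]; apply: (lt_trans hN).
  by have := cabsD (z - w) (w - a); rewrite addrA subrK; lra.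
move=> [N _ /(_ N (leqnn N))] h; exists (N.+1%:R^-1); last exact: h.
by rewrite invr_gt0 ltr0n.
Qed.

Lemma support_bounded Ct : exists2 M : R, 0 < M & forall z, contour_support Ct z -> cabs z < M.
Proof.
have /compact_near_coveringP cK := @contour_support_compact _ Ct.
have : \forall N \near \oo, contour_support Ct `<=` [set z | cabs z < N.+1%:R :> R].
  apply: (cK nat \oo (fun N z => cabs z < N.+1%:R :> R)) => z Sz.
  have /ccvgP/(_ _ ltr01) h2 := @ccvg_id R z.
  have h1 := nbhs_infty_ger (cabs z).
  exists ([set w : C | cabs (z - w) < 1], [set N : nat | cabs z <= N%:R]) => /=.
    by split; [exact: h2|exact: h1].
  move=> [w N] /= [hw hN]; rewrite -natr1.
  by have := cabs_sub_le w z; rewrite cabsB; lra.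
move=> [N _ /(_ N (leqnn N))] h; exists (N.+1%:R); last exact: h.
by rewrite ltr0n.
Qed.

Lemma winding_near Ct a : ~ contour_support Ct a ->
  \forall b \near nbhs (a : C), ~ contour_support Ct b /\ winding Ct b = winding Ct a.
Proof.
move=> Sa; have [d d0 hd] := support_dist Sa.
have /ccvgP/(_ _ d0) := @ccvg_id R a; apply: filterS => b; rewrite cabsB => hb; split.
  by move=> Sb; have := hd b Sb; lra.
by apply: winding_lt => // z Sz; apply: (lt_trans hb); exact: hd.
Qed.

Lemma winding_cat (C1 C2 : contour R) a : winding (C1 ++ C2) a = winding C1 a + winding C2 a.
Proof. by rewrite /winding contour_integral_cat mulrDr. Qed.

End Winding.

(** * Circles as contours *)

Section Circles.
Variable R : realType.
Notation C := (R[i])^o.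
Implicit Types (Ct : contour R) (E : set R[i]).

Definition cis (t : R) : R[i] := cos t +i* sin t.

Lemma cisD (s t : R) : cis (s + t) = cis s * cis t.
Proof.
apply/eqP; rewrite eq_complex /=; apply/andP; split; apply/eqP.
  by rewrite cosD.
by rewrite sinD; ring.
Qed.

Lemma cabs_cis t : cabs (cis t) = 1.
Proof. by rewrite /cabs /= cos2Dsin2 sqrtr1. Qed.

Lemma cis_neq0 t : cis t != 0.
Proof. by rewrite -cabs_gt0 cabs_cis. Qed.

Lemma cis0 : cis 0 = 1.
Proof. by rewrite /cis cos0 sin0. Qed.

Lemma is_derive_mulc (f : R -> R) (k s df : R) :
  is_derive s 1 f df -> is_derive s 1 (fun u => k * f u) (k * df).
Proof. move=> h; exact: (is_deriveZ k h). Qed.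

Lemma is_derive_addc (f : R -> R) (k s df : R) :
  is_derive s 1 f df -> is_derive s 1 (fun u => k + f u) df.
Proof.
move=> h; have := is_deriveD (is_derive_cst k s 1) h.
by rewrite add0r.
Qed.

Section Circle.
Variables (c : R[i]) (rho w : R).

(** [w] is the angular velocity, which will be 2 pi or - 2 pi according to the orientation. *)
Definition circle_fun (s : R) : R[i] := c + rho%:C * cis (w * s).

Let der_lin (s : R) : is_derive s 1 (fun u : R => w * u) w.
Proof. by have := is_derive_mulc w (is_derive_id s 1); rewrite mulr1. Qed.

Let der_Re (s : R) :
  is_derive s 1 (fun u : R => complex.Re (circle_fun u)) (- (rho * w * sin (w * s))).
Proof.
have -> : (fun u : R => complex.Re (circle_fun u)) =
  (fun u => complex.Re c + rho * (cos \o (fun u => w * u)) u).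
  by apply: funext => u; rewrite /circle_fun; case: c => a b /=; rewrite mul0r subr0.
have -> : - (rho * w * sin (w * s)) = rho * (- sin (w * s) * w) by ring.
by apply: is_derive_addc; apply: is_derive_mulc; apply: is_derive1_comp.
Qed.

Let der_Im (s : R) :
  is_derive s 1 (fun u : R => complex.Im (circle_fun u)) (rho * w * cos (w * s)).
Proof.
have -> : (fun u : R => complex.Im (circle_fun u)) =
  (fun u => complex.Im c + rho * (sin \o (fun u => w * u)) u).
  by apply: funext => u; rewrite /circle_fun; case: c => a b /=; rewrite mul0r addr0.
have -> : rho * w * cos (w * s) = rho * (cos (w * s) * w) by ring.
by apply: is_derive_addc; apply: is_derive_mulc; apply: is_derive1_comp.
Qed.

Let circle_derivable (s : R) :
  derivable (fun u => complex.Re (circle_fun u)) s 1 /\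
  derivable (fun u => complex.Im (circle_fun u)) s 1.
Proof. by split; [have [] := der_Re s|have [] := der_Im s]. Qed.

Let d1Re : derive1 (fun u => complex.Re (circle_fun u)) = fun s => - (rho * w * sin (w * s)).
Proof. by apply: funext => s; rewrite derive1E; have h := der_Re s; rewrite derive_val. Qed.

Let d1Im : derive1 (fun u => complex.Im (circle_fun u)) = fun s => rho * w * cos (w * s).
Proof. by apply: funext => s; rewrite derive1E; have h := der_Im s; rewrite derive_val. Qed.

Let circle_C1 : continuous (derive1 (fun u => complex.Re (circle_fun u))) /\
           continuous (derive1 (fun u => complex.Im (circle_fun u))).
Proof.
rewrite d1Re d1Im.
have cl s : {for s, continuous (fun u : R => w * u)} by apply: mulrl_continuous.
split=> s.
  apply: cvgN; apply: cvgM; first exact: cvg_cst.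
  by apply: (continuous_comp (cl s)); exact: continuous_sin.
apply: cvgM; first exact: cvg_cst.
by apply: (continuous_comp (cl s)); exact: continuous_cos.
Qed.

Definition circle_arc : C1arc R := C1Arc circle_derivable circle_C1.

Lemma circle_arc_deriv s : arc_deriv circle_arc s = (0 +i* w) * (circle_fun s - c).
Proof.
rewrite /arc_deriv /= d1Re d1Im /circle_fun addrAC subrr add0r.
by apply/eqP; rewrite eq_complex /=; apply/andP; split; apply/eqP; ring.
Qed.

End Circle.

Section ClosedCircle.
Variables (c : R[i]) (rho : R) (e : bool).
Definition orient : R := if e then 1 else -1.
Let w : R := orient * (2 * pi).

Lemma cis_w : cis (w * 1) = 1.
Proof.
rewrite mulr1 /w /orient /cis; case: e; rewrite ?mul1r ?mulN1r ?cosN ?sinN mulr_natl cos2pi sin2pi ?oppr0//.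
Qed.

Let circle_closed : cycle (fun g h : C1arc R => g 1 == h 0) [:: circle_arc c rho w].
Proof. by rewrite /= /circle_fun cis_w mulr0 cis0 eqxx. Qed.

Definition circle : contour R := [:: ClosedCurve circle_closed].

Lemma circle_support z : contour_support circle z -> cabs (z - c) = `|rho|.
Proof.
rewrite contour_supportE /arcs /= big_seq1 => -[s _ <-] /=.
by rewrite /circle_fun addrAC subrr add0r cabsM cabs_cis mulr1 cabs_real.
Qed.

Lemma circle_winding_center : rho != 0 -> winding circle c = orient%:C.
Proof.
move=> r0; rewrite /winding contour_integralE /arcs /= big_seq1 /arcint.
rewrite (_ : (fun s => _) = fun _ => 0 +i* w); last first.
  apply: funext => s; rewrite circle_arc_deriv mulrCA mulVf ?mulr1//.
  by rewrite /= /circle_fun addrAC subrr add0r mulf_neq0 ?cis_neq0// eq_complex /= eqxx andbT.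
rewrite /cRintegral /= !Rintegral_cst// [X in fine X]lebesgue_measure_itv /= lte_fin ltr01 oppr0 adde0 /= !mulr1.
have -> : 0 +i* w = two_pi_i R * orient%:C.
  by apply/eqP; rewrite eq_complex /= /w; apply/andP; split; apply/eqP; ring.
by rewrite mulKf// two_pi_i_neq0.
Qed.

Lemma circle_winding_in b : cabs (b - c) < `|rho| -> winding circle b = orient%:C.
Proof.
move=> hb; have r0 : rho != 0.
  by rewrite -normr_gt0; apply: le_lt_trans hb; exact: cabs_ge0.
rewrite -circle_winding_center//; apply: winding_lt.
  by move=> /circle_support; rewrite subrr cabs0 => /esym/eqP; rewrite normr_eq0 (negbTE r0).
by move=> z /circle_support ->.
Qed.

Lemma circle_winding_out b : `|rho| < cabs (b - c) -> winding circle b = 0.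
Proof. by move=> hb; apply: (@winding_gt _ _ c) => z /circle_support ->. Qed.

Lemma circle_notin b : cabs (b - c) != `|rho| -> ~ contour_support circle b.
Proof. by move=> /eqP h /circle_support. Qed.

End ClosedCircle.

End Circles.

(** * Contours that separate two discrete sets *)

Section Separation.
Variable R : realType.
Notation C := (R[i])^o.
Implicit Types (Ct : contour R) (E : set R[i]).

Lemma finite_lower (T : choiceType) (S : set T) (f : T -> R) : finite_set S ->
  (forall x, S x -> 0 < f x) -> exists2 e : R, 0 < e & forall x, S x -> e < f x.
Proof.
move=> /finite_seqP[s ->]; elim: s => [|x s IH] h; first by exists 1.
have [|e e0 he] := IH; first by move=> y ys; apply: h; rewrite /= inE ys orbT.
have fx := h x (mem_head _ _).
exists (Num.min e (f x / 2)); first by rewrite lt_min e0 divr_gt0.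
move=> y /=; rewrite inE => /orP[/eqP->|ys].
  by apply: (@le_lt_trans _ _ (f x / 2)); [rewrite ge_min lexx orbT|lra].
by apply: (@le_lt_trans _ _ e); [rewrite ge_min lexx|exact: he].
Qed.

Lemma real_avoid (l : seq R) (a b : R) : a < b -> exists2 x, a < x < b & x \notin l.
Proof.
elim: l a b => [|h l IH] a b ab.
  by exists ((a + b) / 2) => //; apply/andP; split; lra.
have [/andP[ah hb]|hab] := boolP (a < h < b).
  have [x /andP[ax xh] xl] := IH _ _ ah; exists x; first by rewrite ax (lt_trans xh hb).
  by rewrite inE negb_or xl andbT lt_eqF.
have [x xab xl] := IH _ _ ab; exists x => //; rewrite inE negb_or xl andbT.
by apply/eqP => e; move: hab; rewrite -e xab.
Qed.

Section Separate.
Variables (A B : set R[i]).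
Hypotheses (A0 : ~ A 0) (B0 : ~ B 0) (AB : forall x, A x -> B x -> False).
Hypothesis finA : forall e : R, 0 < e -> finite_set [set x | A x /\ e <= cabs x].
Hypothesis finB : forall e : R, finite_set [set x | B x /\ cabs x <= e].

Let X : set R[i] := [set x | x = 0 \/ A x \/ B x].

(** By [finA] and [finB] the set [A] accumulates only at 0 and [B] only at infinity, so only
    finitely many points have to be kept away from [p]. *)
Lemma isolated p : A p \/ B p ->
  exists2 e : R, 0 < e & forall x, X x -> x != p -> e < cabs (x - p).
Proof.
move=> hp; have p0 : 0 < cabs p.
  by rewrite cabs_gt0; apply/eqP => e; case: hp; rewrite e.
have p2 : 0 < cabs p / 2 by rewrite divr_gt0.
have fS : finite_set [set x | ((A x /\ cabs p / 2 <= cabs x) \/ (B x /\ cabs x <= 2 * cabs p)) /\ x != p].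
  apply: (@sub_finite_set _ _ ([set x | A x /\ cabs p / 2 <= cabs x] `|` [set x | B x /\ cabs x <= 2 * cabs p])).
    by move=> x [].
  by rewrite finite_setU; split; [exact: finA|exact: finB].
have [x [_ xp]|e e0 he] := finite_lower (f := fun x => cabs (x - p)) fS.
  by rewrite cabs_gt0 subr_eq0.
exists (Num.min e (cabs p / 2)); first by rewrite lt_min e0.
have le_e : Num.min e (cabs p / 2) <= e by rewrite ge_min lexx.
have le_p : Num.min e (cabs p / 2) <= cabs p / 2 by rewrite ge_min lexx orbT.
move=> x [->|[Ax|Bx]] xp.
- by rewrite sub0r cabsN; lra.
- have [h|h] := leP (cabs p / 2) (cabs x).
    by apply: (le_lt_trans le_e); apply: he; split=> //; left.
  by have := cabs_sub_le p x; rewrite cabsB; lra.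
- have [h|h] := leP (cabs x) (2 * cabs p).
    by apply: (le_lt_trans le_e); apply: he; split=> //; right.
  by have := cabs_sub_le x p; lra.
Qed.

(** A small circle around [p] changes the winding number by 1 or -1 at [p] and at no other point of
    [X]. It may cross the old contour, because only sums of winding numbers matter. *)
Let modify Ct p (s : bool) : avoids Ct X -> A p \/ B p -> exists2 Ct' : contour R, avoids Ct' X &
  forall x, X x -> winding Ct' x = winding Ct x + (if x == p then (orient R s)%:C else 0).
Proof.
move=> aX hp; have [e e0 he] := isolated hp.
exists (Ct ++ circle p e s).
  move=> x Xx; rewrite contour_support_cat => -[/(aX _ Xx)//|]; apply: circle_notin.
  rewrite (gtr0_norm e0); have [->|xp] := eqVneq x p.
    by rewrite subrr cabs0 lt_eqF.
  by rewrite gt_eqF// he.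
move=> x Xx; rewrite winding_cat; congr (_ + _).
have [->|xp] := eqVneq x p.
  by apply: circle_winding_in; rewrite subrr cabs0 gtr0_norm.
by apply: circle_winding_out; rewrite gtr0_norm// he.
Qed.

Let modify_seq (s : R[i] -> bool) (L : seq R[i]) Ct : avoids Ct X -> uniq L ->
  (forall p, p \in L -> A p \/ B p) ->
  exists2 Ct' : contour R, avoids Ct' X &
  forall x, X x -> winding Ct' x = winding Ct x + (if x \in L then (orient R (s x))%:C else 0).
Proof.
elim: L Ct => [|p L IH] Ct aX; first by exists Ct => // x _; rewrite addr0.
rewrite /= => /andP[pL uL] hL.
have [Ct1 a1 w1] := modify (s p) aX (hL p (mem_head _ _)).
have [|Ct2 a2 w2] := IH Ct1 a1 uL.
  by move=> y yL; apply: hL; rewrite inE yL orbT.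
exists Ct2 => // x Xx; rewrite w2// w1// inE.
have [->|xp] := eqVneq x p; first by rewrite (negbTE pL) addr0.
by rewrite addr0.
Qed.

(** A circle around 0 of radius between 1/2 and 1 treats all but finitely many points of [A] and [B]
    correctly. The points of [A] outside it receive a positive small circle, the points of [B]
    inside it a negative one. *)
Lemma separating_contour : exists Ct, ~ contour_support Ct 0 /\
  (forall a, A a -> contour_contains Ct a) /\ (forall b, B b -> contour_excludes Ct b).
Proof.
have half0 : 0 < 2^-1 :> R by rewrite invr_gt0.
have fA := finA half0; have fB := finB 1.
have [sA esA] := (finite_seqP _).1 fA; have [sB esB] := (finite_seqP _).1 fB.
(* The radius avoids the moduli of the finitely many points of [A] and [B] that a circle in this
   range could meet. *)
have [rho /andP[r1 r2] rl] : exists2 x : R, 2^-1 < x < 1 & x \notin map (@cabs R) (sA ++ sB).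
  by apply: real_avoid; lra.
have r0 : 0 < rho by lra.
have rA a : A a -> cabs a != rho.
  move=> Aa; apply/eqP => e; move/negP: rl; apply; apply/mapP; exists a => //.
  have : [set` sA] a by rewrite -esA /=; split=> //; lra.
  by rewrite /= mem_cat => ->.
have rB b : B b -> cabs b != rho.
  move=> Bb; apply/eqP => e; move/negP: rl; apply; apply/mapP; exists b => //.
  have : [set` sB] b by rewrite -esB /=; split=> //; lra.
  by rewrite /= mem_cat orbC => ->.
have aX : avoids (circle 0 rho true) X.
  move=> x Xx; apply: circle_notin; rewrite subr0 gtr0_norm//.
  by case: Xx => [->|[/rA|/rB]//]; rewrite cabs0 lt_eqF.
have fL : finite_set [set x | (A x /\ rho < cabs x) \/ (B x /\ cabs x < rho)].
  apply: (@sub_finite_set _ _ ([set x | A x /\ 2^-1 <= cabs x] `|` [set x | B x /\ cabs x <= 1])).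
    by move=> x [[? ?]|[? ?]]; [left|right]; split=> //; lra.
  by rewrite finite_setU.
have [L0 eL0] := (finite_seqP _).1 fL; pose L := undup L0.
have LP x : (x \in L) <-> (A x /\ rho < cabs x) \/ (B x /\ cabs x < rho).
  rewrite mem_undup; split=> [h|h].
    by have : [set` L0] x by []; rewrite -eL0.
  suff : [set` L0] x by [].
  by rewrite -eL0.
have [|Ct a1 w1] := modify_seq (fun x => `[< A x >]) aX (undup_uniq L0).
  by move=> p /LP[[]|[]]; [left|right].
exists Ct; split; first by apply: a1; left.
have orT : (orient R true)%:C = 1 by [].
have orF : (orient R false)%:C = -1 by rewrite /orient rmorphN rmorph1.
split=> x hx; (split; first by apply: a1; right; tauto); rewrite w1; try by right; tauto.
- have := rA x hx; rewrite neq_lt => /orP[lt|lt].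
    rewrite circle_winding_in ?subr0 ?gtr0_norm// orT.
    rewrite ifF ?addr0//; apply/negP => /LP[[_ h]|[h _]]; first lra.
    exact: AB hx h.
  rewrite circle_winding_out ?subr0 ?gtr0_norm// add0r ifT; last by apply/LP; left.
  by rewrite asboolT.
- have nA : ~ A x by move=> h; exact: AB h hx.
  have := rB x hx; rewrite neq_lt => /orP[lt|lt].
    rewrite circle_winding_in ?subr0 ?gtr0_norm// orT ifT; last by apply/LP; right.
    by rewrite asboolF// orF subrr.
  rewrite circle_winding_out ?subr0 ?gtr0_norm// add0r ifF//.
  by apply/negP => /LP[[h _]//|[_ h]]; lra.
Qed.

End Separate.
End Separation.

(** * The infinite products *)

Section Jets.
Variable R : realType.
Notation C := (R[i])^o.

(* A triple (f (x + h), f x, df h): products of functions act on it by the   *)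
(* Leibniz rule, and jnorm t, with t = |h|, is submultiplicative.            *)
Definition jet := (R[i] * R[i] * R[i])%type.
Definition jmul (X Y : jet) : jet :=
  (X.1.1 * Y.1.1, X.1.2 * Y.1.2, X.1.2 * Y.2 + Y.1.2 * X.2).
Definition jone : jet := (1, 1, 0).

Lemma jmulA : associative jmul.
Proof. by move=> [[a b] c] [[d e] f] [[g h] k]; congr (_, _, _) => /=; ring. Qed.
Lemma jmulC : commutative jmul.
Proof. by move=> [[a b] c] [[d e] f]; congr (_, _, _) => /=; ring. Qed.
Lemma jmul1 : left_id jone jmul.
Proof. by move=> [[a b] c]; congr (_, _, _) => /=; ring. Qed.
HB.instance Definition _ := Monoid.isComLaw.Build jet jone jmul jmulA jmulC jmul1.

Lemma jmulDr (X Y Z : jet) : jmul X (Y + Z) = jmul X Y + jmul X Z.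
Proof. by case: X Y Z => [[a b] c] [[d e] f] [[g h] k]; congr (_, _, _) => /=; ring. Qed.

Variables (lam t : R).
Hypotheses (lam0 : 0 < lam) (t0 : 0 < t).

Definition jnorm (X : jet) : R :=
  Num.max (cabs X.1.1) (cabs X.1.2) +
  lam / t * Num.max (cabs (X.1.1 - X.1.2)) (cabs X.2) +
  (lam / t) ^+ 2 * cabs (X.1.1 - X.1.2 - X.2).

Let m0 : 0 < lam / t. Proof. by rewrite divr_gt0. Qed.

Lemma max_cabs_ge0 (x y : R[i]) : 0 <= Num.max (cabs x) (cabs y).
Proof. by rewrite le_max cabs_ge0. Qed.

Let mid_ge0 (X : jet) : 0 <= lam / t * Num.max (cabs (X.1.1 - X.1.2)) (cabs X.2).
Proof. by apply: mulr_ge0; [exact: ltW|exact: max_cabs_ge0]. Qed.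

Let rem_ge0 (X : jet) : 0 <= (lam / t) ^+ 2 * cabs (X.1.1 - X.1.2 - X.2).
Proof. by apply: mulr_ge0; [exact: exprn_ge0 (ltW _)|exact: cabs_ge0]. Qed.

Lemma jnorm_ge0 X : 0 <= jnorm X.
Proof. by apply: addr_ge0; [apply: addr_ge0|]; [exact: max_cabs_ge0|exact: mid_ge0|exact: rem_ge0]. Qed.

Lemma jnorm1 : jnorm jone = 1.
Proof. by rewrite /jnorm /= !subrr !cabs0 !cabs1 !maxxx !mulr0 !addr0. Qed.

Lemma ler_maxD (a b c d : R) : Num.max (a + c) (b + d) <= Num.max a b + Num.max c d.
Proof. by rewrite ge_max; apply/andP; split; apply: lerD; rewrite le_max lexx ?orbT. Qed.

Lemma max_cabsD (a b c d : R[i]) :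
  Num.max (cabs (a + c)) (cabs (b + d)) <= Num.max (cabs a) (cabs b) + Num.max (cabs c) (cabs d).
Proof.
apply: le_trans (ler_maxD _ _ _ _).
by rewrite ge_max; apply/andP; split; rewrite le_max cabsD ?orbT.
Qed.

Lemma jnorm_diag (z : R[i]) : jnorm (z, z, 0) = cabs z.
Proof. by rewrite /jnorm /= !subrr !cabs0 !maxxx !mulr0 !addr0. Qed.

Lemma jnormD X Y : jnorm (X + Y) <= jnorm X + jnorm Y.
Proof.
case: X Y => [[a b] c] [[d e] f]; rewrite /jnorm /=.
rewrite [leRHS]addrACA [X in _ <= X + _]addrACA -!mulrDr; apply: lerD; first apply: lerD.
- exact: max_cabsD.
- rewrite ler_pM2l//.
  have -> : a + d - (b + e) = (a - b) + (d - e) by ring.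
  exact: max_cabsD.
- rewrite ler_pM2l ?exprn_gt0//.
  have -> : a + d - (b + e) - (c + f) = (a - b - c) + (d - e - f) by ring.
  exact: cabsD.
Qed.

(** With m = lam / t, a jet norm is a polynomial of degree 2 in m. In the product of two of them the
    terms of degree at most 2 dominate the norm of the product jet, and those of degree 3 and 4 are
    nonnegative. *)
Lemma jnormM X Y : jnorm (jmul X Y) <= jnorm X * jnorm Y.
Proof.
case: X Y => [[u v] w] [[u' v'] w']; rewrite /jnorm /jmul /=.
set a := Num.max (cabs u) _; set b := Num.max (cabs (u - v)) _; set c := cabs (u - v - w).
set a' := Num.max (cabs u') _; set b' := Num.max (cabs (u' - v')) _; set c' := cabs (u' - v' - w').
have [ua va] : cabs u <= a /\ cabs v <= a by rewrite /a !le_max !lexx orbT.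
have [ua' va'] : cabs u' <= a' /\ cabs v' <= a' by rewrite /a' !le_max !lexx orbT.
have [ub wb] : cabs (u - v) <= b /\ cabs w <= b by rewrite /b !le_max !lexx orbT.
have [ub' wb'] : cabs (u' - v') <= b' /\ cabs w' <= b' by rewrite /b' !le_max !lexx orbT.
have a0 : 0 <= a := max_cabs_ge0 _ _. have a0' : 0 <= a' := max_cabs_ge0 _ _.
have b0 : 0 <= b := max_cabs_ge0 _ _. have b0' : 0 <= b' := max_cabs_ge0 _ _.
have c0 : 0 <= c := cabs_ge0 _. have c0' : 0 <= c' := cabs_ge0 _.
have mm (x y : R[i]) (e f : R) : cabs x <= e -> cabs y <= f -> cabs (x * y) <= e * f.
  by move=> h1 h2; rewrite cabsM ler_pM ?cabs_ge0.
set m := lam / t; have mp : 0 < m := m0.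
apply: (@le_trans _ _ (a * a' + m * (a * b' + b * a') + m ^+ 2 * (c * a' + b * b' + a * c'))).
  apply: lerD; first apply: lerD.
  - by rewrite ge_max !mm.
  - rewrite ler_pM2l// ge_max; apply/andP; split.
      have -> : u * u' - v * v' = v * (u' - v') + (u - v) * u' by ring.
      by apply: (le_trans (cabsD _ _)); apply: lerD; exact: mm.
    by apply: (le_trans (cabsD _ _)); apply: lerD; [|rewrite mulrC]; exact: mm.
  - rewrite ler_pM2l ?exprn_gt0//.
    have -> : u * u' - v * v' - (v * w' + v' * w) =
      (u - v - w) * u' + w * (u' - v') + v * (u' - v' - w') by ring.
    apply: (le_trans (cabsD _ _)); apply: lerD; last exact: mm.
    by apply: (le_trans (cabsD _ _)); apply: lerD; exact: mm.
rewrite -subr_ge0.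
have -> : (a + m * b + m ^+ 2 * c) * (a' + m * b' + m ^+ 2 * c') -
  (a * a' + m * (a * b' + b * a') + m ^+ 2 * (c * a' + b * b' + a * c')) =
  m ^+ 3 * (b * c' + c * b') + m ^+ 4 * (c * c') by ring.
have h1 : 0 <= b * c' + c * b' by rewrite addr_ge0// mulr_ge0.
by apply: addr_ge0; apply: mulr_ge0; [exact: exprn_ge0 (ltW mp)|exact: h1|exact: exprn_ge0 (ltW mp)|exact: mulr_ge0].
Qed.

Lemma jnorm_fst X : cabs X.1.1 <= jnorm X.
Proof.
rewrite /jnorm -addrA; apply: ler_wpDr; last by rewrite le_max lexx.
by apply: addr_ge0; [exact: mid_ge0|exact: rem_ge0].
Qed.

Lemma jnorm_snd X : cabs X.1.2 <= jnorm X.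
Proof.
rewrite /jnorm -addrA; apply: ler_wpDr; last by rewrite le_max lexx orbT.
by apply: addr_ge0; [exact: mid_ge0|exact: rem_ge0].
Qed.

Lemma jnorm_lin X : lam / t * cabs X.2 <= jnorm X.
Proof.
rewrite /jnorm addrAC; apply: ler_wpDl.
  by apply: addr_ge0; [exact: max_cabs_ge0|exact: rem_ge0].
by rewrite ler_pM2l// le_max lexx orbT.
Qed.

Lemma jnorm_rem X : (lam / t) ^+ 2 * cabs (X.1.1 - X.1.2 - X.2) <= jnorm X.
Proof.
rewrite /jnorm; apply: ler_wpDl => //.
by apply: addr_ge0; [exact: max_cabs_ge0|exact: mid_ge0].
Qed.

Lemma jnorm_prod (I : Type) (s : seq I) (U : I -> jet) (K : I -> R) :
  (forall i, jnorm (U i) <= K i) ->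
  jnorm (\big[jmul/jone]_(i <- s) (jone + U i)) <= \prod_(i <- s) (1 + K i).
Proof.
move=> h; elim: s => [|i s IH]; first by rewrite !big_nil jnorm1.
rewrite !big_cons; apply: (le_trans (jnormM _ _)); apply: ler_pM => //; try exact: jnorm_ge0.
by apply: (le_trans (jnormD _ _)); rewrite jnorm1 lerD2l.
Qed.

(** Appending a factor 1 + U_i changes the product X by X U_i, and the majorant grows by at least
    the norm of that. *)
Lemma jnorm_prodB (I : Type) (s s' : seq I) (U : I -> jet) (K : I -> R) :
  (forall i, jnorm (U i) <= K i) ->
  jnorm (\big[jmul/jone]_(i <- s ++ s') (jone + U i) - \big[jmul/jone]_(i <- s) (jone + U i))
  <= \prod_(i <- s ++ s') (1 + K i) - \prod_(i <- s) (1 + K i).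
Proof.
move=> h; have K0 i : 0 <= K i by apply: le_trans (h i); exact: jnorm_ge0.
elim/last_ind: s' => [|s' i IH].
  by rewrite cats0 !subrr (_ : 0 = (0, 0, 0) :> jet)// jnorm_diag cabs0.
rewrite -cats1 catA; move: IH; move: (s ++ s') => r IH.
rewrite !big_cat /= !big_seq1.
set X := \big[jmul/jone]_(j <- r) _; set P := \prod_(j <- r) _.
have X1 : jmul X jone = X by rewrite jmulC jmul1.
rewrite jmulDr X1 addrAC.
apply: (le_trans (jnormD _ _)).
set S := \prod_(i <- s) _.
have -> : P * (1 + K i) - S = (P - S) + P * K i by ring.
apply: lerD; first exact: IH.
apply: (le_trans (jnormM _ _)); apply: ler_pM; [exact: jnorm_ge0|exact: jnorm_ge0| |exact: h].
exact: jnorm_prod.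
Qed.

End Jets.

(** * Double products and their majorants *)

Section DoubleProduct.
Variable R : realType.
Notation C := (R[i])^o.

(** The index pairs are listed by growing squares. Square partial products then become partial
    products along a single sequence, and [jnorm_prodB] compares any two of them. *)
Definition shell (n : nat) : seq (nat * nat) :=
  [seq (j, n) | j <- iota 0 n] ++ [seq (n, k) | k <- iota 0 n.+1].
Definition square (n : nat) : seq (nat * nat) := flatten [seq shell i | i <- iota 0 n].

Lemma squareS n : square n.+1 = square n ++ shell n.
Proof. by rewrite /square -addn1 iotaD map_cat flatten_cat /= cats0 add0n. Qed.

Lemma square_le m n : (m <= n)%N -> exists s, square n = square m ++ s.
Proof.
elim: n => [|n IH]; first by rewrite leqn0 => /eqP->; exists [::].
rewrite leq_eqVlt => /orP[/eqP->|]; first by exists [::]; rewrite cats0.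
by rewrite ltnS => /IH[s es]; exists (s ++ shell n); rewrite squareS es catA.
Qed.

Lemma big_square (T : Type) (idx : T) (op : Monoid.com_law idx) (F : nat -> nat -> T) n :
  \big[op/idx]_(jk <- square n) F jk.1 jk.2 =
  \big[op/idx]_(j < n) \big[op/idx]_(k < n) F j k.
Proof.
elim: n => [|n IH]; first by rewrite big_ord0 /square /= big_nil.
rewrite squareS big_cat IH /shell big_cat !big_map big_ord_recr /=.
under [in RHS]eq_bigr do rewrite big_ord_recr /=.
rewrite big_split /= -!Monoid.mulmA; congr (op _ _); congr (op _ _).
  by rewrite -(big_mkord xpredT (fun i => F i n)) /index_iota subn0.
by rewrite -(big_mkord xpredT (fun i => F n i)) /index_iota subn0.
Qed.

Definition dpN (N : nat) (x p q : R[i]) : R[i] :=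
  \prod_(j < N) \prod_(k < N) (1 - p ^+ j * q ^+ k * x).

Definition majN (M r : R) (N : nat) : R := \prod_(jk <- square N) (1 + M * r ^+ jk.1 * r ^+ jk.2).

Lemma dpN_square N x p q :
  dpN N x p q = \prod_(jk <- square N) (1 - p ^+ jk.1 * q ^+ jk.2 * x).
Proof. by rewrite (big_square _ (fun j k => 1 - p ^+ j * q ^+ k * x)). Qed.

Section Maj.
Variables (M r : R).
Hypotheses (M0 : 0 <= M) (r0 : 0 <= r) (r1 : r < 1).

Let K0 (jk : nat * nat) : 0 <= M * r ^+ jk.1 * r ^+ jk.2.
Proof. by rewrite !mulr_ge0// exprn_ge0. Qed.

Lemma majN_ge1 (s : seq (nat * nat)) : 1 <= \prod_(jk <- s) (1 + M * r ^+ jk.1 * r ^+ jk.2).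
Proof.
elim: s => [|i s IH]; first by rewrite big_nil.
by rewrite big_cons; apply: mulr_ege1 => //; rewrite lerDl.
Qed.

Lemma majN_nd m n : (m <= n)%N -> majN M r m <= majN M r n.
Proof.
move=> /square_le[s es]; rewrite /majN es big_cat /= ler_peMr//.
  by apply: le_trans (majN_ge1 _); exact: ler01.
exact: majN_ge1.
Qed.

Lemma sum_geo_le n : \sum_(k < n) r ^+ k <= (1 - r)^-1.
Proof.
have r10 : 0 < 1 - r by rewrite subr_gt0.
rewrite -(ler_pM2l r10) divff ?gt_eqF//.
rewrite -(opprB r 1) mulNr -subrX1 opprB.
by rewrite lerBlDr lerDl exprn_ge0.
Qed.

(** By 1 + x <= e^x the product is bounded by the exponential of a product of two geometric sums. *)
Lemma majN_bounded n : majN M r n <= expR (M * (1 - r)^-1 * (1 - r)^-1).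
Proof.
have r10 : 0 <= (1 - r)^-1 by rewrite invr_ge0 subr_ge0 ltW.
apply: (@le_trans _ _ (\prod_(jk <- square n) expR (M * r ^+ jk.1 * r ^+ jk.2))).
  apply: ler_prod => jk _; rewrite addr_ge0//=; exact: expR_ge1Dx.
rewrite -expR_sum ler_expR (big_square _ (fun j k => M * r ^+ j * r ^+ k)).
rewrite (_ : \big[_/_]_(j < n) _ = M * (\sum_(j < n) r ^+ j) * (\sum_(k < n) r ^+ k)).
  have S0 : 0 <= \sum_(j < n) r ^+ j by apply: sumr_ge0 => i _; rewrite exprn_ge0.
  have S1 := sum_geo_le n.
  by apply: ler_pM => //; [exact: mulr_ge0|exact: ler_wpM2l].
have -> : M * (\sum_(j < n) r ^+ j) = \sum_(j < n) M * r ^+ j by rewrite mulr_sumr.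
by rewrite big_distrlr.
Qed.

Definition majlim : R := limn (majN M r).

Lemma majN_cvg : majN M r @ \oo --> majlim.
Proof.
apply: nondecreasing_is_cvgn; first by move=> m n; exact: majN_nd.
by exists (expR (M * (1 - r)^-1 * (1 - r)^-1)) => _ [n _ <-]; exact: majN_bounded.
Qed.

Lemma majN_le n : majN M r n <= majlim.
Proof.
apply: nondecreasing_cvgn_le; first by move=> m k; exact: majN_nd.
exact: (cvgP _ majN_cvg).
Qed.

(** [a] plus the majorant is nondecreasing and bounded, so [a] converges as a difference of two
    monotone sequences. *)
Lemma real_maj_cvg (a : R^nat) : (forall m n, (m <= n)%N -> `|a n - a m| <= majN M r n - majN M r m) ->
  exists l : R, a @ \oo --> l.
Proof.
move=> h.
have nd : nondecreasing_seq (fun n => a n + majN M r n).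
  move=> m n mn; have := h m n mn; rewrite ler_norml => /andP[h1 _]; lra.
have ub : has_ubound (range (fun n => a n + majN M r n)).
  exists (a 0 + 2 * majlim) => _ [n _ <-].
  have := h 0 n (leq0n n); rewrite ler_norml => /andP[_ h2].
  have := majN_le n; have : 0 <= majN M r 0 by apply: le_trans (majN_ge1 _); exact: ler01.
  lra.
have cv := nondecreasing_is_cvgn nd ub.
exists (limn (fun n => a n + majN M r n) - majlim).
have e : (fun n => a n + majN M r n - majN M r n) = a by apply: funext => n; rewrite addrK.
rewrite -[X in X @ _ --> _]e.
by apply: cvgB; [exact: cv|exact: majN_cvg].
Qed.

Lemma maj_cvg (a : nat -> R[i]) :
  (forall m n, (m <= n)%N -> cabs (a n - a m) <= majN M r n - majN M r m) ->
  exists2 l : R[i], ccvg \oo a l & forall m, cabs (l - a m) <= majlim - majN M r m.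
Proof.
move=> h.
have [|u hu] := @real_maj_cvg (fun n => complex.Re (a n)).
  by move=> m n mn; rewrite -raddfB; apply: le_trans (h m n mn); exact: Re_le_cabs.
have [|v hv] := @real_maj_cvg (fun n => complex.Im (a n)).
  by move=> m n mn; rewrite -raddfB; apply: le_trans (h m n mn); exact: Im_le_cabs.
have cv : ccvg \oo a (u +i* v).
  have e : a = (fun n => complex.Re (a n) +i* complex.Im (a n)) by apply: funext => n; case: (a n).
  by rewrite e; apply: ccvg_ReIm.
exists (u +i* v) => // m.
have cm : (fun n => cabs (a n - a m)) @ \oo --> cabs ((u +i* v) - a m).
  by apply: ccvg_cabs; apply: ccvgB; [exact: cv|exact: ccvg_cst].
have cP : (fun n => majN M r n - majN M r m) @ \oo --> majlim - majN M r m.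
  by apply: cvgB; [exact: majN_cvg|exact: cvg_cst].
apply: ler_cvg_to cm cP _.
by exists m => // n /= mn; exact: h.
Qed.

End Maj.

Section JetProduct.
Variables (lam t M r : R) (U : nat * nat -> jet R).
Hypotheses (lam0 : 0 < lam) (t0 : 0 < t) (M0 : 0 <= M) (r0 : 0 <= r) (r1 : r < 1).
Hypothesis hU : forall jk, jnorm lam t (U jk) <= M * r ^+ jk.1 * r ^+ jk.2.

Definition jetN N : jet R := \big[@jmul R/jone R]_(jk <- square N) (jone R + U jk).

Lemma jetN_le N : jnorm lam t (jetN N) <= majN M r N.
Proof. exact: jnorm_prod. Qed.

Lemma jetNB m n : (m <= n)%N -> jnorm lam t (jetN n - jetN m) <= majN M r n - majN M r m.
Proof.
move=> /square_le[s es]; rewrite /jetN /majN es.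
exact: jnorm_prodB.
Qed.

Lemma jetN_fst N : (jetN N).1.1 = \prod_(jk <- square N) (1 + (U jk).1.1).
Proof.
rewrite /jetN; elim: (square N) => [|i s IH]; first by rewrite !big_nil.
by rewrite !big_cons /= IH.
Qed.

Lemma jetN_snd N : (jetN N).1.2 = \prod_(jk <- square N) (1 + (U jk).1.2).
Proof.
rewrite /jetN; elim: (square N) => [|i s IH]; first by rewrite !big_nil.
by rewrite !big_cons /= IH.
Qed.

Lemma jetN_cvg : exists X : jet R, [/\ ccvg \oo (fun N => (jetN N).1.1) X.1.1,
  ccvg \oo (fun N => (jetN N).1.2) X.1.2, ccvg \oo (fun N => (jetN N).2) X.2,
  (forall m, cabs (X.1.1 - (jetN m).1.1) <= majlim M r - majN M r m) &
  lam / t * cabs X.2 <= majlim M r /\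
  (lam / t) ^+ 2 * cabs (X.1.1 - X.1.2 - X.2) <= majlim M r].
Proof.
have [|a ca ba] := @maj_cvg M r M0 r0 r1 (fun N => (jetN N).1.1).
  by move=> m n mn; apply: le_trans (jetNB mn); exact: (jnorm_fst lam0 t0 (jetN n - jetN m)).
have [|b cb _] := @maj_cvg M r M0 r0 r1 (fun N => (jetN N).1.2).
  by move=> m n mn; apply: le_trans (jetNB mn); exact: (jnorm_snd lam0 t0 (jetN n - jetN m)).
have m0 : 0 < lam / t by rewrite divr_gt0.
(* Scaled by lam / t the linear parts are dominated by the jet norm ([jnorm_lin]), and hence by the
   same majorant. *)
have [|c cc _] := @maj_cvg M r M0 r0 r1 (fun N => (lam / t)%:C * (jetN N).2).
  move=> m n mn; apply: le_trans (jetNB mn).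
  apply: le_trans (jnorm_lin lam0 t0 (jetN n - jetN m)).
  by rewrite -mulrBr cabsM cabs_real gtr0_norm.
have m0c : (lam / t)%:C != 0 :> R[i] by rewrite -cabs_gt0 cabs_real gtr0_norm.
have cc' : ccvg \oo (fun N => (jetN N).2) ((lam / t)%:C^-1 * c).
  have : ccvg \oo (fun N => (lam / t)%:C^-1 * ((lam / t)%:C * (jetN N).2)) ((lam / t)%:C^-1 * c).
    by apply: ccvgM; [exact: ccvg_cst|exact: cc].
  by congr ccvg; apply: funext => N; rewrite mulKf.
have bd (Y : nat -> R[i]) (y : R[i]) (k : R) : ccvg \oo Y y ->
    (forall N, k * cabs (Y N) <= jnorm lam t (jetN N)) -> k * cabs y <= majlim M r.
  move=> cY hY.
  have c1 : (fun n => k * cabs (Y n)) @ \oo --> k * cabs y.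
    by apply: cvgM; [exact: cvg_cst|exact: ccvg_cabs].
  apply: ler_cvg_to c1 (cvg_cst (majlim M r)) _.
  apply: nearW => n; apply: (le_trans (hY n)); apply: (le_trans (jetN_le n)).
  exact: majN_le.
exists (a, b, (lam / t)%:C^-1 * c); split => //=; split.
  by apply: (bd _ _ _ cc') => N; exact: jnorm_lin.
apply: (bd (fun N => (jetN N).1.1 - (jetN N).1.2 - (jetN N).2)).
  by apply: ccvgB; [apply: ccvgB; [exact: ca|exact: cb]|exact: cc'].
by move=> N; exact: jnorm_rem.
Qed.

End JetProduct.
End DoubleProduct.

Section DpLimit.
Variable R : realType.
Notation C := (R[i])^o.

(** The double q-Pochhammer symbol (x; p, q). *)
Definition dp (x p q : R[i]) : R[i] := limn (fun N => dpN N x p q : C).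

(** Jets without displacement, whose norm is the modulus of the value: the bounds for products of
    jets then apply to the values alone. *)
Let diagjet (x p q : R[i]) (jk : nat * nat) : jet R :=
  (- (p ^+ jk.1 * q ^+ jk.2 * x), - (p ^+ jk.1 * q ^+ jk.2 * x), 0).

Let diagjetN x p q N : (jetN (diagjet x p q) N).1.1 = dpN N x p q.
Proof. by rewrite jetN_fst dpN_square. Qed.

Section Bound.
Variables (M r : R) (x p q : R[i]).
Hypotheses (r0 : 0 <= r) (r1 : r < 1).
Hypotheses (xM : cabs x <= M) (pr : cabs p <= r) (qr : cabs q <= r).

Let M0 : 0 <= M. Proof. by apply: le_trans xM; exact: cabs_ge0. Qed.

Let hU jk : jnorm 1 1 (diagjet x p q jk) <= M * r ^+ jk.1 * r ^+ jk.2.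
Proof.
have hX (z : R[i]) n : cabs z <= r -> cabs (z ^+ n) <= r ^+ n.
  by move=> h; rewrite cabsX lerXn2r// nnegrE cabs_ge0.
rewrite jnorm_diag// cabsN !cabsM [leRHS]mulrAC -mulrA mulrC; apply: ler_pM; rewrite ?mulr_ge0 ?cabs_ge0//.
  by rewrite mulrC; apply: ler_pM; rewrite ?cabs_ge0// hX.
exact: hX.
Qed.

Lemma dpN_dist m n : (m <= n)%N -> cabs (dpN n x p q - dpN m x p q) <= majN M r n - majN M r m.
Proof.
move=> mn; have := jetNB (@ltr01 R) (@ltr01 R) hU mn.
by apply: le_trans; rewrite -!diagjetN; exact: (jnorm_fst (@ltr01 R) (@ltr01 R) (_ - _)).
Qed.

Let dp_cvg_dist : ccvg \oo (fun N => dpN N x p q) (dp x p q) /\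
  forall m, cabs (dp x p q - dpN m x p q) <= majlim M r - majN M r m.
Proof.
have [l cl bl] := maj_cvg M0 r0 r1 dpN_dist.
have -> : dp x p q = l by apply: (@cvg_lim C); [exact: norm_hausdorff|exact: cl].
by split.
Qed.

Lemma dp_cvg0 : ccvg \oo (fun N => dpN N x p q) (dp x p q).
Proof. by case: dp_cvg_dist. Qed.

Lemma dp_dist m : cabs (dp x p q - dpN m x p q) <= majlim M r - majN M r m.
Proof. by case: dp_cvg_dist. Qed.

End Bound.

Lemma mid_lt1 (a b : R) : a < 1 -> b < 1 -> exists2 r, (a < r /\ b < r) & r < 1.
Proof.
move=> a1 b1; exists ((1 + Num.max a b) / 2).
  have h1 : a <= Num.max a b by rewrite le_max lexx.
  have h2 : b <= Num.max a b by rewrite le_max lexx orbT.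
  have : Num.max a b < 1 by rewrite gt_max a1.
  by split; lra.
have : Num.max a b < 1 by rewrite gt_max a1.
lra.
Qed.

Lemma dp_cvg x p q : cabs p < 1 -> cabs q < 1 -> ccvg \oo (fun N => dpN N x p q) (dp x p q).
Proof.
move=> p1 q1; have [r [pr qr] r1] := mid_lt1 p1 q1.
have r0 : 0 <= r by apply: le_trans (ltW pr); exact: cabs_ge0.
by apply: (dp_cvg0 r0 r1 (lexx (cabs x))); exact: ltW.
Qed.

Lemma ccvg_dpN (T : Type) (F : set_system T) {FF : Filter F} N (x p q : T -> R[i]) (x0 p0 q0 : R[i]) :
  ccvg F x x0 -> ccvg F p p0 -> ccvg F q q0 ->
  ccvg F (fun t => dpN N (x t) (p t) (q t)) (dpN N x0 p0 q0).
Proof.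
move=> cx cp cq; apply: ccvg_prod => j _; apply: ccvg_prod => k _.
apply: ccvgB; first exact: ccvg_cst.
by apply: ccvgM; [apply: ccvgM; apply: ccvgX|].
Qed.

Lemma ccvg_lt (T : Type) (F : set_system T) {FF : Filter F} (f : T -> R[i]) (l : R[i]) (b : R) :
  ccvg F f l -> cabs l < b -> \forall t \near F, cabs (f t) <= b.
Proof.
move=> cf lb; have e0 : 0 < b - cabs l by rewrite subr_gt0.
have /ccvgP/(_ _ e0) := cf; apply: filterS => t.
by have := cabs_sub_le (f t) l; rewrite cabsB; lra.
Qed.

(** An epsilon / 3 argument: the tail bound is uniform for bounded |x| and for |p|, |q| <= r < 1,
    and truncated products are continuous. Any [f] with that tail bound is allowed, in order to
    cover both [dp] and truncations of growing order. *)
Let joint_aux (T : Type) (F : set_system T) {FF : Filter F} (x p q : T -> R[i]) (x0 p0 q0 : R[i])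
  (f : T -> R[i]) : cabs p0 < 1 -> cabs q0 < 1 ->
  ccvg F x x0 -> ccvg F p p0 -> ccvg F q q0 ->
  (forall M r m, 0 <= r -> r < 1 -> \forall t \near F, cabs (x t) <= M -> cabs (p t) <= r -> cabs (q t) <= r ->
     cabs (f t - dpN m (x t) (p t) (q t)) <= majlim M r - majN M r m) ->
  ccvg F f (dp x0 p0 q0).
Proof.
move=> p1 q1 cx cp cq hf.
have [r [pr qr] r1] := mid_lt1 p1 q1.
have r0 : 0 <= r by apply: le_trans (ltW pr); exact: cabs_ge0.
set M := cabs x0 + 1.
have xM : cabs x0 < M by rewrite /M; lra.
have M0 : 0 <= M by rewrite addr_ge0 ?cabs_ge0.
apply/ccvgP => e e0; have e3 : 0 < e / 3 by rewrite divr_gt0.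
have /cvgrPdist_lt/(_ _ e3) [m _ /(_ m (leqnn m)) /= hmaj] := majN_cvg M0 r0 r1.
have h1 := @ccvg_lt T F FF _ _ _ cx xM.
have h2 := @ccvg_lt T F FF _ _ _ cp pr.
have h3 := @ccvg_lt T F FF _ _ _ cq qr.
have h5 := hf M r m r0 r1.
have /ccvgP/(_ _ e3) h4 := @ccvg_dpN T F FF m _ _ _ _ _ _ cx cp cq.
have hb : majlim M r - majN M r m < e / 3 by apply: le_lt_trans hmaj; exact: ler_norm.
have h0 : cabs (dp x0 p0 q0 - dpN m x0 p0 q0) < e / 3.
  by apply: le_lt_trans hb; apply: dp_dist => //; exact: ltW.
near=> t.
have k1 : cabs (f t - dpN m (x t) (p t) (q t)) < e / 3.
  apply: le_lt_trans hb.
  have a1 : cabs (x t) <= M by near: t.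
  have a2 : cabs (p t) <= r by near: t.
  have a3 : cabs (q t) <= r by near: t.
  by move: a1 a2 a3; near: t.
have k2 : cabs (dpN m x0 p0 q0 - dpN m (x t) (p t) (q t)) < e / 3 by near: t.
set a := dp _ _ _ in h0 *; set b := dpN m x0 _ _ in h0 k2 *.
set c := dpN m (x t) _ _ in k1 k2 *.
have -> : a - f t = (a - b) + ((b - c) - (f t - c)) by ring.
have := cabsD (a - b) ((b - c) - (f t - c)).
have := cabsD (b - c) (- (f t - c)); rewrite cabsN; lra.
Unshelve. all: by end_near. Qed.

Lemma ccvg_dp (T : Type) (F : set_system T) {FF : Filter F} (x p q : T -> R[i]) (x0 p0 q0 : R[i]) :
  cabs p0 < 1 -> cabs q0 < 1 -> ccvg F x x0 -> ccvg F p p0 -> ccvg F q q0 ->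
  ccvg F (fun t => dp (x t) (p t) (q t)) (dp x0 p0 q0).
Proof.
move=> p1 q1 cx cp cq; apply: joint_aux p1 q1 cx cp cq _.
move=> M r m r0 r1; apply: nearW => t xM pr qr; exact: dp_dist.
Qed.

Lemma ccvg_dpN_oo (T : Type) (F : set_system T) {FF : Filter F} (x p q : T -> R[i]) (x0 p0 q0 : R[i])
  (N : T -> nat) :
  cabs p0 < 1 -> cabs q0 < 1 -> ccvg F x x0 -> ccvg F p p0 -> ccvg F q q0 ->
  (forall m, \forall t \near F, (m <= N t)%N) ->
  ccvg F (fun t => dpN (N t) (x t) (p t) (q t)) (dp x0 p0 q0).
Proof.
move=> p1 q1 cx cp cq hN; apply: joint_aux p1 q1 cx cp cq _.
move=> M r m r0 r1; have := hN m; apply: filterS => t mN xM pr qr.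
have M0 : 0 <= M by apply: le_trans xM; exact: cabs_ge0.
apply: le_trans (dpN_dist r0 xM pr qr mN) _.
by rewrite lerD2r; exact: majN_le.
Qed.

End DpLimit.

(** * Theta functions and the elliptic gamma function *)

Section Theta.
Variable R : realType.
Notation C := (R[i])^o.
Implicit Types (x p q : R[i]).

(** The symbol (x; p): with second base 0, and 0 ^+ 0 = 1, only the factors with k = 0 differ from
    1. *)
Definition qp x p : R[i] := dp x p 0.
Definition th x p : R[i] := qp x p * qp (p / x) p.
(** The elliptic gamma function as a quotient of two convergent products. It agrees with [ellGamma]
    where neither [x] nor [dp x p q] vanishes ([ellGammaE]). *)
Definition Gam x p q : R[i] := dp (p * q / x) p q / dp x p q.

Lemma cabs0_lt1 : cabs (0 : R[i]) < 1. Proof. by rewrite cabs0 ltr01. Qed.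
Hint Resolve cabs0_lt1 : core.

Lemma dpN_sym N x p q : dpN N x p q = dpN N x q p.
Proof.
rewrite /dpN exchange_big /=; apply: eq_bigr => j _; apply: eq_bigr => k _.
by rewrite (mulrC (p ^+ _)).
Qed.

Lemma dp_sym x p q : dp x p q = dp x q p.
Proof. by rewrite /dp (_ : (fun N => dpN N x p q) = fun N => dpN N x q p)//; apply: funext => N; exact: dpN_sym. Qed.

Lemma dpN0 N p q : dpN N 0 p q = 1.
Proof. by rewrite /dpN big1// => j _; rewrite big1// => k _; rewrite mulr0 subr0. Qed.

Lemma dp0 p q : cabs p < 1 -> cabs q < 1 -> dp 0 p q = 1.
Proof.
move=> p1 q1; apply: (@ccvg_uniq _ _ \oo _ _ _ _ (dp_cvg p1 q1)).
by under eq_fun do rewrite dpN0; exact: ccvg_cst.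
Qed.

Lemma dpN_q0 N x p : dpN N.+1 x p 0 = \prod_(j < N.+1) (1 - p ^+ j * x).
Proof.
apply: eq_bigr => j _; rewrite big_ord_recl expr0 mulr1 big1 ?mulr1// => k _.
by rewrite /= expr0n /= mulr0 mul0r subr0.
Qed.

Lemma ccvg_pow0 q x : cabs q < 1 -> ccvg \oo (fun N => q ^+ N * x) 0.
Proof.
move=> q1; apply: (@ccvg_squeeze _ _ \oo _ _ _ (fun N => cabs q ^+ N * cabs x)).
  by apply: nearW => N; rewrite sub0r cabsN cabsM cabsX.
rewrite -[X in _ --> X](mul0r (cabs x)); apply: cvgM; last exact: cvg_cst.
by apply: cvg_expr; rewrite ger0_norm ?cabs_ge0.
Qed.

Lemma dp_shift x p q : cabs p < 1 -> cabs q < 1 -> dp x p q = qp x p * dp (q * x) p q.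
Proof.
move=> p1 q1.
(* Shifting the columns of a truncated product leaves over the column [dpN N (q ^+ N * x) p 0],
   which tends to 1. *)
have h1 : ccvg \oo (fun N => dpN N x p q * dpN N (q ^+ N * x) p 0) (dp x p q * 1).
  apply: ccvgM; first exact: dp_cvg.
  rewrite -(dp0 p1 cabs0_lt1); apply: (ccvg_dpN_oo p1 cabs0_lt1); [exact: ccvg_pow0|exact: ccvg_cst|exact: ccvg_cst|].
  by move=> m; exists m.
have h2 : ccvg \oo (fun N => dpN N x p 0 * dpN N (q * x) p q) (qp x p * dp (q * x) p q).
  by apply: ccvgM; apply: dp_cvg.
rewrite -[LHS]mulr1; apply: (@ccvg_uniq _ _ \oo _ _ _ _ h1).
apply: ccvg_eq h2; exists 1%N => // -[//|N] _ /=.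
rewrite !dpN_q0 /dpN -!big_split /=; apply: eq_bigr => j _.
transitivity (\prod_(k < N.+2) (1 - p ^+ j * q ^+ k * x)).
  rewrite [RHS]big_ord_recl expr0 mulr1; congr (_ * _).
  by apply: eq_bigr => k _; rewrite /bump /= exprS; congr (1 - _); ring.
by rewrite [LHS]big_ord_recr /=; congr (_ * (1 - _)); ring.
Qed.

Lemma qp_shift x p : cabs p < 1 -> qp x p = (1 - x) * qp (p * x) p.
Proof.
move=> p1; rewrite /qp dp_sym (dp_shift x cabs0_lt1 p1) dp_sym; congr (_ * _).
apply: (@ccvg_uniq _ _ \oo _ _ _ _ (dp_cvg cabs0_lt1 cabs0_lt1)).
apply: ccvg_near_cst; exists 1%N => // -[//|N] _ /=.
rewrite dpN_q0 big_ord_recl expr0 mul1r big1 ?mulr1// => k _.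
by rewrite /= expr0n /= mul0r subr0.
Qed.

Lemma ccvg_qp (T : Type) (F : set_system T) {FF : Filter F} (x p : T -> R[i]) (x0 p0 : R[i]) :
  cabs p0 < 1 -> ccvg F x x0 -> ccvg F p p0 -> ccvg F (fun t => qp (x t) (p t)) (qp x0 p0).
Proof. by move=> p1 cx cp; apply: ccvg_dp; [exact: p1|exact: cabs0_lt1|exact: cx|exact: cp|exact: ccvg_cst]. Qed.

Lemma dp_pow_neq0 x p q y : cabs p < 1 -> cabs q < 1 -> cabs y < 1 -> exists K, dp (y ^+ K * x) p q != 0.
Proof.
move=> p1 q1 y1.
have h : ccvg \oo (fun N => dp (y ^+ N * x) p q) 1.
  by rewrite -(dp0 p1 q1); apply: ccvg_dp; [exact: p1|exact: q1|exact: ccvg_pow0|exact: ccvg_cst|exact: ccvg_cst].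
have /ccvgP/(_ _ ltr01) [K _ /(_ K (leqnn K)) /= hK] := h.
by exists K; apply/eqP => e; move: hK; rewrite e subr0 cabs1 ltxx.
Qed.

(** Finitely many factors are pulled out until the argument is so small that the remaining product
    is close to 1. *)
Lemma qp_neq0 x p : cabs p < 1 -> (forall j, p ^+ j * x != 1) -> qp x p != 0.
Proof.
move=> p1 h; have [K hK] := dp_pow_neq0 x p1 cabs0_lt1 p1.
elim: K x h hK => [|K IH] x h hK; first by rewrite expr0 mul1r in hK.
rewrite qp_shift// mulf_neq0//.
  by rewrite subr_eq0 eq_sym; have := h 0%N; rewrite expr0 mul1r.
apply: IH; first by move=> j; rewrite mulrA -exprSr.
by rewrite mulrA -exprSr.
Qed.

Lemma dp_neq0 x p q : cabs p < 1 -> cabs q < 1 -> (forall j k, p ^+ j * q ^+ k * x != 1) ->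
  dp x p q != 0.
Proof.
move=> p1 q1 h; have [K hK] := dp_pow_neq0 x p1 q1 q1.
elim: K x h hK => [|K IH] x h hK; first by rewrite expr0 mul1r in hK.
rewrite dp_shift// mulf_neq0//.
  by apply: qp_neq0 => // j; have := h j 0%N; rewrite expr0 mulr1.
apply: IH; first by move=> j k; rewrite mulrA -(mulrA _ (q ^+ k)) -exprSr.
by rewrite mulrA -exprSr.
Qed.

Lemma dp_eq0 x p q j k : cabs p < 1 -> cabs q < 1 -> p ^+ j * q ^+ k * x = 1 -> dp x p q = 0.
Proof.
move=> p1 q1 e; apply: (@ccvg_uniq _ _ \oo _ _ _ _ (dp_cvg p1 q1)).
apply: ccvg_near_cst; exists (maxn j k).+1 => // N /= hN.
have jN : (j < N)%N by apply: leq_trans hN; rewrite ltnS leq_maxl.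
have kN : (k < N)%N by apply: leq_trans hN; rewrite ltnS leq_maxr.
rewrite /dpN (bigD1 (Ordinal jN)) //= (bigD1 (Ordinal kN)) //=.
by rewrite e subrr !mul0r.
Qed.

Lemma ellGammaE x p q : cabs p < 1 -> cabs q < 1 -> x != 0 -> dp x p q != 0 ->
  ellGamma x p q = Gam x p q.
Proof.
move=> p1 q1 x0 d0; rewrite /ellGamma; apply: (@cvg_lim C); first exact: norm_hausdorff.
have h : ccvg \oo (fun N => dpN N (p * q / x) p q * (dpN N x p q)^-1) (Gam x p q).
  by apply: ccvgM; [exact: dp_cvg|apply: ccvgV => //; exact: dp_cvg].
suff : ccvg \oo (fun N => \prod_(j < N) \prod_(k < N)
     ((1 - p ^+ j.+1 * q ^+ k.+1 / x) / (1 - p ^+ j * q ^+ k * x))) (Gam x p q) by [].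
apply: ccvg_eq h; apply: nearW => N; rewrite /dpN -prodfV -big_split /=.
apply: eq_bigr => j _; rewrite -prodfV -big_split /=; apply: eq_bigr => k _.
by rewrite !exprS; congr ((1 - _) * _); ring.
Qed.

Lemma qpochE p : cabs p < 1 -> qpoch p = qp p p.
Proof.
move=> p1; rewrite /qpoch; apply: (@cvg_lim C); first exact: norm_hausdorff.
suff : ccvg \oo (fun N => \prod_(1 <= k < N.+1) (1 - p ^+ k)) (qp p p) by [].
apply: ccvg_eq (dp_cvg p1 cabs0_lt1); exists 1%N => // -[//|N] _ /=.
rewrite dpN_q0 big_add1 /= big_mkord; apply: eq_bigr => j _.
by rewrite exprSr.
Qed.

Lemma th_inv x p : cabs p < 1 -> x != 0 -> th x^-1 p = - x^-1 * th x p.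
Proof.
move=> p1 x0; rewrite /th invrK (qp_shift x p1) (qp_shift x^-1 p1).
by rewrite (mulrC p x); field.
Qed.

Lemma th_shift x p : cabs p < 1 -> p != 0 -> x != 0 -> th (p * x) p = - x^-1 * th x p.
Proof.
move=> p1 p0 x0; rewrite -(th_inv p1 x0) /th invrK mulrC.
have -> : p / (p * x) = x^-1 by field; rewrite x0 p0.
by [].
Qed.

Lemma th1 p : cabs p < 1 -> th 1 p = 0.
Proof. by move=> p1; rewrite /th (qp_shift 1 p1) subrr !mul0r. Qed.

Lemma th_neq0 x p : cabs p < 1 -> (forall j, p ^+ j * x != 1) -> (forall j, p ^+ j.+1 / x != 1) ->
  th x p != 0.
Proof.
move=> p1 h1 h2; rewrite mulf_neq0// qp_neq0// => j.
by rewrite mulrA -exprSr.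
Qed.

(** Removing a row and a column from each double product on the left leaves simple products that
    combine to theta functions. In this multiplied form of the reflection formula nothing has to be
    nonzero. *)
Lemma dp_reflection x p q : cabs p < 1 -> cabs q < 1 -> 
  dp x p q * dp x^-1 p q = dp (p * q / x) p q * dp (p * q * x) p q * (th x p * th x^-1 q).
Proof.
move=> p1 q1; rewrite (dp_shift x p1 q1) (dp_sym (q * x)) (dp_shift (q * x) q1 p1).
rewrite (dp_sym x^-1) (dp_shift x^-1 q1 p1) (dp_sym (p / x) q) (dp_shift (p / x) p1 q1).
rewrite /th invrK (dp_sym (p * (q * x))) !mulrA (mulrC q p); ring.
Qed.

Lemma GamM x p q : cabs p < 1 -> cabs q < 1 -> dp x p q != 0 -> dp x^-1 p q != 0 ->
  dp (p * q / x) p q != 0 -> dp (p * q * x) p q != 0 ->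
  (Gam x p q * Gam x^-1 p q)^-1 = th x p * th x^-1 q.
Proof.
move=> p1 q1 h1 h2 h3 h4; rewrite /Gam invrK.
have := dp_reflection x p1 q1 => e.
have -> : th x p * th x^-1 q = dp x p q * dp x^-1 p q / (dp (p * q / x) p q * dp (p * q * x) p q).
  by rewrite e [X in X / _]mulrC mulfK// mulf_neq0.
by field; rewrite h1 h2 h3 h4.
Qed.

Lemma Gam_shift x p q : cabs p < 1 -> cabs q < 1 -> x != 0 -> q != 0 -> dp x p q != 0 ->
  Gam (q * x) p q = th x p * Gam x p q.
Proof.
move=> p1 q1 x0 q0 h; rewrite /Gam.
have e : p * q / (q * x) = p / x by field; rewrite x0.
rewrite e (dp_shift (p / x) p1 q1) /th.
have -> : q * (p / x) = p * q / x by ring.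
move: h; rewrite (dp_shift x p1 q1) mulf_eq0 negb_or => /andP[h1 h2].
by field; rewrite h1 h2.
Qed.

Lemma Gam_sym x p q : Gam x p q = Gam x q p.
Proof. by rewrite /Gam (mulrC p) !(dp_sym _ p). Qed.

(** [dp] without its factor 1 - y ([dp_dp1]), for the residues at simple poles of the gamma
    function. *)
Definition dp1 y p q := qp (p * y) p * dp (q * y) p q.

Lemma dp_dp1 y p q : cabs p < 1 -> cabs q < 1 -> dp y p q = (1 - y) * dp1 y p q.
Proof. by move=> p1 q1; rewrite dp_shift// qp_shift// mulrA. Qed.

Lemma dp1_1 p q : cabs p < 1 -> cabs q < 1 -> dp1 1 p q = qp p p * qp q q * dp (p * q) p q.
Proof.
move=> p1 q1; rewrite /dp1 !mulr1 (dp_sym q) (dp_shift q q1 p1) (dp_sym (p * q)).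
by rewrite mulrA.
Qed.

End Theta.
#[global] Hint Resolve cabs0_lt1 : core.
#[global] Hint Resolve cabs0_lt1 : core.

(** * Differentiability by means of jets *)

Section Differentiability.
Variable R : realType.
Notation C := (R[i])^o.
Variables (V : normedModType R[i]) (y0 : V) (lam r0 : R).
Hypotheses (lam0 : 0 < lam) (r00 : 0 < r0).

Definition vabs (h : V) : R := complex.Re `|h|.

Lemma normE_vabs (h : V) : `|h| = (vabs h)%:C.
Proof. by rewrite /vabs; have := ger0_Im (normr_ge0 h); case: `|h| => a b /= ->. Qed.

Lemma vabs_ge0 h : 0 <= vabs h.
Proof. by have := normr_ge0 h; rewrite normE_vabs lecR. Qed.

Lemma vabs_eq0 h : (vabs h == 0) = (h == 0).
Proof. by rewrite -[RHS]normr_eq0 normE_vabs eq_complex /= eqxx andbT. Qed.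

Lemma vabsZ (a : R[i]) h : vabs (a *: h) = cabs a * vabs h.
Proof.
by apply: complexI; rewrite -normE_vabs normrZ normcE_cabs normE_vabs rmorphM.
Qed.

(* Uniform bounds on jets pass to infinite products, and the bound on the quadratic remainder
   that they contain gives differentiability. *)
Definition jlin (J : V -> jet R) : Prop := (forall h, (J h).1.2 = (J 0).1.2) /\
  forall a u v, (J (a *: u + v)).2 = a * (J u).2 + (J v).2.

Definition isjet (f : V -> R[i]) (K : R) : Prop := 0 <= K /\ exists2 J, jlin J &
  forall h, [/\ (J h).1.1 = f (y0 + h), (J h).1.2 = f y0 &
    0 < vabs h -> vabs h <= r0 -> jnorm lam (vabs h) (J h) <= K].

Lemma jlinM J1 J2 : jlin J1 -> jlin J2 -> jlin (fun h => jmul (J1 h) (J2 h)).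
Proof.
move=> [a1 b1] [a2 b2]; split; first by move=> h; rewrite /= a1 a2.
by move=> a u v; rewrite /= b1 b2 !(a1 (_ + _)) !(a2 (_ + _)) (a1 u) (a1 v) (a2 u) (a2 v); ring.
Qed.

Lemma jlin_one : jlin (fun _ => jone R).
Proof. by split=> // a u v; rewrite /= mulr0 addr0. Qed.

Lemma jlinD J1 J2 : jlin J1 -> jlin J2 -> jlin (fun h => J1 h + J2 h).
Proof.
move=> [a1 b1] [a2 b2]; split; first by move=> h; rewrite /= a1 a2.
by move=> a u v; rewrite /= b1 b2; ring.
Qed.

Lemma isjetM f g K L : isjet f K -> isjet g L -> isjet (fun y => f y * g y) (K * L).
Proof.
move=> [K0 [J1 l1 h1]] [L0 [J2 l2 h2]]; split; first exact: mulr_ge0.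
exists (fun h => jmul (J1 h) (J2 h)); first exact: jlinM.
move=> h; have [a1 b1 c1] := h1 h; have [a2 b2 c2] := h2 h.
split; rewrite /= ?a1 ?a2 ?b1 ?b2// => p0 pr.
apply: (le_trans (jnormM lam0 p0 _ _)); apply: ler_pM; [exact: jnorm_ge0|exact: jnorm_ge0|exact: c1|exact: c2].
Qed.

Lemma isjet1 : isjet (fun _ => 1) 1.
Proof.
split; first exact: ler01.
exists (fun _ => jone R); first exact: jlin_one.
by move=> h; split => // p0 _; rewrite jnorm1.
Qed.

Lemma isjetX f K n : isjet f K -> isjet (fun y => f y ^+ n) (K ^+ n).
Proof.
move=> hf; elim: n => [|n IH]; first exact: isjet1.
have := isjetM hf IH; rewrite -exprS; congr isjet.
by apply: funext => y; rewrite exprS.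
Qed.

Lemma isjet_le f K L : K <= L -> isjet f K -> isjet f L.
Proof.
move=> KL [K0 [J lJ hJ]]; split; first exact: le_trans KL.
exists J => // h; have [a b c] := hJ h; split=> // p0 pr; exact: le_trans (c p0 pr) KL.
Qed.

Lemma isjetN f K : isjet f K -> isjet (fun y => - f y) K.
Proof.
move=> [K0 [J [l1 l2] hJ]]; split=> //.
exists (fun h => (- (J h).1.1, - (J h).1.2, - (J h).2)).
  split; first by move=> h /=; rewrite l1.
  by move=> a u v /=; rewrite l2; ring.
move=> h; have [a b c] := hJ h; split; rewrite /= ?a ?b// => p0 pr.
apply: le_trans (c p0 pr); rewrite /jnorm /=.
have e1 (u v : R[i]) : - u - - v = - (u - v) by ring.
by rewrite -a -b !e1 !cabsN.
Qed.

Lemma isjet_prod (I : Type) (s : seq I) (P : pred I) (f : I -> V -> R[i]) :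
  (forall i, P i -> exists K, isjet (f i) K) -> exists K, isjet (fun y => \prod_(i <- s | P i) f i y) K.
Proof.
move=> h; elim: s => [|i s [K IH]].
  by exists 1; under eq_fun do rewrite big_nil; exact: isjet1.
case Pi : (P i); last by exists K; under eq_fun do rewrite big_cons Pi.
have [L hL] := h i Pi; exists (L * K); under eq_fun do rewrite big_cons Pi.
exact: isjetM.
Qed.

(** The values contribute at most |l y0| + r0 to the norm, the linear part lam / t * |l h| <= lam,
    and the remainder is 0. *)
Lemma isjet_lin (l : V -> R[i]) : (forall a u v, l (a *: u + v) = a * l u + l v) ->
  (forall h, cabs (l h) <= vabs h) -> isjet l (cabs (l y0) + r0 + lam).
Proof.
move=> lin bd; split; first by rewrite !addr_ge0 ?cabs_ge0// ltW.
exists (fun h => (l (y0 + h), l y0, l h)); first by split.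
move=> h; split=> //= p0 pr.
have e : l (y0 + h) - l y0 = l h.
  by have := lin 1 y0 h; rewrite scale1r mul1r => ->; rewrite addrAC subrr add0r.
rewrite /jnorm /= e subrr cabs0 maxxx mulr0 addr0; apply: lerD.
  have h1 : cabs (l (y0 + h)) <= cabs (l y0) + r0.
    rewrite -(subrK (l y0) (l (y0 + h))) e; apply: (le_trans (cabsD _ _)).
    by rewrite addrC lerD2l; exact: le_trans (bd h) pr.
  by rewrite ge_max h1 lerDl ltW.
by rewrite mulrAC ler_pdivrMr// ler_pM2l.
Qed.

Lemma isjet_small f K h : isjet f K -> 0 < vabs h -> vabs h <= r0 -> cabs (f (y0 + h)) <= K.
Proof.
move=> [_ [J _ hJ]] p0 pr; have [<- _ /(_ p0 pr)] := hJ h.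
by apply: le_trans; exact: jnorm_fst.
Qed.

Lemma isjet_small0 f K h : isjet f K -> 0 < vabs h -> vabs h <= r0 -> cabs (f y0) <= K.
Proof.
move=> [_ [J _ hJ]] p0 pr; have [_ <- /(_ p0 pr)] := hJ h.
by apply: le_trans; exact: jnorm_snd.
Qed.

(** Jet norms are submultiplicative, so jets of norm less than 1 serve as bases of the product just
    as numbers of modulus less than 1 do. The derivative is obtained as the limit of the linear
    parts of the partial products. *)
Lemma isjet_dp x p q Kx Kp Kq : isjet x Kx -> isjet p Kp -> isjet q Kq -> Kp < 1 -> Kq < 1 ->
  exists K, isjet (fun y => dp (x y) (p y) (q y)) K.
Proof.
move=> jx jp jq Kp1 Kq1.
set r := Num.max Kp Kq.
have r1 : r < 1 by rewrite gt_max Kp1.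
have Kp0 : 0 <= Kp by case: jp. have Kq0 : 0 <= Kq by case: jq.
have Kx0 : 0 <= Kx by case: jx.
have rr0 : 0 <= r by rewrite le_max Kp0.
have hU jk : isjet (fun y => - (p y ^+ jk.1 * q y ^+ jk.2 * x y)) (Kx * r ^+ jk.1 * r ^+ jk.2).
  apply: isjetN; apply: isjet_le (isjetM (isjetM (isjetX jk.1 jp) (isjetX jk.2 jq)) jx).
  have -> : Kx * r ^+ jk.1 * r ^+ jk.2 = r ^+ jk.1 * r ^+ jk.2 * Kx by ring.
  apply: ler_wpM2r => //; apply: ler_pM; rewrite ?exprn_ge0// lerXn2r ?nnegrE// le_max lexx ?orbT//.
have /choice[J hJ] : forall jk, exists J, jlin J /\
    forall h, [/\ (J h).1.1 = - (p (y0 + h) ^+ jk.1 * q (y0 + h) ^+ jk.2 * x (y0 + h)),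
      (J h).1.2 = - (p y0 ^+ jk.1 * q y0 ^+ jk.2 * x y0) &
      0 < vabs h -> vabs h <= r0 -> jnorm lam (vabs h) (J h) <= Kx * r ^+ jk.1 * r ^+ jk.2].
  by move=> jk; have [_ [J lJ hJ]] := hU jk; exists J.
pose X h N := jetN (fun jk => J jk h) N.
have X1 h N : (X h N).1.1 = dpN N (x (y0 + h)) (p (y0 + h)) (q (y0 + h)).
  rewrite jetN_fst dpN_square; apply: eq_bigr => jk _.
  by have [_ /(_ h)[-> _ _]] := hJ jk.
have X2 h N : (X h N).1.2 = dpN N (x y0) (p y0) (q y0).
  rewrite jetN_snd dpN_square; apply: eq_bigr => jk _.
  by have [_ /(_ h)[_ -> _]] := hJ jk.
have Xlin N : jlin (fun h => X h N).
  rewrite /X /jetN; elim: (square N) => [|jk s IH].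
    by under eq_fun do rewrite big_nil; exact: jlin_one.
  under eq_fun do rewrite big_cons.
  by apply: jlinM => //; apply: jlinD; [exact: jlin_one|case: (hJ jk)].
have lim_small h : 0 < vabs h -> vabs h <= r0 -> exists Y : jet R,
    [/\ Y.1.1 = dp (x (y0 + h)) (p (y0 + h)) (q (y0 + h)), Y.1.2 = dp (x y0) (p y0) (q y0),
      ccvg \oo (fun N => (X h N).2) Y.2 & jnorm lam (vabs h) Y <= majlim Kx r].
  move=> p0 pr.
  have hb jk : jnorm lam (vabs h) (J jk h) <= Kx * r ^+ jk.1 * r ^+ jk.2.
    by have [_ /(_ h)[_ _ /(_ p0 pr)]] := hJ jk.
  have [Y [c1 c2 c3 _ _]] := jetN_cvg lam0 p0 Kx0 rr0 r1 hb.
  exists Y; split.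
  - apply: (@ccvg_uniq _ _ \oo _ _ _ _ c1).
    under eq_fun do rewrite X1.
    apply: dp_cvg; [apply: le_lt_trans Kp1|apply: le_lt_trans Kq1]; exact: isjet_small p0 pr.
  - apply: (@ccvg_uniq _ _ \oo _ _ _ _ c2).
    under eq_fun do rewrite X2.
    apply: dp_cvg; [apply: le_lt_trans Kp1|apply: le_lt_trans Kq1]; exact: isjet_small0 p0 pr.
  - exact: c3.
  have cN : (fun N => jnorm lam (vabs h) (X h N)) @ \oo --> jnorm lam (vabs h) Y.
    have cm (a b : nat -> R[i]) (a0 b0 : R[i]) : ccvg \oo a a0 -> ccvg \oo b b0 ->
       (fun N => Num.max (cabs (a N)) (cabs (b N))) @ \oo --> Num.max (cabs a0) (cabs b0).
      move=> ca cb; under eq_fun do rewrite maxr_absE; rewrite maxr_absE.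
      apply: cvgMl; apply: cvgD; first by apply: cvgD; apply: ccvg_cabs.
      by apply: cvg_norm; apply: cvgB; apply: ccvg_cabs.
    have c12 : ccvg \oo (fun N => (X h N).1.1 - (X h N).1.2) (Y.1.1 - Y.1.2).
      by apply: ccvgB; [exact: c1|exact: c2].
    apply: cvgD; first apply: cvgD.
    - by apply: cm; [exact: c1|exact: c2].
    - by apply: cvgM; [exact: cvg_cst|apply: cm; [exact: c12|exact: c3]].
    - by apply: cvgM; [exact: cvg_cst|apply: ccvg_cabs; apply: ccvgB; [exact: c12|exact: c3]].
  apply: ler_cvg_to cN (cvg_cst (majlim Kx r)) _.
  apply: nearW => N; apply: (le_trans (jetN_le lam0 p0 hb N)).
  exact: majN_le.
(* Outside the ball of radius [r0] there is no bound, but the linear parts are homogeneous, so that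
   they converge for every [h]. *)
have lim_all h : exists l : R[i], ccvg \oo (fun N => (X h N).2) l.
  have [->|h0] := eqVneq h 0.
    exists 0; apply: ccvg_near_cst; apply: nearW => N.
    have := (Xlin N).2 1 0 0; rewrite scale1r addr0 mul1r => /eqP.
    by rewrite -subr_eq subrr eq_sym => /eqP.
  have p0 : 0 < vabs h by rewrite lt_def vabs_eq0 h0 vabs_ge0.
  have a0 : 0 < r0 / vabs h by rewrite divr_gt0.
  have ac : (r0 / vabs h)%:C != 0 :> R[i] by rewrite -cabs_gt0 cabs_real gtr0_norm.
  have va : vabs ((r0 / vabs h)%:C *: h) = r0.
    by rewrite vabsZ cabs_real gtr0_norm// divfK// gt_eqF.
  have [||Y [_ _ cY _]] := lim_small ((r0 / vabs h)%:C *: h); rewrite ?va//.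
  exists ((r0 / vabs h)%:C^-1 * Y.2).
  have : ccvg \oo (fun N => (r0 / vabs h)%:C^-1 * (X ((r0 / vabs h)%:C *: h) N).2) ((r0 / vabs h)%:C^-1 * Y.2).
    by apply: ccvgM; [exact: ccvg_cst|exact: cY].
  congr ccvg; apply: funext => N.
  have X00 : (X 0 N).2 = 0.
    have := (Xlin N).2 1 0 0; rewrite scale1r addr0 mul1r => /eqP.
    by rewrite -subr_eq subrr eq_sym => /eqP.
  by have := (Xlin N).2 (r0 / vabs h)%:C h 0; rewrite addr0 X00 addr0 => ->; rewrite mulKf.
have [L hL] := choice lim_all.
exists (majlim Kx r); split.
  apply: le_trans (majN_le Kx0 rr0 r1 0%N); apply: le_trans (majN_ge1 Kx0 rr0 _); exact: ler01.
exists (fun h => (dp (x (y0 + h)) (p (y0 + h)) (q (y0 + h)), dp (x y0) (p y0) (q y0), L h)).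
  split=> //= a u v; apply: (@ccvg_uniq _ _ \oo _ _ _ _ (hL _)).
  have : ccvg \oo (fun N => a * (X u N).2 + (X v N).2) (a * L u + L v).
    by apply: ccvgD; [apply: ccvgM; [exact: ccvg_cst|exact: hL]|exact: hL].
  by congr ccvg; apply: funext => N; rewrite (Xlin N).2.
move=> h; split=> //= p0 pr.
have [[[a b] c] /= [-> -> cY hn]] := lim_small h p0 pr.
by have -> : L h = c by apply: (@ccvg_uniq _ _ \oo _ _ _ _ (hL h)).
Qed.

Lemma isjet_differentiable f K : isjet f K -> differentiable (f : V -> C) y0.
Proof.
move=> [K0 [J [J1 J2] hJ]].
pose L (h : V) : C := (J h).2.
have Ll : linear L by move=> a u v; rewrite /L J2.
pose Lf : {linear V -> C} := HB.pack L (GRing.isLinear.Build _ _ _ _ L Ll).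
have L0 : L 0 = 0 by exact: (linear0 Lf).
(* Scaling [h] to norm [r0], where the jet norm is bounded by [K], bounds the linear part as an
   operator. *)
have bd h : cabs (L h) <= K / lam * vabs h.
  have [->|h0] := eqVneq h 0; first by rewrite L0 cabs0 mulr_ge0 ?divr_ge0 ?vabs_ge0// ltW.
  have p0 : 0 < vabs h by rewrite lt_def vabs_eq0 h0 vabs_ge0.
  have a0 : 0 < r0 / vabs h by rewrite divr_gt0.
  have va : vabs ((r0 / vabs h)%:C *: h) = r0.
    by rewrite vabsZ cabs_real gtr0_norm// divfK// gt_eqF.
  have [_ _] := hJ ((r0 / vabs h)%:C *: h); rewrite va => /(_ r00 (lexx _)).
  move=> /(le_trans (jnorm_lin lam0 r00 _)).
  have -> : (J ((r0 / vabs h)%:C *: h)).2 = (r0 / vabs h)%:C * L h by exact: (linearZ_LR Lf).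
  rewrite cabsM cabs_real gtr0_norm// => H.
  have -> : K / lam * vabs h = K * (vabs h / lam) by ring.
  rewrite -ler_pdivrMr ?divr_gt0// invf_div.
  by apply: le_trans H; rewrite le_eqVlt; apply/orP; left; apply/eqP; field; rewrite !gt_eqF.
have cL : continuous Lf.
  apply/linear_bounded_continuous/linear_boundedP.
  exists ((K / lam)%:C); split; first by rewrite realE ler0c divr_ge0// ltW.
  move=> M hM x; apply: (@le_trans _ _ ((K / lam)%:C * `|x|)).
    by rewrite normE_vabs -rmorphM [leLHS]normcE_cabs lecR; exact: bd.
  by rewrite ler_wpM2r// ltW.
have E : (f : V -> C) \o shift y0 = cst (f y0 : C) + Lf +o_ 0 id.
  apply/eqaddoP => e e0.
  have ere : e = (complex.Re e)%:C by have /ger0_Im := ltW e0; case: (e) => a b /= ->.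
  have e1 : 0 < complex.Re e by move: e0; rewrite ere ltcR.
  set e' := complex.Re e in ere e1.
  have d0 : 0 < Num.min r0 (e' * lam ^+ 2 / (K + 1)).
    by rewrite lt_min r00 divr_gt0 ?mulr_gt0 ?exprn_gt0//; lra.
  have : \forall h \near nbhs (0 : V), vabs h < Num.min r0 (e' * lam ^+ 2 / (K + 1)).
    have d0c : 0 < (Num.min r0 (e' * lam ^+ 2 / (K + 1)))%:C :> R[i] by rewrite ltcR.
    apply/nbhs_normP; exists (Num.min r0 (e' * lam ^+ 2 / (K + 1)))%:C => //= h.
    by rewrite /= sub0r normrN normE_vabs ltcR.
  apply: filterS => h; rewrite lt_min => /andP[hr he].
  have [->|h0] := eqVneq h 0.
    have -> : ((f : V -> C) \o shift y0 - (cst (f y0 : C) + Lf)) 0 = 0.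
      rewrite [LHS](_ : _ = f (0 + y0) - (f y0 + L 0)); last by [].
      by rewrite add0r L0 addr0 subrr.
    by rewrite !normr0 mulr0.
  have p0 : 0 < vabs h by rewrite lt_def vabs_eq0 h0 vabs_ge0.
  have [a b /(_ p0 (ltW hr))] := hJ h.
  move=> /(le_trans (jnorm_rem lam0 p0 _)); rewrite a b => H.
  have -> : ((f : V -> C) \o shift y0 - (cst (f y0 : C) + Lf)) h = f (y0 + h) - f y0 - (J h).2.
    rewrite [LHS](_ : _ = f (h + y0) - (f y0 + L h)); last by [].
    by rewrite [h + y0]addrC opprD addrA.
  rewrite [leLHS]normcE_cabs normE_vabs ere -rmorphM lecR.
  have m0 : 0 < (lam / vabs h) ^+ 2 by rewrite exprn_gt0// divr_gt0.
  rewrite -(ler_pM2l m0); apply: (le_trans H).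
  have -> : (lam / vabs h) ^+ 2 * (e' * vabs h) = e' * lam ^+ 2 / vabs h.
    by field; rewrite gt_eqF.
  rewrite ler_pdivlMr//; move: he; rewrite ltr_pdivlMr; last lra.
  nra.
apply/diff_locallyP.
have -> : ('d (f : V -> C) y0 : V -> C) = Lf by apply: diff_unique.
by split.
Qed.

End Differentiability.

(** * Theta functions *)

Section HolTheta.
Variable R : realType.
Notation C := (R[i])^o.
Implicit Types (x p q t : R[i]) (E : set R[i]).
Local Opaque dp qp.

Lemma jcvg_dpN E u p q z : cabs p < 1 -> cabs q < 1 -> ratl E u -> ~ E z ->
  jcvg (fun N w => dpN N (u w) p q) z (dp (u z) p q).
Proof.
move=> p1 q1 ru Ez.
rewrite /jcvg; apply: (ccvg_dpN_oo p1 q1 (x := fun wn : C * nat => u wn.1) (p := fun _ => p) (q := fun _ => q) (N := snd)).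
- exact: (@jcvg_fst _ u z _ (ratl_contat ru Ez)).
- exact: ccvg_cst.
- exact: ccvg_cst.
- by move=> m; exists (setT, [set n | (m <= n)%N]) => [|[w n] []//]; split; [exact: filterT|exists m].
Qed.

Lemma hol_dp E u p q : cabs p < 1 -> cabs q < 1 -> ratl E u -> hol E (fun z => dp (u z) p q).
Proof.
move=> p1 q1 ru; split.
  move=> z Ez; apply: ccvg_dp; [exact: p1|exact: q1|exact: ratl_contat ru _ Ez|exact: ccvg_cst|exact: ccvg_cst].
exists (fun N z => dpN N (u z) p q).
  move=> N; apply: ratl_prod => j _; apply: ratl_prod => k _.
  apply: (@ratl_eq0 _ _ (fun z => 1 + - (p ^+ j * q ^+ k) * u z)).
    by move=> z; rewrite mulNr.
  by apply: ratl_D; [exact: ratl_cst|apply: ratl_Z; exact: ru].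
by move=> z Ez; apply: (jcvg_dpN p1 q1 ru Ez).
Qed.

Lemma hol_dpV E u p q : cabs p < 1 -> cabs q < 1 -> ratl E u ->
  (forall j k : nat, ratl E (fun z => (1 - p ^+ j * q ^+ k * u z)^-1)) ->
  (forall z, ~ E z -> forall j k : nat, p ^+ j * q ^+ k * u z != 1) ->
  hol E (fun z => (dp (u z) p q)^-1).
Proof.
move=> p1 q1 ru rv u1.
have n0 z : ~ E z -> dp (u z) p q != 0 by move=> Ez; apply: dp_neq0 => //; exact: u1.
split.
  move=> z Ez; apply: ccvgV; first exact: n0.
  apply: ccvg_dp; [exact: p1|exact: q1|exact: ratl_contat ru _ Ez|exact: ccvg_cst|exact: ccvg_cst].
exists (fun N z => (dpN N (u z) p q)^-1).
  move=> N; apply: (@ratl_eq0 _ _ (fun z => \prod_(j < N) \prod_(k < N) (1 - p ^+ j * q ^+ k * u z)^-1)).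
    by move=> z; rewrite /dpN -prodfV; apply: eq_bigr => j _; rewrite -prodfV.
  by apply: ratl_prod => j _; apply: ratl_prod => k _; exact: rv.
by move=> z Ez; apply: ccvgV; [exact: n0|exact: (jcvg_dpN p1 q1 ru Ez)].
Qed.

Lemma ratl_1Bz E c : (c != 0 -> E c^-1) -> ratl E (fun z => (1 - c * z)^-1).
Proof.
have [->|c0] := eqVneq c 0.
  by move=> _; apply: ratl_eq0 (ratl_cst E 1) => z; rewrite mul0r subr0 invr1.
move=> /(_ isT) Ec; apply: ratl_eq0 (ratl_Z (- c^-1) (ratl_inv Ec)) => z.
by rewrite mulNr -mulrN -invrN opprB -invfM mulrBr divff.
Qed.

Lemma ratl_1BVz E c : E 0 -> E c -> ratl E (fun z => (1 - c / z)^-1).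
Proof.
move=> E0 Ec; apply: (@ratl_eq _ _ [:: 0] (fun z => z * (z - c)^-1)).
- by move=> a; rewrite inE => /eqP ->.
- move=> z; rewrite inE => z0; rewrite -[X in X * _]invrK -invfM mulrBr mulVf//.
  by rewrite (mulrC c).
- by apply: ratl_M; [exact: ratl_id|exact: ratl_inv].
Qed.

Lemma ratlV E c : E 0 -> ratl E (fun z => c / z).
Proof. by move=> E0; apply: ratl_Z; apply: ratl_eq0 (ratl_inv E0) => z; rewrite subr0. Qed.

Lemma ratlZ E c : ratl E (fun z => c * z).
Proof. by apply: ratl_Z; exact: ratl_id. Qed.

Lemma hol_dpVz E t p q : cabs p < 1 -> cabs q < 1 ->
  (forall j k : nat, p ^+ j * q ^+ k * t != 0 -> E (p ^+ j * q ^+ k * t)^-1) ->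
  hol E (fun z => (dp (t * z) p q)^-1).
Proof.
move=> p1 q1 h; apply: hol_dpV => //; first exact: ratlZ.
  move=> j k; apply: (@ratl_eq0 _ _ (fun z => (1 - (p ^+ j * q ^+ k * t) * z)^-1)).
    by move=> z; rewrite !mulrA.
  by apply: ratl_1Bz; exact: h.
move=> z Ez j k; apply/eqP; rewrite mulrA => e.
have n0 : p ^+ j * q ^+ k * t != 0.
  by apply/eqP => e0; move: e; rewrite e0 mul0r => /esym/eqP; rewrite oner_eq0.
apply: Ez; suff -> : z = (p ^+ j * q ^+ k * t)^-1 by exact: h.
by apply: (mulfI n0); rewrite e divff.
Qed.

Lemma hol_dpVVz E t p q : cabs p < 1 -> cabs q < 1 -> E 0 ->
  (forall j k : nat, E (p ^+ j * q ^+ k * t)) -> hol E (fun z => (dp (t / z) p q)^-1).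
Proof.
move=> p1 q1 E0 h; apply: hol_dpV => //; first exact: ratlV.
  move=> j k; apply: (@ratl_eq0 _ _ (fun z => (1 - (p ^+ j * q ^+ k * t) / z)^-1)).
    by move=> z; rewrite !mulrA.
  exact: ratl_1BVz.
move=> z Ez j k; apply/eqP; rewrite mulrA => e.
have z0 : z != 0 by apply/eqP => z0; apply: Ez; rewrite z0.
by apply: Ez; move: e => /(canRL (divfK z0)); rewrite mul1r => <-.
Qed.

Lemma hol_GamZ E t p q : cabs p < 1 -> cabs q < 1 -> E 0 ->
  (forall j k : nat, p ^+ j * q ^+ k * t != 0 -> E (p ^+ j * q ^+ k * t)^-1) ->
  hol E (fun z => Gam (t * z) p q).
Proof.
move=> p1 q1 E0 h; apply: holM; last exact: hol_dpVz.
apply: hol_dp => //; apply: (@ratl_eq0 _ _ (fun z => (p * q / t) / z)); last exact: ratlV.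
by move=> z; rewrite invfM mulrA.
Qed.

Lemma hol_GamV E t p q : cabs p < 1 -> cabs q < 1 -> E 0 ->
  (forall j k : nat, E (p ^+ j * q ^+ k * t)) -> hol E (fun z => Gam (t / z) p q).
Proof.
move=> p1 q1 E0 h; apply: holM; last exact: hol_dpVVz.
apply: hol_dp => //; apply: (@ratl_eq0 _ _ (fun z => (p * q / t) * z)); last exact: ratlZ.
by move=> z; rewrite invf_div -mulrA; congr (_ * _); rewrite mulrC.
Qed.

Lemma hol_th E u p : cabs p < 1 -> ratl E u -> ratl E (fun z => (u z)^-1) -> hol E (fun z => th (u z) p).
Proof.
move=> p1 ru rv; apply: holM; apply: hol_dp => //; exact: ratl_Z.
Qed.

Lemma hol_thZ E c p : cabs p < 1 -> E 0 -> hol E (fun z => th (c * z) p).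
Proof.
move=> p1 E0; apply: hol_th => //; first exact: ratlZ.
by apply: ratl_eq0 (ratlV c^-1 E0) => z; rewrite invfM.
Qed.

Lemma hol_thV E c p : cabs p < 1 -> E 0 -> hol E (fun z => th (c / z) p).
Proof.
move=> p1 E0; apply: hol_th => //; first exact: ratlV.
by apply: ratl_eq0 (ratlZ E c^-1) => z; rewrite invf_div mulrC.
Qed.

Lemma hol_thX E p n : cabs p < 1 -> E 0 -> hol E (fun z => th (z ^+ n) p).
Proof.
move=> p1 E0; apply: hol_th => //; first exact: ratl_X.
apply: (@ratl_eq0 _ _ (fun z => (1 / z) ^+ n)); last by apply: ratl_exp; exact: ratlV.
by move=> z; rewrite div1r exprVn.
Qed.

Lemma hol_thVX E p n : cabs p < 1 -> E 0 -> hol E (fun z => th (z ^- n) p).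
Proof.
move=> p1 E0; apply: hol_th => //; last by apply: ratl_eq0 (ratl_X E n) => z; rewrite invrK.
apply: (@ratl_eq0 _ _ (fun z => (1 / z) ^+ n)); last by apply: ratl_exp; exact: ratlV.
by move=> z; rewrite div1r exprVn.
Qed.


Local Opaque th.
(** The factor z^-1 makes this antisymmetric in [z] and [w] ([ThN]) and invariant under z -> 1 / z
    ([Th_inv]). *)
Definition Th z w p := z^-1 * th (z * w) p * th (z / w) p.

Lemma hol_Th E w p : cabs p < 1 -> E 0 -> hol E (fun z => Th z w p).
Proof.
move=> p1 E0; apply: holM; first apply: holM; first exact: hol_inv.
  by apply: (@hol_eq _ _ (fun z => th (w * z) p)) => [z|]; [rewrite mulrC|exact: hol_thZ].
by apply: (@hol_eq _ _ (fun z => th (w^-1 * z) p)) => [z|]; [rewrite mulrC|exact: hol_thZ].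
Qed.

Lemma ThN z w p : cabs p < 1 -> z != 0 -> w != 0 -> Th w z p = - Th z w p.
Proof.
move=> p1 z0 w0; rewrite /Th (mulrC w z) -[w / z]invf_div th_inv ?mulf_neq0 ?invr_eq0//.
by field; rewrite z0 w0.
Qed.

Lemma Th_inv z w p : cabs p < 1 -> z != 0 -> w != 0 -> Th z^-1 w p = Th z w p.
Proof.
move=> p1 z0 w0; rewrite /Th.
have -> : z^-1 * w = (z / w)^-1 by rewrite invf_div mulrC.
have -> : z^-1 / w = (z * w)^-1 by rewrite invfM.
rewrite !th_inv ?mulf_neq0 ?invr_eq0//; field; by rewrite z0 w0.
Qed.

Lemma Th_shift z w p : cabs p < 1 -> p != 0 -> z != 0 -> w != 0 ->
  Th (p * z) w p = p^-1 * z ^- 2 * Th z w p.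
Proof.
move=> p1 p0 z0 w0; have zw : z / w != 0 by rewrite mulf_neq0 ?invr_eq0.
rewrite /Th -[p * z * w]mulrA -[p * z / w]mulrA !th_shift ?(mulf_neq0 z0 w0)//.
by field; rewrite z0 w0 p0.
Qed.

Lemma Th_diag z p : cabs p < 1 -> z != 0 -> Th z z p = 0.
Proof. by move=> p1 z0; rewrite /Th divff// th1// mulr0. Qed.

(** [x] lies in the group p^Z; natural exponents on both sides replace negative ones. *)
Definition pZ p x : Prop := exists a c : nat, p ^+ a * x = p ^+ c.

Lemma th_pZ x p : cabs p < 1 -> p != 0 -> x != 0 -> ~ pZ p x -> th x p != 0.
Proof.
move=> p1 p0 x0 h; apply: th_neq0 => // j; apply/eqP => e; apply: h.
  by exists j, 0%N.
by exists 0%N, j.+1; rewrite expr0 mul1r -[LHS]mul1r -e divfK.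
Qed.

Lemma Th_neq0 z w p : cabs p < 1 -> p != 0 -> z != 0 -> w != 0 -> ~ pZ p (z * w) -> ~ pZ p (z / w) ->
  Th z w p != 0.
Proof.
move=> p1 p0 z0 w0 h1 h2; rewrite /Th; apply: mulf_neq0; first apply: mulf_neq0.
- by rewrite invr_eq0.
- by apply: th_pZ => //; apply: mulf_neq0.
- by apply: th_pZ => //; apply: mulf_neq0 => //; rewrite invr_eq0.
Qed.
End HolTheta.

(** * Laurent coefficients on the punctured plane *)

Section Laurent.
Variable R : realType.
Notation C := (R[i])^o.
Notation E0 := [set (0 : R[i])].

Lemma circle_ok (rho : R) (e : bool) : 0 < rho ->
  avoids (circle 0 rho e) E0 /\ winding (circle 0 rho e) 0 = (orient R e)%:C.
Proof.
move=> r0; split.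
  by move=> a /= ->; apply: circle_notin; rewrite subrr cabs0 gtr0_norm// lt_eqF.
by apply: circle_winding_in; rewrite subrr cabs0 gtr0_norm.
Qed.

Lemma nz_supp (rho : R) (e : bool) z : 0 < rho -> contour_support (circle 0 rho e) z -> z != 0.
Proof. move=> r0 Sz; apply/eqP => z0; have [h _] := circle_ok e r0; exact: (h z z0 Sz). Qed.

(** This is 2 pi i times the constant Laurent coefficient. *)
Definition mean (f : R[i] -> R[i]) : R[i] := contour_integral (circle 0 1 true) (fun z => f z * z^-1).

Lemma hol0V : hol E0 (fun z : R[i] => z^-1). Proof. exact: hol_inv. Qed.

Lemma hol0X (k : int) : hol E0 (fun z : R[i] => z ^ k).
Proof.
case: k => k; first exact: (@hol_eq _ _ (fun z => id z ^+ k) _ _ (holX k (@hol_id _ _))).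
by have := holX k.+1 hol0V; apply: hol_eq => z; rewrite NegzE exprVn.
Qed.

Lemma mean_contat f : hol E0 f -> contat (contour_support (circle 0 1 true)) (fun z => f z * z^-1).
Proof.
move=> hf; have [a _] := circle_ok true (@ltr01 R).
by apply: (hol_supp a); apply: holM; [exact: hf|exact: hol0V].
Qed.

Lemma eq_mean f g : (forall z, z != 0 -> f z = g z) -> mean f = mean g.
Proof.
by move=> h; apply: eq_contour_integral => z Sz; rewrite h//; exact: (nz_supp ltr01 Sz).
Qed.

Lemma meanZ c f : hol E0 f -> mean (fun z => c * f z) = c * mean f.
Proof.
move=> hf; rewrite -(contour_integralZ _ (mean_contat hf)).
by apply: eq_contour_integral => z _; rewrite mulrA.
Qed.

Lemma meanD f g : hol E0 f -> hol E0 g -> mean (fun z => f z + g z) = mean f + mean g.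
Proof.
move=> hf hg; rewrite -(contour_integralD (mean_contat hf) (mean_contat hg)).
by apply: eq_contour_integral => z _; rewrite mulrDl.
Qed.

Lemma mean_sum (I : Type) (r : seq I) (P : pred I) (f : I -> R[i] -> R[i]) :
  (forall i, P i -> hol E0 (f i)) ->
  mean (fun z => \sum_(i <- r | P i) f i z) = \sum_(i <- r | P i) mean (f i).
Proof.
move=> h; rewrite -contour_integral_sum; last by move=> i Pi; apply: mean_contat; exact: h.
by apply: eq_contour_integral => z _; rewrite mulr_suml.
Qed.

Lemma ratl_mean_scale p f : p != 0 -> ratl E0 f -> mean (fun z => f (p * z)) = mean f.
Proof.
move=> p0; have [av _] := circle_ok true (@ltr01 R).
have S0 : ~ contour_support (circle 0 1 true) (0 : R[i]) by exact: av.
have h1 k : mean (fun z => z ^+ k.+1) = 0.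
  rewrite -[RHS](contour_integralX (circle 0 1 true) k); apply: eq_contour_integral => z Sz.
  by rewrite exprSr mulfK// (nz_supp ltr01 Sz).
have h2 k : mean (fun z => (z - 0)^-1 ^+ k.+1) = 0.
  rewrite -[RHS](contour_integralVX k S0); apply: eq_contour_integral => z Sz.
  by rewrite subr0 [RHS]exprSr.
have hs f1 : ratl E0 f1 -> hol E0 (fun z => f1 (p * z)).
  move=> hf; apply: hol_ratl; elim: hf => {f1} [k|a k /= ->|f1 g _ h _ h'|c f1 _ h|s f1 g hs fg _ h].
  - by apply: ratl_exp; apply: ratl_Z; exact: ratl_id.
  - apply: (@ratl_eq0 _ _ (fun z => p^-1 ^+ k.+1 * (z - 0)^-1 ^+ k.+1)).
      by move=> z; rewrite -exprMn -invfM !subr0.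
    by apply: ratl_Z; exact: ratl_VX.
  - exact: ratl_D.
  - exact: ratl_Z.
  - apply: (@ratl_eq _ _ s (fun z => f1 (p * z))) => //.
    move=> z zs; apply: fg; apply: contra zs => /[dup] pzs /hs /= /eqP.
    by rewrite mulf_eq0 (negPf p0) /= => /eqP z0; move: pzs; rewrite z0 mulr0.
elim=> {f} [k|a k /= ->|f g hf IHf hg IHg|c f hf IHf|s f g hsE fg hf IHf].
- case: k => [|k]; first by apply: eq_mean => z _; rewrite !expr0.
  have := meanZ (p ^+ k.+1) (hol_ratl (ratl_X E0 k.+1)); rewrite h1 mulr0 => <-.
  by apply: eq_mean => z _; rewrite exprMn.
- have e2 : mean (fun z => (p * z - 0)^-1 ^+ k.+1) = p^-1 ^+ k.+1 * mean (fun z => (z - 0)^-1 ^+ k.+1).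
    rewrite -meanZ; last by apply: hol_ratl; exact: ratl_VX.
    by apply: eq_mean => z _; rewrite -exprMn -invfM !subr0.
  by rewrite e2 h2 mulr0.
- rewrite (meanD (hs _ hf) (hs _ hg)) IHf IHg -meanD//; exact: hol_ratl.
- by rewrite (meanZ c (hs _ hf)) IHf -meanZ//; exact: hol_ratl.
- transitivity (mean (fun z => f (p * z))); last first.
    rewrite IHf; apply: eq_mean => z z0; apply: fg; apply/negP => /hsE /= /eqP; exact/negP.
  apply: eq_mean => z z0; apply/esym/fg; apply/negP => /hsE /= /eqP.
  by rewrite mulf_eq0 (negPf p0) (negPf z0).
Qed.

(** This turns the functional equation of a theta function into a recursion for its Laurent
    coefficients. As all poles are at 0, it can be checked on powers of z. *)
Lemma mean_scale p f : p != 0 -> hol E0 f -> mean (fun z => f (p * z)) = mean f.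
Proof.
move=> p0 [cf [f_ rf jf]]; have [av _] := circle_ok true (@ltr01 R).
have c0 := mean_contat (@hol_cst R E0 1).
have c1 : contat (contour_support (circle 0 1 true)) (fun z : R[i] => z^-1).
  by move: c0; under eq_fun do rewrite mul1r.
have h1 : ccvg \oo _ _ := @hol_integral_cvg _ (circle 0 1 true) E0 f f_ id (fun z => z^-1) _ c1 cf rf jf.
have h2 : ccvg \oo _ _ := @hol_integral_cvg _ (circle 0 1 true) E0 f f_ (fun z => p * z) (fun z => z^-1) _ c1 cf rf jf.
apply: (@ccvg_uniq _ _ \oo _ _ _ _ (h2 _)).
  move=> z Sz; split; first by apply: ccvgM; [exact: ccvg_cst|exact: ccvg_id].
  move=> /= /eqP; rewrite mulf_eq0 (negPf p0) /=; exact/negP/(nz_supp ltr01 Sz).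
have e N := ratl_mean_scale p0 (rf N); rewrite /mean in e.
under eq_fun do rewrite e.
by apply: h1 => z Sz; split; [exact: ccvg_id|move=> /av].
Qed.

Lemma mean_inv f : hol E0 f -> mean (fun z => f z^-1) = mean f.
Proof.
move=> hf; have [av _] := circle_ok true (@ltr01 R).
have S0 : ~ contour_support (circle 0 1 true) (0 : R[i]) by exact: av.
rewrite /mean (@hol_inversion _ _ E0 1 f)//.
- by apply: eq_contour_integral => z _; rewrite div1r.
- by move=> a /= ->; rewrite eqxx.
- by move=> a /= ->; rewrite eqxx.
Qed.

(** Cauchy's formula on the circles of radius 2 |b| and |b| / 2, with (z - b)^-1 expanded in a
    geometric series on each of them, expresses f(b) through the integrals that vanish by
    hypothesis. *)
Lemma hol0_eq0 f : hol E0 f -> (forall k : int, mean (fun z => f z * z ^ k) = 0) ->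
  forall b, b != 0 -> f b = 0.
Proof.
move=> hf hk b b0; have cb0 : 0 < cabs b by rewrite cabs_gt0.
have r1 : 0 < 2 * cabs b by rewrite mulr_gt0.
have r2 : 0 < 2^-1 * cabs b by rewrite mulr_gt0 ?invr_gt0.
have z0 (rho : R) e (k : int) : 0 < rho -> contour_integral (circle 0 rho e) (fun z => f z * z ^ k) = 0.
  move=> rho0; have [av1 w1] := circle_ok true (@ltr01 R); have [av2 w2] := circle_ok e rho0.
  have hz : hol E0 (fun z => f z * z ^ k) by apply: holM; [exact: hf|exact: hol0X].
  have mk : contour_integral (circle 0 1 true) (fun z => f z * z ^ k) = 0.
    rewrite -[RHS](hk (k + 1)) /mean; apply: eq_contour_integral => z Sz.
    by rewrite exprzDr ?unitfE ?(nz_supp ltr01 Sz)// expr1z -!mulrA mulfV ?(nz_supp ltr01 Sz)// mulr1.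
  case: e av2 w2 => av2 w2.
    by rewrite -[RHS]mk; apply: (hol_int_eq av2 av1 _ hz) => a /= ->; rewrite w1 w2.
  (* A clockwise circle and the unit circle together wind around 0 as often as the empty contour. *)
  have := @hol_int_eq _ (circle 0 rho false ++ circle 0 1 true) [::] E0 _ _ _ _ hz.
  rewrite contour_integral_cat mk addr0 => ->.
  - by rewrite /contour_integral big_nil.
  - by move=> a Ea; rewrite contour_support_cat => -[/av2|/av1].
  - by move=> a _; rewrite /contour_support big_nil.
  - move=> a ->; rewrite winding_cat w1 w2 /winding /contour_integral big_nil mulr0.
    by rewrite -rmorphD /orient addNr.
have [av1 w1] := circle_ok true r1; have [av2 w2] := circle_ok false r2.
have s1 z : contour_support (circle 0 (2 * cabs b) true) z -> cabs z = 2 * cabs b.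
  by move=> /circle_support; rewrite subr0 gtr0_norm.
have s2 z : contour_support (circle 0 (2^-1 * cabs b) false) z -> cabs z = 2^-1 * cabs b.
  by move=> /circle_support; rewrite subr0 gtr0_norm.
have n1 : ~ contour_support (circle 0 (2 * cabs b) true) b by move=> /s1; lra.
have n2 : ~ contour_support (circle 0 (2^-1 * cabs b) false) b by move=> /s2; lra.
have := @hol_residue _ (circle 0 (2 * cabs b) true ++ circle 0 (2^-1 * cabs b) false) E0 b f _ _ _ _ hf.
rewrite contour_integral_cat winding_cat circle_winding_in; last by rewrite subr0 gtr0_norm//; lra.
rewrite circle_winding_out; last by rewrite subr0 gtr0_norm//; lra.
have i1 : contour_integral (circle 0 (2 * cabs b) true) (fun z => f z * (z - b)^-1) = 0.
  have h := @geom_int _ (circle 0 (2 * cabs b) true) (fun z => f z * z^-1) (fun z => b * z^-1) _ _ _.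
  have {}h : ccvg \oo _ _ := h (hol_supp av1 (holM hf hol0V)) (hol_supp av1 (holZ b hol0V)) _.
  have {}h := h _; have e : contour_integral (circle 0 (2 * cabs b) true) (fun z => f z * (z - b)^-1) =
     contour_integral (circle 0 (2 * cabs b) true) (fun z => (f z * z^-1) / (1 - b * z^-1)).
    apply: eq_contour_integral => z Sz; have zn := nz_supp r1 Sz.
    by rewrite -mulrA -invfM mulrBr mulr1 mulrCA mulfV// mulr1.
  rewrite e; apply: (@ccvg_uniq _ _ \oo _ _ _ _ (h _)).
    move=> z Sz; rewrite cabsM cabsV (s1 z Sz) ltr_pdivrMr//; lra.
  apply: ccvg_near_cst; apply: nearW => N; apply: big1 => k _.
  rewrite -[RHS](mulr0 (b ^+ k)) -[X in _ = _ * X](z0 (2 * cabs b) true (- (k%:Z + 1)) r1) -contour_integralZ; last first.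
    by apply: (hol_supp av1); apply: holM; [exact: hf|exact: hol0X].
  apply: eq_contour_integral => z Sz; rewrite -exprnN addn1 exprMn exprVn exprS invfM; ring.
have i2 : contour_integral (circle 0 (2^-1 * cabs b) false) (fun z => f z * (z - b)^-1) = 0.
  have h := @geom_int _ (circle 0 (2^-1 * cabs b) false) (fun z => - b^-1 * f z) (fun z => b^-1 * z) _ _ _.
  have {}h : ccvg \oo _ _ := h (hol_supp av2 (holZ _ hf)) (hol_supp av2 (holZ _ (@hol_id _ _))) _.
  have {}h := h _; have e : contour_integral (circle 0 (2^-1 * cabs b) false) (fun z => f z * (z - b)^-1) =
     contour_integral (circle 0 (2^-1 * cabs b) false) (fun z => (- b^-1 * f z) / (1 - b^-1 * z)).
    apply: eq_contour_integral => z Sz; have zb : z - b != 0.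
      by rewrite subr_eq0; apply/eqP => e; move: (s2 z Sz); rewrite e; lra.
    have -> : 1 - b^-1 * z = - b^-1 * (z - b) by field.
    by field; rewrite b0 zb.
  rewrite e; apply: (@ccvg_uniq _ _ \oo _ _ _ _ (h _)).
    move=> z Sz; rewrite cabsM cabsV (s2 z Sz) mulrC ltr_pdivrMr//; lra.
  apply: ccvg_near_cst; apply: nearW => N; apply: big1 => k _.
  rewrite -[RHS](mulr0 (- b^-1 * b^-1 ^+ k)) -[X in _ = _ * X](z0 (2^-1 * cabs b) false k%:Z r2) -contour_integralZ; last first.
    by apply: (hol_supp av2); apply: holM; [exact: hf|exact: hol0X].
  apply: eq_contour_integral => z Sz; rewrite exprMn -exprnP; ring.
rewrite i1 i2 !addr0 /orient rmorph1 mulr1 => H.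
apply: (mulfI (two_pi_i_neq0 R)); rewrite mulr0 -H//.
- by move=> a Ea; rewrite contour_support_cat => -[/av1|/av2]; apply.
- by move=> /= /eqP; exact/negP.
- by rewrite contour_support_cat => -[].
- by move=> a ->; rewrite winding_cat w1 w2 -rmorphD /orient subrr.
Qed.

End Laurent.

(** Each b_i occurs in m - 1 of the unordered pairs. *)
Lemma prod_triangle (F : comNzRingType) m (b : 'I_m -> F) :
  \prod_(i < m) \prod_(k < m | (i < k)%N) (b i * b k) = \prod_(i < m) b i ^+ m.-1.
Proof.
transitivity (\prod_(i < m) \prod_(k < m | k != i) b i); last first.
  apply: eq_bigr => i _; rewrite prodr_const; congr (_ ^+ _).
  by rewrite (@eq_card _ _ (predC1 i)) ?cardC1 ?card_ord.
transitivity (\prod_(i < m) (\prod_(k < m | (i < k)%N) b i * \prod_(k < m | (k < i)%N) b i)).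
  under eq_bigr do rewrite big_split /=.
  rewrite !big_split /=; congr (_ * _).
  by rewrite (exchange_big_dep xpredT) //=.
apply: eq_bigr => i _; rewrite [RHS](bigID (fun k : 'I_m => (i < k)%N)) /=; congr (_ * _).
  by apply: eq_bigl => k; case: ltngtP => h; rewrite ?andbF ?andbT//; apply/esym/eqP => e; rewrite e ltnn in h.
apply: eq_bigl => k; rewrite -leqNgt ltn_neqAle; congr (_ && _).
Qed.

(** The homogeneous Vandermonde determinant is reduced to the ordinary one in a_i / b_i. In the
    applications the zeros of b are excluded, as they form a countable set. *)
Lemma det_hvander (F : fieldType) m (a b : 'I_m -> F) : (forall i, b i != 0) ->
  \det (\matrix_(j < m, i < m) (a i ^+ j * b i ^+ (m.-1 - j))) =
  \prod_(i < m) \prod_(k < m | (i < k)%N) (a k * b i - a i * b k).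
Proof.
move=> b0.
have -> : \matrix_(j < m, i < m) (a i ^+ j * b i ^+ (m.-1 - j)) =
    Vandermonde m (\row_i (a i / b i)) *m diag_mx (\row_i b i ^+ m.-1).
  apply/matrixP => j i; rewrite mul_mx_diag !mxE expr_div_n -mulrA; congr (_ * _).
  have jm : (j <= m.-1)%N by rewrite -ltnS prednK// (leq_ltn_trans _ (ltn_ord j)).
  by rewrite -{2}(subnKC jm) exprD mulKf// expf_neq0.
rewrite det_mulmx det_Vandermonde det_diag.
have -> : \prod_i (\row_i0 b i0 ^+ m.-1) 0 i = \prod_(i < m) \prod_(k < m | (i < k)%N) (b i * b k).
  by rewrite prod_triangle; apply: eq_bigr => i _; rewrite mxE.
rewrite -big_split /=; apply: eq_bigr => i _; rewrite -big_split /=; apply: eq_bigr => k _.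
rewrite !mxE; field; by rewrite !b0.
Qed.

(** * Spaces of theta functions and the three-term relation *)

Section ThetaSpaces.
Variable R : realType.
Notation C := (R[i])^o.
Notation E0 := [set (0 : R[i])].
Implicit Types (p q : R[i]).
Local Opaque dp qp th mean Th.

(** An interval has positive measure, a countable set has measure 0. *)
Lemma countable_avoid (E : set R) (e : R) : countable E -> 0 < e ->
  exists2 d : R, 0 < d < e & ~ E d.
Proof.
move=> cE e0; apply: contrapT => h.
have sub : `]0, e[%classic `<=` E.
  by move=> d /=; rewrite in_itv /= => de; apply: contrapT => Ed; apply: h; exists d.
have := @countable_lebesgue_measure0 R _ (sub_countable (subset_card_le sub) cE).
rewrite lebesgue_measure_itv /= lte_fin e0 oppr0 adde0 => /eqP.
by rewrite eqe gt_eqF.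
Qed.

Lemma countable_avoidC (E : set R[i]) : countable E -> exists2 z : R[i], z != 0 & ~ E z.
Proof.
move=> cE; have [|d /andP[d0 _] Ed] := @countable_avoid ((fun d : R => d%:C) @^-1` E) 1 _ ltr01.
  have /countable_injP[f hf] := cE; apply/countable_injP; exists (fun d : R => f d%:C).
  by move=> x y; rewrite !inE => Ex Ey /hf; rewrite !inE => /(_ Ex Ey) /complexI.
by exists d%:C => //; rewrite eq_complex /= eqxx andbT gt_eqF.
Qed.

Lemma countable_pZ p (u : R[i] -> R[i]) : p != 0 -> (forall c, countable [set z | u z = c]) ->
  countable [set z | pZ p (u z)].
Proof.
move=> p0 hu; apply: (@sub_countable _ _ _ (\bigcup_(ac in [set: nat * nat]) [set z | u z = p ^- ac.1 * p ^+ ac.2])).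
  apply: subset_card_le => z [a [c e]]; exists (a, c) => //=; rewrite -e mulKf// expf_neq0//.
by apply: bigcup_countable => // ac _; exact: hu.
Qed.

(** 2 pi i times the Laurent coefficient of z^k. *)
Definition coef (f : R[i] -> R[i]) (k : int) := mean (fun z => f z * z ^ (- k)).

Lemma hol_coef f k : hol E0 f -> hol E0 (fun z => f z * z ^ (- k)).
Proof. by move=> hf; apply: holM; [exact: hf|exact: hol0X]. Qed.

Lemma coefD f g k : hol E0 f -> hol E0 g -> coef (fun z => f z + g z) k = coef f k + coef g k.
Proof.
move=> hf hg; rewrite /coef -(meanD (hol_coef k hf) (hol_coef k hg)).
by apply: eq_mean => z _; rewrite mulrDl.
Qed.

Lemma coefZ c f k : hol E0 f -> coef (fun z => c * f z) k = c * coef f k.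
Proof.
move=> hf; rewrite /coef -(meanZ _ (hol_coef k hf)).
by apply: eq_mean => z _; rewrite mulrA.
Qed.

Lemma coef_sum (I : Type) (r : seq I) (P : pred I) (f : I -> R[i] -> R[i]) k :
  (forall i, P i -> hol E0 (f i)) ->
  coef (fun z => \sum_(i <- r | P i) f i z) k = \sum_(i <- r | P i) coef (f i) k.
Proof.
move=> h; rewrite /coef -mean_sum; last by move=> i Pi; apply: hol_coef; exact: h.
by apply: eq_mean => z _; rewrite mulr_suml.
Qed.

Lemma coefN f s k : hol E0 f -> (forall z, z != 0 -> f z^-1 = s * f z) -> coef f (- k) = s * coef f k.
Proof.
move=> hf hs; rewrite /coef -(meanZ _ (hol_coef k hf)) -(mean_inv (hol_coef (- k) hf)).
apply: eq_mean => z z0; rewrite (hs _ z0) mulrA; congr (_ * _).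
by rewrite exprz_inv opprK.
Qed.

Definition theta_fun p mu (d : nat) (f : R[i] -> R[i]) : Prop :=
  hol E0 f /\ forall z, z != 0 -> f (p * z) = mu * z ^- d * f z.

Lemma coef_theta p mu d f k : p != 0 -> theta_fun p mu d f ->
  coef f k = mu * p ^ (- k) * coef f (k + d%:Z).
Proof.
move=> p0 [hf e]; rewrite /coef -(mean_scale p0 (hol_coef k hf)).
rewrite -(meanZ _ (hol_coef _ hf)); apply: eq_mean => z z0.
rewrite (e _ z0) expfzMl opprD expfzDr// -exprnN; ring.
Qed.

(** The functional equation links the coefficients of index k and k + d by a nonzero factor, so d
    consecutive ones determine all of them. *)
Lemma theta_eq0 p mu d f a : p != 0 -> mu != 0 -> (0 < d)%N -> theta_fun p mu d f ->
  (forall j : nat, (j < d)%N -> coef f (a + j%:Z) = 0) -> forall b, b != 0 -> f b = 0.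
Proof.
move=> p0 mu0 d0 tf h; have [hf _] := tf.
have step k : (coef f k == 0) = (coef f (k + d%:Z) == 0).
  by rewrite (coef_theta k p0 tf) !mulf_eq0 (negPf mu0) expfz_eq0 (negPf p0) andbF.
have all0 (m : int) (j : nat) : (j < d)%N -> coef f (a + j%:Z + m * d%:Z) = 0.
  move=> jd; apply/eqP; elim/int_ind: m => [|m /eqP IH|m /eqP IH].
  - by rewrite mul0r addr0 h.
  - by rewrite -addn1 PoszD mulrDl mul1r addrA -step; exact/eqP.
  - by rewrite step -addrA -[X in _ + (_ + X)]mul1r -mulrDl -addn1 PoszD opprD subrK; exact/eqP.
apply: (hol0_eq0 hf) => k; rewrite -[k]opprK -[mean _]/(coef f (- k)).
have dn0 : d%:Z != 0 by rewrite eqz_nat -lt0n.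
have := modz_ge0 (- k - a) dn0; have := ltz_pmod (- k - a) (isT : 0 < 1 :> int).
move=> _; have : ((- k - a) %% d%:Z)%Z < d%:Z by rewrite ltz_pmod// ltz_nat.
case e : ((- k - a) %% d%:Z)%Z => [j|j] // jd _.
have := all0 ((- k - a) %/ d%:Z)%Z j jd.
by congr (coef f _ = 0); rewrite -e -addrA [X in a + X]addrC -divz_eq addrC subrK.
Qed.

Lemma theta_funD p mu d f g : theta_fun p mu d f -> theta_fun p mu d g -> theta_fun p mu d (fun z => f z + g z).
Proof.
move=> [hf ef] [hg eg]; split; first by apply: holD; [exact: hf|exact: hg].
by move=> z z0; rewrite (ef _ z0) (eg _ z0) mulrDr.
Qed.

Lemma theta_funZ p mu d f c : theta_fun p mu d f -> theta_fun p mu d (fun z => c * f z).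
Proof.
move=> [hf ef]; split; first by apply: holZ; exact: hf.
by move=> z z0; rewrite (ef _ z0) mulrCA.
Qed.

Lemma theta_fun_sum p mu d (I : Type) (r : seq I) (f : I -> R[i] -> R[i]) :
  (forall i, theta_fun p mu d (f i)) -> theta_fun p mu d (fun z => \sum_(i <- r) f i z).
Proof.
move=> h; split; first by apply: hol_sum => i _; case: (h i).
by move=> z z0; rewrite mulr_sumr; apply: eq_bigr => i _; case: (h i) => _ ->.
Qed.

Lemma Th_theta p w : cabs p < 1 -> p != 0 -> w != 0 -> theta_fun p p^-1 2 (fun z => Th z w p).
Proof.
by move=> p1 p0 w0; split; [exact: hol_Th|move=> z z0; exact: Th_shift].
Qed.

Lemma lin_comb_eq0 (F : comPzRingType) (a b c d : F) : a * d - b * c = 0 ->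
  c * a + - a * c = 0 /\ c * b + - a * d = 0.
Proof. by move=> h; split; [ring|rewrite -[RHS]oppr0 -h; ring]. Qed.

Lemma cramer2 (F : comPzRingType) (a b c d e f : F) :
  (a * d - b * c) * e + (- (e * d - f * c) * a + - (a * f - b * e) * c) = 0 /\
  (a * d - b * c) * f + (- (e * d - f * c) * b + - (a * f - b * e) * d) = 0.
Proof. by split; ring. Qed.

Section DimensionTwo.
Variables (p a b : R[i]) (A B V : R[i] -> R[i]).
Hypotheses (p0 : p != 0) (a0 : a != 0) (b0 : b != 0).
Hypotheses (tA : theta_fun p p^-1 2 A) (tB : theta_fun p p^-1 2 B) (tV : theta_fun p p^-1 2 V).
Hypotheses (Aa : A a = 0) (Bb : B b = 0) (Ba : B a != 0) (Ab : A b != 0) (Va : V a = 0) (Vb : V b = 0).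

Lemma theta2_coef f : theta_fun p p^-1 2 f -> coef f 0 = 0 -> coef f 1 = 0 -> forall x, x != 0 -> f x = 0.
Proof.
move=> tf c0 c1; apply: (theta_eq0 (a := 0) p0 _ _ tf); [by rewrite invr_eq0|by []|].
by case=> [|[|]]//; rewrite add0r.
Qed.

Let comb x y u : theta_fun p p^-1 2 (fun t => x * V t + (y * A t + u * B t)) /\
  forall k, coef (fun t => x * V t + (y * A t + u * B t)) k = x * coef V k + (y * coef A k + u * coef B k).
Proof.
have [hA _] := tA; have [hB _] := tB; have [hV _] := tV.
split.
  apply: theta_funD; first by apply: theta_funZ; exact: tV.
  by apply: theta_funD; apply: theta_funZ; [exact: tA|exact: tB].
move=> k; rewrite coefD; [|exact: (holZ x hV)|exact: (holD (holZ y hA) (holZ u hB))].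
rewrite coefD; [|exact: (holZ y hA)|exact: (holZ u hB)].
by rewrite (coefZ x k hV) (coefZ y k hA) (coefZ u k hB).
Qed.

Let comb0 x y u : x * coef V 0 + (y * coef A 0 + u * coef B 0) = 0 ->
  x * coef V 1 + (y * coef A 1 + u * coef B 1) = 0 ->
  [/\ y = 0, u = 0 & forall z, z != 0 -> x * V z = 0].
Proof.
move=> e0 e1; have [t c] := comb x y u; have h := theta2_coef t; rewrite !c in h.
have {}h := h e0 e1; have ha := h a a0; have hb := h b b0.
rewrite Va Aa !mulr0 !add0r in ha; rewrite Vb Bb !mulr0 addr0 add0r in hb.
have u0 : u = 0 by apply/eqP; move/eqP: ha; rewrite mulf_eq0 (negPf Ba) orbF.
have y0 : y = 0 by apply/eqP; move/eqP: hb; rewrite mulf_eq0 (negPf Ab) orbF.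
by split=> // z z0; move: (h z z0); rewrite u0 y0 !mul0r !addr0.
Qed.

(** Two Laurent coefficients determine a theta function of degree 2, and A, B are independent
    because each vanishes at just one of the points a, b. Hence V is a combination of A and B, and
    its zeros at a and b make both coefficients vanish. *)
Lemma theta2_eq0 z : z != 0 -> V z = 0.
Proof.
move=> z0; have D0 : coef A 0 * coef B 1 - coef A 1 * coef B 0 != 0.
  apply/eqP => d0.
  have [h1 h2] := lin_comb_eq0 d0.
  have [_ /eqP A0 _] : [/\ coef B 0 = 0, - coef A 0 = 0 & forall z, z != 0 -> 0 * V z = 0].
    by apply: comb0; rewrite mul0r add0r.
  have d1 : coef A 1 * coef B 0 - coef A 0 * coef B 1 = 0 by rewrite -opprB d0 oppr0.
  have [h3 h4] := lin_comb_eq0 d1.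
  have [_ /eqP A1 _] : [/\ coef B 1 = 0, - coef A 1 = 0 & forall z, z != 0 -> 0 * V z = 0].
    by apply: comb0; rewrite mul0r add0r.
  rewrite oppr_eq0 in A0; rewrite oppr_eq0 in A1.
  by move: Ab; rewrite (theta2_coef tA (eqP A0) (eqP A1) b0) eqxx.
have [e0 e1] := cramer2 (coef A 0) (coef A 1) (coef B 0) (coef B 1) (coef V 0) (coef V 1).
have [_ _ /(_ z z0) /eqP] := comb0 e0 e1.
by rewrite mulf_eq0 (negPf D0) /= => /eqP.
Qed.

End DimensionTwo.

(** The three-term relation of theta functions. As functions of z both sides have degree 2 and the
    same multiplier, and they agree at z = a and z = b. *)
Lemma Th_plucker p z w a b : cabs p < 1 -> p != 0 -> z != 0 -> w != 0 -> a != 0 -> b != 0 ->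
  Th a b p != 0 -> Th z w p * Th a b p = Th z a p * Th w b p - Th z b p * Th w a p.
Proof.
move=> p1 p0 z0 w0 a0 b0 ab.
have tT x : x != 0 -> theta_fun p p^-1 2 (fun z => Th z x p) by move=> x0; exact: Th_theta.
have Aa := Th_diag p1 a0; have Bb := Th_diag p1 b0.
have Ab : Th b a p != 0 by rewrite (ThN p1 a0 b0) oppr_eq0.
have := @theta2_eq0 p a b (fun z => Th z a p) (fun z => Th z b p)
  (fun x => Th a b p * Th x w p + ((- Th w b p) * Th x a p + Th w a p * Th x b p))
  p0 a0 b0 (tT a a0) (tT b b0) _ Aa Bb ab Ab _ _ z z0.
move=> H; apply/eqP; rewrite -subr_eq0.
have -> : forall u v x y s t : R[i], u * v - (x * y - s * t) = v * u + (- y * x + t * s).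
  by move=> u v x y s t; ring.
apply/eqP; apply: H.
- apply: theta_funD; first by apply: theta_funZ; exact: tT.
  by apply: theta_funD; apply: theta_funZ; [exact: tT|exact: tT].
- by rewrite Aa (ThN p1 a0 w0) mulr0 add0r mulNr mulrC addrN.
- by rewrite Bb (ThN p1 a0 b0) (ThN p1 b0 w0) mulr0 addr0; move: (Th a b p) (Th b w p) => u v; ring.
Qed.

End ThetaSpaces.

(** * Odd theta functions *)

Section OddTheta.
Variable R : realType.
Notation C := (R[i])^o.
Notation E0 := [set (0 : R[i])].
Local Opaque dp qp th mean Th coef.
Variables (n : nat) (p a b : R[i]).
Hypotheses (p1 : cabs p < 1) (p0 : p != 0) (a0 : a != 0) (b0 : b != 0) (ab : Th a b p != 0).

Definition ThA z := Th z a p.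
(** Divided by [Th a b p] so that [Th_AB] holds without a constant; consequently ThB takes the value
    1 at a. *)
Definition ThB z := Th z b p / Th a b p.
Definition del z := z^-1 * th (z ^+ 2) p.

Lemma Th_AB z w : z != 0 -> w != 0 -> Th z w p = ThA z * ThB w - ThB z * ThA w.
Proof.
move=> z0 w0; apply: (mulIf ab); rewrite (Th_plucker p1 p0 z0 w0 a0 b0 ab) /ThA /ThB.
by field.
Qed.

Lemma hol_ThA E : E 0 -> hol E ThA. Proof. by move=> h; exact: hol_Th. Qed.
Lemma hol_ThB E : E 0 -> hol E ThB.
Proof.
move=> h; apply: (@hol_eq _ _ (fun z => (Th a b p)^-1 * Th z b p)); last by apply: holZ; exact: hol_Th.
by move=> z; rewrite /ThB mulrC.
Qed.

Lemma hol_del E : E 0 -> hol E del.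
Proof. by move=> h; apply: holM; [exact: hol_inv|exact: hol_thX]. Qed.

Lemma ThA_inv z : z != 0 -> ThA z^-1 = ThA z. Proof. by move=> z0; exact: Th_inv. Qed.
Lemma ThB_inv z : z != 0 -> ThB z^-1 = ThB z. Proof. by move=> z0; rewrite /ThB Th_inv. Qed.
Lemma del_inv z : z != 0 -> del z^-1 = - del z.
Proof.
move=> z0; rewrite /del exprVn th_inv ?expf_neq0// invrK.
by field.
Qed.
Lemma ThA_shift z : z != 0 -> ThA (p * z) = p^-1 * z ^- 2 * ThA z.
Proof. by move=> z0; exact: Th_shift. Qed.
Lemma ThB_shift z : z != 0 -> ThB (p * z) = p^-1 * z ^- 2 * ThB z.
Proof. by move=> z0; rewrite /ThB Th_shift// mulrA. Qed.
Lemma del_shift z : z != 0 -> del (p * z) = p ^- 2 * z ^- 4 * del z.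
Proof.
move=> z0; rewrite /del.
have -> : (p * z) ^+ 2 = p * (p * z ^+ 2) by ring.
have z2 : z ^+ 2 != 0 by rewrite expf_neq0.
rewrite th_shift// ?mulf_neq0// th_shift//.
by field; rewrite z0 p0.
Qed.

Definition oddth (j : nat) z := del z * (ThA z ^+ j * ThB z ^+ (n - j)).

Definition odd_fun f := theta_fun p (p ^- (n + 2)) (2 * n + 4) f /\ forall z, z != 0 -> f z^-1 = - f z.

Lemma oddth_odd j : (j <= n)%N -> odd_fun (oddth j).
Proof.
move=> jn; split; last by move=> z z0; rewrite /oddth ThA_inv// ThB_inv// del_inv// mulNr.
split.
  apply: holM; first exact: hol_del.
  by apply: holM; apply: holX; [exact: hol_ThA|exact: hol_ThB].
move=> z z0; rewrite /oddth ThA_shift// ThB_shift// del_shift//.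
move: (ThA z) (ThB z) (del z) => x y d.
rewrite !exprMn -[in (2 * n + 4)%N](subnKC jn) -[in (n + 2)%N](subnKC jn).
move: (n - j)%N => u; rewrite -!exprVn -!exprM.
have -> : (2 * (j + u) + 4 = 2 * j + 2 * u + 4)%N by lia.
rewrite !exprD; move: (x ^+ j) (y ^+ u) => x' y'.
rewrite !expr0 !mulr1; move: (p^-1) (z^-1) => p' z'; ring.
Qed.

(** The coefficients satisfy c_(-k) = - c_k, hence c_0 = 0. The recursion of step 2n + 4 gives
    c_(-n-2) = c_(n+2), since the multiplier cancels there, and so c_(n+2) = 0 too. In the period
    from -n-1 to n+2 only c_1, ..., c_(n+1) and their negatives remain. *)
Lemma odd_eq0 f : odd_fun f -> (forall k : 'I_n.+1, coef f (k.+1)%:Z = 0) -> forall z, z != 0 -> f z = 0.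
Proof.
move=> [tf of_] ck; have [hf _] := tf.
have cN k : coef f (- k) = - coef f k.
  by rewrite (@coefN _ f (-1)) ?mulN1r// => z z0; rewrite of_// mulN1r.
have half0 (x : R[i]) : x = - x -> x = 0.
  move=> e; have : x *+ 2 = 0 by rewrite mulr2n {1}e addNr.
  by move/eqP; rewrite -mulr_natr mulf_eq0 pnatr_eq0 orbF => /eqP.
have c0 : coef f 0 = 0 by apply: half0; rewrite -cN oppr0.
have cpos k : (0 < k < n + 2)%N -> coef f k%:Z = 0.
  case: k => // k; rewrite addn2 => /andP[_ kn]; exact: (ck (Ordinal (kn : (k < n.+1)%N))).
have cn2 : coef f (n + 2)%:Z = 0.
  apply: half0; rewrite -cN; have := coef_theta (- (n + 2)%:Z) p0 tf.
  rewrite opprK -exprnP mulVf ?expf_neq0// mul1r => e; rewrite [RHS]e; congr coef.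
  by rewrite -[(2 * n + 4)%N](_ : (n + 2) + (n + 2) = _)%N ?PoszD ?addKr//; lia.
apply: (theta_eq0 (a := - (n.+1)%:Z) p0 _ _ tf); first by rewrite invr_eq0 expf_neq0.
  by rewrite addnS.
move=> j jd; have [e|[e|e]] : (j < n.+1)%N \/ j = n.+1 \/ (n.+1 < j)%N by lia.
- have -> : - (n.+1)%:Z + j%:Z = - (n.+1 - j)%:Z by lia.
  by rewrite cN cpos ?oppr0//; lia.
- by rewrite e addNr.
- have -> : - (n.+1)%:Z + j%:Z = (j - n.+1)%:Z by lia.
  have [h|h] : (j - n.+1 < n + 2)%N \/ (j - n.+1 = n + 2)%N by lia.
    by apply: cpos; lia.
  by rewrite h.
Qed.

Lemma countable_U (T : Type) (A B : set T) : countable A -> countable B -> countable (A `|` B).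
Proof.
move=> cA cB; rewrite (_ : A `|` B = \bigcup_(b in [set: bool]) (if b then A else B)).
  by apply: bigcup_countable => [|[] _]; [exact: finite_set_countable|exact: cA|exact: cB].
by apply/seteqP; split=> [x [Ax|Bx]|x [[] _ h]]; [exists true|exists false|left|right].
Qed.

Lemma countable_fib2 (c : R[i]) : countable [set z : R[i] | z ^+ 2 = c].
Proof.
have [[z0 e0]|h] := EM (exists z : R[i], z ^+ 2 = c).
  apply: (@sub_countable _ _ _ [set z0; - z0]); last by apply: finite_set_countable.
  apply: subset_card_le => z /= e.
  have : (z - z0) * (z + z0) == 0 by rewrite -subr_sqr e e0 subrr.
  by rewrite mulf_eq0 subr_eq0 addr_eq0 => /orP[/eqP ->|/eqP ->]; [left|right].
rewrite (_ : [set z | _] = set0); first exact: countable0.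
by apply/seteqP; split=> // z e; apply: h; exists z.
Qed.

Lemma countable_fib_mul (x c : R[i]) : x != 0 -> countable [set z : R[i] | z * x = c].
Proof.
move=> x0; apply: (@sub_countable _ _ _ [set c / x]); last exact: countable1.
by apply: subset_card_le => z /= <-; rewrite mulfK.
Qed.

(** For given earlier points, each condition on the next one excludes only countably many values. *)
Lemma generic_points m : exists w : 'I_m -> R[i],
  [/\ forall i, w i != 0, forall i, ThB (w i) != 0, forall i, del (w i) != 0 &
      forall i k : 'I_m, (i < k)%N -> Th (w k) (w i) p != 0].
Proof.
elim: m => [|m [w [w0 wB wd wT]]]; first by exists (fun _ => 0); split=> -[].
pose bad (z : R[i]) := [\/ pZ p (z * b), pZ p (z / b), pZ p (z ^+ 2) |
   exists i, pZ p (z * w i) \/ pZ p (z * (w i)^-1)].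
have cb : countable [set z | bad z].
  have h x : x != 0 -> countable [set z : R[i] | pZ p (z * x)].
    by move=> x0; apply: countable_pZ => // c; exact: countable_fib_mul.
  pose U i := [set z : R[i] | pZ p (z * w i)] `|` [set z : R[i] | pZ p (z / w i)].
  apply: (@sub_countable _ _ _ (([set z : R[i] | pZ p (z * b)] `|` [set z : R[i] | pZ p (z / b)]) `|`
     ([set z : R[i] | pZ p (z ^+ 2)] `|` \bigcup_(i in [set: 'I_m]) U i))).
    apply: subset_card_le => z [h1|h1|h1|[i h1]]; [by left; left|by left; right|by right; left|].
    by right; right; exists i.
  apply: countable_U; first by apply: countable_U; apply: h; rewrite ?invr_eq0.
  apply: countable_U; first by apply: countable_pZ => // c; exact: countable_fib2.
  apply: bigcup_countable; first by apply: finite_set_countable.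
  by move=> i _; apply: countable_U; apply: h; rewrite ?invr_eq0 w0.
have [z z0 nb] := countable_avoidC cb.
exists (fun i => if unlift ord_max i is Some k then w k else z); split=> i.
- by case: unliftP => [k _|_].
- case: unliftP => [k _|_]; first exact: wB.
  rewrite /ThB mulf_neq0 ?invr_eq0//; apply: Th_neq0 => // h; apply: nb; [by constructor 1|by constructor 2].
- case: unliftP => [k _|_]; first exact: wd.
  rewrite /del mulf_neq0 ?invr_eq0//; apply: th_pZ; rewrite ?expf_neq0// => h; apply: nb; by constructor 3.
- move=> k; case: (unliftP ord_max i) => [i' ->|->]; case: (unliftP ord_max k) => [k' ->|->].
  + by rewrite !lift_max; exact: wT.
  + move=> _; apply: Th_neq0 => // h; apply: nb; constructor 4; exists i'; [by left|by right].
  + by rewrite lift_max /= ltnNge (ltnW (ltn_ord k')).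
  + by rewrite ltnn.
Qed.

(** By [odd_eq0] there are at most n + 1 degrees of freedom, given by Laurent coefficients. The n +
    1 functions [oddth j] are independent, because their values at generic points form, up to
    factors [del], an invertible Vandermonde matrix; so their coefficient matrix [M] is
    invertible. *)
Lemma odd_span f : odd_fun f -> exists v : 'I_n.+1 -> R[i],
  forall z, z != 0 -> f z = \sum_(j < n.+1) v j * oddth j z.
Proof.
move=> of_; have ot (j : 'I_n.+1) : odd_fun (oddth j) by apply: oddth_odd; rewrite -ltnS.
have ht j := (ot j).1.1.
have sum_odd (u : 'I_n.+1 -> R[i]) : odd_fun (fun z => \sum_(j < n.+1) u j * oddth j z).
  split; first by apply: theta_fun_sum => j; apply: theta_funZ; exact: (ot j).1.
  by move=> z z0; rewrite -sumrN; apply: eq_bigr => j _; rewrite (ot j).2// mulrN.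
have coef_odd (u : 'I_n.+1 -> R[i]) k : coef (fun z => \sum_(j < n.+1) u j * oddth j z) k = \sum_(j < n.+1) u j * coef (oddth j) k.
  rewrite coef_sum; last by move=> j _; apply: holZ; exact: ht.
  by apply: eq_bigr => j _; rewrite (coefZ _ _ (ht j)).
pose M := \matrix_(j < n.+1, k < n.+1) coef (oddth j) (k.+1)%:Z.
have Mf : row_free M.
  apply: inj_row_free => u uM.
  have z0 : forall z, z != 0 -> \sum_(j < n.+1) u 0 j * oddth j z = 0.
    apply: (odd_eq0 (sum_odd (fun j => u 0 j))) => k; rewrite coef_odd.
    by move/matrixP/(_ 0 k): uM; rewrite [X in X = _]mxE [X in _ = X]mxE => e; rewrite -[RHS]e; apply: eq_bigr => j _; rewrite mxE.
  have [w [w0 wB wd wT]] := generic_points n.+1.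
  pose W := \matrix_(j < n.+1, i < n.+1) (ThA (w i) ^+ j * ThB (w i) ^+ (n.+1.-1 - j)).
  have uW : u *m W = 0.
    apply/rowP => i; rewrite !mxE; apply: (mulfI (wd i)); rewrite mulr0 mulr_sumr -[RHS](z0 _ (w0 i)).
    by apply: eq_bigr => j _; rewrite mxE mulrCA.
  have Wu : W \in unitmx.
    rewrite unitmxE unitfE det_hvander//; apply/prodf_neq0 => i _; apply/prodf_neq0 => k ik.
    by rewrite [X in _ - X]mulrC -Th_AB// wT.
  by rewrite -[u](mulmxK Wu) uW mul0mx.
rewrite row_free_unit in Mf.
pose v := (\row_k coef f (k.+1)%:Z) *m invmx M.
exists (fun j => v 0 j) => z z0; apply/eqP; rewrite -subr_eq0; apply/eqP.
have od : odd_fun (fun z => f z + (-1) * \sum_(j < n.+1) v 0 j * oddth j z).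
  split; first by apply: theta_funD; [exact: of_.1|apply: theta_funZ; exact: (sum_odd _).1].
  by move=> x x0; rewrite of_.2// (sum_odd (fun j => v 0 j)).2// mulrN opprD.
rewrite -mulN1r; apply: (odd_eq0 od _ z0) => k.
rewrite (coefD _ of_.1.1 (holZ _ (sum_odd (fun j => v 0 j)).1.1)) (coefZ _ _ (sum_odd (fun j => v 0 j)).1.1).
rewrite coef_odd mulN1r; apply/eqP; rewrite subr_eq0; apply/eqP.
have /matrixP/(_ 0 k) : v *m M = \row_k coef f (k.+1)%:Z by rewrite /v mulmxKV.
by rewrite !mxE => <-; apply: eq_bigr => j _; rewrite [M _ _]mxE.
Qed.

End OddTheta.

(** * The determinant formula *)

Section IteratedIntegrals.
Variable R : realType.
Variable Ct : contour R.
Implicit Types (B : set R[i]) (Q : R[i] -> set R[i]).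

(** [B] and [Q] collect the points where the product formula may fail: [B] for each single variable,
    [Q z] for the variables that come after one equal to [z]. When the first variable is fixed at
    [z], the set [Q z] is added to [B] for the others; the inner integral is then known for all [z]
    outside the countable set [B], which is enough for the outer one. *)
Lemma contour_integral_n_sum (I : Type) (r : seq I) Q n (phi : I -> nat -> R[i] -> R[i]) B (c : I -> R[i])
    (f : n.-tuple R[i] -> R[i]) :
  countable B -> (forall z, countable (Q z)) ->
  (forall k i, contat (contour_support Ct) (phi k i)) ->
  (forall zs : n.-tuple R[i], (forall i, contour_support Ct (tnth zs i) /\ ~ B (tnth zs i)) ->
    (forall i j : 'I_n, (i < j)%N -> ~ Q (tnth zs i) (tnth zs j)) ->
    f zs = \sum_(k <- r) c k * \prod_(i < n) phi k i (tnth zs i)) ->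
  contour_integral_n Ct f = \sum_(k <- r) c k * \prod_(i < n) contour_integral Ct (phi k i).
Proof.
move=> cB cQ; elim: n phi B cB c f => [|n IH] phi B cB c f ch hf.
  rewrite /= hf; [|by case|by case].
  by apply: eq_bigr => k _; rewrite !big_ord0.
pose g z := \sum_(k <- r) (c k * \prod_(i < n) contour_integral Ct (phi k i.+1)) * phi k 0%N z.
have cg : contat (contour_support Ct) g.
  by apply: contat_sum => k _; apply: contatM; [exact: contat_cst|exact: ch].
rewrite /= (@contour_integral_countable _ Ct _ g B cg cB); last first.
  move=> z Sz Bz; rewrite (IH (fun k i => phi k i.+1) (B `|` Q z) _ (fun k => c k * phi k 0%N z)).
  - by apply: eq_bigr => k _; rewrite mulrAC.
  - exact: countable_U.
  - by move=> k i; exact: ch.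
  - move=> zs h1 h2; rewrite hf.
    + by apply: eq_bigr => k _; rewrite big_ord_recl tnth0 mulrA; congr (_ * _); apply: eq_bigr => i _; rewrite tnthS.
    + move=> i; case: (unliftP ord0 i) => [j ->|->]; last by rewrite tnth0.
      by rewrite tnthS; have [h3 h4] := h1 j; split=> // Bj; apply: h4; left.
    + move=> i j; case: (unliftP ord0 j) => [j' ->|->]; last by rewrite ltn0.
      case: (unliftP ord0 i) => [i' ->|->]; rewrite ?tnth0 !tnthS.
        by rewrite !lift0 ltnS; exact: h2.
      by move=> _ Qj; have [_] := h1 j'; apply; right.
rewrite /g contour_integral_sum; last by move=> k _; apply: contatM; [exact: contat_cst|exact: ch].
apply: eq_bigr => k _; rewrite contour_integralZ; last exact: ch.
by rewrite big_ord_recl [RHS]mulrCA mulrC.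
Qed.

Lemma andreief Q n (phi psi : nat -> R[i] -> R[i]) (w : R[i] -> R[i]) B (f : n.-tuple R[i] -> R[i]) :
  countable B -> (forall z, countable (Q z)) ->
  (forall i, contat (contour_support Ct) (phi i)) ->
  (forall i, contat (contour_support Ct) (psi i)) -> contat (contour_support Ct) w ->
  (forall zs : n.-tuple R[i], (forall i, contour_support Ct (tnth zs i) /\ ~ B (tnth zs i)) ->
    (forall i j : 'I_n, (i < j)%N -> ~ Q (tnth zs i) (tnth zs j)) ->
    f zs = \det (\matrix_(j < n, i < n) phi j (tnth zs i)) * \det (\matrix_(j < n, i < n) psi j (tnth zs i)) *
      \prod_(i < n) w (tnth zs i)) ->
  contour_integral_n Ct f =
    n`!%:R * \det (\matrix_(j < n, k < n) contour_integral Ct (fun z => phi j z * psi k z * w z)).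
Proof.
move=> cB cQ cphi cpsi cw hf.
set L := \matrix_(j, k) _.
pose r := [seq (s, t) | s <- index_enum 'S_n, t <- index_enum 'S_n].
(* The functions are indexed by natural numbers, so a permutation is extended by an arbitrary value
   outside its range. *)
pose o (s : 'S_n) (i : nat) : nat := if insub i is Some k then s k else 0%N.
have oE (s : 'S_n) (i : 'I_n) : o s i = s i by rewrite /o valK.
rewrite (@contour_integral_n_sum _ r Q n (fun st i z => phi (o st.1 i) z * psi (o st.2 i) z * w z) B
   (fun st => (-1) ^+ st.1 * (-1) ^+ st.2) f cB cQ).
- rewrite /r big_allpairs_dep /=.
  transitivity (\sum_(s : 'S_n) \det L); last by rewrite sumr_const card_Sn mulr_natl.
  apply: eq_bigr => s _.
  transitivity ((-1) ^+ s * \det (row_perm s L)).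
    rewrite mulr_sumr; apply: eq_bigr => t _; rewrite -mulrA; congr (_ * (_ * _)).
    by apply: eq_bigr => i _; rewrite !mxE !oE.
  by rewrite row_permE det_mulmx det_perm mulrA -expr2 sqrr_sign mul1r.
- move=> st i; apply: contatM; last exact: cw.
  by apply: contatM; [exact: cphi|exact: cpsi].
- move=> zs h1 h2; rewrite hf// -det_tr -(det_tr (\matrix_(j, i) psi _ _)).
  rewrite /r big_allpairs_dep /= /determinant mulr_suml mulr_suml.
  apply: eq_bigr => s _; rewrite mulr_sumr mulr_suml; apply: eq_bigr => t _.
  rewrite -!mulrA; congr (_ * _); rewrite mulrCA; congr (_ * _); rewrite mulrA -!big_split /=.
  by apply: eq_bigr => i _; rewrite !mxE !oE.
Qed.

End IteratedIntegrals.

(** * The weight in one variable and its admissible contours *)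

Section Weights.
Variable R : realType.
Notation C := (R[i])^o.
Implicit Types (p q : R[i]) (t : seq R[i]) (Ct : contour R).
Local Opaque dp qp th Th Gam.

(** The two theta functions stand for the reciprocal of Gamma(z^(+-2)). *)
Definition weight p q t z : R[i] :=
  \prod_(x <- t) (Gam (x * z) p q * Gam (x / z) p q) * (th (z ^+ 2) p * th (z ^- 2) q) *
  (two_pi_i R * z)^-1.

Definition inner_poles p q t : set R[i] := [set a | exists x i j, x \in t /\ a = p ^+ i * q ^+ j * x].
Definition poles p q t : set R[i] := [set a | [\/ a = 0, inner_poles p q t a | inner_poles p q t a^-1]].

Definition nome p := p != 0 /\ cabs p < 1.

Definition adm p q t Ct : Prop := ~ contour_support Ct 0 /\
  forall a, inner_poles p q t a -> contour_contains Ct a /\ contour_excludes Ct a^-1.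

(** No inner pole is the reciprocal of an inner pole. For nonzero parameters this is equivalent to
    the existence of an admissible contour ([adm_gen], [exists_adm]). *)
Definition gen p q t : Prop := forall x y i j, x \in t -> y \in t -> p ^+ i * q ^+ j * (x * y) != 1.

Lemma inner_poles_neq0 p q t a : nome p -> nome q -> all (fun x => x != 0) t -> inner_poles p q t a -> a != 0.
Proof.
move=> [p0 _] [q0 _] /allP t0 [x [i [j [xt ->]]]].
by rewrite !mulf_neq0 ?expf_neq0// t0.
Qed.

Lemma inner_polesM p q t a i j : inner_poles p q t a -> inner_poles p q t (p ^+ i * q ^+ j * a).
Proof.
move=> [x [k [l [xt ->]]]]; exists x, (i + k)%N, (j + l)%N; split=> //.
by rewrite !exprD; ring.
Qed.

Lemma inner_polesC p q t : inner_poles p q t = inner_poles q p t.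
Proof.
apply/seteqP; split=> a [x [i [j [xt ->]]]]; exists x, j, i; split=> //; by rewrite (mulrC (_ ^+ i)).
Qed.

Lemma admC p q t Ct : adm p q t Ct -> adm q p t Ct.
Proof. by rewrite /adm inner_polesC. Qed.

Lemma inner_poles_sub p q t t' : {subset t <= t'} -> inner_poles p q t `<=` inner_poles p q t'.
Proof. by move=> h a [x [i [j [xt ->]]]]; exists x, i, j; split=> //; exact: h. Qed.

Lemma adm_gen p q t Ct : nome p -> nome q -> all (fun x => x != 0) t -> adm p q t Ct -> gen p q t.
Proof.
move=> np nq t0 [_ h] x y i j xt yt; apply/eqP => e.
have hx : inner_poles p q t (p ^+ i * q ^+ j * x) by exists x, i, j.
have hy : inner_poles p q t y by exists y, 0%N, 0%N; rewrite !expr0 !mul1r.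
have y0 := allP t0 _ yt.
have e' : p ^+ i * q ^+ j * x = y^-1 by apply: (mulIf y0); rewrite mulVf// -e !mulrA.
have [[_ w1] _] := h _ hx; have [_ [_ w0]] := h _ hy.
by move: w1; rewrite e' w0 => /eqP; rewrite eq_sym oner_eq0.
Qed.

Lemma adm_avoids p q t Ct : adm p q t Ct -> avoids Ct (poles p q t).
Proof.
move=> [h0 h] a [->//|/h[[]]//|/h[_ []]]; by rewrite invrK.
Qed.

Lemma pow_small p : cabs p < 1 -> forall e : R, 0 < e -> exists N : nat, forall n, (N <= n)%N -> cabs p ^+ n < e.
Proof.
move=> p1 e e0; have : (fun n => cabs p ^+ n) @ \oo --> (0 : R).
  by apply: cvg_expr; rewrite ger0_norm ?cabs_ge0.
move=> /cvgrPdist_lt/(_ _ e0)[N _ hN]; exists N => n Nn.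
by have := hN n Nn; rewrite /= sub0r normrN ger0_norm ?exprn_ge0 ?cabs_ge0.
Qed.

Lemma winding_near0 Ct : ~ contour_support Ct 0 -> exists2 d : R, 0 < d &
  forall b, cabs b < d -> ~ contour_support Ct b /\ winding Ct b = winding Ct 0.
Proof.
move=> S0; have [d d0 hd] := support_dist S0; exists d => // b bd; split.
  by move=> /hd; rewrite subr0; lra.
by apply: winding_lt => // z /hd; rewrite !subr0; lra.
Qed.

Lemma winding_far Ct : exists2 M : R, 0 < M &
  forall b, M < cabs b -> ~ contour_support Ct b /\ winding Ct b = 0.
Proof.
have [M M0 hM] := support_bounded Ct; exists M => // b Mb; split; first by move=> /hM; lra.
by apply: (@winding_gt _ _ 0) => z /hM; rewrite !subr0; lra.
Qed.

(** Admissibility does not prescribe the winding number about 0. It is forced by the inner poles p^N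
    x, which tend to 0 and have winding number 1. *)
Lemma adm_winding0 p q t Ct : cabs p < 1 -> t != [::] -> adm p q t Ct -> winding Ct 0 = 1.
Proof.
case: t => // x t p1 _ [S0 h]; have [d d0 hd] := winding_near0 S0.
have e0 : 0 < d / (cabs x + 1) by rewrite divr_gt0// ltr_wpDl ?cabs_ge0.
have [N hN] := pow_small p1 e0.
suff /hd[_ <-] : cabs (p ^+ N * q ^+ 0 * x) < d.
  have [|[_ //] _] := h (p ^+ N * q ^+ 0 * x); by exists x, N, 0%N; rewrite mem_head.
rewrite expr0 mulr1 cabsM cabsX; have := hN N (leqnn _); rewrite ltr_pdivlMr ?ltr_wpDl ?cabs_ge0// => H.
by apply: le_lt_trans H; apply: ler_wpM2l; [rewrite exprn_ge0 ?cabs_ge0|lra].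
Qed.

Lemma hol_gamZ p q t x E : nome p -> nome q -> poles p q t `<=` E -> x \in t ->
  hol E (fun z => Gam (x * z) p q).
Proof.
move=> [p0 p1] [q0 q1] sub xt; apply: hol_GamZ => //; first by apply: sub; constructor 1.
by move=> j k _; apply: sub; constructor 3; rewrite invrK; exists x, j, k.
Qed.

Lemma hol_gamV p q t x E : nome p -> nome q -> poles p q t `<=` E -> x \in t ->
  hol E (fun z => Gam (x / z) p q).
Proof.
move=> [p0 p1] [q0 q1] sub xt; apply: hol_GamV => //; first by apply: sub; constructor 1.
by move=> j k; apply: sub; constructor 2; exists x, j, k.
Qed.

Lemma hol_big_seq E (I : eqType) (r : seq I) (f : I -> R[i] -> R[i]) :
  (forall i, i \in r -> hol E (f i)) -> hol E (fun z => \prod_(i <- r) f i z).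
Proof.
move=> h; apply: (@hol_eq _ _ (fun z => \prod_(i <- r | i \in r) f i z)).
  by move=> z; rewrite -big_seq.
by apply: hol_prod => i ir; exact: h.
Qed.

Lemma hol_weight p q t : nome p -> nome q -> hol (poles p q t) (weight p q t).
Proof.
move=> np nq; have E0 : poles p q t 0 by constructor 1.
have [p0 p1] := np; have [q0 q1] := nq.
apply: holM; first apply: holM.
- by apply: hol_big_seq => x xt; apply: holM; [exact: (hol_gamZ np nq (@subset_refl _ _) xt)|exact: (hol_gamV np nq (@subset_refl _ _) xt)].
- by apply: holM; [exact: hol_thX|exact: hol_thVX].
- apply: (@hol_eq _ _ (fun z => (two_pi_i R)^-1 * z^-1)); first by move=> z; rewrite invfM.
  by apply: holZ; exact: hol_inv.
Qed.

Definition basis_fun n p a b j z : R[i] := ThA p a z ^+ j * ThB p a b z ^+ (n.-1 - j).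

Lemma hol_basis n p a b j E : cabs p < 1 -> E 0 -> hol E (basis_fun n p a b j).
Proof. by move=> p1 E0; apply: holM; apply: holX; [exact: hol_ThA|exact: hol_ThB]. Qed.

Definition moment n p q t a b a' b' Ct j k : R[i] :=
  contour_integral Ct (fun z => basis_fun n p a b j z * basis_fun n q a' b' k z * weight p q t z).

(* [BC_integrand], with the reciprocals of its gamma factors rewritten as theta functions. *)
Definition clean n p q t (zs : n.-tuple R[i]) : R[i] :=
  \prod_(i < n) \prod_(k < n | (i < k)%N)
    (Th (tnth zs i) (tnth zs k) p * Th (tnth zs i) (tnth zs k) q) *
  \prod_(i < n) weight p q t (tnth zs i).

Definition clean_int n p q t Ct := contour_integral_n Ct (@clean n p q t).

Lemma countable_ThB0 p a b : cabs p < 1 -> p != 0 -> b != 0 -> Th a b p != 0 ->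
  countable [set z | z = 0 \/ ThB p a b z = 0].
Proof.
move=> p1 p0 b0 ab.
have h x : x != 0 -> countable [set z : R[i] | pZ p (z * x)].
  by move=> x0; apply: countable_pZ => // c; exact: countable_fib_mul.
apply: (@sub_countable _ _ _ ([set 0] `|` ([set z : R[i] | pZ p (z * b)] `|` [set z : R[i] | pZ p (z / b)]))).
  apply: subset_card_le => z [->|e]; first by left.
  have [->|z0] := eqVneq z 0; first by left.
  right; apply: contrapT => /not_orP[h1 h2].
  by move/eqP: e; rewrite /ThB mulf_eq0 invr_eq0 (negPf ab) orbF; apply/negP; exact: Th_neq0.
apply: countable_U; first exact: countable1.
by apply: countable_U; apply: h; rewrite ?invr_eq0.
Qed.

(** The zeros of the two functions [ThB] join the exceptional set, because [det_hvander] divides by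
    them. *)
Lemma eq_clean_intE n p q t a b a' b' Ct B Q f : nome p -> nome q -> adm p q t Ct ->
  a != 0 -> b != 0 -> Th a b p != 0 -> a' != 0 -> b' != 0 -> Th a' b' q != 0 ->
  countable B -> (forall z, countable (Q z)) ->
  (forall zs : n.-tuple R[i], (forall i, contour_support Ct (tnth zs i) /\ ~ B (tnth zs i)) ->
    (forall i j : 'I_n, (i < j)%N -> ~ Q (tnth zs i) (tnth zs j)) -> f zs = clean p q t zs) ->
  contour_integral_n Ct f = n`!%:R * \det (\matrix_(j < n, k < n) moment n p q t a b a' b' Ct j k).
Proof.
move=> np nq ad a0 b0 ab a0' b0' ab' cB cQ hf; have [p0 p1] := np; have [q0 q1] := nq.
have E0 : poles p q t 0 by constructor 1.
have av := adm_avoids ad.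
pose B1 := B `|` ([set z | z = 0 \/ ThB p a b z = 0] `|` [set z | z = 0 \/ ThB q a' b' z = 0]).
apply: (@andreief _ _ Q n (basis_fun n p a b) (basis_fun n q a' b') (weight p q t) B1) => //.
- by apply: countable_U => //; apply: countable_U; exact: countable_ThB0.
- by move=> i; apply: hol_supp av _; exact: hol_basis.
- by move=> i; apply: hol_supp av _; exact: hol_basis.
- by apply: hol_supp av _; exact: hol_weight.
move=> zs hz hQ; rewrite hf //; last by move=> i; have [h1 h2] := hz i; split=> // h; apply: h2; left.
have z0 i : tnth zs i != 0.
  by apply/eqP => e; have [_] := hz i; apply; right; left; left.
have hB i : ThB p a b (tnth zs i) != 0.
  by apply/eqP => e; have [_] := hz i; apply; right; left; right.
have hB' i : ThB q a' b' (tnth zs i) != 0.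
  by apply/eqP => e; have [_] := hz i; apply; right; right; right.
rewrite (det_hvander _ hB) (det_hvander _ hB') /clean; congr (_ * _).
rewrite -big_split /=; apply: eq_bigr => i _; rewrite -big_split /=; apply: eq_bigr => k _.
by rewrite (Th_AB p1 p0 a0 b0 ab)// (Th_AB q1 q0 a0' b0' ab')//; ring.
Qed.

Lemma clean_intE n p q t a b a' b' Ct : nome p -> nome q -> adm p q t Ct ->
  a != 0 -> b != 0 -> Th a b p != 0 -> a' != 0 -> b' != 0 -> Th a' b' q != 0 ->
  clean_int n p q t Ct = n`!%:R * \det (\matrix_(j < n, k < n) moment n p q t a b a' b' Ct j k).
Proof.
by move=> np nq ad a0 b0 ab a0' b0' ab'; apply: (@eq_clean_intE _ _ _ _ _ _ _ _ _ set0 (fun _ => set0)).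
Qed.

(** The base point [a] is prescribed: at the pinch it has to be the critical parameter. *)
Lemma exists_basis_at p a : nome p -> a != 0 -> exists2 b, b != 0 & Th a b p != 0.
Proof.
move=> [p0 p1] a0.
have h x : x != 0 -> countable [set z : R[i] | pZ p (z * x)].
  by move=> x0; apply: countable_pZ => // c; exact: countable_fib_mul.
have [|z z0 nz] := @countable_avoidC R ([set z | pZ p (z * a)] `|` [set z | pZ p (z * a^-1)]).
  by apply: countable_U; apply: h; rewrite ?invr_eq0.
exists z => //; rewrite ThN// oppr_eq0; apply: Th_neq0 => // hz; apply: nz; by [left|right].
Qed.

Lemma exists_basis p : nome p -> exists a b, [/\ a != 0, b != 0 & Th a b p != 0].
Proof.
by move=> np; have [b b0 hb] := exists_basis_at np (oner_neq0 _); exists 1, b; split; rewrite ?oner_neq0.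
Qed.

Lemma eq_clean_int n p q t Ct B Q f : nome p -> nome q -> adm p q t Ct ->
  countable B -> (forall z, countable (Q z)) ->
  (forall zs : n.-tuple R[i], (forall i, contour_support Ct (tnth zs i) /\ ~ B (tnth zs i)) ->
    (forall i j : 'I_n, (i < j)%N -> ~ Q (tnth zs i) (tnth zs j)) -> f zs = clean p q t zs) ->
  contour_integral_n Ct f = clean_int n p q t Ct.
Proof.
move=> np nq ad cB cQ hf.
have [a [b [a0 b0 ab]]] := exists_basis np; have [a' [b' [a0' b0' ab']]] := exists_basis nq.
rewrite (clean_intE n np nq ad a0 b0 ab a0' b0' ab').
exact: eq_clean_intE np nq ad a0 b0 ab a0' b0' ab' cB cQ hf.
Qed.

(** Admissible contours have equal winding numbers about all poles of the integrand, 0 included. *)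
Lemma moment_contour n p q t a b a' b' C1 C2 j k : nome p -> nome q -> t != [::] ->
  adm p q t C1 -> adm p q t C2 -> moment n p q t a b a' b' C1 j k = moment n p q t a b a' b' C2 j k.
Proof.
move=> np nq tn ad1 ad2; have [p0 p1] := np; have [q0 q1] := nq.
have E0 : poles p q t 0 by constructor 1.
apply: (hol_int_eq (adm_avoids ad1) (adm_avoids ad2)).
- move=> x [->|hx|hx]; first by rewrite (adm_winding0 p1 tn ad1) (adm_winding0 p1 tn ad2).
  + by have [[_ ->] _] := ad1.2 _ hx; have [[_ ->] _] := ad2.2 _ hx.
  + have [_ [_]] := ad1.2 _ hx; have [_ [_]] := ad2.2 _ hx; by rewrite invrK => -> ->.
- by apply: holM; [apply: holM; exact: hol_basis|exact: hol_weight].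
Qed.

Lemma clean_int_contour n p q t C1 C2 : nome p -> nome q -> t != [::] ->
  adm p q t C1 -> adm p q t C2 -> clean_int n p q t C1 = clean_int n p q t C2.
Proof.
move=> np nq tn ad1 ad2.
have [a [b [a0 b0 ab]]] := exists_basis np; have [a' [b' [a0' b0' ab']]] := exists_basis nq.
rewrite (clean_intE n np nq ad1 a0 b0 ab a0' b0' ab') (clean_intE n np nq ad2 a0 b0 ab a0' b0' ab').
by congr (_ * \det _); apply/matrixP => j k; rewrite !mxE; exact: moment_contour.
Qed.

Lemma weightC p q t z : cabs p < 1 -> cabs q < 1 -> z != 0 -> weight p q t z = weight q p t z.
Proof.
move=> p1 q1 z0; have z2 : z ^+ 2 != 0 by rewrite expf_neq0.
have e1 : \prod_(x <- t) (Gam (x * z) p q * Gam (x / z) p q) =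
    \prod_(x <- t) (Gam (x * z) q p * Gam (x / z) q p).
  by apply: eq_bigr => x _; rewrite (Gam_sym (x * z) p q) (Gam_sym (x / z) p q).
have e2 : th (z ^+ 2) p * th (z ^- 2) q = th (z ^+ 2) q * th (z ^- 2) p.
  by rewrite (th_inv p1 z2) (th_inv q1 z2); move: (th _ p) (th _ q) => u v; ring.
exact: (f_equal2 (fun u v => u * v * (two_pi_i R * z)^-1) e1 e2).
Qed.

(** Exchanging [p] and [q] transposes the matrix of moments. Thus a relation for shifts by [q]
    yields one for shifts by [p]. *)
Lemma clean_intC n p q t Ct : nome p -> nome q -> adm p q t Ct -> clean_int n p q t Ct = clean_int n q p t Ct.
Proof.
move=> np nq ad.
have [a [b [a0 b0 ab]]] := exists_basis np; have [a' [b' [a0' b0' ab']]] := exists_basis nq.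
rewrite (clean_intE n np nq ad a0 b0 ab a0' b0' ab') (clean_intE n nq np (admC ad) a0' b0' ab' a0 b0 ab).
pose M := \matrix_(j < n, k < n) moment n p q t a b a' b' Ct j k.
pose M' := \matrix_(j < n, k < n) moment n q p t a' b' a b Ct j k.
have e : M = M'^T.
  apply/matrixP => j k; rewrite mxE [RHS]mxE [RHS]mxE.
  apply: eq_contour_integral => z Sz; have z0 : z != 0 by apply/eqP => e; apply: ad.1; rewrite -e.
  by rewrite (weightC t np.2 nq.2 z0) [X in X * _]mulrC.
exact: (f_equal (fun d => n`!%:R * d) (etrans (f_equal determinant e) (det_tr M'))).
Qed.

(** Recursive on the list, so that the factors of its first parameters split off by computation. *)
Fixpoint pair_prod p q t : R[i] :=
  if t is x :: s then \prod_(y <- s) Gam (x * y) p q * pair_prod p q s else 1.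

Lemma pair_prodC p q t : pair_prod p q t = pair_prod q p t.
Proof.
elim: t => [|x s IH]; first by [].
have e : \prod_(y <- s) Gam (x * y) p q = \prod_(y <- s) Gam (x * y) q p.
  by apply: eq_bigr => y _; exact: Gam_sym.
exact: (f_equal2 (fun u v => u * v) e IH).
Qed.

Lemma finite_inner_poles p q t (e : R) : nome p -> nome q -> 0 < e ->
  finite_set [set a | inner_poles p q t a /\ e <= cabs a].
Proof.
move=> np nq e0; pose M := \sum_(x <- t) cabs x + 1.
have M0 : 0 < M by rewrite ltr_wpDl// sumr_ge0// => x _; exact: cabs_ge0.
have xM x : x \in t -> cabs x <= M.
  move=> xt; rewrite /M (big_rem _ xt) /= -addrA lerDl addr_ge0// sumr_ge0// => y _; exact: cabs_ge0.
have eM : 0 < e / M by rewrite divr_gt0.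
have [N hN] := pow_small np.2 eM; have [N' hN'] := pow_small nq.2 eM.
apply: (@sub_finite_set _ _ [set` [seq p ^+ ij.1 * q ^+ ij.2 * x | x <- t, ij <- [seq (i, j) | i <- iota 0 N, j <- iota 0 N']]]); last exact: finite_seq.
move=> _ [[x [i [j [xt ->]]]] he] /=.
have pw (r : R[i]) k : cabs r < 1 -> cabs r ^+ k <= 1 by move=> h; rewrite exprn_ile1 ?cabs_ge0// ltW.
move: he; rewrite !cabsM !cabsX => he.
have iN : (i < N)%N.
  rewrite ltnNge; apply/negP => /hN; rewrite ltr_pdivlMr// => h; move: he; apply/negP; rewrite -ltNge.
  apply: le_lt_trans h; apply: ler_pM; rewrite ?mulr_ge0 ?exprn_ge0 ?cabs_ge0 ?xM//.
  by rewrite ler_piMr ?exprn_ge0 ?cabs_ge0// pw// nq.2.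
have jN : (j < N')%N.
  rewrite ltnNge; apply/negP => /hN'; rewrite ltr_pdivlMr// => h; move: he; apply/negP; rewrite -ltNge.
  apply: le_lt_trans h; apply: ler_pM; rewrite ?mulr_ge0 ?exprn_ge0 ?cabs_ge0 ?xM//.
  by rewrite ler_piMl ?exprn_ge0 ?cabs_ge0// pw// np.2.
by apply/allpairsP; exists (x, (i, j)); split=> //=; apply/allpairsP; exists (i, j); rewrite !mem_iota.
Qed.

Lemma finite_inv_poles p q t (e : R) : nome p -> nome q ->
  finite_set [set b | (b != 0 /\ inner_poles p q t b^-1) /\ cabs b <= e].
Proof.
move=> np nq; have e0 : 0 < (Num.max e 1)^-1 by rewrite invr_gt0 lt_max ltr01 orbT.
apply: (@sub_finite_set _ _ ((fun a => a^-1) @` [set a | inner_poles p q t a /\ (Num.max e 1)^-1 <= cabs a])).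
  move=> b [[b0 hb] be]; exists b^-1; last by rewrite invrK.
  split=> //; rewrite cabsV lef_pV2 ?posrE ?cabs_gt0//; first by rewrite le_max be.
  by rewrite lt_max ltr01 orbT.
by apply: finite_image; exact: finite_inner_poles.
Qed.

Lemma exists_adm p q t : nome p -> nome q -> all (fun x => x != 0) t -> gen p q t -> exists Ct, adm p q t Ct.
Proof.
move=> np nq t0 g; have n0 a : inner_poles p q t a -> a != 0 by exact: inner_poles_neq0.
have nA : ~ inner_poles p q t 0 by move=> /n0; rewrite eqxx.
have nB : ~ [set b | b != 0 /\ inner_poles p q t b^-1] 0 by move=> []; rewrite eqxx.
have nAB x : inner_poles p q t x -> [set b | b != 0 /\ inner_poles p q t b^-1] x -> False.
  move=> [u [i [j [ut xE]]]] [x0 [v [k [l [vt vE]]]]].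
  have /eqP := g u v (i + k)%N (j + l)%N ut vt; apply.
  by rewrite -(mulfV x0) vE xE !exprD; ring.
have [Ct [S0 [h1 h2]]] := separating_contour nA nB nAB (fun e => @finite_inner_poles p q t e np nq) (fun e => @finite_inv_poles p q t e np nq).
exists Ct; split=> // a ha; split; first exact: h1.
by apply: h2; rewrite /= invrK invr_eq0; split=> //; exact: n0.
Qed.

Lemma dp_support p q t Ct x z : nome p -> nome q -> avoids Ct (poles p q t) -> x != 0 ->
  x \in t -> contour_support Ct z -> dp (x * z) p q != 0 /\ dp (x / z) p q != 0.
Proof.
move=> np nq av x0 xt Sz; have [p0 p1] := np; have [q0 q1] := nq.
have z0 : z != 0 by apply/eqP => e; apply: (av 0); [constructor 1|rewrite -e].
have h i j : inner_poles p q t (p ^+ i * q ^+ j * x) by exists x, i, j.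
have c0 i j : p ^+ i * q ^+ j * x != 0 by rewrite !mulf_neq0 ?expf_neq0.
split; apply: dp_neq0 => // i j; apply/eqP => e.
  apply: (av (p ^+ i * q ^+ j * x)^-1); first by constructor 3; rewrite invrK.
  suff -> : (p ^+ i * q ^+ j * x)^-1 = z by [].
  by apply: (mulfI (c0 i j)); rewrite mulfV// -e !mulrA.
apply: (av (p ^+ i * q ^+ j * x)); first by constructor 2.
suff -> : p ^+ i * q ^+ j * x = z by [].
by apply: (mulIf (invr_neq0 z0)); rewrite mulfV// -e !mulrA.
Qed.

End Weights.

(** * The shift relation *)

Section ThetaProducts.
Variable R : realType.
Implicit Types (p q : R[i]) (t : seq R[i]).
Local Opaque dp qp th Th Gam.

Lemma prod_scale (c : R[i]) t : \prod_(x <- t) (c * x) = c ^+ size t * \prod_(x <- t) x.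
Proof.
elim: t => [|x t IH]; first by rewrite !big_nil mulr1.
by rewrite !big_cons IH /= exprS; ring.
Qed.

Lemma prod_th_mul p t z : nome p -> all (fun x => x != 0) t -> z != 0 ->
  \prod_(x <- t) th (x * (p * z)) p = (- z) ^- size t * (\prod_(x <- t) x)^-1 * \prod_(x <- t) th (x * z) p.
Proof.
move=> [p0 p1] t0 z0; rewrite -invfM -prod_scale -prodfV -big_split /= !big_seq.
apply: eq_bigr => x xt; have x0 := allP t0 _ xt.
rewrite mulrCA th_shift ?mulf_neq0//; congr (_ * _).
by rewrite mulNr mulrC invrN.
Qed.

Lemma prod_th_div p t z : nome p -> all (fun x => x != 0) t -> z != 0 ->
  \prod_(x <- t) th (x / (p * z)) p = (- (p * z)) ^- size t * (\prod_(x <- t) x) * \prod_(x <- t) th (x / z) p.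
Proof.
move=> [p0 p1] t0 z0; rewrite -exprVn -prod_scale -big_split /= !big_seq.
apply: eq_bigr => x xt; have x0 := allP t0 _ xt.
have -> : th (x / z) p = - (x / (p * z))^-1 * th (x / (p * z)) p.
  have y0 : x / (p * z) != 0 by rewrite mulf_neq0// invr_eq0 mulf_neq0.
  have e : x / z = p * (x / (p * z)) by field; rewrite z0 p0.
  by rewrite e (th_shift p1 p0 y0).
rewrite invrN !mulNr mulrN opprK !mulrA; set y := th _ _.
have : (p * z)^-1 * x * (x / (p * z))^-1 = 1 by rewrite [_^-1 * x]mulrC mulfV// mulf_neq0// invr_eq0 mulf_neq0.
by move=> ->; rewrite mul1r.
Qed.

Definition odd_prod n p t z : R[i] :=
  z ^+ n.+1 * \prod_(x <- t) th (x / z) p + - (z ^- n.+1 * \prod_(x <- t) th (x * z) p).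

Lemma odd_prod_odd n p t : nome p -> size t = (2 * n + 4)%N -> \prod_(x <- t) x = p ->
  all (fun x => x != 0) t -> odd_fun n p (odd_prod n p t).
Proof.
move=> np st tp t0; have [p0 p1] := np.
have E0 : [set (0 : R[i])] 0 by [].
split; last first.
  by move=> z z0; rewrite /odd_prod invrK opprB exprVn invrK.
split.
  apply: holD.
    by apply: holM; [apply: holX; exact: hol_id|apply: hol_big_seq => x _; exact: hol_thV].
  apply: (@hol_eq _ _ (fun z => - 1 * ((z^-1) ^+ n.+1 * \prod_(x <- t) th (x * z) p))).
    by move=> z; rewrite mulN1r exprVn.
  apply: holZ; apply: holM; first by apply: holX; exact: hol_inv.
  by apply: hol_big_seq => x _; exact: hol_thZ.
move=> z z0; rewrite /odd_prod prod_th_mul// prod_th_div// tp st.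
(* The number of parameters is even, so the signs of the quasi-periodicity factors cancel. *)
have ev (x : R[i]) : (- x) ^+ (2 * n + 4) = x ^+ (2 * n + 4).
  by rewrite exprNn -signr_odd oddD oddM /= expr0 mul1r.
rewrite !ev mulrDr mulrN; congr (_ - _).
  rewrite !exprMn !mulrA; congr (_ * _).
  rewrite mul2n -addnn !exprD !(exprS _ n) !exprS expr0; field.
  by rewrite z0 p0 !expf_neq0.
rewrite !exprMn !mulrA; congr (_ * _).
rewrite mul2n -addnn !exprD !(exprS _ n) !exprS expr0; field.
by rewrite z0 p0 !expf_neq0.
Qed.

End ThetaProducts.

Lemma GamE (R : realType) (x p q : R[i]) : Gam x p q = dp (p * q / x) p q / dp x p q.
Proof. by []. Qed.

(* With this [u], the moments of the odd theta function times [f] are integrals of [u z + u z^-1],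
   and [u (q / z) = - u z]. *)
Definition shift_fun (R : realType) (n : nat) (p q : R[i]) (t : seq R[i]) (f : R[i] -> R[i]) z : R[i] :=
  (two_pi_i R)^-1 * z ^+ (n + 2) * \prod_(x <- t) (Gam (x * z) p q * Gam (q * x / z) p q) * (th (z ^- 2) q * f z).

(** Cramer's rule for a relation among n + 1 rows of length n. The rows are completed to a square
    matrix [K] by a first column with a single entry 1 on top; then u K is v_0 times the first unit
    vector, and multiplying by the adjugate compares det K with a cofactor. *)
Lemma det_shift_rows (F : comNzRingType) n (mu : nat -> nat -> F) (v : 'I_n.+1 -> F) :
  (forall k : 'I_n, \sum_(j < n.+1) v j * mu j k = 0) ->
  v ord_max * \det (\matrix_(j < n, k < n) mu j.+1 k) =
  (-1) ^+ n * v ord0 * \det (\matrix_(j < n, k < n) mu j k).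
Proof.
move=> h; pose f (j k : 'I_n.+1) : F := oapp (fun l : 'I_n => mu j l) ((j == ord0)%:R) (unlift ord0 k).
pose K := \matrix_(j < n.+1, k < n.+1) f j k.
pose u : 'rV_n.+1 := \row_j v j.
have K0 j : K j ord0 = (j == ord0)%:R by rewrite mxE /f unlift_none.
have KS j k : K j (lift ord0 k) = mu j k by rewrite mxE /f liftK.
have uK : u *m K = v ord0 *: delta_mx 0 ord0.
  apply/rowP => k; rewrite !mxE; case: (unliftP ord0 k) => [k' ->|->].
    rewrite eq_sym (negPf (neq_lift _ _)) andbF mulr0 -[RHS](h k'); apply: eq_bigr => j _.
    by rewrite KS mxE.
  rewrite eqxx mulr1 big_ord_recl K0 eqxx mulr1 big1 ?addr0 ?mxE// => j _.
  by rewrite K0 eq_sym (negPf (neq_lift _ _)) mulr0.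
have dK : \det K = \det (\matrix_(j < n, k < n) mu j.+1 k).
  rewrite (expand_det_col K ord0) big_ord_recl big1 ?addr0; last first.
    by move=> j _; rewrite K0 eq_sym (negPf (neq_lift _ _)) mul0r.
  rewrite K0 eqxx mul1r /cofactor addn0 expr0 mul1r; congr (\det _).
  by apply/matrixP => j k; rewrite !mxE /f liftK.
have cK : cofactor K ord_max ord0 = (-1) ^+ n * \det (\matrix_(j < n, k < n) mu j k).
  rewrite /cofactor addn0; congr (_ * \det _).
  by apply/matrixP => j k; rewrite !mxE /f liftK lift_max.
have := congr1 (fun M => (M *m \adj K) 0 ord_max) uK.
rewrite -mulmxA mul_mx_adj mul_mx_scalar -scalemxAl -rowE !mxE dK cK.
by rewrite mulrC => ->; rewrite mulrCA mulrA.
Qed.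

Lemma ThE (R : realType) (z w p : R[i]) : Th z w p = z^-1 * th (z * w) p * th (z / w) p.
Proof. by []. Qed.

Lemma cancel_common (F : fieldType) (X0 X1 x P0 P1 d d' Y : F) : X0 != 0 -> X1 != 0 -> x != 0 ->
  - (X1^-1 * (x * P1)) * d' = Y * - (X0^-1 * (x * P0)) * d -> X0 * P1 * d' = Y * X1 * P0 * d.
Proof.
move=> h0 h1 hx e; apply: (mulfI hx).
transitivity (- (X0 * X1) * (- (X1^-1 * (x * P1)) * d')); first by field.
by rewrite e; field.
Qed.

Lemma common_factor (F : comPzRingType) (X0 X1 P0 P1 d d' Y N e : F) :
  X0 * P1 * d' = Y * X1 * P0 * d -> P1 * (N * (e * X0 * d')) = P0 * (N * (e * X1 * Y * d)).
Proof.
move=> h; transitivity (e * N * (X0 * P1 * d')); first by ring.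
by rewrite h; ring.
Qed.

Section Shift.
Variable R : realType.
Notation C := (R[i])^o.
Local Opaque dp qp th Th Gam.
Variables (m : nat) (p q t0 t1 a' b' : R[i]) (s : seq R[i]) (Ct : contour R).
Let t := [:: t0, t1 & s].
Let n := m.+1.
Hypotheses (np : nome p) (nq : nome q) (st : size t = (2 * n + 4)%N) (tn : all (fun x => x != 0) t).
Hypotheses (tp : \prod_(x <- t) x = p) (ad : adm p q t Ct).
Hypotheses (h01 : Th t0 t1 p != 0) (d0 : del p t0 != 0) (d1 : del p t1 != 0).
Hypotheses (a0' : a' != 0) (b0' : b' != 0) (ab' : Th a' b' q != 0).

Let p0 : p != 0. Proof. by case: np. Qed.
Let p1 : cabs p < 1. Proof. by case: np. Qed.
Let q0 : q != 0. Proof. by case: nq. Qed.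
Let q1 : cabs q < 1. Proof. by case: nq. Qed.
Let t00 : t0 != 0. Proof. by case/and3P: tn. Qed.
Let t10 : t1 != 0. Proof. by case/and3P: tn. Qed.
Let nz z : contour_support Ct z -> z != 0.
Proof. by move=> Sz; apply/eqP => e; apply: ad.1; rewrite -e. Qed.
Let psi k z := basis_fun n q a' b' k z.
Let av := adm_avoids ad.
Let E0 : poles p q t 0. Proof. by constructor 1. Qed.

Let U k := shift_fun n p q t (psi k).

(** The poles of [U]. Those of Gamma(q x / z) lie at q times inner poles, which makes this set,
    apart from 0, invariant under z -> q / z; the full set [poles] is not. *)
Let EU : set R[i] := [set a | [\/ a = 0, inner_poles p q t (a / q) | inner_poles p q t a^-1]].

Let EU_sub : EU `<=` poles p q t.
Proof.
move=> a [->|h|h]; [by constructor 1|constructor 2|by constructor 3].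
by have := inner_polesM 0 1 h; rewrite expr0 expr1 mul1r mulrCA divff// mulr1.
Qed.

Let hol_psi k E : E 0 -> hol E (psi k). Proof. by move=> h; exact: hol_basis. Qed.

Let hol_U k : hol EU (U k).
Proof.
have E1 : EU 0 by constructor 1.
apply: holM; first apply: holM.
- by apply: holM; [exact: hol_cst|apply: holX; exact: hol_id].
- apply: hol_big_seq => x xt; apply: holM.
    apply: hol_GamZ => // i j _; constructor 3; rewrite invrK; by exists x, i, j.
  apply: hol_GamV => // i j; constructor 2; exists x, i, j; split=> //.
  by rewrite mulrCA mulrAC mulfV// mul1r.
- by apply: holM; [exact: hol_thVX|exact: hol_psi].
Qed.

Let w0 : winding Ct 0 = 1. Proof. by apply: (adm_winding0 p1 _ ad). Qed.

Let psi_qdiv k z : (k <= m)%N -> z != 0 -> psi k (q / z) = q ^- m * z ^+ (2 * m) * psi k z.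
Proof.
move=> km z0; have zi : z^-1 != 0 by rewrite invr_eq0.
rewrite /psi /basis_fun ThA_shift// ThB_shift// ThA_inv// ThB_inv//=.
move: (ThA q a' z) (ThB q a' b' z) => x y.
rewrite !exprMn -[in RHS](subnKC km); move: (m - k)%N => u.
have -> : z^-1 ^- 2 = z ^+ 2 by rewrite exprVn invrK.
rewrite addKn -[q ^- _]exprVn -!exprM mulnDr !exprD; ring.
Qed.

(** The gamma product is invariant under z -> q / z. The sign comes from [th (z ^- 2) q], and the
    powers of [z] and [q] balance because n = m + 1. *)
Let U_anti k z : (k <= m)%N -> z != 0 -> U k (q / z) = - U k z.
Proof.
move=> km z0; rewrite /U /shift_fun psi_qdiv//.
have -> : \prod_(x <- t) (Gam (x * (q / z)) p q * Gam (q * x / (q / z)) p q) =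
    \prod_(x <- t) (Gam (x * z) p q * Gam (q * x / z) p q).
  apply: eq_bigr => x _; rewrite mulrC; congr (Gam _ p q * Gam _ p q).
    by rewrite invf_div; field.
  by rewrite mulrA (mulrC x).
have z2 : z ^+ 2 != 0 by rewrite expf_neq0.
have e y : y != 0 -> th (y / q) q = - (y / q) * th y q.
  move=> y0; have := th_shift q1 q0 (mulf_neq0 y0 (invr_neq0 q0)).
  rewrite mulrCA divff// mulr1 => ->; rewrite mulrA mulrNN mulfV ?mul1r//.
  by rewrite mulf_neq0// invr_eq0.
have -> : (q / z) ^- 2 = z ^+ 2 / q / q by field; rewrite z0 q0.
rewrite e ?mulf_neq0 ?invr_eq0// e// -[th (z ^+ 2) q](opprK) -mulN1r.
have -> : th (z ^- 2) q = - (z ^- 2) * th (z ^+ 2) q by rewrite th_inv.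
move: (th (z ^+ 2) q) (psi k z) (\prod_(x <- t) _) => X Y Z.
rewrite /n expr_div_n mul2n -addnn addSn addn2 !exprS exprD.
by field; rewrite z0 q0 two_pi_i_neq0 !expf_neq0.
Qed.

Let ccont k : contat (contour_support Ct) (fun z => U k z * z^-1).
Proof.
apply: (hol_supp av); apply: holM; first exact: hol_sub EU_sub (hol_U k).
exact: hol_inv.
Qed.

Local Opaque shift_fun.

(** Of two poles a and q / a of [U] one is enclosed by the contour and the other is not, so
    [hol_inversion] applies and the integral equals its negative. *)
Let int_U0 k : (k <= m)%N -> contour_integral Ct (fun z => U k z * z^-1) = 0.
Proof.
move=> km; have avU : avoids Ct EU by move=> a /EU_sub; exact: av.
have qE a : EU a -> a != 0 -> inner_poles p q t (q / a)^-1 /\ inner_poles p q t (a / q) \/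
     inner_poles p q t a^-1 /\ inner_poles p q t (q / a / q).
  move=> [->|h|h] an; [by rewrite eqxx in an|left|right].
    by rewrite invf_div.
  by split=> //; rewrite mulrAC divff// mul1r.
have eq1 : contour_integral Ct (fun z => U k z * z^-1) = contour_integral Ct (fun z => U k (q / z) * z^-1).
  apply: (hol_inversion q0 ad.1 avU _ _ (hol_U k)) => a Ea an.
    apply: avU; have [[h _]|[_ h]] := qE a Ea an; [by constructor 3|by constructor 2].
  rewrite w0; have [[h1 h2]|[h1 h2]] := qE a Ea an.
    have [_ [_]] := ad.2 _ h1; rewrite invrK => ->.
    have := inner_polesM 0 1 h2; rewrite expr0 expr1 mul1r mulrCA divff// mulr1 => /(ad.2 _)[[_ ->] _].
    by rewrite addr0.
  have [_ [_]] := ad.2 _ h1; rewrite invrK => ->.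
  have := inner_polesM 0 1 h2; rewrite expr0 expr1 mul1r mulrC mulfVK// => /(ad.2 _)[[_ ->] _].
  by rewrite add0r.
have eq2 : contour_integral Ct (fun z => U k (q / z) * z^-1) = - contour_integral Ct (fun z => U k z * z^-1).
  rewrite -contour_integralN; last exact: ccont.
  by apply: eq_contour_integral => z Sz; have -> := U_anti km (nz Sz); exact: mulNr.
have : contour_integral Ct (fun z => U k z * z^-1) *+ 2 = 0 by rewrite mulr2n {2}eq1 eq2 addrN.
by move/eqP; rewrite -mulr_natr mulf_eq0 pnatr_eq0 orbF => /eqP.
Qed.

(** This is the inversion with q replaced by 1: it exchanges the enclosed and the excluded members
    of [poles]. *)
Let int_Uinv k : (k <= m)%N -> contour_integral Ct (fun z => U k z^-1 * z^-1) = 0.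
Proof.
move=> km; rewrite -(int_U0 km).
have oi a : poles p q t a -> a != 0 -> poles p q t a^-1 /\ winding Ct a + winding Ct a^-1 = 1.
  move=> [->|h|h] an; first by rewrite eqxx in an.
    by split; [constructor 3; rewrite invrK|have [[_ ->] [_ ->]] := ad.2 _ h; rewrite addr0].
  split; first by constructor 2.
  by have [[_ ->] [_]] := ad.2 _ h; rewrite invrK => ->; rewrite add0r.
have i1 a : poles p q t a -> a != 0 -> ~ contour_support Ct (1 / a).
  by move=> Ea an; rewrite div1r; apply: av; case: (oi a Ea an).
have i2 a : poles p q t a -> a != 0 -> winding Ct a + winding Ct (1 / a) = winding Ct 0.
  by move=> Ea an; rewrite div1r w0; case: (oi a Ea an).
apply: etrans (esym (hol_inversion (oner_neq0 _) ad.1 av i1 i2 (hol_sub EU_sub (hol_U k)))).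
by apply: eq_contour_integral => z _; rewrite div1r.
Qed.

Let mom j k : R[i] := contour_integral Ct (fun z => ThA p t0 z ^+ j * ThB p t0 t1 z ^+ (n - j) * psi k z * weight p q t z).

Let dp_supp x z : x \in t -> contour_support Ct z -> dp (x * z) p q != 0 /\ dp (x / z) p q != 0.
Proof.
by move=> xt Sz; exact: dp_support np nq av (allP tn _ xt) xt Sz.
Qed.

Local Transparent shift_fun.

(** The weight contains [del], so that this combination of integrands contains the odd function
    [odd_prod]. By Gamma(q x) = theta(x; p) Gamma(x) the two terms of the latter are absorbed into
    the gamma factors and produce U(z) and U(1 / z). *)
Let mom_rel : exists2 v : 'I_n.+1 -> R[i],
  forall z, z != 0 -> odd_prod n p t z = \sum_(j < n.+1) v j * oddth n p t0 t1 j z &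
  forall k, (k <= m)%N -> \sum_(j < n.+1) v j * mom j k = 0.
Proof.
have [v hv] := odd_span p1 p0 t00 t10 h01 (odd_prod_odd np st tp tn).
exists v => // k km.
have cw j : contat (contour_support Ct) (fun z => ThA p t0 z ^+ j * ThB p t0 t1 z ^+ (n - j) * psi k z * weight p q t z).
  apply: (hol_supp av); apply: holM; last exact: hol_weight.
  apply: holM; last exact: hol_psi.
  by apply: holM; apply: holX; [exact: hol_ThA|exact: hol_ThB].
transitivity (contour_integral Ct (fun z => U k z * z^-1 + U k z^-1 * z^-1)); last first.
  rewrite contour_integralD; first by rewrite int_U0// int_Uinv// addr0.
    exact: ccont.
  apply: contatM.
    have := @contat_comp_div R (contour_support Ct) 1 (U k) ad.1.
    have -> : (fun z => U k (1 / z)) = (fun z => U k z^-1) by apply: funext => z; rewrite div1r.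
    apply=> z Sz; apply: (hol_contat (hol_sub EU_sub (hol_U k))) => /= h.
    have z0 := nz Sz; have : poles p q t z.
      move: h; rewrite div1r => -[/eqP|h|h]; [by rewrite invr_eq0 (negPf z0)|by constructor 3|by constructor 2; rewrite invrK in h].
    by move=> /av.
  by have := contat_inv ad.1; under eq_fun do rewrite subr0.
transitivity (\sum_(j < n.+1) contour_integral Ct (fun z => v j * (ThA p t0 z ^+ j * ThB p t0 t1 z ^+ (n - j) * psi k z * weight p q t z))).
  by apply: eq_bigr => j _; rewrite contour_integralZ.
rewrite -contour_integral_sum; last by move=> j _; apply: contatM; [exact: contat_cst|exact: cw].
apply: eq_contour_integral => z Sz; have z0 := nz Sz.
have -> : \sum_(j < n.+1) v j * (ThA p t0 z ^+ j * ThB p t0 t1 z ^+ (n - j) * psi k z * weight p q t z) =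
   (\sum_(j < n.+1) v j * oddth n p t0 t1 j z) * (\prod_(x <- t) (Gam (x * z) p q * Gam (x / z) p q) * th (z ^- 2) q * psi k z * (two_pi_i R)^-1).
  rewrite mulr_suml; apply: eq_bigr => j _; rewrite /oddth /weight /del.
  move: (ThA p t0 z ^+ j) (ThB p t0 t1 z ^+ (n - j)) (psi k z) (\prod_(x <- t) _) (th (z ^+ 2) p) (th (z ^- 2) q) => x1 x2 x3 x4 x5 x6.
  by field; rewrite z0 two_pi_i_neq0.
rewrite -hv// /U /shift_fun /odd_prod.
have psii : psi k z^-1 = psi k z by rewrite /psi /basis_fun ThA_inv// ThB_inv.
have z2 : z ^+ 2 != 0 by rewrite expf_neq0.
rewrite psii !exprVn !invrK (th_inv q1 z2).
have eZ : \prod_(x <- t) (Gam (x * z) p q * Gam (q * x / z) p q) = \prod_(x <- t) th (x / z) p *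
    \prod_(x <- t) (Gam (x * z) p q * Gam (x / z) p q).
  rewrite -big_split /= !big_seq; apply: eq_bigr => x xt; have [_ h] := dp_supp xt Sz.
  have xz : x / z != 0 by rewrite mulf_neq0 ?invr_eq0// (allP tn).
  by rewrite -[q * x / z]mulrA Gam_shift// mulrCA.
have eV : \prod_(x <- t) (Gam (x / z) p q * Gam (q * x * z) p q) = \prod_(x <- t) th (x * z) p *
    \prod_(x <- t) (Gam (x * z) p q * Gam (x / z) p q).
  rewrite -big_split /= !big_seq; apply: eq_bigr => x xt; have [h _] := dp_supp xt Sz.
  have xz : x * z != 0 by rewrite mulf_neq0// (allP tn).
  by rewrite -[q * x * z]mulrA Gam_shift// mulrCA [X in _ * X]mulrC.
rewrite eZ eV; move: (\prod_(x <- t) th (x / z) p) (\prod_(x <- t) th (x * z) p) (\prod_(x <- t) _) => X Y Z.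
move: (th (z ^+ 2) q) (psi k z) => T P.
rewrite !exprD /n !exprS !expr0 !mulr1.
by field; rewrite z0 two_pi_i_neq0 !expf_neq0.
Qed.

Local Opaque Th.

Let th2 x z : x != 0 -> z != 0 -> th (x * z) p * th (x / z) p = - x * Th z x p.
Proof.
move=> x0 z0; have -> : th (x / z) p = - (z / x)^-1 * th (z / x) p.
  by rewrite -th_inv ?mulf_neq0 ?invr_eq0// invf_div.
rewrite ThE (mulrC x z); move: (th (z * x) p) (th (z / x) p) => X Y; field.
by rewrite x0 z0.
Qed.

(** Shifting t_0 multiplies the weight by a multiple of [ThA], which turns moment j into [mom j.+1].
    Shifting t_1 yields [ThB] instead and keeps the index j. *)
Let weight_shift0 z : contour_support Ct z ->
  weight p q [:: q * t0, t1 & s] z = - t0 * ThA p t0 z * weight p q t z.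
Proof.
move=> Sz; have z0 := nz Sz; rewrite -[- t0 * _]/(- t0 * Th z t0 p) -th2//.
have [h1 h2] := dp_supp (mem_head _ _) Sz.
rewrite /weight /t !big_cons -[q * t0 * z]mulrA -[q * t0 / z]mulrA.
rewrite !Gam_shift ?mulf_neq0 ?invr_eq0//.
move: (Gam (t0 * z) p q) (Gam (t0 / z) p q) (th (t0 * z) p) (th (t0 / z) p) => X1 X2 X3 X4.
move: (Gam (t1 * z) p q * _) (\prod_(j <- s) _) (th _ p * th _ q) => Y1 Y2 Y3; ring.
Qed.

Let weight_shift1 z : contour_support Ct z ->
  weight p q [:: t0, q * t1 & s] z = - t1 * Th t0 t1 p * ThB p t0 t1 z * weight p q t z.
Proof.
move=> Sz; have z0 := nz Sz.
have -> : - t1 * Th t0 t1 p * ThB p t0 t1 z = - t1 * Th z t1 p.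
  have e : Th t0 t1 p * ThB p t0 t1 z = Th z t1 p by rewrite /ThB mulrC divfK.
  by rewrite -mulrA e.
rewrite -th2//.
have t1t : t1 \in t by rewrite !inE eqxx orbT.
have [h1 h2] := dp_supp t1t Sz.
rewrite /weight /t !big_cons -[q * t1 * z]mulrA -[q * t1 / z]mulrA.
rewrite !Gam_shift ?mulf_neq0 ?invr_eq0//.
move: (Gam (t1 * z) p q) (Gam (t1 / z) p q) (th (t1 * z) p) (th (t1 / z) p) => X1 X2 X3 X4.
move: (Gam (t0 * z) p q * _) (\prod_(j <- s) _) (th _ p * th _ q) => Y1 Y2 Y3; ring.
Qed.

Let cmom j k : contat (contour_support Ct) (fun z => ThA p t0 z ^+ j * ThB p t0 t1 z ^+ (n - j) * psi k z * weight p q t z).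
Proof.
apply: (hol_supp av); apply: holM; last exact: hol_weight.
apply: holM; last exact: hol_psi.
by apply: holM; apply: holX; [exact: hol_ThA|exact: hol_ThB].
Qed.

Let adm_shift0 : adm p q [:: q * t0, t1 & s] Ct.
Proof.
split; first exact: ad.1.
move=> a [x [i [j [xt ->]]]]; apply: ad.2.
move: xt; rewrite !inE => /or3P[/eqP ->|/eqP ->|xs].
- by exists t0, i, j.+1; rewrite mem_head exprSr; split=> //; ring.
- by exists t1, i, j; rewrite !inE eqxx orbT.
- by exists x, i, j; rewrite !inE xs !orbT.
Qed.

Let adm_shift1 : adm p q [:: t0, q * t1 & s] Ct.
Proof.
split; first exact: ad.1.
move=> a [x [i [j [xt ->]]]]; apply: ad.2.
move: xt; rewrite !inE => /or3P[/eqP ->|/eqP ->|xs].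
- by exists t0, i, j; rewrite mem_head.
- by exists t1, i, j.+1; rewrite !inE eqxx orbT exprSr; split=> //; ring.
- by exists x, i, j; rewrite !inE xs !orbT.
Qed.

Lemma shift_relation :
  \prod_(x <- s) th (x * t1) p * clean_int n p q [:: q * t0, t1 & s] Ct =
  \prod_(x <- s) th (x * t0) p * clean_int n p q [:: t0, q * t1 & s] Ct.
Proof.
have [v hv hr] := mom_rel.
have := @det_shift_rows _ n mom v (fun k => hr k _).
have lk (k : 'I_n) : (k <= m)%N by rewrite -ltnS.
move=> /(_ lk) hdet.
rewrite (clean_intE n np nq adm_shift0 t00 t10 h01 a0' b0' ab').
rewrite (clean_intE n np nq adm_shift1 t00 t10 h01 a0' b0' ab').
have -> : \matrix_(j < n, k < n) moment n p q [:: q * t0, t1 & s] t0 t1 a' b' Ct j k =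
    (- t0) *: \matrix_(j < n, k < n) mom j.+1 k.
  apply/matrixP => j k; rewrite !mxE -contour_integralZ; last exact: cmom.
  apply: eq_contour_integral => z Sz; rewrite weight_shift0// [basis_fun n p _ _ _ _]/basis_fun.
  have -> : (n - j.+1 = n.-1 - j)%N by rewrite /n subSS.
  rewrite exprS.
  rewrite -/(psi k z); move: (ThA p t0 z) (ThB p t0 t1 z ^+ _) (psi k z) (weight _ _ _ _) => X1 X2 X3 X4; ring.
have -> : \matrix_(j < n, k < n) moment n p q [:: t0, q * t1 & s] t0 t1 a' b' Ct j k =
    (- t1 * Th t0 t1 p) *: \matrix_(j < n, k < n) mom j k.
  apply/matrixP => j k; rewrite !mxE -contour_integralZ; last exact: cmom.
  apply: eq_contour_integral => z Sz; rewrite weight_shift1// [basis_fun n p _ _ _ _]/basis_fun.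
  have -> : (n - j = (n.-1 - j).+1)%N by rewrite subSn// lk.
  rewrite exprS -/(psi k z); move: (ThA p t0 z ^+ _) (ThB p t0 t1 z) (psi k z) (weight _ _ _ _) => X1 X2 X3 X4; ring.
rewrite !detZ; move: hdet.
move: (\det (\matrix_(j, k) mom j.+1 k)) (\det (\matrix_(j, k) mom j k)) => D1 D0 hdet.
have A00 : ThA p t0 t0 = 0 by exact: Th_diag.
have B11 : ThB p t0 t1 t1 = 0 by rewrite /ThB Th_diag// mul0r.
have B01 : ThB p t0 t1 t0 = 1 by rewrite /ThB mulfV.
have A10 : ThA p t0 t1 = - Th t0 t1 p by rewrite /ThA (ThN p1 t00 t10).
(* At t0 all terms with j > 0 vanish, at t1 all those with j < n. This determines the two extreme
   coefficients of the relation. *)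
have e0 : odd_prod n p t t0 = del p t0 * v ord0.
  rewrite hv// big_ord_recl big1; last by move=> j _; rewrite /oddth A00 exprS mul0r !mul0r !mulr0.
  by rewrite /oddth B01 expr1n expr0 !mulr1 addr0 mulrC.
have e1 : odd_prod n p t t1 = del p t1 * v ord_max * (- Th t0 t1 p) ^+ n.
  rewrite hv// big_ord_recr /= big1; last first.
    by move=> j _; rewrite /oddth B11 /= subSn ?exprS ?mul0r ?mulr0// -ltnS ltn_ord.
  by rewrite /oddth A10 subnn expr0 mulr1 add0r /= mulrA [v _ * _]mulrC.
have f0 : odd_prod n p t t0 = - (t0 ^- n.+1 * (th (t0 ^+ 2) p * (th (t0 * t1) p * \prod_(x <- s) th (x * t0) p))).
  by rewrite /odd_prod /t !big_cons divff// th1// mul0r mulr0 add0r expr2 (mulrC t1).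
have f1 : odd_prod n p t t1 = - (t1 ^- n.+1 * (th (t1 ^+ 2) p * (th (t0 * t1) p * \prod_(x <- s) th (x * t1) p))).
  rewrite /odd_prod /t !big_cons divff// th1// mul0r !mulr0 add0r expr2.
  by congr (- (_ * _)); rewrite mulrCA.
have h2 : th (t0 * t1) p != 0.
  by apply: contra_neq h01 => e; rewrite ThE e mulr0 mul0r.
have g0 : v ord0 = - (t0 ^- n * (th (t0 * t1) p * \prod_(x <- s) th (x * t0) p)).
  apply: (mulfI d0); rewrite -e0 f0 /del exprS.
  move: (th (t0 ^+ 2) p) (th _ p) (\prod_(x <- s) _) => X Y Z; field.
  by rewrite t00 expf_neq0.
have g1 : v ord_max * (- Th t0 t1 p) ^+ n = - (t1 ^- n * (th (t0 * t1) p * \prod_(x <- s) th (x * t1) p)).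
  apply: (mulfI d1); rewrite mulrA -e1 f1 /del exprS.
  move: (th (t1 ^+ 2) p) (th _ p) (\prod_(x <- s) _) => X Y Z; field.
  by rewrite t10 expf_neq0.
have key : v ord_max * (- Th t0 t1 p) ^+ n * D1 = Th t0 t1 p ^+ n * v ord0 * D0.
  rewrite exprNn; transitivity ((-1) ^+ n * Th t0 t1 p ^+ n * (v ord_max * D1)); first by ring.
  rewrite hdet; transitivity ((-1) ^+ n * (-1) ^+ n * (Th t0 t1 p ^+ n * v ord0 * D0)); first by ring.
  by rewrite -expr2 sqrr_sign mul1r.
move: key; rewrite g0 g1 => key.
have {}key := cancel_common (expf_neq0 n t00) (expf_neq0 n t10) h2 key.
have e2 : (- t0) ^+ n = (-1) ^+ n * t0 ^+ n := exprNn _ _.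
have e3 : (- t1 * Th t0 t1 p) ^+ n = (-1) ^+ n * t1 ^+ n * Th t0 t1 p ^+ n by rewrite exprMn [(- t1) ^+ n]exprNn.
have {}key := common_factor (n`!%:R) ((-1) ^+ n) key.
by rewrite e2 e3; exact: key.
Qed.

End Shift.

(** * Independence of the first two parameters *)

Section Continuity.
Variable R : realType.
Notation C := (R[i])^o.
Implicit Types (p q : R[i]) (t : seq R[i]) (Ct : contour R).
Local Opaque dp qp th Gam.

Lemma near_ltn (T : Type) (F : set_system T) {FF : Filter F} N (P : nat -> T -> Prop) :
  (forall i, (i < N)%N -> \forall x \near F, P i x) -> \forall x \near F, forall i, (i < N)%N -> P i x.
Proof.
elim: N => [|N IH] h; first by apply: nearW => x i; rewrite ltn0.
have h1 : \forall x \near F, forall i, (i < N)%N -> P i x by apply: IH => i iN; apply: h; exact: ltnW.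
have h2 := h N (ltnSn N).
apply: filterS2 h1 h2 => x hx hN i; rewrite ltnS leq_eqVlt => /predU1P[->//|]; exact: hx.
Qed.

Lemma ccvg_th (T : Type) (F : set_system T) {FF : Filter F} (x p : T -> R[i]) (x0 p0 : R[i]) :
  cabs p0 < 1 -> x0 != 0 -> ccvg F x x0 -> ccvg F p p0 -> ccvg F (fun s => th (x s) (p s)) (th x0 p0).
Proof.
move=> p1 xn cx cp; apply: ccvgM; first by apply: ccvg_qp; [exact: p1|exact: cx|exact: cp].
apply: ccvg_qp; [exact: p1| |exact: cp].
by apply: ccvgM; [exact: cp|apply: ccvgV; [exact: xn|exact: cx]].
Qed.

Lemma ccvg_Gam (T : Type) (F : set_system T) {FF : Filter F} (x p q : T -> R[i]) (x0 p0 q0 : R[i]) :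
  cabs p0 < 1 -> cabs q0 < 1 -> x0 != 0 -> dp x0 p0 q0 != 0 ->
  ccvg F x x0 -> ccvg F p p0 -> ccvg F q q0 -> ccvg F (fun s => Gam (x s) (p s) (q s)) (Gam x0 p0 q0).
Proof.
move=> p1 q1 xn d0 cx cp cq; apply: ccvgM.
  apply: ccvg_dp; [exact: p1|exact: q1| |exact: cp|exact: cq].
  by apply: ccvgM; [apply: ccvgM; [exact: cp|exact: cq]|apply: ccvgV; [exact: xn|exact: cx]].
apply: ccvgV; first exact: d0.
by apply: ccvg_dp; [exact: p1|exact: q1|exact: cx|exact: cp|exact: cq].
Qed.

Lemma ccvg_Th (T : Type) (F : set_system T) {FF : Filter F} (z w p : T -> R[i]) (z0 w0 p0 : R[i]) :
  cabs p0 < 1 -> z0 != 0 -> w0 != 0 -> ccvg F z z0 -> ccvg F w w0 -> ccvg F p p0 ->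
  ccvg F (fun s => Th (z s) (w s) (p s)) (Th z0 w0 p0).
Proof.
move=> p1 zn wn cz cw cp; apply: ccvgM; first apply: ccvgM.
- by apply: ccvgV; [exact: zn|exact: cz].
- apply: ccvg_th; [exact: p1|by rewrite mulf_neq0| |exact: cp].
  by apply: ccvgM; [exact: cz|exact: cw].
- apply: ccvg_th; [exact: p1|by rewrite mulf_neq0 ?invr_eq0| |exact: cp].
  by apply: ccvgM; [exact: cz|apply: ccvgV; [exact: wn|exact: cw]].
Qed.

Lemma ccvg_det (T : Type) (F : set_system T) {FF : Filter F} n (f : 'I_n -> 'I_n -> T -> R[i])
    (f0 : 'I_n -> 'I_n -> R[i]) : (forall j k, ccvg F (f j k) (f0 j k)) ->
  ccvg F (fun s => \det (\matrix_(j, k) f j k s)) (\det (\matrix_(j, k) f0 j k)).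
Proof.
move=> h; have e (g : 'I_n -> 'I_n -> R[i]) : \det (\matrix_(j, k) g j k) =
    \sum_(s : 'S_n) (-1) ^+ s * \prod_i g i (s i).
  by apply: eq_bigr => s _; under eq_bigr do rewrite mxE.
under eq_fun do rewrite e; rewrite e.
apply: ccvg_sum => s _; apply: ccvgM; first exact: ccvg_cst.
by apply: ccvg_prod => i _; exact: h.
Qed.

Lemma ccvg_near_neq0 (T : Type) (F : set_system T) {FF : Filter F} (f : T -> R[i]) l :
  l != 0 -> ccvg F f l -> \forall x \near F, f x != 0.
Proof.
rewrite -cabs_gt0 => l0 /ccvgP/(_ _ l0); apply: filterS => x h.
rewrite -cabs_gt0; have := cabs_sub_le l (l - f x); have -> : l - (l - f x) = f x by ring.
lra.
Qed.

Lemma pair_prodE p q t : pair_prod p q t =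
  \prod_(i < size t) \prod_(j < size t | (i < j)%N) Gam (t`_i * t`_j) p q.
Proof.
elim: t => [|x t IH]; first by rewrite /= big_ord0.
rewrite [LHS]/= IH [size _]/= big_ord_recl [X in _ = X * _]big_mkcond big_ord_recl /= mul1r.
have -> : \prod_(y <- t) Gam (x * y) p q = \prod_(i < size t) Gam (x * t`_i) p q.
  by rewrite (big_nth 0) big_mkord.
have -> : \prod_(i < size t) \prod_(j < (size t).+1 | (bump 0 i < j)%N) Gam (t`_i * (x :: t)`_j) p q =
   \prod_(i < size t) \prod_(j < size t | (i < j)%N) Gam (t`_i * t`_j) p q.
  apply: eq_bigr => i _; rewrite big_mkcond big_ord_recl /= mul1r [RHS]big_mkcond.
  by apply: eq_bigr => j _; rewrite /bump !add1n ltnS.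
by [].
Qed.

Section Family.
Variables (T : Type) (F : set_system T).
Context {FF : Filter F}.
Variables (pp qq : T -> R[i]) (tt : T -> seq R[i]) (p q : R[i]) (t : seq R[i]).
Hypotheses (np : nome p) (nq : nome q) (tn : all (fun x => x != 0) t).
Hypotheses (cp : ccvg F pp p) (cq : ccvg F qq q) (st : forall s, size (tt s) = size t).
Hypothesis (ct : forall i, (i < size t)%N -> ccvg F (fun s => (tt s)`_i) t`_i).

Let tn_nth i : (i < size t)%N -> t`_i != 0.
Proof. by move=> h; apply: (allP tn); exact: mem_nth. Qed.

Lemma ccvg_pair_prod : gen p q t -> ccvg F (fun s => pair_prod (pp s) (qq s) (tt s)) (pair_prod p q t).
Proof.
move=> g; under eq_fun do rewrite pair_prodE st.
rewrite pair_prodE; apply: ccvg_prod => i _; apply: ccvg_prod => j _.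
have ti : t`_i \in t by rewrite mem_nth. have tj : t`_j \in t by rewrite mem_nth.
apply: ccvg_Gam; [by case: np|by case: nq| | | |exact: cp|exact: cq].
- by rewrite mulf_neq0 ?tn_nth.
- by apply: dp_neq0; [by case: np|by case: nq|move=> k l; exact: g].
- by apply: ccvgM; apply: ct.
Qed.

Lemma nome_near : \forall s \near F, nome (pp s) /\ nome (qq s).
Proof.
have [p0 p1] := np; have [q0 q1] := nq.
have h1 := ccvg_near_neq0 (FF := FF) p0 cp; have h2 := ccvg_near_neq0 (FF := FF) q0 cq.
have [r [pr qr] r1] := mid_lt1 p1 q1.
have h3 := ccvg_lt (FF := FF) cp pr; have h4 := ccvg_lt (FF := FF) cq qr.
apply: filterS2 (filterI h1 h2) (filterI h3 h4) => s [a b] [c d].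
by split; split=> //; [exact: le_lt_trans c r1|exact: le_lt_trans d r1].
Qed.

(** There are infinitely many conditions. Poles with an exponent of at least N lie so close to 0,
    uniformly in the parameters, that their winding number is that of 0, namely 1; their reciprocals
    lie so far out that theirs is 0. The finitely many other poles are treated by continuity. *)
Lemma adm_near Ct : t != [::] -> adm p q t Ct -> \forall s \near F, adm (pp s) (qq s) (tt s) Ct.
Proof.
move=> tne ad; have [p0 p1] := np; have [q0 q1] := nq.
have W0 := adm_winding0 p1 tne ad.
have [d d0 hd] := winding_near0 ad.1; have [M M0 hM] := winding_far Ct.
have [r [pr qr] r1] := mid_lt1 p1 q1.
have nr := near_ltn (FF := FF) (N := size t) (P := fun r s => forall i j : nat,
  let a := pp s ^+ i * qq s ^+ j * (tt s)`_r in contour_contains Ct a /\ contour_excludes Ct a^-1).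
suff /nr : forall k, (k < size t)%N -> \forall s \near F, forall i j : nat,
    let a := pp s ^+ i * qq s ^+ j * (tt s)`_k in contour_contains Ct a /\ contour_excludes Ct a^-1.
  apply: filterS => s h; split; first exact: ad.1.
  move=> a [x [i [j [xt ->]]]]; have := h (index x (tt s)) _ i j; rewrite nth_index//.
  by apply; rewrite -(st s) index_mem.
move=> k kt; pose K := cabs t`_k + 1.
have K0 : 0 < K by rewrite ltr_wpDl ?cabs_ge0.
have e0 : 0 < Num.min d M^-1 / K by rewrite divr_gt0// lt_min d0 invr_gt0.
have r0 : 0 <= r by apply: le_trans (ltW pr); exact: cabs_ge0.
have rc : cabs (r%:C) < 1 by rewrite cabs_real ger0_norm.
have [N hN] := pow_small rc e0; rewrite cabs_real ger0_norm// in hN.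
have np1 := ccvg_lt (FF := FF) cp pr; have nq1 := ccvg_lt (FF := FF) cq qr.
have tK : cabs t`_k < K by rewrite /K; lra.
have nt1 := ccvg_lt (FF := FF) (ct kt) tK.
have nt0 := ccvg_near_neq0 (FF := FF) (tn_nth kt) (ct kt).
have npq := nome_near.
have fin : \forall s \near F, forall i, (i < N)%N -> forall j, (j < N)%N ->
    let a := pp s ^+ i * qq s ^+ j * (tt s)`_k in contour_contains Ct a /\ contour_excludes Ct a^-1.
  apply: near_ltn => i _; apply: near_ltn => j _ /=.
  have hin : inner_poles p q t (p ^+ i * q ^+ j * t`_k) by exists t`_k, i, j; rewrite mem_nth.
  have an : p ^+ i * q ^+ j * t`_k != 0 by rewrite !mulf_neq0 ?expf_neq0 ?tn_nth.
  have ca : ccvg F (fun s => pp s ^+ i * qq s ^+ j * (tt s)`_k) (p ^+ i * q ^+ j * t`_k).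
    by apply: ccvgM; [apply: ccvgM; apply: ccvgX; [exact: cp|exact: cq]|exact: ct].
  have cv : ccvg F (fun s => (pp s ^+ i * qq s ^+ j * (tt s)`_k)^-1) (p ^+ i * q ^+ j * t`_k)^-1.
    by apply: ccvgV; [exact: an|exact: ca].
  have [[n1 w1] [n2 w2]] := ad.2 _ hin.
  have h1 : \forall s \near F, ~ contour_support Ct (pp s ^+ i * qq s ^+ j * (tt s)`_k) /\
      winding Ct (pp s ^+ i * qq s ^+ j * (tt s)`_k) = winding Ct (p ^+ i * q ^+ j * t`_k) := ca _ (winding_near n1).
  have h2 : \forall s \near F, ~ contour_support Ct (pp s ^+ i * qq s ^+ j * (tt s)`_k)^-1 /\
      winding Ct (pp s ^+ i * qq s ^+ j * (tt s)`_k)^-1 = winding Ct (p ^+ i * q ^+ j * t`_k)^-1 := cv _ (winding_near n2).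
  apply: filterS2 h1 h2 => s /= [a1 a2] [b1 b2].
  by rewrite /contour_contains /contour_excludes a2 b2 w1 w2.
apply: filterS2 (filterI (filterI np1 nq1) (filterI nt1 nt0)) (filterI fin npq).
move=> s [[hp hq] [ht h0]] [hf [[pn _] [qn _]]] i j /=; set a := _ * _ * _.
have [iN|iN] := ltnP i N; first have [jN|jN] := ltnP j N; first exact: (hf i iN j jN).
all: have an : a != 0 by rewrite /a !mulf_neq0 ?expf_neq0.
all: have small : cabs a < Num.min d M^-1.
1,3: rewrite /a !cabsM !cabsX.
- have := hN j jN; rewrite ltr_pdivlMr// => H; apply: le_lt_trans H.
  apply: ler_pM; rewrite ?mulr_ge0 ?exprn_ge0 ?cabs_ge0//.
  apply: (@le_trans _ _ (1 * cabs (qq s) ^+ j)).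
    by apply: ler_wpM2r; [rewrite exprn_ge0 ?cabs_ge0|rewrite exprn_ile1 ?cabs_ge0// ltW// (le_lt_trans hp)].
  by rewrite mul1r lerXn2r ?nnegrE ?cabs_ge0.
- have := hN i iN; rewrite ltr_pdivlMr// => H; apply: le_lt_trans H.
  apply: ler_pM; rewrite ?mulr_ge0 ?exprn_ge0 ?cabs_ge0//.
  apply: (@le_trans _ _ (cabs (pp s) ^+ i * 1)).
    by apply: ler_wpM2l; [rewrite exprn_ge0 ?cabs_ge0|rewrite exprn_ile1 ?cabs_ge0// ltW// (le_lt_trans hq)].
  by rewrite mulr1 lerXn2r ?nnegrE ?cabs_ge0.
all: move: small; rewrite lt_min => /andP[/hd[n1 w1] sm]; split; first by rewrite /contour_contains w1 W0.
all: apply: hM; rewrite cabsV -[M]invrK ltf_pV2 ?posrE ?invr_gt0 ?cabs_gt0//.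
Qed.

(** The variable moves together with the parameters, as [contour_integral_cvg] demands. *)
Lemma ccvg_weight (S : Type) (G : set_system S) {GG : Filter G} (Z : S -> R[i]) (f : S -> T) z :
  f @ G --> F -> ccvg G Z z -> z != 0 ->
  (forall x, x \in t -> dp (x * z) p q != 0 /\ dp (x / z) p q != 0) ->
  ccvg G (fun s => weight (pp (f s)) (qq (f s)) (tt (f s)) (Z s)) (weight p q t z).
Proof.
move=> cf cZ z0 hd; have [p0 p1] := np; have [q0 q1] := nq.
have cpf : ccvg G (fun s => pp (f s)) p by exact: (ccvg_comp cf cp).
have cqf : ccvg G (fun s => qq (f s)) q by exact: (ccvg_comp cf cq).
have cVZ : ccvg G (fun s => (Z s)^-1) z^-1 by apply: ccvgV; [exact: z0|exact: cZ].
apply: ccvgM; first apply: ccvgM.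
- under eq_fun do rewrite (big_nth 0) big_mkord st.
  rewrite (big_nth 0) big_mkord; apply: ccvg_prod => i _.
  have ctf : ccvg G (fun s => (tt (f s))`_i) t`_i by exact: (ccvg_comp cf (ct (ltn_ord i))).
  have tin : t`_i \in t by rewrite mem_nth.
  have [d1 d2] := hd _ tin.
  apply: ccvgM; apply: ccvg_Gam; [exact: p1|exact: q1|by rewrite mulf_neq0 ?tn_nth|exact: d1| |exact: cpf|exact: cqf|
     exact: p1|exact: q1|by rewrite mulf_neq0 ?tn_nth ?invr_eq0|exact: d2| |exact: cpf|exact: cqf].
    by apply: ccvgM; [exact: ctf|exact: cZ].
  by apply: ccvgM; [exact: ctf|exact: cVZ].
- apply: ccvgM; apply: ccvg_th; [exact: p1|by rewrite expf_neq0|by apply: ccvgX; exact: cZ|exact: cpf|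
    exact: q1|by rewrite invr_eq0 expf_neq0| |exact: cqf].
  by apply: ccvgV; [by rewrite expf_neq0|apply: ccvgX; exact: cZ].
- apply: ccvgV; first by rewrite mulf_neq0 ?two_pi_i_neq0.
  by apply: ccvgM; [exact: ccvg_cst|exact: cZ].
Qed.

End Family.

Section CleanLimit.
Variables (T : Type) (F : set_system T).
Context {FF : Filter F}.
Variables (pp qq : T -> R[i]) (tt : T -> seq R[i]) (p q : R[i]) (t : seq R[i]).
Hypotheses (np : nome p) (nq : nome q) (tn : all (fun x => x != 0) t).
Hypotheses (cp : ccvg F pp p) (cq : ccvg F qq q) (st : forall s, size (tt s) = size t).
Hypothesis (ct : forall i, (i < size t)%N -> ccvg F (fun s => (tt s)`_i) t`_i).
Variable Ct : contour R.

(** The first base point may move, since at the pinch it is the parameter that tends to its critical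
    value. *)
Lemma ccvg_basis (S : Type) (G : set_system S) {GG : Filter G} (Z pf A : S -> R[i]) (r z a b : R[i]) m j :
  cabs r < 1 -> ccvg G pf r -> ccvg G Z z -> ccvg G A a -> z != 0 -> a != 0 -> b != 0 -> Th a b r != 0 ->
  ccvg G (fun s => basis_fun m (pf s) (A s) b j (Z s)) (basis_fun m r a b j z).
Proof.
move=> r1 cr cZ cA z0 a0 b0 ab; apply: ccvgM; apply: ccvgX.
  by apply: ccvg_Th; [exact: r1|exact: z0|exact: a0|exact: cZ|exact: cA|exact: cr].
apply: ccvgM; first by apply: ccvg_Th; [exact: r1|exact: z0|exact: b0|exact: cZ|exact: ccvg_cst|exact: cr].
apply: ccvgV; first exact: ab.
by apply: ccvg_Th; [exact: r1|exact: a0|exact: b0|exact: cA|exact: ccvg_cst|exact: cr].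
Qed.

Lemma contat_moment n p1 q1 t1 a b a' b' j k : nome p1 -> nome q1 -> avoids Ct (poles p1 q1 t1) ->
  contat (contour_support Ct) (fun z => basis_fun n p1 a b j z * basis_fun n q1 a' b' k z * weight p1 q1 t1 z).
Proof.
move=> n1 n2 av; apply: (hol_supp av); apply: holM; last exact: hol_weight.
by apply: holM; apply: hol_basis; [case: n1|constructor 1|case: n2|constructor 1].
Qed.

Lemma ccvg_moment n (A A' : T -> R[i]) a b a' b' j k :
  avoids Ct (poles p q t) -> (\forall s \near F, avoids Ct (poles (pp s) (qq s) (tt s))) ->
  ccvg F A a -> ccvg F A' a' ->
  a != 0 -> b != 0 -> Th a b p != 0 -> a' != 0 -> b' != 0 -> Th a' b' q != 0 ->
  ccvg F (fun s => moment n (pp s) (qq s) (tt s) (A s) b (A' s) b' Ct j k) (moment n p q t a b a' b' Ct j k).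
Proof.
move=> av avn cA cA' a0 b0 ab a0' b0' ab'; have [p0 p1] := np; have [q0 q1] := nq.
apply: contour_integral_cvg.
- exact: contat_moment.
- apply: filterS2 (nome_near (FF := FF) np nq cp cq) avn => s [n1 n2] av'; exact: contat_moment.
- move=> z Sz; have z0 : z != 0 by apply/eqP => e; apply: (av 0); [constructor 1|rewrite -e].
  have c2 : (fun zt : C * T => zt.2) @ filter_prod (nbhs (z : C)) F --> F by exact: cvg_snd.
  have c1 : ccvg (filter_prod (nbhs (z : C)) F) (fun zt : C * T => zt.1) z.
    exact: (@ccvg_comp R (C * T) C _ (nbhs (z : C)) id (fun zn => zn.1) z cvg_fst (@ccvg_id _ z)).
  apply: ccvgM; first apply: ccvgM.
  + by apply: ccvg_basis; [exact: p1|exact: (ccvg_comp c2 cp)|exact: c1|exact: (ccvg_comp c2 cA)|exact: z0|exact: a0|exact: b0|exact: ab].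
  + by apply: ccvg_basis; [exact: q1|exact: (ccvg_comp c2 cq)|exact: c1|exact: (ccvg_comp c2 cA')|exact: z0|exact: a0'|exact: b0'|exact: ab'].
  + apply: (ccvg_weight np nq tn cp cq st ct c2 c1 z0) => x xt.
    exact: dp_support np nq av (allP tn _ xt) xt Sz.
Qed.

Lemma ccvg_clean_int n : t != [::] -> adm p q t Ct ->
  ccvg F (fun s => clean_int n (pp s) (qq s) (tt s) Ct) (clean_int n p q t Ct).
Proof.
move=> tne ad; have [a [b [a0 b0 ab]]] := exists_basis np; have [a' [b' [a0' b0' ab']]] := exists_basis nq.
rewrite (clean_intE n np nq ad a0 b0 ab a0' b0' ab').
have cab : ccvg F (fun s => Th a b (pp s)) (Th a b p).
  by apply: ccvg_Th; [by case: np|exact: a0|exact: b0|exact: ccvg_cst|exact: ccvg_cst|exact: cp].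
have cab' : ccvg F (fun s => Th a' b' (qq s)) (Th a' b' q).
  by apply: ccvg_Th; [by case: nq|exact: a0'|exact: b0'|exact: ccvg_cst|exact: ccvg_cst|exact: cq].
have n1 := nome_near (FF := FF) np nq cp cq; have n2 := adm_near (FF := FF) np nq tn cp cq st ct tne ad.
have n3 := ccvg_near_neq0 (FF := FF) ab cab; have n4 := ccvg_near_neq0 (FF := FF) ab' cab'.
apply: (@ccvg_eq _ _ F FF (fun s => n`!%:R * \det (\matrix_(j < n, k < n) moment n (pp s) (qq s) (tt s) a b a' b' Ct j k))).
  apply: filterS2 (filterI n1 n2) (filterI n3 n4) => s [[h1 h2] h3] [h4 h5].
  by rewrite (clean_intE n h1 h2 h3 a0 b0 h4 a0' b0' h5).
apply: ccvgM; first exact: ccvg_cst.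
have avn : \forall s \near F, avoids Ct (poles (pp s) (qq s) (tt s)) by apply: filterS n2 => s; exact: adm_avoids.
apply: ccvg_det => j k.
exact: (@ccvg_moment n (fun _ => a) (fun _ => a') a b a' b' j k (adm_avoids ad) avn (@ccvg_cst _ _ F FF a) (@ccvg_cst _ _ F FF a') a0 b0 ab a0' b0' ab').
Qed.

End CleanLimit.
End Continuity.

(** * Chains of shifts by p and by q *)

Section Chain.
Variable R : realType.
Notation C := (R[i])^o.
Implicit Types (p q t : R[i]) (s : seq R[i]) (Ct : contour R).
Local Opaque dp qp th Gam Th.

(** Membership in the group generated by [p] and [q], again without negative exponents. *)
Definition pqZ p q x : Prop := exists a b c d : nat, p ^+ a * q ^+ b * x = p ^+ c * q ^+ d.

Lemma pqZC p q x : pqZ p q x -> pqZ q p x.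
Proof.
move=> [a [b [c [d e]]]]; exists b, a, d, c.
by rewrite (mulrC (q ^+ b)) e mulrC.
Qed.

Lemma pqZp p q : pqZ p q p.
Proof. by exists 0%N, 0%N, 1%N, 0%N; rewrite !expr0 !mul1r mulr1. Qed.

Lemma pqZq p q : pqZ p q q.
Proof. by apply: pqZC; exact: pqZp. Qed.

Lemma pqZ1 p q : pqZ p q 1.
Proof. by exists 0%N, 0%N, 0%N, 0%N; rewrite !expr0 !mulr1. Qed.

Lemma pqZM p q x y : pqZ p q x -> pqZ p q y -> pqZ p q (x * y).
Proof.
move=> [a [b [c [d e]]]] [a' [b' [c' [d' e']]]]; exists (a + a')%N, (b + b')%N, (c + c')%N, (d + d')%N.
rewrite !exprD; transitivity ((p ^+ a * q ^+ b * x) * (p ^+ a' * q ^+ b' * y)); first by ring.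
by rewrite e e'; ring.
Qed.

Lemma pqZV p q x : x != 0 -> pqZ p q x -> pqZ p q x^-1.
Proof.
move=> x0 [a [b [c [d e]]]]; exists c, d, a, b.
by rewrite -e mulfK.
Qed.

Lemma pqZMl p q c x : c != 0 -> pqZ p q c -> pqZ p q (c * x) -> pqZ p q x.
Proof.
move=> c0 hc h; have := pqZM (pqZV c0 hc) h.
by rewrite mulKf.
Qed.

Lemma pqZX p q x m : pqZ p q x -> pqZ p q (x ^+ m).
Proof. by move=> h; elim: m => [|m IH]; [rewrite expr0; exact: pqZ1|rewrite exprS; exact: pqZM]. Qed.

(** Unlike [gen], these conditions are stable when t_0 and t_1 are multiplied by powers of [p] and
    [q] of either sign ([supergenM]), so they hold at every stage of a chain of shifts. *)
Definition supergen p q t0 t1 s : Prop := ~ pqZ p q (t0 / t1) /\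
  forall x y, x \in [:: t0, t1 & s] -> y \in [:: t0, t1 & s] -> ~ pqZ p q (x * y).

Lemma supergenC p q t0 t1 s : supergen p q t0 t1 s -> supergen q p t0 t1 s.
Proof.
by move=> [h1 h2]; split=> [/pqZC|x y xt yt /pqZC]; [exact: h1|exact: h2].
Qed.

Lemma supergenM p q t0 t1 s u0 u1 : u0 != 0 -> u1 != 0 -> pqZ p q u0 -> pqZ p q u1 ->
  supergen p q t0 t1 s -> supergen p q (u0 * t0) (u1 * t1) s.
Proof.
move=> u00 u10 hu0 hu1 [h1 h2]; split.
  rewrite invfM mulrACA => h; apply: h1; apply: (@pqZMl p q (u0 / u1)) h.
    by rewrite mulf_neq0 ?invr_eq0.
  by apply: pqZM => //; exact: pqZV.
have rep x : x \in [:: u0 * t0, u1 * t1 & s] -> exists c x', [/\ x = c * x', c != 0, pqZ p q c & x' \in [:: t0, t1 & s]].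
  rewrite !inE => /or3P[/eqP ->|/eqP ->|xs].
  - by exists u0, t0; rewrite inE eqxx.
  - by exists u1, t1; rewrite !inE eqxx orbT.
  - by exists 1, x; rewrite mul1r oner_neq0 !inE xs !orbT; split=> //; exact: pqZ1.
move=> x y /rep[c [x' [-> c0 hc xt]]] /rep[d [y' [-> d0 hd yt]]].
rewrite mulrACA => h; apply: (h2 x' y' xt yt); apply: (@pqZMl p q (c * d)) h; first by rewrite mulf_neq0.
exact: pqZM.
Qed.

Lemma pqZ_pZ p q x : pZ p x -> pqZ p q x.
Proof. by move=> [a [c e]]; exists a, 0%N, c, 0%N; rewrite !expr0 !mulr1. Qed.

Lemma supergen_gen p q t0 t1 s : supergen p q t0 t1 s -> gen p q [:: t0, t1 & s].
Proof.
move=> [_ h] x y i j xt yt; apply/eqP => e; apply: (h x y xt yt).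
by exists i, j, 0%N, 0%N; rewrite !expr0 mulr1.
Qed.

Lemma Gam_neq0 p q x : nome p -> nome q -> x != 0 -> ~ pqZ p q x -> Gam x p q != 0.
Proof.
move=> [p0 p1] [q0 q1] x0 h; rewrite GamE mulf_neq0 ?invr_eq0//; apply: dp_neq0 => // j k; apply/eqP => e; apply: h.
  exists 0%N, 0%N, j.+1, k.+1; rewrite !expr0 !mul1r !exprSr.
  by rewrite -[LHS]mul1r -e !mulrA mulfVK//; ring.
by exists j, k, 0%N, 0%N; rewrite !expr0 mulr1.
Qed.

Lemma pair_prod_neq0 p q (t : seq R[i]) : nome p -> nome q -> all (fun x => x != 0) t ->
  (forall x y, x \in t -> y \in t -> ~ pqZ p q (x * y)) -> pair_prod p q t != 0.
Proof.
move=> np nq t0 h; rewrite pair_prodE; apply/prodf_neq0 => i _; apply/prodf_neq0 => j _.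
have ti : t`_i \in t by rewrite mem_nth. have tj : t`_j \in t by rewrite mem_nth.
by apply: Gam_neq0 => //; [rewrite mulf_neq0 ?(allP t0)|exact: h].
Qed.

(** All admissible contours are included, because the contour changes from one shift to the next. *)
Definition has_ratio n p q (t : seq R[i]) (v : R[i]) := forall Ct, adm p q t Ct -> clean_int n p q t Ct = v * pair_prod p q t.

Lemma has_ratioC n p q (t : seq R[i]) v : nome p -> nome q -> has_ratio n p q t v -> has_ratio n q p t v.
Proof.
move=> np nq h Ct ad; rewrite (clean_intC n nq np ad) pair_prodC; apply: h; exact: admC.
Qed.

Lemma pair_prod_shift0 p q t0 t1 s : nome p -> nome q -> t0 != 0 -> t1 != 0 -> all (fun x => x != 0) s ->
  gen p q [:: t0, t1 & s] ->
  pair_prod p q [:: q * t0, t1 & s] = \prod_(x <- s) th (x * t0) p *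
   (Gam (q * t0 * t1) p q * \prod_(x <- s) Gam (t0 * x) p q * \prod_(x <- s) Gam (t1 * x) p q * pair_prod p q s).
Proof.
move=> [p0 p1] [q0 q1] t00 t10 s0 g; rewrite /= big_cons.
have -> : \prod_(y <- s) Gam (q * t0 * y) p q = \prod_(x <- s) th (x * t0) p * \prod_(x <- s) Gam (t0 * x) p q.
  rewrite -big_split /= !big_seq; apply: eq_bigr => x xs.
  rewrite -mulrA Gam_shift//; first by rewrite (mulrC x).
    by rewrite mulf_neq0// (allP s0).
  by apply: dp_neq0 => // i j; apply: g; rewrite !inE ?eqxx ?xs ?orbT.
move: (Gam _ p q) (\prod_(x <- s) _) (\prod_(x <- s) _) (\prod_(x <- s) _) (pair_prod p q s) => a b c d e; ring.
Qed.

Lemma pair_prod_shift1 p q t0 t1 s : nome p -> nome q -> t0 != 0 -> t1 != 0 -> all (fun x => x != 0) s ->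
  gen p q [:: t0, t1 & s] ->
  pair_prod p q [:: t0, q * t1 & s] = \prod_(x <- s) th (x * t1) p *
   (Gam (q * t0 * t1) p q * \prod_(x <- s) Gam (t0 * x) p q * \prod_(x <- s) Gam (t1 * x) p q * pair_prod p q s).
Proof.
move=> [p0 p1] [q0 q1] t00 t10 s0 g; rewrite /= big_cons.
have -> : \prod_(y <- s) Gam (q * t1 * y) p q = \prod_(x <- s) th (x * t1) p * \prod_(x <- s) Gam (t1 * x) p q.
  rewrite -big_split /= !big_seq; apply: eq_bigr => x xs.
  rewrite -mulrA Gam_shift//; first by rewrite (mulrC x).
    by rewrite mulf_neq0// (allP s0).
  by apply: dp_neq0 => // i j; apply: g; rewrite !inE ?eqxx ?xs ?orbT.
have -> : t0 * (q * t1) = q * t0 * t1 by ring.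
move: (Gam _ p q) (\prod_(x <- s) _) (\prod_(x <- s) _) (\prod_(x <- s) _) (pair_prod p q s) => a b c d e; ring.
Qed.

Lemma adm_subset p q (t t' : seq R[i]) Ct : (forall x, x \in t' -> exists i j x', x' \in t /\ x = p ^+ i * q ^+ j * x') ->
  adm p q t Ct -> adm p q t' Ct.
Proof.
move=> h ad; split; first exact: ad.1.
move=> _ [x [i [j [/h[k [l [x' [xt ->]]]] ->]]]]; apply: ad.2.
by exists x', (i + k)%N, (j + l)%N; split=> //; rewrite !exprD; ring.
Qed.

(** The product of the parameters is [p] here, so that it is p q after either shift. A contour
    admissible for the unshifted list is admissible for both shifted ones, and there
    [shift_relation] compares the integrals. *)
Lemma ratio_shift m p q t0 t1 s v : nome p -> nome q -> t0 != 0 -> t1 != 0 -> all (fun x => x != 0) s ->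
  size s = (2 * m.+1 + 2)%N -> t0 * t1 * \prod_(x <- s) x = p -> supergen p q t0 t1 s ->
  has_ratio m.+1 p q [:: q * t0, t1 & s] v <-> has_ratio m.+1 p q [:: t0, q * t1 & s] v.
Proof.
move=> np nq t00 t10 s0 ss sp sg; have [p0 p1] := np; have [q0 q1] := nq.
have g := supergen_gen sg; have [sg1 sg2] := sg.
have tn : all (fun x => x != 0) [:: t0, t1 & s] by rewrite /= t00 t10.
have [Ct ad] := exists_adm np nq tn g.
have [a' [b' [a0' b0' ab']]] := exists_basis nq.
have i0 : t0 \in [:: t0, t1 & s] by rewrite inE eqxx.
have i1 : t1 \in [:: t0, t1 & s] by rewrite !inE eqxx orbT.
have is_ x : x \in s -> x \in [:: t0, t1 & s] by rewrite !inE => ->; rewrite !orbT.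
have ad0 : adm p q [:: q * t0, t1 & s] Ct.
  apply: adm_subset ad => x; rewrite 2![in X in X -> _]inE => /or3P[/eqP ->|/eqP ->|xs].
  - by exists 0%N, 1%N, t0; rewrite expr0 mul1r.
  - by exists 0%N, 0%N, t1; rewrite !expr0 !mul1r.
  - by exists 0%N, 0%N, x; rewrite !expr0 !mul1r; split=> //; exact: is_.
have ad1 : adm p q [:: t0, q * t1 & s] Ct.
  apply: adm_subset ad => x; rewrite 2![in X in X -> _]inE => /or3P[/eqP ->|/eqP ->|xs].
  - by exists 0%N, 0%N, t0; rewrite !expr0 !mul1r.
  - by exists 0%N, 1%N, t1; rewrite expr0 mul1r.
  - by exists 0%N, 0%N, x; rewrite !expr0 !mul1r; split=> //; exact: is_.
have nZ x y : x \in [:: t0, t1 & s] -> y \in [:: t0, t1 & s] -> ~ pZ p (x * y).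
  by move=> xt yt /(pqZ_pZ q); exact: sg2.
have nd x : x \in [:: t0, t1 & s] -> del p x != 0.
  move=> xt; have x0 := allP tn _ xt; rewrite /del mulf_neq0 ?invr_eq0//.
  by apply: th_pZ; rewrite ?expf_neq0// expr2; exact: nZ.
have hT : Th t0 t1 p != 0.
  by apply: Th_neq0 => //; [exact: nZ|move=> /(pqZ_pZ q)].
have st : size [:: t0, t1 & s] = (2 * m.+1 + 4)%N by rewrite /= ss -!addnS.
have tp : \prod_(x <- [:: t0, t1 & s]) x = p by rewrite !big_cons mulrA.
have key := shift_relation np nq st tn tp ad hT (nd _ i0) (nd _ i1) a0' b0' ab'.
have P0 : \prod_(x <- s) th (x * t0) p != 0.
  rewrite prodf_seq_neq0; apply/allP => x xs /=; apply: th_pZ => //; first by rewrite mulf_neq0// (allP s0).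
  by apply: nZ => //; exact: is_.
have P1 : \prod_(x <- s) th (x * t1) p != 0.
  rewrite prodf_seq_neq0; apply/allP => x xs /=; apply: th_pZ => //; first by rewrite mulf_neq0// (allP s0).
  by apply: nZ => //; exact: is_.
have e0 := pair_prod_shift0 np nq t00 t10 s0 g; have e1 := pair_prod_shift1 np nq t00 t10 s0 g.
split=> h C1 adC.
  rewrite (clean_int_contour m.+1 np nq _ adC ad1)//; apply: (mulfI P0).
  by rewrite -key (h _ ad0) e0 e1; ring.
rewrite (clean_int_contour m.+1 np nq _ adC ad0)//; apply: (mulfI P1).
by rewrite key (h _ ad1) e0 e1; ring.
Qed.

Lemma ratio_up m p q t0 t1 s v k : nome p -> nome q -> t0 != 0 -> t1 != 0 -> all (fun x => x != 0) s ->
  size s = (2 * m.+1 + 2)%N -> t0 * t1 * \prod_(x <- s) x = p * q -> supergen p q t0 t1 s ->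
  has_ratio m.+1 p q [:: t0, t1 & s] v <-> has_ratio m.+1 p q [:: q ^+ k * t0, q ^- k * t1 & s] v.
Proof.
move=> np nq t00 t10 s0 ss sp sg; have [p0 p1] := np; have [q0 q1] := nq.
elim: k => [|k IH]; first by rewrite expr0 invr1 !mul1r.
have qk : q ^+ k != 0 by rewrite expf_neq0.
have qk' : q ^+ k.+1 != 0 by rewrite expf_neq0.
rewrite IH; have := @ratio_shift m p q (q ^+ k * t0) (q ^- k.+1 * t1) s v np nq.
have -> : q * (q ^+ k * t0) = q ^+ k.+1 * t0 by rewrite exprS mulrA.
have -> : q * (q ^- k.+1 * t1) = q ^- k * t1 by rewrite exprS invfM; field; rewrite q0 qk.
move=> H; apply: iff_sym; apply: H => //.
- by rewrite mulf_neq0.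
- by rewrite mulf_neq0// invr_eq0.
- transitivity (t0 * t1 * (\prod_(x <- s) x) / q); last by rewrite sp mulfK.
  by rewrite exprS; field; rewrite q0 qk.
- apply: supergenM => //; first by rewrite invr_eq0.
    by apply: pqZX; exact: pqZq.
  by apply: pqZV => //; apply: pqZX; exact: pqZq.
Qed.

(** From t_0 the chain goes up by k shifts with [q], from w t_0 by l shifts with [p], and both end
    at q^k t_0 = p^l w t_0. *)
Lemma ratio_chain m p q t0 t1 s v w k l : nome p -> nome q -> t0 != 0 -> t1 != 0 -> all (fun x => x != 0) s ->
  size s = (2 * m.+1 + 2)%N -> t0 * t1 * \prod_(x <- s) x = p * q -> supergen p q t0 t1 s ->
  q ^+ k = w * p ^+ l ->
  has_ratio m.+1 p q [:: t0, t1 & s] v -> has_ratio m.+1 p q [:: w * t0, t1 / w & s] v.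
Proof.
move=> np nq t00 t10 s0 ss sp sg e h; have [p0 p1] := np; have [q0 q1] := nq.
have qk : q ^+ k != 0 by rewrite expf_neq0.
have pl : p ^+ l != 0 by rewrite expf_neq0.
have w0 : w != 0 by move: qk; rewrite e mulf_eq0 => /norP[].
apply: has_ratioC => //.
apply/(@ratio_up m q p (w * t0) (t1 / w) s v l nq np) => //.
- by rewrite mulf_neq0.
- by rewrite mulf_neq0// invr_eq0.
- by rewrite (mulrC q) -sp; field.
- apply: supergenC.
  have -> : t1 / w = (p ^+ l * q ^- k) * t1 by rewrite e; field; rewrite w0 pl.
  have -> : w * t0 = q ^+ k / p ^+ l * t0 by rewrite e mulfK.
  apply: supergenM => //; rewrite ?mulf_neq0 ?invr_eq0//.
  + by apply: pqZM; [apply: pqZX; exact: pqZq|apply: pqZV => //; apply: pqZX; exact: pqZp].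
  + by apply: pqZM; [apply: pqZX; exact: pqZp|apply: pqZV => //; apply: pqZX; exact: pqZq].
apply: has_ratioC => //.
have -> : p ^+ l * (w * t0) = q ^+ k * t0 by rewrite e; ring.
have -> : p ^- l * (t1 / w) = q ^- k * t1 by rewrite e; field; rewrite w0 pl.
exact: (iffLR (@ratio_up m p q t0 t1 s v k np nq t00 t10 s0 ss sp sg) h).
Qed.

End Chain.

(** * Approximation of q and generic perturbations *)

Section Approximation.
Variable R : realType.
Notation C := (R[i])^o.
Implicit Types (p q w : R[i]).

Lemma polar (u : R[i]) : u != 0 -> exists2 B : R, `|B| <= pi & u = (cabs u)%:C * cis B.
Proof.
move=> u0; have c0 : 0 < cabs u by rewrite cabs_gt0.
pose v := (cabs u)^-1%:C * u.
have uv : u = (cabs u)%:C * v by rewrite /v mulrA -rmorphM mulfV ?gt_eqF// mul1r.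
have v1 : complex.Re v ^+ 2 + complex.Im v ^+ 2 = 1.
  have : cabs v = 1 by rewrite /v cabsM cabs_real gtr0_norm ?invr_gt0// mulVf ?gt_eqF.
  move=> h; have := cabs_sqr v; rewrite h expr1n => /(congr1 (@complex.Re R)).
  by case: v {uv h} => a b /= ->; ring.
have x1 : -1 <= complex.Re v <= 1.
  by rewrite -ler_norml -(@ler_pXn2r _ 2)// ?nnegrE// expr1n real_normK ?num_real//; have := sqr_ge0 (complex.Im v); lra.
have [/andP[a0 ap] ca] := acos_def x1; have sa := sin_acos x1.
have e1 : 1 - complex.Re v ^+ 2 = complex.Im v ^+ 2 by rewrite -v1; ring.
rewrite e1 sqrtr_sqr in sa.
have [i0|i0] := leP 0 (complex.Im v).
  exists (acos (complex.Re v)); first by rewrite ger0_norm.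
  rewrite {1}uv; congr (_ * _); rewrite /cis ca sa ger0_norm//; by case: (v).
exists (- acos (complex.Re v)); first by rewrite normrN ger0_norm.
rewrite {1}uv; congr (_ * _); rewrite /cis cosN sinN ca sa ltr0_norm// opprK; by case: (v).
Qed.

Lemma cisX (x : R) n : cis x ^+ n = cis (n%:R * x).
Proof.
elim: n => [|n IH]; first by rewrite expr0 mul0r cis0.
by rewrite exprS IH -cisD -natr1 mulrDl mul1r addrC.
Qed.

(** For the largest k with |w p^k| >= |q|^m the quotient u = w p^k / q^m has modulus between 1 and 1
    / |p|. Its logarithm is bounded independently of m, so q_m = q u^(1/m) tends to q. *)
Lemma root_approx p q w : nome p -> nome q -> w != 0 -> exists q_ : nat -> R[i], exists k_ : nat -> nat,
  ccvg \oo q_ q /\ \forall m \near \oo, q_ m ^+ m = w * p ^+ k_ m.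
Proof.
move=> [p0 p1] [q0 q1] w0.
have cw : 0 < cabs w by rewrite cabs_gt0.
have cp : 0 < cabs p by rewrite cabs_gt0.
have cq : 0 < cabs q by rewrite cabs_gt0.
have [M hM] := pow_small q1 cw.
pose L := - ln (cabs p).
have L0 : 0 <= L by rewrite oppr_ge0; apply: ln_le0; exact: ltW.
have exk m : (M <= m)%N -> exists k : nat, exists A B : R,
    [/\ `|A| <= L, `|B| <= pi & w * p ^+ k = q ^+ m * ((expR A)%:C * cis B)].
  move=> Mm; have qm : 0 < cabs q ^+ m by rewrite exprn_gt0.
  have ex : exists k, cabs w * cabs p ^+ k < cabs q ^+ m.
    have [K hK] := pow_small p1 (divr_gt0 qm cw); exists K.
    by have := hK K (leqnn K); rewrite ltr_pdivlMr// mulrC.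
  have h1 := ex_minnP ex; case: h1 => [[|k] h1 h2].
    (* For m >= M the exponent 0 is excluded by |q|^m < |w|, so the minimal exponent has a
       predecessor. *)
    by move: h1; rewrite expr0 mulr1 => h1; have := hM m Mm; rewrite ltNge (ltW h1).
  have h3 : cabs q ^+ m <= cabs w * cabs p ^+ k.
    by rewrite leNgt; apply/negP => /h2; rewrite ltnn.
  pose u := w * p ^+ k / q ^+ m.
  have u0 : u != 0 by rewrite mulf_neq0 ?invr_eq0 ?expf_neq0// mulf_neq0// expf_neq0.
  have [B hB uB] := polar u0.
  have cu : 0 < cabs u by rewrite cabs_gt0.
  have u1 : 1 <= cabs u by rewrite /u !cabsM cabsV !cabsX ler_pdivlMr// mul1r.
  have u2 : cabs u <= (cabs p)^-1.
    rewrite /u !cabsM cabsV !cabsX ler_pdivrMr// [leRHS]mulrC ler_pdivlMr//.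
    by apply: ltW; apply: le_lt_trans h1; rewrite exprSr mulrA.
  exists k, (ln (cabs u)), B; split=> //.
    rewrite ger0_norm ?ln_ge0// /L -lnV ?posrE// ler_ln ?posrE ?invr_gt0//.
  by rewrite lnK ?posrE// -uB /u [RHS]mulrC divfK ?expf_neq0.
have ex2 m : exists kAB : nat * R * R, (M <= m)%N ->
    [/\ `|kAB.1.2| <= L, `|kAB.2| <= pi & w * p ^+ kAB.1.1 = q ^+ m * ((expR kAB.1.2)%:C * cis kAB.2)].
  have [Mm|Mm] := boolP (M <= m)%N; last by exists (0%N, 0, 0).
  by have [k [A [B h]]] := exk m Mm; exists (k, A, B).
have [f hf] := choice ex2.
pose a m := (f m).1.2 / m%:R; pose b m := (f m).2 / m%:R.
exists (fun m => q * ((expR (a m))%:C * cis (b m))), (fun m => (f m).1.1); split; last first.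
  exists (maxn M 1) => // m; rewrite /= geq_max => /andP[Mm m1].
  have m0 : m%:R != 0 :> R by rewrite pnatr_eq0 -lt0n.
  have [_ _ ->] := hf m Mm; rewrite exprMn; congr (_ * _).
  rewrite exprMn -rmorphXn /= -expRM_natl cisX /a /b; congr ((expR _)%:C * cis _); by rewrite mulrC divfK.
have c0 (x : nat -> R) (K : R) : 0 <= K -> (forall m, (M <= m)%N -> `|x m| <= K) -> (fun m => x m / m%:R) @ \oo --> (0 : R).
  move=> K0 hx; apply/norm_cvg0P.
  apply: (@squeeze_cvgr _ _ _ _ (fun _ => 0) (fun m => K * m.+1%:R^-1 *+ 2)).
  - exists (maxn M 1) => // m; rewrite /= geq_max => /andP[Mm m1].
    rewrite normr_ge0 normrM /=; have m0 : 0 < m%:R :> R by rewrite ltr0n.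
    rewrite normfV (ger0_norm (ltW m0)) -mulrnAr; apply: ler_pM; [exact: normr_ge0|by rewrite invr_ge0 ltW|exact: hx|].
    rewrite -[_ *+ 2]mulr_natl ler_pdivlMr ?ltr0Sn// mulrC ler_pdivrMr//.
    by rewrite -natrM ler_nat; lia.
  - exact: cvg_cst.
  - rewrite -[X in _ --> X](mul0rn _ 2) -[X in _ --> X *+ 2](mulr0 K).
    apply: cvgMn; apply: cvgM; [exact: cvg_cst|exact: cvg_harmonic].
have ca : a @ \oo --> (0 : R) by apply: (c0 (fun m => (f m).1.2) L) => // m /hf[].
have cb : b @ \oo --> (0 : R) by apply: (c0 (fun m => (f m).2) pi) => // [|m /hf[]//]; exact: pi_ge0.
rewrite -[X in ccvg _ _ X](mulr1 q); apply: ccvgM; first exact: ccvg_cst.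
rewrite -[X in ccvg _ _ X](mulr1 1); apply: ccvgM.
  rewrite -[X in ccvg _ _ X]/(1%:C) -(@expR0 R); apply: ccvg_real.
  by apply: (@cvg_comp _ _ _ a expR _ (nbhs (0 : R))); [exact: ca|exact: continuous_expR].
rewrite -[X in ccvg _ _ X](@cis0 R); apply: ccvg_ReIm.
  by apply: (@cvg_comp _ _ _ b cos _ (nbhs (0 : R))); [exact: cb|exact: continuous_cos].
by apply: (@cvg_comp _ _ _ b sin _ (nbhs (0 : R))); [exact: cb|exact: continuous_sin].
Qed.

Lemma countable_pqZ (I : Type) p q (u : I -> R[i]) : p != 0 -> q != 0 ->
  (forall c, countable [set z | u z = c]) -> countable [set z | pqZ p q (u z)].
Proof.
move=> p0 q0 hu.
apply: (@sub_countable _ _ _ (\bigcup_(ac in [set: nat * nat * nat * nat])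
   [set z | u z = (p ^+ ac.1.1.1 * q ^+ ac.1.1.2)^-1 * (p ^+ ac.1.2 * q ^+ ac.2)])).
  apply: subset_card_le => z [a [b [c [d e]]]]; exists (a, b, c, d) => //=; rewrite -e mulKf//.
  by rewrite mulf_neq0 ?expf_neq0.
by apply: bigcup_countable => // ac _; exact: hu.
Qed.

Lemma monomial_inj (c : R[i]) (e : int) (x y : R) : c != 0 -> e != 0 -> 0 < x -> 0 < y ->
  c * (1 + x)%:C ^ e = c * (1 + y)%:C ^ e -> x = y.
Proof.
move=> c0 e0 x0 y0 /(mulfI c0).
have nz (d : R) : 0 < d -> (1 + d)%:C != 0 :> R[i].
  by move=> d0; rewrite eq_complex /= eqxx andbT gt_eqF// addr_gt0.
have pos (n : nat) : n != 0%N -> forall x y : R, 0 < x -> 0 < y -> (1 + x)%:C ^+ n = (1 + y)%:C ^+ n :> R[i] -> x = y.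
  move=> n0 a b a0 b0; rewrite -!rmorphXn => /complexI /eqP; rewrite eqrXn2 ?lt0n//; try by rewrite addr_ge0// ltW.
  by move=> /eqP /addrI.
case: e e0 => n n0; first exact: pos.
by rewrite !NegzE -!exprnN => /invr_inj; apply: pos.
Qed.

(** Since the exponent is nonzero, d -> c (1 + d)^e is injective for d > 0, so each of the countably
    many elements of the group excludes at most one d. *)
Lemma generic_perturbation p q (L : seq (R[i] * int)) (eps : R) : nome p -> nome q -> 0 < eps ->
  (forall ce, ce \in L -> ce.1 != 0 /\ ce.2 != 0) ->
  exists2 d : R, 0 < d < eps & forall ce, ce \in L -> ~ pqZ p q (ce.1 * (1 + d)%:C ^ ce.2).
Proof.
move=> [p0 p1] [q0 q1] e0 hL.
pose B := \bigcup_(ce in [set` L]) [set d : R | 0 < d /\ pqZ p q (ce.1 * (1 + d)%:C ^ ce.2)].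
have cB : countable B.
  apply: bigcup_countable; first by apply: finite_set_countable; exact: finite_seq.
  move=> ce /hL[c0 n0].
  apply: (@sub_countable _ _ _ (\bigcup_(ac in [set: nat * nat * nat * nat])
     [set d : R | 0 < d /\ ce.1 * (1 + d)%:C ^ ce.2 = (p ^+ ac.1.1.1 * q ^+ ac.1.1.2)^-1 * (p ^+ ac.1.2 * q ^+ ac.2)])).
    apply: subset_card_le => z [z0 [a [b [c [d e]]]]]; exists (a, b, c, d) => //=; split=> //.
    by rewrite -e mulKf// mulf_neq0 ?expf_neq0.
  apply: bigcup_countable => // ac _; apply/countable_injP; exists (fun _ => 0%N) => x y.
  move=> /set_mem[x0 ex] /set_mem[y0 ey] _.
  exact: (monomial_inj c0 n0 x0 y0 (etrans ex (esym ey))).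
have [d de dB] := countable_avoid cB e0; exists d => // ce ceL h; apply: dB; exists ce => //.
by case/andP: de.
Qed.

Lemma ccvg_shrink (d : nat -> R) : (forall j, 0 < d j < j.+1%:R^-1) -> ccvg \oo (fun j => (1 + d j)%:C) (1 : R[i]).
Proof.
move=> hd; rewrite -[X in ccvg _ _ X]/((1 : R)%:C); apply: ccvg_real; rewrite -[X in _ --> X]addr0.
apply: cvgD; first exact: cvg_cst.
apply: (@squeeze_cvgr _ _ _ _ (fun _ => 0) (fun j => j.+1%:R^-1)).
- by apply: nearW => j; have /andP[h1 h2] := hd j; rewrite !ltW.
- exact: cvg_cst.
- exact: cvg_harmonic.
Qed.

Lemma real_1D_neq0 (d : R) : 0 < d -> (1 + d)%:C != 0 :> R[i].
Proof. by move=> d0; rewrite eq_complex /= eqxx andbT gt_eqF// addr_gt0. Qed.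

End Approximation.

(** * Invariance under multiplication of the first parameter by any number *)

Section Constancy.
Variable R : realType.
Notation C := (R[i])^o.
Local Opaque dp qp th Gam Th.
Variables (m : nat) (p q t0 t1 t2 t3 w : R[i]) (s : seq R[i]).
Hypotheses (np : nome p) (nq : nome q).
Hypotheses (t00 : t0 != 0) (t10 : t1 != 0) (t20 : t2 != 0) (t30 : t3 != 0) (s0 : all (fun x => x != 0) s) (w0 : w != 0).
Hypotheses (ss : size s = (2 * m.+1)%N) (tp : t0 * t1 * t2 * t3 * \prod_(x <- s) x = p * q).

Let N := (2 * m.+1 + 5)%N.
(** [r] will be [q_ j / q], which makes the product of the parameters equal to p times [q_ j]. The
    powers of [d] cancel in this product; t_0 and t_1 carry different powers, so that t_0 / t_1 is
    perturbed as well. *)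
Let tail (d r : R[i]) : seq R[i] := [:: t2 * d ^+ 2, t3 * r * d ^- N & [seq x * d | x <- s]].
Let fam (d r : R[i]) : seq R[i] := [:: t0 * d, t1 * d ^+ 2 & tail d r].
Let famw (d r : R[i]) : seq R[i] := [:: w * (t0 * d), t1 * d ^+ 2 / w & tail d r].

(* The exponents of [d] sum to [0], but those of any two parameters do not. *)
Let exps (r : R[i]) : seq (R[i] * int) :=
  [:: (t0, 1%:Z), (t1, 2%:Z), (t2, 2%:Z), (t3 * r, - N%:Z) & [seq (x, 1%:Z) | x <- s]].

Let famE d r : d != 0 -> fam d r = [seq ce.1 * d ^ ce.2 | ce <- exps r].
Proof.
move=> d0; by rewrite /fam /tail /exps /= -map_comp expr1z -exprnN.
Qed.

Let exps_neq0 r ce : r != 0 -> ce \in exps r -> ce.1 != 0.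
Proof.
move=> r0; rewrite !inE => /orP[/eqP -> //|/orP[/eqP -> //|/orP[/eqP -> //|/orP[/eqP ->|/mapP[x xs ->]]]]] /=.
  by rewrite mulf_neq0.
exact: (allP s0).
Qed.

Let exps_sum r ce ce' : ce \in exps r -> ce' \in exps r -> ce.2 + ce'.2 != 0.
Proof.
have h x : x \in exps r -> [\/ x.2 = 1, x.2 = 2 | x.2 = - N%:Z].
  rewrite !inE => /orP[/eqP ->|/orP[/eqP ->|/orP[/eqP ->|/orP[/eqP ->|/mapP[y ys ->]]]]];
    by [constructor 1|constructor 2|constructor 3].
move=> /h h1 /h h2; rewrite /N in h1 h2; clear h.
by case: h1 => ->; case: h2 => ->; apply/eqP; lia.
Qed.

Let perturb qj j : exists d : R, 0 < d < j.+1%:R^-1 /\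
  (nome qj -> supergen p qj (t0 * (1 + d)%:C) (t1 * (1 + d)%:C ^+ 2) (tail (1 + d)%:C (qj / q))).
Proof.
have e0 : 0 < j.+1%:R^-1 :> R by rewrite invr_gt0 ltr0Sn.
have [nqj|nqj] := EM (nome qj); last by exists (j.+1%:R^-1 / 2); split=> //; rewrite divr_gt0// ltr_pdivrMr// ltr_pMr// ltr1n.
set r := qj / q; have r0 : r != 0 by rewrite mulf_neq0 ?invr_eq0; [|case: nqj|case: nq].
pose L := (t0 / t1, - 1%:Z) :: [seq (x.1 * y.1, x.2 + y.2) | x <- exps r, y <- exps r].
have hL ce : ce \in L -> ce.1 != 0 /\ ce.2 != 0.
  rewrite inE => /predU1P[-> /=|/allpairsP[[x y] /= [xe ye ->]]] /=.
    by rewrite mulf_neq0 ?invr_eq0.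
  by split; [rewrite mulf_neq0// (@exps_neq0 r)|exact: exps_sum xe ye].
have [d de dL] := generic_perturbation np nqj e0 hL; exists d; split=> // _.
have d0 : (1 + d)%:C != 0 :> R[i] by apply: real_1D_neq0; case/andP: de.
split.
  have := dL _ (mem_head _ _); rewrite /= exprN1; congr (~ pqZ _ _ _).
  by move: (1 + d)%:C d0 => e d0; field; rewrite t10 d0.
move=> x y; rewrite -/(fam _ _) famE// => /mapP[ce cei ->] /mapP[ce' cei' ->].
have /dL /= : (ce.1 * ce'.1, ce.2 + ce'.2) \in L.
  by rewrite inE; apply/orP; right; apply/allpairsP; exists (ce, ce').
by congr (~ pqZ _ _ _); rewrite expfzDr//; ring.
Qed.

Let cfam (T : Type) (F : set_system T) {FF : Filter F} (d r : T -> R[i]) (i : nat) :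
  ccvg F d 1 -> ccvg F r 1 -> (i < size (fam 1%R 1%R))%N -> ccvg F (fun x => nth 0 (fam (d x) (r x)) i) (nth 0 (fam 1 1) i).
Proof.
move=> cd cr; case: i => [|[|[|[|i]]]] /=.
- by move=> _; apply: ccvgM; [exact: ccvg_cst|exact: cd].
- by move=> _; apply: ccvgM; [exact: ccvg_cst|apply: ccvgX; exact: cd].
- by move=> _; apply: ccvgM; [exact: ccvg_cst|apply: ccvgX; exact: cd].
- move=> _; apply: ccvgM; first by apply: ccvgM; [exact: ccvg_cst|exact: cr].
  by apply: ccvgV; [rewrite expf_neq0// oner_neq0|apply: ccvgX; exact: cd].
- rewrite size_map !ltnS => h.
  have e (u : R[i]) : nth 0 [seq x * u | x <- s] i = s`_i * u by rewrite (nth_map 0).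
  rewrite e; under eq_fun do rewrite e.
  by apply: ccvgM; [exact: ccvg_cst|exact: cd].
Qed.

Let cfamw (T : Type) (F : set_system T) {FF : Filter F} (d r : T -> R[i]) (i : nat) :
  ccvg F d 1 -> ccvg F r 1 -> (i < size (famw 1%R 1%R))%N -> ccvg F (fun x => nth 0 (famw (d x) (r x)) i) (nth 0 (famw 1 1) i).
Proof.
move=> cd cr; case: i => [|[|i]] h.
- by apply: ccvgM; [exact: ccvg_cst|apply: ccvgM; [exact: ccvg_cst|exact: cd]].
- by apply: ccvgM; [apply: ccvgM; [exact: ccvg_cst|apply: ccvgX; exact: cd]|exact: ccvg_cst].
- exact: (@cfam T F FF d r i.+2 cd cr h).
Qed.

Let t := [:: t0, t1, t2, t3 & s].
Let tw := [:: w * t0, t1 / w, t2, t3 & s].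

Let fam11 : fam 1 1 = t.
Proof.
rewrite /fam /tail /t !expr1n invr1 !mulr1.
suff -> : [seq x * 1 | x <- s] = s by [].
by rewrite -[RHS]map_id; apply: eq_map => x; rewrite mulr1.
Qed.

Let famw11 : famw 1 1 = tw.
Proof. by have := fam11; rewrite /fam /famw /tw /tail => -[-> -> -> -> ->]. Qed.

(** Stated crosswise, because a gamma product may vanish for the given parameters; only the
    perturbed ones are divided by. At each late stage j the perturbed parameters are generic for
    [q_ j], and [ratio_chain] applies exactly. *)
Lemma constancy C1 C2 : adm p q t C1 -> adm p q tw C2 ->
  clean_int m.+1 p q t C1 * pair_prod p q tw = clean_int m.+1 p q tw C2 * pair_prod p q t.
Proof.
move=> ad1 ad2; have [p0 p1] := np; have [q0 q1] := nq.
have [q_ [k_ [cq hk]]] := root_approx np nq w0.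
have [d_ hd] := choice (fun j => perturb (q_ j) j).
have cd : ccvg \oo (fun j => (1 + d_ j)%:C) (1 : R[i]) by apply: ccvg_shrink => j; case: (hd j).
have cr : ccvg \oo (fun j => q_ j / q) 1.
  by rewrite -(mulfV q0); apply: ccvgM; [exact: cq|exact: ccvg_cst].
pose ft j := fam (1 + d_ j)%:C (q_ j / q); pose fw j := famw (1 + d_ j)%:C (q_ j / q).
have cp : ccvg \oo (fun _ : nat => p) p by exact: ccvg_cst.
have tn : all (fun x => x != 0) t by rewrite /= t00 t10 t20 t30 s0.
have twn : all (fun x => x != 0) tw by rewrite /= !mulf_neq0 ?invr_eq0// t20 t30 s0.
have szf j : size (ft j) = size t by rewrite /= size_map.
have szw j : size (fw j) = size tw by rewrite /= size_map.
have ctf i : (i < size t)%N -> ccvg \oo (fun j => (ft j)`_i) t`_i.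
  by rewrite -fam11 => h; exact: (cfam cd cr h).
have ctw i : (i < size tw)%N -> ccvg \oo (fun j => (fw j)`_i) tw`_i.
  by rewrite -famw11 => h; exact: (cfamw cd cr h).
have l1 : ccvg \oo (fun j => clean_int m.+1 p (q_ j) (ft j) C1) (clean_int m.+1 p q t C1).
  by apply: ccvg_clean_int.
have l2 : ccvg \oo (fun j => clean_int m.+1 p (q_ j) (fw j) C2) (clean_int m.+1 p q tw C2).
  by apply: ccvg_clean_int.
have l3 : ccvg \oo (fun j => pair_prod p (q_ j) (ft j)) (pair_prod p q t).
  by apply: ccvg_pair_prod => //; exact: adm_gen ad1.
have l4 : ccvg \oo (fun j => pair_prod p (q_ j) (fw j)) (pair_prod p q tw).
  by apply: ccvg_pair_prod => //; exact: adm_gen ad2.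
have n1 : \forall j \near \oo, nome p /\ nome (q_ j) by apply: (nome_near np nq cp cq).
have n2 : \forall j \near \oo, adm p (q_ j) (ft j) C1
  by apply: (adm_near np nq tn cp cq szf ctf _ ad1).
have n3 : \forall j \near \oo, adm p (q_ j) (fw j) C2
  by apply: (adm_near np nq twn cp cq szw ctw _ ad2).
apply: (@ccvg_uniq _ _ \oo _ (fun j => clean_int m.+1 p (q_ j) (ft j) C1 * pair_prod p (q_ j) (fw j))).
  by apply: ccvgM; [exact: l1|exact: l4].
apply: (@ccvg_eq _ _ \oo _ (fun j => clean_int m.+1 p (q_ j) (fw j) C2 * pair_prod p (q_ j) (ft j))); last first.
  by apply: ccvgM; [exact: l2|exact: l3].
apply: (@filterS2 _ \oo _ _ _ _ _ (filterI n1 n2) (filterI n3 hk)) => j [[_ nqj] a1] [a2 ej].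
have [dj /(_ nqj) sg] := hd j.
have d0 : (1 + d_ j)%:C != 0 :> R[i] by apply: real_1D_neq0; case/andP: dj.
have rj : q_ j / q != 0 by rewrite mulf_neq0 ?invr_eq0//; case: nqj.
have fn : all (fun x => x != 0) (ft j).
  rewrite /ft famE//; apply/allP => _ /mapP[ce cei ->]; rewrite mulf_neq0//.
    exact: exps_neq0 cei.
  by rewrite expfz_neq0.
have [f0 f1 fs] : [/\ t0 * (1 + d_ j)%:C != 0, t1 * (1 + d_ j)%:C ^+ 2 != 0 &
    all (fun x => x != 0) (tail (1 + d_ j)%:C (q_ j / q))] by case/and3P: fn.
have G0 : pair_prod p (q_ j) (ft j) != 0.
  by apply: pair_prod_neq0 => // x y xt yt; exact: sg.2.
pose v := clean_int m.+1 p (q_ j) (ft j) C1 / pair_prod p (q_ j) (ft j).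
have hv : has_ratio m.+1 p (q_ j) (ft j) v.
  by move=> C3 a3; rewrite /v divfK// (clean_int_contour m.+1 np nqj _ a3 a1).
have size_tail : size (tail (1 + d_ j)%:C (q_ j / q)) = (2 * m.+1 + 2)%N.
  by rewrite /= size_map ss addn2.
have prod_tail : t0 * (1 + d_ j)%:C * (t1 * (1 + d_ j)%:C ^+ 2) * (\prod_(x <- tail (1 + d_ j)%:C (q_ j / q)) x) = p * q_ j.
  rewrite /tail !big_cons big_map; under eq_bigr do rewrite mulrC.
  rewrite prod_scale ss.
  transitivity (t0 * t1 * t2 * t3 * (\prod_(x <- s) x) * (q_ j / q) * ((1 + d_ j)%:C ^+ (2 * m.+1 + 5) / (1 + d_ j)%:C ^+ N)).
    by rewrite exprD; ring.
  by rewrite mulfV ?expf_neq0// tp; field.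
have := ratio_chain np nqj f0 f1 fs size_tail prod_tail sg ej hv => /(_ C2 a2) ->.
by rewrite /v mulrAC divfK.
Qed.

End Constancy.

(** * The pinched contour *)

Section Pinch.
Variable R : realType.
Notation C := (R[i])^o.
Implicit Types (p q x y z : R[i]) (t : seq R[i]) (Ct : contour R).
Local Opaque dp Th.

(** [Gam] times 1 - y ([Gam_Gam1]), regular at the pole y = 1. *)
Definition Gam1 y p q := dp (p * q / y) p q / dp1 y p q.

Lemma Gam_Gam1 y p q : cabs p < 1 -> cabs q < 1 -> Gam y p q = Gam1 y p q / (1 - y).
Proof. by move=> p1 q1; rewrite GamE (dp_dp1 y p1 q1) invfM /Gam1; move: (dp _ _ _) (dp1 _ _ _) => u v; ring. Qed.

Definition thr y p := qp (p * y) p * qp (p / y) p.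

Lemma th_thr y p : cabs p < 1 -> th y p = (1 - y) * thr y p.
Proof. by move=> p1; rewrite /th /thr qp_shift// mulrA. Qed.

(** This exhibits the factors that cancel the denominator in [weight_weight1]. *)
Lemma Th_thr x z p : cabs p < 1 -> x != 0 -> z != 0 ->
  Th z x p = (1 - x * z) * (1 - x / z) * (- x^-1 * (thr (z * x) p * thr (z / x) p)).
Proof.
move=> p1 x0 z0; rewrite ThE !th_thr//; move: (thr _ _) (thr _ _) => u v.
by field; rewrite x0 z0.
Qed.

Lemma hol_thr E u p : cabs p < 1 -> ratl E u -> ratl E (fun z => (u z)^-1) -> hol E (fun z => thr (u z) p).
Proof.
move=> p1 ru rv; apply: holM; apply: hol_dp; [exact: p1|exact: cabs0_lt1| |exact: p1|exact: cabs0_lt1|]; exact: ratl_Z.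
Qed.

Lemma hol_Gam1Z E x p q : nome p -> nome q -> E 0 ->
  (forall j k : nat, p ^+ j * q ^+ k * (p * x) != 0 -> E (p ^+ j * q ^+ k * (p * x))^-1) ->
  (forall j k : nat, p ^+ j * q ^+ k * (q * x) != 0 -> E (p ^+ j * q ^+ k * (q * x))^-1) ->
  hol E (fun z => Gam1 (x * z) p q).
Proof.
move=> [p0 p1] [q0 q1] E0 h1 h2.
apply: holM.
  apply: hol_dp; [exact: p1|exact: q1|].
  apply: (@ratl_eq0 _ _ (fun z => (p * q / x) / z)); last exact: ratlV.
  by move=> z; rewrite invfM mulrA.
apply: (@hol_eq _ _ (fun z => (dp (p * x * z) p 0)^-1 * (dp (q * x * z) p q)^-1)).
  by move=> z; rewrite -invfM /dp1 /qp !mulrA.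
apply: holM; apply: hol_dpVz; [exact: p1|exact: cabs0_lt1| |exact: p1|exact: q1|exact: h2].
case=> [|j] [|k]; try by rewrite ?expr0n /= ?mulr0 ?mul0r eqxx.
  by have := h1 0%N 0%N; rewrite !expr0.
by have := h1 j.+1 0%N; rewrite !expr0.
Qed.

Lemma hol_Gam1V E x p q : nome p -> nome q -> E 0 ->
  (forall j k : nat, E (p ^+ j * q ^+ k * (p * x))) ->
  (forall j k : nat, E (p ^+ j * q ^+ k * (q * x))) ->
  hol E (fun z => Gam1 (x / z) p q).
Proof.
move=> [p0 p1] [q0 q1] E0 h1 h2.
apply: holM.
  apply: hol_dp; [exact: p1|exact: q1|].
  apply: (@ratl_eq0 _ _ (fun z => (p * q / x) * z)); last exact: ratlZ.
  by move=> z; rewrite invf_div -mulrA; congr (_ * _); rewrite mulrC.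
apply: (@hol_eq _ _ (fun z => (dp (p * x / z) p 0)^-1 * (dp (q * x / z) p q)^-1)).
  by move=> z; rewrite -invfM /dp1 /qp !mulrA.
apply: holM; apply: hol_dpVVz; [exact: p1|exact: cabs0_lt1|exact: E0| |exact: p1|exact: q1|exact: E0|exact: h2].
move=> j [|k]; last by rewrite expr0n /= mulr0 mul0r.
by have := h1 j 0%N; rewrite !expr0.
Qed.

Definition weight1 p q x t z := Gam1 (x * z) p q * Gam1 (x / z) p q * weight p q t z.

Lemma weight_weight1 p q x t z : cabs p < 1 -> cabs q < 1 ->
  weight p q (x :: t) z = weight1 p q x t z / ((1 - x * z) * (1 - x / z)).
Proof.
move=> p1 q1; rewrite /weight1 /weight big_cons !(Gam_Gam1 _ p1 q1).
have e (a b u v P T W : R[i]) : a / u * (b / v) * P * T * W = a * b * (P * T * W) / (u * v).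
  by rewrite invfM; ring.
exact: e.
Qed.

Lemma pole_isolated p q t x : nome p -> nome q -> all (fun x => x != 0) t -> gen p q t -> 
  x \in t -> exists2 e : R, 0 < e & forall z, poles p q t z ->
    (z != x -> e < cabs (z - x)) /\ (z != x^-1 -> e < cabs (z - x^-1)).
Proof.
move=> np nq t0 g xt; have n0 a : inner_poles p q t a -> a != 0 by exact: inner_poles_neq0.
pose B := [set b | b != 0 /\ inner_poles p q t b^-1].
have nA : ~ inner_poles p q t 0 by move=> /n0; rewrite eqxx.
have nB : ~ B 0 by move=> []; rewrite eqxx.
have x0 := allP t0 _ xt.
have hx : inner_poles p q t x by exists x, 0%N, 0%N; rewrite !expr0 !mul1r.
have hA : inner_poles p q t x \/ B x by left.
have hB : inner_poles p q t x^-1 \/ B x^-1 by right; split; rewrite ?invr_eq0 ?invrK.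
have [e1 e10 h1] := isolated nA nB (fun e => @finite_inner_poles _ p q t e np nq) (fun e => @finite_inv_poles _ p q t e np nq) hA.
have [e2 e20 h2] := isolated nA nB (fun e => @finite_inner_poles _ p q t e np nq) (fun e => @finite_inv_poles _ p q t e np nq) hB.
exists (Num.min e1 e2); first by rewrite lt_min e10.
have m1 : Num.min e1 e2 <= e1 by rewrite ge_min lexx.
have m2 : Num.min e1 e2 <= e2 by rewrite ge_min lexx orbT.
move=> z hz; have hz' : z = 0 \/ inner_poles p q t z \/ B z.
  case: hz => [->|h|h]; [by left|by right; left|right; right].
  by split=> //; have := n0 _ h; rewrite invr_eq0.
by split=> zx; [apply: (le_lt_trans m1); apply: h1|apply: (le_lt_trans m2); apply: h2].
Qed.

Section FixedParameter.
Variables (n : nat) (p q x b b' : R[i]) (t : seq R[i]) (Ct : contour R).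
Hypotheses (np : nome p) (nq : nome q) (x0 : x != 0) (tn : all (fun x => x != 0) t).
Hypotheses (g : gen p q (x :: t)) (ad : adm p q [:: p * x, q * x & t] Ct).
Hypotheses (Sx : contour_excludes Ct x) (SVx : contour_contains Ct x^-1).
Hypotheses (b0 : b != 0) (xb : Th x b p != 0) (b0' : b' != 0) (xb' : Th x b' q != 0).

(** [Ct] is admissible for [x :: t] but for excluding [x] and containing 1 / x. With p x and q x in
    place of [x], the set [E] consists of all poles except these two. *)
Let E : set R[i] := poles p q [:: p * x, q * x & t].

Lemma inner_poles_cons a : inner_poles p q (x :: t) a -> a = x \/ inner_poles p q [:: p * x, q * x & t] a.
Proof.
move=> [y [i [j [yt ->]]]]; move: yt; rewrite inE => /predU1P[->|yt]; last first.
  by right; exists y, i, j; rewrite !inE yt !orbT.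
case: i => [|i].
  case: j => [|j]; first by left; rewrite !expr0 !mul1r.
  right; exists (q * x), 0%N, j; rewrite !inE eqxx orbT; split=> //.
  by rewrite exprSr; ring.
right; exists (p * x), i, j; rewrite !inE eqxx; split=> //.
by rewrite exprSr; ring.
Qed.

Lemma inner_poles_consS a : inner_poles p q [:: p * x, q * x & t] a -> inner_poles p q (x :: t) a.
Proof.
move=> [y [i [j [yt ->]]]]; move: yt; rewrite !inE => /or3P[/eqP->|/eqP->|yt].
- by exists x, i.+1, j; rewrite mem_head exprSr; split=> //; ring.
- by exists x, i, j.+1; rewrite mem_head exprSr; split=> //; ring.
- by exists y, i, j; rewrite inE yt orbT.
Qed.

Lemma poles_consS a : E a -> poles p q (x :: t) a.
Proof.
by case=> [->|/inner_poles_consS h|/inner_poles_consS h]; [constructor 1|constructor 2|constructor 3].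
Qed.

Let avE : avoids Ct E := adm_avoids ad.

Let E0 : E 0. Proof. by constructor 1. Qed.

Let nEx : ~ E x.
Proof.
have x1 : 1 != 0 :> R[i] := oner_neq0 _.
case=> [/eqP|h|h]; first by rewrite (negPf x0).
  by have [[_ w1] _] := ad.2 _ h; move: w1; rewrite Sx.2 => /eqP; rewrite eq_sym oner_eq0.
have [y [i [j [yt e]]]] := inner_poles_consS h.
have /eqP := g i j yt (mem_head x t); apply.
by rewrite mulrA -e mulVf.
Qed.

Let nEVx : ~ E x^-1.
Proof.
have EV z : E z -> E z^-1.
  by case=> [->|h|h]; [rewrite invr0; constructor 1|constructor 3; rewrite invrK|constructor 2].
by move=> /EV; rewrite invrK.
Qed.

Lemma hol_weight1 : hol E (weight1 p q x t).
Proof.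
have sub : poles p q t `<=` E.
  have s (y : R[i]) : y \in t -> y \in [:: p * x, q * x & t] by rewrite !inE => ->; rewrite !orbT.
  by move=> z [->|h|h]; [constructor 1|constructor 2; exact: (inner_poles_sub s)|constructor 3; exact: (inner_poles_sub s)].
have ip i j : inner_poles p q [:: p * x, q * x & t] (p ^+ i * q ^+ j * (p * x)).
  by exists (p * x), i, j; rewrite mem_head.
have iq i j : inner_poles p q [:: p * x, q * x & t] (p ^+ i * q ^+ j * (q * x)).
  by exists (q * x), i, j; rewrite !inE eqxx orbT.
apply: holM; last exact: (hol_sub sub (hol_weight t np nq)).
apply: holM.
  by apply: (hol_Gam1Z np nq E0) => i j _; constructor 3; rewrite invrK.
by apply: (hol_Gam1V np nq E0) => i j; constructor 2.
Qed.

Lemma weight1_inv z : z != 0 -> weight1 p q x t z^-1 * z^-1 = weight1 p q x t z * z.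
Proof.
move=> z0; have z2 : z ^+ 2 != 0 by rewrite expf_neq0.
rewrite /weight1 /weight invrK exprVn invrK (th_inv np.2 z2).
have -> : th (z ^+ 2) q = - (z ^+ 2) * th (z ^- 2) q.
  by rewrite (th_inv nq.2 z2); move: (th _ _) => u; field.
have -> : \prod_(y <- t) (Gam (y / z) p q * Gam (y * z) p q) = \prod_(y <- t) (Gam (y * z) p q * Gam (y / z) p q).
  by apply: eq_bigr => y _; exact: mulrC.
move: (two_pi_i R) (two_pi_i_neq0 R) (\prod_(_ <- _) _) (Gam1 _ _ _) (Gam1 _ _ _) (th _ _) (th _ _) => c c0 u v w u' v'.
by field; rewrite z0 c0.
Qed.

(** The residues at [x] and 1 / x contribute equally, whence the factor 2; [Gam1 1 p q] is what
    remains of the singular factor Gamma(x / z) at z = x. *)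
Definition pinch_residue : R[i] :=
  2 * Gam (x ^+ 2) p q * Gam1 1 p q * \prod_(y <- t) (Gam (y * x) p q * Gam (y / x) p q) *
  (th (x ^+ 2) p * th (x ^- 2) q).

(* With [x] as a base point of the basis functions, the integrand of every other entry has a zero
   at [x] and [x^-1], where the weight has simple poles. *)
Lemma pinch_moment : exists Cx, adm p q (x :: t) Cx /\ forall j k,
  (j < n)%N -> (k < n)%N -> moment n p q (x :: t) x b x b' Cx j k = 
    moment n p q (x :: t) x b x b' Ct j k + (if (j == 0)%N && (k == 0)%N then pinch_residue else 0).
Proof.
have [p0 p1] := np; have [q0 q1] := nq.
have xtn : all (fun x => x != 0) (x :: t) by rewrite /= x0.
have [e e0 he] := pole_isolated np nq xtn g (mem_head x t).
have hxx : x ^+ 2 != 1 by have := g 0 0 (mem_head x t) (mem_head x t); rewrite !expr0 !mul1r.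
have xV : x != x^-1.
  by apply: contra hxx => /eqP h; rewrite expr2 {1}h mulVf.
have px : poles p q (x :: t) x by constructor 2; exists x, 0%N, 0%N; rewrite mem_head !expr0 !mul1r.
have pVx : poles p q (x :: t) x^-1 by constructor 3; rewrite invrK; exists x, 0%N, 0%N; rewrite mem_head !expr0 !mul1r.
have en : `|e| = e by rewrite gtr0_norm.
pose c1 := circle x e true; pose c2 := circle x^-1 e false.
have far1 z : poles p q (x :: t) z -> z != x -> ~ contour_support c1 z /\ winding c1 z = 0.
  move=> hz zx; have h := (he z hz).1 zx; split; last by apply: circle_winding_out; rewrite en.
  by apply: circle_notin; rewrite en gt_eqF.
have far2 z : poles p q (x :: t) z -> z != x^-1 -> ~ contour_support c2 z /\ winding c2 z = 0.
  move=> hz zx; have h := (he z hz).2 zx; split; last by apply: circle_winding_out; rewrite en.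
  by apply: circle_notin; rewrite en gt_eqF.
have at1 : ~ contour_support c1 x /\ winding c1 x = 1.
  split; first by apply: circle_notin; rewrite subrr cabs0 en lt_eqF.
  by rewrite circle_winding_center ?gt_eqF.
have at2 : ~ contour_support c2 x^-1 /\ winding c2 x^-1 = -1.
  split; first by apply: circle_notin; rewrite subrr cabs0 en lt_eqF.
  by rewrite circle_winding_center ?gt_eqF//= rmorphN rmorph1.
have farE z : E z -> (~ contour_support c1 z /\ winding c1 z = 0) /\ (~ contour_support c2 z /\ winding c2 z = 0).
  move=> hz; split; [apply: far1|apply: far2]; try exact: poles_consS.
    by apply/eqP => ez; apply: nEx; rewrite -ez.
  by apply/eqP => ez; apply: nEVx; rewrite -ez.
(* A positive circle around [x] and a negative one around 1 / x make the contour admissible. *)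
pose Cx := Ct ++ c1 ++ c2.
have suppC z : ~ contour_support Ct z -> ~ contour_support c1 z -> ~ contour_support c2 z -> ~ contour_support Cx z.
  by move=> h1 h2 h3; rewrite /Cx !contour_support_cat => -[|[|]].
have windC z : winding Cx z = winding Ct z + (winding c1 z + winding c2 z) by rewrite /Cx !winding_cat.
exists Cx; split.
  split.
    have [[h1 _] [h2 _]] := farE 0 E0; apply: suppC => //; exact: ad.1.
  move=> a /inner_poles_cons[->|ha].
    split; split.
    + by apply: suppC; [exact: Sx.1|exact: at1.1|exact: (far2 x px xV).1].
    + by rewrite windC Sx.2 at1.2 (far2 x px xV).2 add0r addr0.
    + by apply: suppC; [exact: SVx.1|apply: (far1 x^-1 pVx _).1; rewrite eq_sym|exact: at2.1].
    + rewrite windC SVx.2 at2.2 (far1 x^-1 pVx _).2; last by rewrite eq_sym.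
      by rewrite add0r subrr.
  have Ea : E a by constructor 2.
  have EVa : E a^-1 by constructor 3; rewrite invrK.
  have [[h1 h2] [h3 h4]] := ad.2 _ ha.
  have [[k1 k2] [k3 k4]] := farE _ Ea; have [[l1 l2] [l3 l4]] := farE _ EVa.
  split; split; try exact: suppC.
    by rewrite windC h2 k2 k4 !addr0.
  by rewrite windC h4 l2 l4 !addr0.
move=> j k jn kn.
have S0 z : contour_support Ct z \/ contour_support c1 z \/ contour_support c2 z ->
    z != 0 /\ (1 - x * z) * (1 - x / z) != 0.
  have s1 w : contour_support c1 w -> [/\ w != 0, w != x & w != x^-1].
    have [[h1 _] _] := farE 0 E0; have h2 := at1.1; have [|h3 _] := far1 x^-1 pVx; first by rewrite eq_sym.
    by move=> Sw; split; apply/eqP => h; subst w.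
  have s2 w : contour_support c2 w -> [/\ w != 0, w != x & w != x^-1].
    have [_ [h1 _]] := farE 0 E0; have h2 := at2.1; have [h3 _] := far2 x px xV.
    by move=> Sw; split; apply/eqP => h; subst w.
  have s3 w : contour_support Ct w -> [/\ w != 0, w != x & w != x^-1].
    have h1 := ad.1; have h2 := Sx.1; have h3 := SVx.1.
    by move=> Sw; split; apply/eqP => h; subst w.
  move=> h; have [z0 zx zV] : [/\ z != 0, z != x & z != x^-1] by case: h => [/s3|[/s1|/s2]].
  split=> //; apply: mulf_neq0; rewrite subr_eq0.
    by apply: contra zV => /eqP ez; apply/eqP; apply: (mulfI x0); rewrite -ez mulfV.
  by apply: contra zx => /eqP ez; apply/eqP; rewrite -[LHS]mul1r {1}ez divfK.
have CxS z : contour_support Cx z -> contour_support Ct z \/ contour_support c1 z \/ contour_support c2 z.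
  by rewrite /Cx !contour_support_cat.
pose f z := basis_fun n p x b j z * basis_fun n q x b' k z * weight p q (x :: t) z.
rewrite /moment -/f.
case jk : ((j == 0%N) && (k == 0%N)); last first.
  have [f' hf' ff'] : exists2 f', hol E f' & forall z, z != 0 -> (1 - x * z) * (1 - x / z) != 0 -> f z = f' z.
    have hb i : hol E (basis_fun n p x b i) by apply: hol_basis.
    have hb' i : hol E (basis_fun n q x b' i) by apply: hol_basis.
    have hT r : cabs r < 1 -> hol E (fun z => - x^-1 * (thr (z * x) r * thr (z / x) r)).
      move=> r1; apply: holZ; apply: holM.
        apply: (@hol_eq _ _ (fun z => thr (x * z) r)); first by move=> z; rewrite mulrC.
        apply: hol_thr => //; first exact: ratlZ.
        by apply: ratl_eq0 (ratlV x^-1 E0) => z; rewrite invfM.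
      apply: (@hol_eq _ _ (fun z => thr (x^-1 * z) r)); first by move=> z; rewrite mulrC.
      apply: hol_thr => //; first exact: ratlZ.
      by apply: ratl_eq0 (ratlV x E0) => z; rewrite invfM invrK.
    have al (c A B B' w : R[i]) : c != 0 -> c * A * B * B' * (w / c) = A * B * B' * w.
      by move=> c0; field.
    case: j jn jk @f => [|j] jn jk f.
      case: k kn jk @f => [//|k] kn jk f.
      exists (fun z => - x^-1 * (thr (z * x) q * thr (z / x) q) * (ThA q x z ^+ k * ThB q x b' z ^+ (n.-1 - k.+1)) *
          basis_fun n p x b 0 z * weight1 p q x t z).
        apply: holM; last exact: hol_weight1.
        apply: holM; last exact: hb.
        apply: holM; first exact: hT.
        by apply: holM; apply: holX; [exact: hol_ThA|exact: hol_ThB].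
      move=> z z0 hz; rewrite -(al _ _ _ _ _ hz) /f weight_weight1// /basis_fun exprS.
      have -> : ThA q x z = Th z x q by [].
      rewrite {1}(Th_thr q1 x0 z0); move: (weight1 _ _ _ _ _) (ThA _ _ _) (ThB _ _ _ _) (ThB _ _ _ _) (thr _ _) (thr _ _) (Th _ _ _) => *; ring.
    exists (fun z => - x^-1 * (thr (z * x) p * thr (z / x) p) * (ThA p x z ^+ j * ThB p x b z ^+ (n.-1 - j.+1)) *
        basis_fun n q x b' k z * weight1 p q x t z).
      apply: holM; last exact: hol_weight1.
      apply: holM; last exact: hb'.
      apply: holM; first exact: hT.
      by apply: holM; apply: holX; [exact: hol_ThA|exact: hol_ThB].
    move=> z z0 hz; rewrite -(al _ _ _ _ _ hz) /f weight_weight1// /basis_fun exprS.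
    have -> : ThA p x z = Th z x p by [].
    rewrite {1}(Th_thr p1 x0 z0); move: (weight1 _ _ _ _ _) (ThA _ _ _) (ThB _ _ _ _) (ThB _ _ _ _) (thr _ _) (thr _ _) (Th _ _ _) => *; ring.
  rewrite addr0 (@eq_contour_integral _ Cx f f'); last by move=> z /CxS /S0[]; exact: ff'.
  rewrite (@eq_contour_integral _ Ct f f'); last by move=> z Sz; have [|z0 hz] := S0 z; [left|exact: ff'].
  apply: (hol_int_eq _ avE _ hf').
    move=> a Ea; have [[h1 _] [h2 _]] := farE _ Ea; apply: suppC => //; exact: avE.
  by move=> a Ea; have [[_ h1] [_ h2]] := farE _ Ea; rewrite windC h1 h2 !addr0.
move/andP: jk => [/eqP j0 /eqP k0]; rewrite /Cx !contour_integral_cat; congr (_ + _).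
pose K z := basis_fun n p x b 0 z * basis_fun n q x b' 0 z * weight1 p q x t z.
have hK : hol E K.
  by apply: holM; [apply: holM; apply: hol_basis|exact: hol_weight1].
have fK z : f z = K z / ((1 - x * z) * (1 - x / z)).
  by rewrite /f weight_weight1// j0 k0 mulrA.
have i1 : contour_integral c1 f = two_pi_i R * winding c1 x * (K x * (x * (1 - x * x)^-1)).
  (* Near [x] the factor (1 - x z)^-1 is regular; its pole 1 / x joins the poles that the circle
     does not enclose. *)
  pose E1 := E `|` [set x^-1].
  have sE1 a : E1 a -> ~ contour_support c1 a /\ winding c1 a = 0.
    by case=> [/farE[]//|->]; apply: far1; rewrite 1?eq_sym.
  rewrite -(@hol_residue _ c1 E1 x (fun z => K z * (z * (1 - x * z)^-1))).
  - apply: eq_contour_integral => z Sz; have [|z0 hz] := S0 z; first by right; left.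
    rewrite fK; have al (a c d : R[i]) : c * d != 0 -> z - x = z * d -> a / (c * d) = a * (z * c^-1) / (z - x).
      move=> cd ->; move: cd; rewrite mulf_eq0 negb_or => /andP[c0 d0].
      by field; rewrite z0 c0 d0.
    by apply: al hz _; field.
  - by move=> a /sE1[].
  - by case=> [//|/= ex]; move: xV; rewrite {1}ex eqxx.
  - exact: at1.1.
  - by move=> a /sE1[].
  - apply: holM; first by apply: (hol_sub _ hK) => z hz; left.
    by apply: holM; [exact: hol_id|apply: hol_ratl; apply: ratl_1Bz => _; right].
have i2 : contour_integral c2 f = two_pi_i R * winding c2 x^-1 * (K x^-1 * (x^-1 * (x^-1 - x)^-1 * (- x^-1))).
  pose E1 := E `|` [set x].
  have sE1 a : E1 a -> ~ contour_support c2 a /\ winding c2 a = 0.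
    by case=> [/farE[]//|->]; apply: far2.
  rewrite -(@hol_residue _ c2 E1 x^-1 (fun z => K z * (z * (z - x)^-1 * (- x^-1)))).
  - apply: eq_contour_integral => z Sz; have [|z0 hz] := S0 z; first by right; right.
    rewrite fK; have al (a c d : R[i]) : c * d != 0 -> z - x = z * d -> z - x^-1 = - x^-1 * c ->
        a / (c * d) = a * (z * (z - x)^-1 * (- x^-1)) / (z - x^-1).
      move=> cd -> ->; move: cd; rewrite mulf_eq0 negb_or => /andP[c0 d0].
      by field; rewrite z0 c0 d0 x0.
    by apply: al hz _ _; field.
  - by move=> a /sE1[].
  - by case=> [//|/= ex]; move: xV; rewrite -{1}ex eqxx.
  - exact: at2.1.
  - by move=> a /sE1[].
  - apply: holM; first by apply: (hol_sub _ hK) => z hz; left.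
    by apply: holM; [apply: holM; [exact: hol_id|apply: hol_ratl; apply: ratl_inv; right]|exact: hol_cst].
(* The symmetry z -> 1 / z relates the values of [K] at the two poles and makes their contributions
   equal. *)
have KV : K x^-1 * x^-1 = K x * x.
  have bi r c d : nome r -> c != 0 -> basis_fun n r x c d x^-1 = basis_fun n r x c d x.
    by move=> [r0 r1] c0; rewrite /basis_fun /ThA /ThB !Th_inv.
  have al (a a' b1 b1' c c' : R[i]) : a = a' -> b1 = b1' -> c * x^-1 = c' * x -> a * b1 * c * x^-1 = a' * b1' * c' * x.
    by move=> -> -> e1; rewrite -!mulrA e1.
  exact: (al _ _ _ _ _ _ (bi _ _ _ np b0) (bi _ _ _ nq b0') (weight1_inv x0)).
have Kx : K x = weight1 p q x t x.
  have bi r c : Th x c r != 0 -> basis_fun n r x c 0 x = 1.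
    by move=> h; rewrite /basis_fun /ThB expr0 mul1r mulfV// expr1n.
  by rewrite /K !bi// !mul1r.
have x20 : 1 - x * x != 0 by rewrite subr_eq0 eq_sym -expr2.
rewrite i1 i2 at1.2 at2.2 /pinch_residue (Gam_Gam1 (x ^+ 2) p1 q1).
transitivity (two_pi_i R * 1 * (2 * (K x * x) / (1 - x * x))).
  have al (c u v w : R[i]) : 1 - w * w != 0 -> w != 0 -> v * w^-1 = u * w ->
      c * 1 * (u * (w * (1 - w * w)^-1)) + c * -1 * (v * (w^-1 * (w^-1 - w)^-1 * - w^-1)) = c * 1 * (2 * (u * w) / (1 - w * w)).
    move=> w2 w0 e1; rewrite (_ : v * _ = v * w^-1 * ((w^-1 - w)^-1 * - w^-1)); last by ring.
    rewrite e1 (_ : w^-1 - w = (1 - w * w) / w); last by field.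
    by field; rewrite w0 w2.
  exact: al.
rewrite Kx /weight1 /weight mulfV// expr2.
have al (c a d P T X D : R[i]) : c != 0 -> X != 0 -> c * 1 * (2 * (a * d * (P * T * (c * X)^-1) * X) * D) = 2 * (a * D) * d * P * T.
  by move=> c0 X0; field; rewrite c0 X0.
by apply: al; [exact: two_pi_i_neq0|exact: x0].
Qed.

End FixedParameter.
End Pinch.

(** * The limit at the pinch *)

Section PinchLimit.
Variable R : realType.
Notation C := (R[i])^o.
Local Opaque dp Th.

Lemma det_corner (K : comNzRingType) m (f : nat -> nat -> K) r :
  \det (\matrix_(j < m.+1, k < m.+1) (f j k + (if (j == 0 :> nat)%N && (k == 0 :> nat)%N then r else 0))) =
  \det (\matrix_(j < m.+1, k < m.+1) f j k) + r * \det (\matrix_(j < m, k < m) f j.+1 k.+1).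
Proof.
set M := \matrix_(_, _) (_ + _); set N := \matrix_(j < m.+1, k < m.+1) f j k.
have cMN k : cofactor M ord0 k = cofactor N ord0 k.
  by rewrite /cofactor; congr (_ * \det _); apply/matrixP => i j; rewrite !mxE /= addr0.
rewrite (expand_det_row M ord0) (expand_det_row N ord0).
under eq_bigr do rewrite cMN mxE mulrDl.
rewrite big_split /=; congr (_ + _); first by apply: eq_bigr => k _; rewrite mxE.
rewrite big_ord_recl big1 ?addr0 /=; last by move=> k _; rewrite mul0r.
rewrite /cofactor addn0 expr0 mul1r; congr (_ * \det _); apply/matrixP => i j.
by rewrite !mxE.
Qed.

Lemma pow2_lt1 (p q : R[i]) i j : nome p -> nome q -> p ^+ i * q ^+ j = 1 -> i = 0%N /\ j = 0%N.
Proof.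
move=> [p0 p1] [q0 q1] e.
have h (r : R[i]) k : cabs r < 1 -> cabs (r ^+ k) <= 1.
  by move=> r1; rewrite cabsX exprn_ile1 ?cabs_ge0// ltW.
have h1 (r : R[i]) k : cabs r < 1 -> cabs (r ^+ k.+1) < 1.
  by move=> r1; rewrite cabsX exprn_ilt1 ?cabs_ge0.
have e1 : cabs (p ^+ i) * cabs (q ^+ j) = 1 by rewrite -cabsM e cabs1.
have gt (a b : R) : 0 <= a -> 0 <= b -> a * b = 1 -> a <= 1 -> b <= 1 -> a = 1 /\ b = 1.
  by move=> a0 b0 ab a1 b1; split; nra.
have [a b] := gt _ _ (cabs_ge0 _) (cabs_ge0 _) e1 (h p i p1) (h q j q1).
split; [case: i a {e e1} => // i a|case: j b {e e1} => // j b].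
  by have := h1 p i p1; rewrite a ltxx.
by have := h1 q j q1; rewrite b ltxx.
Qed.

(** The source of (p;p) (q;q) in the recursion. *)
Lemma Gam1_1 (p q : R[i]) : nome p -> nome q -> Gam1 1 p q = (qp p p * qp q q)^-1.
Proof.
move=> np nq; have [p0 p1] := np; have [q0 q1] := nq.
have h : dp (p * q) p q != 0.
  apply: dp_neq0 => // j k; apply/eqP => e.
  have [] : j.+1 = 0%N /\ k.+1 = 0%N by apply: (@pow2_lt1 p q) => //; rewrite -e !exprSr; ring.
  by [].
by rewrite /Gam1 dp1_1// divr1 invfM [X in _ * X]mulrC mulrA mulfV// mul1r.
Qed.

Lemma dp_pqM (p q x : R[i]) : nome p -> nome q -> dp x p q != 0 -> dp (p * q * x) p q != 0.
Proof.
move=> [p0 p1] [q0 q1] h; apply: dp_neq0 => // j k; apply/eqP => e; move: h.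
by rewrite (@dp_eq0 _ x p q j.+1 k.+1) ?eqxx// -e !exprSr; ring.
Qed.

Lemma dp_pqZ (p q x : R[i]) : nome p -> nome q -> ~ pqZ p q x -> dp x p q != 0.
Proof.
move=> [p0 p1] [q0 q1] h; apply: dp_neq0 => // j k; apply/eqP => e; apply: h.
by exists j, k, 0%N, 0%N; rewrite !expr0 mulr1.
Qed.

Lemma Gam_inv (p q x : R[i]) : nome p -> nome q -> dp x p q != 0 -> dp x^-1 p q != 0 ->
  Gam x p q * Gam x^-1 p q * (th x p * th x^-1 q) = 1.
Proof.
move=> np nq h1 h2; have h3 := dp_pqM np nq h1; have h4 := dp_pqM np nq h2.
rewrite -(GamM np.2 nq.2 h1 h2 h4 h3) mulfV// !GamE invrK; apply: mulf_neq0.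
  by apply: mulf_neq0; rewrite ?invr_eq0.
by apply: mulf_neq0; rewrite ?invr_eq0.
Qed.

(** Two reflection formulas combined. In an integrand the gamma factors of a pair of parameters x, 1
    / x cancel against the two theta functions that vanish at x; this removes the pair from the
    minor that multiplies the residue. *)
Lemma Th_Gam (p q x z : R[i]) : nome p -> nome q -> x != 0 -> z != 0 ->
  dp (x * z) p q != 0 -> dp (x / z) p q != 0 -> dp (x^-1 * z) p q != 0 -> dp (x^-1 / z) p q != 0 ->
  Th z x p * Th z x q * (Gam (x * z) p q * Gam (x / z) p q) * (Gam (x^-1 * z) p q * Gam (x^-1 / z) p q) = 1.
Proof.
move=> np nq x0 z0 h1 h2 h3 h4.
have e1 : (x * z)^-1 = x^-1 / z by rewrite invfM.
have e2 : (x^-1 * z)^-1 = x / z by rewrite invfM invrK.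
have g1 := Gam_inv np nq h1; rewrite e1 in g1; have {}g1 := g1 h4.
have g2 := Gam_inv np nq h3; rewrite e2 in g2; have {}g2 := g2 h2.
rewrite -[RHS]mulr1 -{1}g1 -g2 !ThE -e1 (th_inv nq.2 (mulf_neq0 x0 z0)) e1 -e2.
rewrite (th_inv nq.2 (mulf_neq0 (invr_neq0 x0) z0)) e2 (mulrC z x) (mulrC z x^-1).
move: (th _ _) (th _ _) (th _ _) (th _ _) (Gam _ _ _) (Gam _ _ _) (Gam _ _ _) (Gam _ _ _) => *.
by field; rewrite x0 z0.
Qed.

Lemma avoids_cons (p q x : R[i]) t Ct : adm p q [:: p * x, q * x & t] Ct -> contour_excludes Ct x ->
  contour_contains Ct x^-1 -> avoids Ct (poles p q (x :: t)).
Proof.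
move=> ad Sx SV; have av := adm_avoids ad.
move=> a [->|/inner_poles_cons[->|h]|/inner_poles_cons[e|h]]; [exact: ad.1|exact: Sx.1| | |].
- by apply: av; constructor 2.
- by rewrite -[a]invrK e; exact: SV.1.
- by apply: av; constructor 3.
Qed.

Section Limit.
Variables (m : nat) (p q P t2 u v : R[i]) (s : seq R[i]) (x_ : nat -> R[i]).
Let x0 := t2^-1.
Let t (x : R[i]) := [:: x, P / x, t2 & s].
Hypotheses (np : nome p) (nq : nome q) (P0 : P != 0) (t20 : t2 != 0) (s0 : all (fun x => x != 0) s).
Hypotheses (gPP : ~ pqZ p q P) (g2 : forall y y', y \in [:: P * t2, t2 & s] -> y' \in [:: P * t2, t2 & s] -> ~ pqZ p q (y * y')).
Hypothesis gd : forall y, y \in s -> ~ pqZ p q (y / t2).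
Hypotheses (xn0 : forall k, x_ k != 0) (cx : ccvg \oo x_ x0) (gx : forall k, gen p q (t (x_ k))).
Hypothesis hD : forall k, has_ratio m.+1 p q (t (x_ k)) v.
Hypothesis hd : has_ratio m p q [:: P * t2 & s] u.

(** As x tends to x0 = 1 / t2, no contour can contain x and exclude 1 / t2 in the limit. So the
    contour is only required to be admissible for p x0, q x0 and the other parameters; as t2 is
    among these, it excludes x0. *)
Let big := [:: p * x0, q * x0, P * t2, t2 & s].
Let p0 := np.1. Let p1 := np.2. Let q0 := nq.1. Let q1 := nq.2.
Let x00 : x0 != 0. Proof. by rewrite invr_eq0. Qed.

Let bign : all (fun x => x != 0) big.
Proof. by rewrite /= !mulf_neq0 ?p0 ?q0 ?x00 ?P0 ?t20. Qed.

Let Pt x : x != 0 -> all (fun x => x != 0) (t x).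
Proof. by move=> h; rewrite /= h t20 s0 mulf_neq0 ?invr_eq0. Qed.

Let w2 w w' : w \in [:: x0, P * t2, t2 & s] -> w' \in [:: x0, P * t2, t2 & s] ->
  ~ pqZ p q (w * w') \/ (w * w' = 1 /\ (w = x0 \/ w' = x0)).
Proof.
have hx y : y \in [:: P * t2, t2 & s] -> ~ pqZ p q (x0 * y) \/ x0 * y = 1.
  rewrite !inE => /or3P[/eqP->|/eqP->|ys].
  - by left; rewrite /x0 mulrCA mulVf// mulr1.
  - by right; rewrite mulVf.
  - by left; rewrite mulrC; exact: gd.
have hxx : ~ pqZ p q (x0 * x0).
  have h : ~ pqZ p q (t2 * t2) by apply: g2; rewrite !inE eqxx orbT.
  move=> h'; apply: h; rewrite -[t2 * t2]invrK invfM; apply: pqZV => //.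
  by rewrite mulf_neq0.
rewrite [w \in _]inE [w' \in _]inE => /predU1P[->|hw] /predU1P[->|hw'].
- by left.
- by have [h|h] := hx _ hw'; [left|right; split=> //; left].
- by rewrite [w * _]mulrC; have [h|h] := hx _ hw; [left|right; split=> //; right].
- by left; exact: g2.
Qed.

(** By [w2] a product of two of x0, P t2, t2, s lies in the group only if it is 1 and one of the two
    is x0. In [big] every occurrence of x0 carries a factor p or q, and then the product cannot be
    1. *)
Let gbig : gen p q big.
Proof.
have h w : w \in big -> exists a b w', [/\ w = p ^+ a * q ^+ b * w', w' \in [:: x0, P * t2, t2 & s] & w' = x0 -> (0 < a + b)%N].
  rewrite inE => /predU1P[->|].
    by exists 1%N, 0%N, x0; rewrite expr1 expr0 mulr1 mem_head.
  rewrite inE => /predU1P[->|hw].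
    by exists 0%N, 1%N, x0; rewrite expr1 expr0 mul1r mem_head.
  have [e|e] := eqVneq w x0; last first.
    by exists 0%N, 0%N, w; rewrite !expr0 !mul1r inE hw orbT; split=> // /eqP; rewrite (negPf e).
  exfalso; move: hw; rewrite e !inE => /or3P[/eqP h|/eqP h|h].
  - have := @g2 (P * t2) t2; rewrite !inE !eqxx /= orbT -h mulVf// => /(_ isT isT); apply; exact: pqZ1.
  - have := @g2 t2 t2; rewrite !inE !eqxx /= orbT -{1}h mulVf// => /(_ isT isT); apply; exact: pqZ1.
  - have := @g2 x0 t2; rewrite !inE h !eqxx /= !orbT mulVf// => /(_ isT isT); apply; exact: pqZ1.
move=> y y' i j /h[a [b [w [-> hw aw]]]] /h[a' [b' [w' [-> hw' aw']]]]; apply/eqP => e.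
have e' : p ^+ (i + a + a') * q ^+ (j + b + b') * (w * w') = 1 by rewrite -e !exprD; ring.
have [h1|[h1 h2]] := w2 hw hw'.
  by apply: h1; exists (i + a + a')%N, (j + b + b')%N, 0%N, 0%N; rewrite e' !expr0 mulr1.
move: e'; rewrite h1 mulr1 => /(pow2_lt1 np nq)[e1 e2].
by case: h2 => [/aw h3|/aw' h3]; clear -e1 e2 h3; lia.
Qed.

(** In the factor, 2 is that of [pinch_residue], m + 1 is a quotient of factorials, and the
    denominator comes from [Gam1_1]. The other gamma factors agree on both sides once the reflection
    formula is applied to x0^2 = t2^-2. *)
Lemma pinch_limit : v = u * (2 * m.+1%:R / (qp p p * qp q q)).
Proof.
have [Ct adb] := exists_adm np nq bign gbig.
have x0E : x0^-1 = t2 by rewrite invrK.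
have [ct2 ex2] : contour_contains Ct t2 /\ contour_excludes Ct x0.
  by apply: adb.2; exists t2, 0%N, 0%N; rewrite !expr0 !mul1r !inE eqxx !orbT.
have [b b0 hb] := exists_basis_at np x00; have [b' b0' hb'] := exists_basis_at nq x00.
pose Tt x := [:: p * x, q * x & behead (t x)].
have Tbig : Tt x0 = big by rewrite /Tt /= x0E.
have Tn : all (fun x => x != 0) (Tt x0) by rewrite Tbig.
have adT : adm p q (Tt x0) Ct by rewrite Tbig.
have cp : ccvg \oo (fun _ : nat => p) p by exact: ccvg_cst.
have cq : ccvg \oo (fun _ : nat => q) q by exact: ccvg_cst.
have cPx : ccvg \oo (fun k => P / x_ k) (P / x0).
  by apply: ccvgM; [exact: ccvg_cst|apply: ccvgV; [exact: x00|exact: cx]].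
have ctt i : (i < size (t x0))%N -> ccvg \oo (fun k => (t (x_ k))`_i) (t x0)`_i.
  by move=> _; case: i => [|[|i]]; [exact: cx|exact: cPx|exact: ccvg_cst].
have ctT i : (i < size (Tt x0))%N -> ccvg \oo (fun k => (Tt (x_ k))`_i) (Tt x0)`_i.
  move=> _; case: i => [|[|[|i]]]; [ | |exact: cPx|exact: ccvg_cst].
    by apply: ccvgM; [exact: cp|exact: cx].
  by apply: ccvgM; [exact: cq|exact: cx].
have stT k : size (Tt (x_ k)) = size (Tt x0) by [].
have stt k : size (t (x_ k)) = size (t x0) by [].
have Tne : Tt x0 != [::] by [].
have adn : \forall k \near \oo, adm p q (Tt (x_ k)) Ct.
  exact: (adm_near np nq Tn cp cq stT ctT Tne adT).
have cV : ccvg \oo (fun k => (x_ k)^-1) t2 by rewrite -x0E; apply: ccvgV; [exact: x00|exact: cx].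
have exn : \forall k \near \oo, contour_excludes Ct (x_ k).
  have h : \forall k \near \oo, ~ contour_support Ct (x_ k) /\ winding Ct (x_ k) = winding Ct x0 := @cx _ (winding_near ex2.1).
  apply: filterS h => k [h1 h2]; split; first exact: h1.
  by rewrite h2 ex2.2.
have con : \forall k \near \oo, contour_contains Ct (x_ k)^-1.
  have h : \forall k \near \oo, ~ contour_support Ct (x_ k)^-1 /\ winding Ct (x_ k)^-1 = winding Ct t2 := @cV _ (winding_near ct2.1).
  apply: filterS h => k [h1 h2]; split; first exact: h1.
  by rewrite h2 ct2.2.
have avl : avoids Ct (poles p q (t x0)).
  by apply: (avoids_cons adT ex2); rewrite x0E.
have avn : \forall k \near \oo, avoids Ct (poles p q (t (x_ k))).
  by apply: (@filterS2 _ \oo _ _ _ _ _ adn (filterI exn con)) => k h1 [h2 h3]; exact: (avoids_cons h1 h2 h3).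
have cb : ccvg \oo (fun k => Th (x_ k) b p) (Th x0 b p).
  by apply: ccvg_Th; [exact: p1|exact: x00|exact: b0|exact: cx|exact: ccvg_cst|exact: cp].
have cb' : ccvg \oo (fun k => Th (x_ k) b' q) (Th x0 b' q).
  by apply: ccvg_Th; [exact: q1|exact: x00|exact: b0'|exact: cx|exact: ccvg_cst|exact: cq].
have bn : \forall k \near \oo, Th (x_ k) b p != 0 by exact: (ccvg_near_neq0 hb cb).
have bn' : \forall k \near \oo, Th (x_ k) b' q != 0 by exact: (ccvg_near_neq0 hb' cb').
(* The base points move with x, because [pinch_moment] needs [x_ k] itself as base point. *)
pose mom k i j := moment m.+1 p q (t (x_ k)) (x_ k) b (x_ k) b' Ct i j.
pose mom0 i j := moment m.+1 p q (t x0) x0 b x0 b' Ct i j.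
have cmom i j : ccvg \oo (fun k => mom k i j) (mom0 i j).
  exact: (@ccvg_moment R nat \oo _ (fun _ => p) (fun _ => q) (fun k => t (x_ k)) p q (t x0) np nq (Pt x00) cp cq
    stt ctt Ct m.+1 x_ x_ x0 b x0 b' i j avl avn cx cx x00 b0 hb x00 b0' hb').
pose detN k := \det (\matrix_(i < m.+1, j < m.+1) mom k i j).
pose detm k := \det (\matrix_(i < m, j < m) mom k i.+1 j.+1).
pose N0 := \det (\matrix_(i < m.+1, j < m.+1) mom0 i j).
pose m0 := \det (\matrix_(i < m, j < m) mom0 i.+1 j.+1).
have cN : ccvg \oo detN N0 by apply: ccvg_det => i j; exact: cmom.
have cm : ccvg \oo detm m0 by apply: ccvg_det => i j; exact: cmom.
(* For late k the fixed contour satisfies the hypotheses of [pinch_moment] at [x_ k]; the integral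
   is thus split into a convergent determinant and the residue times a minor. *)
have eqk : \forall k \near \oo, (m.+1)`!%:R * (detN k + pinch_residue p q (x_ k) (behead (t (x_ k))) * detm k) =
    v * pair_prod p q (t (x_ k)).
  apply: (@filterS2 _ \oo _ _ _ _ _ (filterI adn bn) (filterI bn' (filterI exn con))) => k [h1 h2] [h3 [h4 h5]].
  have tn : all (fun x => x != 0) (behead (t (x_ k))) by have /andP[] := Pt (xn0 k).
  have [Cx [adx hx]] := pinch_moment m.+1 np nq (xn0 k) tn (@gx k) h1 h4 h5 b0 h2 b0' h3.
  rewrite -(hD adx) (clean_intE m.+1 np nq adx (xn0 k) b0 h2 (xn0 k) b0' h3).
  rewrite /detN /detm -(det_corner m (mom k)); congr (_ * \det _).
  by apply/matrixP => i j; rewrite !mxE; exact/esym/hx.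
have h22 : ~ pqZ p q (t2 * t2) by apply: g2; rewrite !inE eqxx orbT.
have hxx : ~ pqZ p q (x0 ^+ 2).
  by move=> h; apply: h22; rewrite -[t2 * t2]invrK invfM; apply: pqZV; rewrite ?mulf_neq0.
have hP2 : ~ pqZ p q (P * t2 * t2) by apply: g2; rewrite !inE eqxx ?orbT.
have hP y : y \in s -> ~ pqZ p q (P * t2 * y) by move=> ys; apply: g2; rewrite !inE ?eqxx ?ys ?orbT.
have h2 y : y \in s -> ~ pqZ p q (t2 * y) by move=> ys; apply: g2; rewrite !inE ?eqxx ?ys ?orbT.
have cG (f : nat -> R[i]) l : l != 0 -> ~ pqZ p q l -> ccvg \oo f l -> ccvg \oo (fun k => Gam (f k) p q) (Gam l p q).
  move=> l0 hl cf; apply: ccvg_Gam; [exact: p1|exact: q1|exact: l0|exact: dp_pqZ|exact: cf|exact: cp|exact: cq].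
have sn y : y \in s -> y != 0 by move=> ys; exact: (allP s0).
have cprod (f : R[i] -> nat -> R[i]) (l : R[i] -> R[i]) : (forall y, y \in s -> ccvg \oo (f y) (l y)) ->
    ccvg \oo (fun k => \prod_(y <- s) f y k) (\prod_(y <- s) l y).
  move=> h; rewrite big_seq; under eq_fun do rewrite big_seq.
  by apply: ccvg_prod => y; exact: h.
have c1 : ccvg \oo (fun k => P / x_ k * x_ k) P.
  by have : ccvg \oo (fun k => P / x_ k * x_ k) (P / x0 * x0); [apply: ccvgM; [exact: cPx|exact: cx]|rewrite divfK].
have c1' : ccvg \oo (fun k => x_ k * (P / x_ k)) P.
  by under eq_fun do rewrite mulrC; exact: c1.
have cPx' : ccvg \oo (fun k => P / x_ k) (P * t2) by move: cPx; rewrite x0E.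
have c2 : ccvg \oo (fun k => P / x_ k / x_ k) (P * t2 * t2) by apply: ccvgM; [exact: cPx'|exact: cV].
have c3 : ccvg \oo (fun k => t2 / x_ k) (t2 * t2) by apply: ccvgM; [exact: ccvg_cst|exact: cV].
have c4 y : ccvg \oo (fun k => y * x_ k) (y / t2) by apply: ccvgM; [exact: ccvg_cst|exact: cx].
have c4' y : ccvg \oo (fun k => x_ k * y) (y / t2) by under eq_fun do rewrite mulrC; exact: c4.
have c5 y : ccvg \oo (fun k => y / x_ k) (t2 * y) by rewrite mulrC; apply: ccvgM; [exact: ccvg_cst|exact: cV].
have c6 y : ccvg \oo (fun k => P / x_ k * y) (P * t2 * y) by apply: ccvgM; [exact: cPx'|exact: ccvg_cst].
have c7 : ccvg \oo (fun k => x_ k ^+ 2) (x0 ^+ 2) by apply: ccvgX; exact: cx.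
have c8 : ccvg \oo (fun k => x_ k ^- 2) (x0 ^- 2) by apply: ccvgV; [rewrite expf_neq0|exact: c7].
have cT : ccvg \oo (fun k => th (x_ k ^+ 2) p * th (x_ k ^- 2) q) (th (x0 ^+ 2) p * th (x0 ^- 2) q).
  apply: ccvgM; apply: ccvg_th; [exact: p1| |exact: c7|exact: cp|exact: q1| |exact: c8|exact: cq]; by rewrite ?invr_eq0 expf_neq0.
have c9 : ccvg \oo (fun k => x_ k * t2) 1.
  have : ccvg \oo (fun k => x_ k * t2) (x0 * t2) by apply: ccvgM; [exact: cx|exact: ccvg_cst].
  by rewrite mulVf.
have d2 : dp (p * q / 1) p q != 0.
  rewrite divr1; apply: dp_neq0 => // j k; apply/eqP => e.
  have [] : j.+1 = 0%N /\ k.+1 = 0%N by apply: (@pow2_lt1 p q) => //; rewrite -e !exprSr; ring.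
  by [].
have cd : ccvg \oo (fun k => dp (p * q / (x_ k * t2)) p q) (dp (p * q / 1) p q).
  apply: ccvg_dp; [exact: p1|exact: q1| |exact: cp|exact: cq].
  by apply: ccvgM; [exact: ccvg_cst|apply: ccvgV; [exact: oner_neq0|exact: c9]].
have dn : \forall k \near \oo, dp (p * q / (x_ k * t2)) p q != 0 by exact: (ccvg_near_neq0 d2 cd).
have cg : ccvg \oo (fun k => (Gam (x_ k * t2) p q)^-1) 0.
  have d1 : dp 1 p q = 0 by apply: (@dp_eq0 _ 1 p q 0 0); rewrite ?p1 ?q1 ?expr0 ?mulr1.
  under eq_fun do rewrite GamE invf_div.
  have : ccvg \oo (fun k => dp (x_ k * t2) p q / dp (p * q / (x_ k * t2)) p q) (dp 1 p q / dp (p * q / 1) p q).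
    apply: ccvgM; first by apply: ccvg_dp; [exact: p1|exact: q1|exact: c9|exact: cp|exact: cq].
    by apply: ccvgV; [exact: d2|exact: cd].
  by rewrite d1 mul0r.
(* Dividing by [Gam (x * t2)], which tends to infinity, leaves only the residue in the limit. *)
have lim : (m.+1)`!%:R * (N0 * 0 + 2 * Gam (x0 ^+ 2) p q * Gam1 1 p q * (Gam P p q * Gam (P * t2 * t2) p q *
      (Gam (t2 * t2) p q * \prod_(y <- s) (Gam (y / t2) p q * Gam (t2 * y) p q))) *
      (th (x0 ^+ 2) p * th (x0 ^- 2) q) * m0) =
    v * (Gam P p q * \prod_(y <- s) Gam (y / t2) p q * (Gam (P * t2 * t2) p q * \prod_(y <- s) Gam (P * t2 * y) p q *
      (\prod_(y <- s) Gam (t2 * y) p q * pair_prod p q s))).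
  apply: (@ccvg_uniq _ _ \oo _ (fun k => (m.+1)`!%:R * (detN k * (Gam (x_ k * t2) p q)^-1 +
      2 * Gam (x_ k ^+ 2) p q * Gam1 1 p q * (Gam (P / x_ k * x_ k) p q * Gam (P / x_ k / x_ k) p q *
      (Gam (t2 / x_ k) p q * \prod_(y <- s) (Gam (y * x_ k) p q * Gam (y / x_ k) p q))) *
      (th (x_ k ^+ 2) p * th (x_ k ^- 2) q) * detm k))).
    apply: ccvgM; first exact: ccvg_cst.
    apply: ccvgD; first by apply: ccvgM; [exact: cN|exact: cg].
    apply: ccvgM; last exact: cm.
    apply: ccvgM; last exact: cT.
    apply: ccvgM; last first.
      apply: ccvgM; first by apply: ccvgM; apply: cG; [exact: P0|exact: gPP|exact: c1|rewrite !mulf_neq0|exact: hP2|exact: c2].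
      apply: ccvgM; first by apply: cG; [rewrite mulf_neq0|exact: h22|exact: c3].
      apply: cprod => y ys; apply: ccvgM; apply: cG; [|exact: gd|exact: c4| |exact: h2|exact: c5].
        by rewrite mulf_neq0 ?invr_eq0// sn.
      by rewrite mulf_neq0// sn.
    apply: ccvgM; last exact: ccvg_cst.
    by apply: ccvgM; [exact: ccvg_cst|apply: cG; [rewrite expf_neq0|exact: hxx|exact: c7]].
  apply: (@ccvg_eq _ _ \oo _ (fun k => v * (Gam (x_ k * (P / x_ k)) p q * \prod_(y <- s) Gam (x_ k * y) p q *
      (Gam (P / x_ k * t2) p q * \prod_(y <- s) Gam (P / x_ k * y) p q * (\prod_(y <- s) Gam (t2 * y) p q * pair_prod p q s))))).
    apply: (@filterS2 _ \oo _ _ _ _ _ eqk dn) => k ek dk.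
    have gk : Gam (x_ k * t2) p q != 0.
      rewrite GamE; apply: mulf_neq0; first exact: dk.
      rewrite invr_eq0; apply: dp_neq0; [exact: p1|exact: q1|move=> i j].
      by apply: (@gx k); rewrite /t !inE eqxx ?orbT.
    move: ek; rewrite /pinch_residue /= !big_cons (mulrC t2 (x_ k)).
    have al (g F D Gx G1 A B C' S T d E Sx H K L : R[i]) : g != 0 ->
        F * (D + 2 * Gx * G1 * (A * B * (g * C' * S)) * T * d) = v * (E * (g * Sx) * (H * K * L)) ->
        v * (E * Sx * (H * K * L)) = F * (D * g^-1 + 2 * Gx * G1 * (A * B * (C' * S)) * T * d).
      move=> g0 e; apply: (mulfI g0); transitivity (v * (E * (g * Sx) * (H * K * L))); first by ring.
      by rewrite -e; field.
    exact: al gk.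
  apply: ccvgM; first exact: ccvg_cst.
  apply: ccvgM.
    apply: ccvgM; first by apply: cG; [exact: P0|exact: gPP|exact: c1'].
    by apply: cprod => y ys; apply: cG; [rewrite mulf_neq0 ?invr_eq0// sn|exact: gd|exact: c4'].
  apply: ccvgM; last exact: ccvg_cst.
  apply: ccvgM; first by apply: cG; [rewrite !mulf_neq0|exact: hP2|exact: c6].
  by apply: cprod => y ys; apply: cG; [rewrite !mulf_neq0// sn|exact: hP|exact: c6].
have m0E : m`!%:R * m0 = u * (\prod_(y <- s) Gam (P * t2 * y) p q * pair_prod p q s).
  have adm' : adm p q [:: P * t2 & s] Ct.
    apply: adm_subset adb => y hy; exists 0%N, 0%N, y; rewrite !expr0 !mul1r; split=> //.
    by move: hy; rewrite !inE => /orP[->|->]; rewrite !orbT.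
  rewrite -[RHS](hd adm') (clean_intE m np nq adm' x00 b0 hb x00 b0' hb'); congr (_ * \det _).
  apply/matrixP => i j; rewrite !mxE; apply: eq_contour_integral => z Sz.
  have z0 : z != 0 by apply/eqP => e; apply: adb.1; rewrite -e.
  have [d1 d5] : dp (x0 * z) p q != 0 /\ dp (x0 / z) p q != 0.
    by apply: (dp_support np nq avl x00 _ Sz); rewrite mem_head.
  have [d3 d4] : dp (t2 * z) p q != 0 /\ dp (t2 / z) p q != 0.
    by apply: (dp_support np nq avl t20 _ Sz); rewrite !inE eqxx !orbT.
  rewrite -x0E in d3 d4; have key := Th_Gam np nq x00 z0 d1 d5 d3 d4.
  rewrite /weight /t !big_cons /basis_fun !exprS.
  have ei (k : 'I_m) : (m.+1.-1 - k.+1 = m.-1 - k)%N by case: m k => [[]|m' k] //=; rewrite subSS.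
  rewrite !ei; move: key; rewrite x0E.
  have -> : Th z x0 p = ThA p x0 z by [].
  have -> : Th z x0 q = ThA q x0 z by [].
  have al (a a' g1 g2' ai aj B B' H S T W : R[i]) : a * a' * g1 * g2' = 1 ->
      a * ai * B * (a' * aj * B') * (g1 * (H * (g2' * S)) * T * W) = ai * B * (aj * B') * (H * S * T * W).
    move=> e; transitivity (a * a' * g1 * g2' * (ai * B * (aj * B') * (H * S * T * W))); first by ring.
    by rewrite e mul1r.
  exact: al.
have key : Gam (x0 ^+ 2) p q * Gam (t2 * t2) p q * (th (x0 ^+ 2) p * th (x0 ^- 2) q) = 1.
  have e : (x0 ^+ 2)^-1 = t2 * t2 by rewrite -exprVn x0E.
  rewrite -e; apply: Gam_inv; [exact: np|exact: nq|exact: dp_pqZ|].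
  by rewrite e; exact: dp_pqZ.
move: lim; rewrite mulr0 add0r (Gam1_1 np nq) big_split /= factS natrM.
have al (GX Gtt T f M pr Z A B GP GPt w d : R[i]) : GX * Gtt * T = 1 -> f * d = u * (Z * pr) ->
    GP != 0 -> A != 0 -> GPt != 0 -> Z != 0 -> B != 0 -> pr != 0 ->
    M * f * (2 * GX * w * (GP * GPt * (Gtt * (A * B))) * T * d) = v * (GP * A * (GPt * Z * (B * pr))) ->
    v = u * (2 * M * w).
  move=> e1 e2 n1 n2 n3 n4 n5 n6 e3.
  have X0 : GP * A * (GPt * Z * (B * pr)) != 0 by rewrite !mulf_neq0.
  apply: (mulIf X0); rewrite -e3.
  transitivity (M * 2 * w * GP * GPt * A * B * (GX * Gtt * T) * (f * d)); first by ring.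
  by rewrite e1 e2; ring.
apply: (al _ _ _ _ _ _ _ _ _ _ _ _ _ key m0E).
- exact: Gam_neq0.
- by rewrite prodf_seq_neq0; apply/allP => y ys; apply: Gam_neq0 => //; [rewrite mulf_neq0 ?invr_eq0// sn|exact: gd].
- by apply: Gam_neq0 => //; rewrite !mulf_neq0.
- by rewrite prodf_seq_neq0; apply/allP => y ys; apply: Gam_neq0 => //; [rewrite !mulf_neq0// sn|exact: hP].
- by rewrite prodf_seq_neq0; apply/allP => y ys; apply: Gam_neq0 => //; [rewrite !mulf_neq0// sn|exact: h2].
- apply: pair_prod_neq0 => // y y' ys ys'; by apply: g2; rewrite !inE ?ys ?ys' !orbT.
Qed.

End Limit.
End PinchLimit.

(** * The value of the integral *)

Section CleanValue.
Variable R : realType.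
Notation C := (R[i])^o.
Local Opaque dp qp Th.
Implicit Types (p q : R[i]).

(** [constancy] with w = [x_ k] / t0 replaces t0, t1 by [x_ k] and P / [x_ k], where [x_ k] tends to
    1 / t2. The ratio does not change on the way, and [pinch_limit] determines it. *)
Lemma generic_value m p q t0 t1 t2 t3 s u Ct : nome p -> nome q ->
  all (fun x => x != 0) [:: t0, t1, t2, t3 & s] -> size s = (2 * m.+1)%N ->
  t0 * t1 * t2 * t3 * \prod_(x <- s) x = p * q ->
  has_ratio m p q [:: t0 * t1 * t2, t3 & s] u ->
  (forall y y', y \in [:: t0, t1, t2, t3 & s] -> y' \in [:: t0, t1, t2, t3 & s] -> ~ pqZ p q (y * y')) ->
  (forall y, y \in [:: t0 * t1 * t2, t2, t3 & s] -> ~ pqZ p q (t0 * t1 * t2 * y)) ->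
  (forall y, y \in t3 :: s -> ~ pqZ p q (y / t2)) ->
  adm p q [:: t0, t1, t2, t3 & s] Ct ->
  clean_int m.+1 p q [:: t0, t1, t2, t3 & s] Ct =
    u * (2 * m.+1%:R / (qp p p * qp q q)) * pair_prod p q [:: t0, t1, t2, t3 & s].
Proof.
move=> np nq tn ss tp hu g gP gd ad.
have [t00 t10 t20 t30 s0] : [/\ t0 != 0, t1 != 0, t2 != 0, t3 != 0 & all (fun x => x != 0) s] by move: tn => /= /and5P.
have x00 : t2^-1 != 0 by rewrite invr_eq0.
set P := t0 * t1; have P0 : P != 0 by rewrite mulf_neq0.
have Pt0 : P * t2 != 0 by rewrite mulf_neq0.
have pn0 : pair_prod p q [:: t0, t1, t2, t3 & s] != 0 by exact: pair_prod_neq0.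
(* The products of two entries of the new parameter list, as monomials in 1 + d, as far as they
   depend on d. *)
pose L := [:: (t2^-1 * t2^-1, 2%:Z), ((P * t2) * (P * t2), - 2%:Z) &
   [seq (t2^-1 * y, 1%:Z) | y <- [:: t2, t3 & s]] ++ [seq (P * t2 * y, - 1%:Z) | y <- [:: t2, t3 & s]]].
have hL ce : ce \in L -> ce.1 != 0 /\ ce.2 != 0.
  have n0 y : y \in [:: t2, t3 & s] -> y != 0.
    by move=> ys; apply: (allP tn); rewrite 2!inE ys !orbT.
  rewrite inE => /predU1P[->|]; first by rewrite /= mulf_neq0.
  rewrite inE => /predU1P[->|]; first by rewrite /= mulf_neq0.
  rewrite mem_cat => /orP[] /mapP[y ys ->]; split=> //.
    exact: (mulf_neq0 x00 (n0 _ ys)).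
  exact: (mulf_neq0 Pt0 (n0 _ ys)).
have hx k : exists d : R, 0 < d < k.+1%:R^-1 /\ gen p q [:: t2^-1 * (1 + d)%:C, P / (t2^-1 * (1 + d)%:C), t2, t3 & s].
  have k0 : 0 < k.+1%:R^-1 :> R by rewrite invr_gt0 ltr0Sn.
  have [d dk hd] := generic_perturbation np nq k0 hL; exists d; split=> //.
  have d0 : (1 + d)%:C != 0 :> R[i] by apply: real_1D_neq0; case/andP: dk.
  have key y y' : y \in [:: t2^-1 * (1 + d)%:C, P / (t2^-1 * (1 + d)%:C), t2, t3 & s] ->
      y' \in [:: t2^-1 * (1 + d)%:C, P / (t2^-1 * (1 + d)%:C), t2, t3 & s] -> ~ pqZ p q (y * y').
    move: (1 + d)%:C d0 hd => e e0 he.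
    have eP : P / (t2^-1 * e) = P * t2 * e^-1 by field; rewrite t20 e0.
    have gPP : ~ pqZ p q P by apply: g; rewrite !inE eqxx ?orbT.
    have h1 z : z \in [:: t2, t3 & s] -> ~ pqZ p q (t2^-1 * e * z).
      move=> zs; have := he (t2^-1 * z, 1%:Z); rewrite /= expr1z mulrAC; apply.
      by rewrite 2!inE mem_cat (map_f (fun y => (t2^-1 * y, 1%:Z)) zs) !orbT.
    have h2 z : z \in [:: t2, t3 & s] -> ~ pqZ p q (P * t2 * e^-1 * z).
      move=> zs; have := he (P * t2 * z, - 1%:Z); rewrite /= exprN1 [P * t2 * _ * z]mulrAC; apply.
      by rewrite 2!inE mem_cat (map_f (fun y => (P * t2 * y, - 1%:Z)) zs) !orbT.
    have h3 : ~ pqZ p q (t2^-1 * e * (t2^-1 * e)).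
      have := he (t2^-1 * t2^-1, 2%:Z); rewrite [t2^-1 * e * _]mulrACA /= -(expr2 e); apply.
      by rewrite inE eqxx.
    have h4 : ~ pqZ p q (P * t2 * e^-1 * (P * t2 * e^-1)).
      have := he (P * t2 * (P * t2), - 2%:Z); rewrite [P * t2 * _ * _]mulrACA /= -(expr2 e^-1) exprVn; apply.
      by rewrite !inE eqxx orbT.
    have h5 : ~ pqZ p q (t2^-1 * e * (P * t2 * e^-1)).
      by have -> : t2^-1 * e * (P * t2 * e^-1) = P by field; rewrite t20 e0.
    rewrite eP [y \in _]inE [y' \in _]inE => /predU1P[->|hy] /predU1P[->|hy']; first exact: h3.
    - by move: hy'; rewrite inE => /predU1P[->|/h1].
    - by rewrite mulrC; move: hy; rewrite inE => /predU1P[->|/h1].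
    move: hy hy'; rewrite [y \in _]inE [y' \in _]inE => /predU1P[->|hy] /predU1P[->|hy']; first exact: h4.
    - exact: h2.
    - by rewrite mulrC; exact: h2.
    - by apply: g; rewrite 2!inE ?hy ?hy' !orbT.
  move=> y y' i j ys ys'; apply/eqP => e; apply: (key y y' ys ys').
  by exists i, j, 0%N, 0%N; rewrite !expr0 mulr1.
have [d_ hd] := choice hx.
pose x_ k := t2^-1 * (1 + d_ k)%:C.
have cx : ccvg \oo x_ t2^-1.
  rewrite -[X in ccvg _ _ X]mulr1; apply: ccvgM; first exact: ccvg_cst.
  by apply: ccvg_shrink => k; case: (hd k).
have xn k : x_ k != 0 by rewrite mulf_neq0// real_1D_neq0//; case: (hd k) => /andP[].
pose v := clean_int m.+1 p q [:: t0, t1, t2, t3 & s] Ct / pair_prod p q [:: t0, t1, t2, t3 & s].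
have hv k : has_ratio m.+1 p q [:: x_ k, P / x_ k, t2, t3 & s] v.
  move=> Cx adx; have w0 : x_ k / t0 != 0 by rewrite mulf_neq0 ?invr_eq0.
  have e1 : x_ k / t0 * t0 = x_ k by rewrite divfK.
  have e2 : t1 / (x_ k / t0) = P / x_ k by rewrite /P; field; rewrite t00 xn.
  have := @constancy R m p q t0 t1 t2 t3 (x_ k / t0) s np nq t00 t10 t20 t30 s0 w0 ss tp Ct Cx ad.
  rewrite e1 e2 => /(_ adx) e; apply: (mulIf pn0); rewrite -e /v.
  by rewrite [RHS]mulrAC (divfK pn0).
have s0' : all (fun x => x != 0) (t3 :: s) by rewrite /= t30.
have gPP : ~ pqZ p q P by apply: g; rewrite !inE eqxx ?orbT.
have g2 y y' : y \in [:: P * t2, t2, t3 & s] -> y' \in [:: P * t2, t2, t3 & s] -> ~ pqZ p q (y * y').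
  move=> hy hy'; have := gP y' hy'; move: hy; rewrite inE => /predU1P[->//|hy] _.
  have := gP y; rewrite inE hy orbT => /(_ isT); move: hy'; rewrite inE => /predU1P[->|hy' _].
    by rewrite mulrC.
  by apply: g; rewrite 2!inE ?hy ?hy' !orbT.
rewrite -(pinch_limit np nq P0 t20 s0' gPP g2 gd xn cx (fun k => (hd k).2) hv hu).
by rewrite /v divfK.
Qed.

(** Complementary pairs among the four parameters have products y and p q / y, and Gamma(y) Gamma(p
    q / y) = 1. *)
Lemma value0 p q t Ct : nome p -> nome q -> all (fun x => x != 0) t -> size t = 4%N ->
  \prod_(x <- t) x = p * q -> adm p q t Ct -> pair_prod p q t = 1.
Proof.
move=> np nq; case: t => [//|a [//|b [//|c [//|d [|//]]]]] tn _; rewrite !big_cons big_nil mulr1 => e ad.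
have g := adm_gen np nq tn ad.
have h x y : x \in [:: a; b; c; d] -> y \in [:: a; b; c; d] -> dp (x * y) p q != 0.
  by move=> xt yt; apply: dp_neq0 => [||i j]; [case: np|case: nq|exact: g].
have n0 x : x \in [:: a; b; c; d] -> x != 0 by exact: (allP tn).
have G x y : x * y = p * q -> dp x p q != 0 -> dp y p q != 0 -> x != 0 -> y != 0 -> Gam x p q * Gam y p q = 1.
  move=> xy hx hy x0 y0; rewrite !GamE -xy.
  have -> : x * y / x = y by field.
  have -> : x * y / y = x by field.
  by move: (dp x p q) (dp y p q) hx hy => u v hu hv; field; rewrite hu hv.
have m1 : a \in [:: a; b; c; d] by rewrite !inE eqxx ?orbT.
have m2 : b \in [:: a; b; c; d] by rewrite !inE eqxx ?orbT.
have m3 : c \in [:: a; b; c; d] by rewrite !inE eqxx ?orbT.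
have m4 : d \in [:: a; b; c; d] by rewrite !inE eqxx ?orbT.
have g1 : Gam (a * b) p q * Gam (c * d) p q = 1.
  by apply: G; rewrite ?h ?mulf_neq0 ?n0// -e; ring.
have g2 : Gam (a * c) p q * Gam (b * d) p q = 1.
  by apply: G; rewrite ?h ?mulf_neq0 ?n0// -e; ring.
have g3 : Gam (a * d) p q * Gam (b * c) p q = 1.
  by apply: G; rewrite ?h ?mulf_neq0 ?n0// -e; ring.
rewrite /= !big_cons !big_nil !mulr1.
rewrite -[RHS]mulr1 -{1}g1 -[X in _ = _ * X]mulr1 -{1}g2 -g3.
by move: (Gam _ _ _) (Gam _ _ _) (Gam _ _ _) (Gam _ _ _) (Gam _ _ _) (Gam _ _ _) => *; ring.
Qed.

Definition monomials (e : seq (R[i] * int)) (d : R[i]) := [seq ce.1 * d ^ ce.2 | ce <- e].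

Lemma ccvg_exprz (T : Type) (F : set_system T) {FF : Filter F} (d : T -> R[i]) (e : int) :
  ccvg F d 1 -> ccvg F (fun x => d x ^ e) (1 ^ e).
Proof.
move=> cd; case: e => n; first by apply: ccvgX; exact: cd.
by apply: ccvgV; [rewrite expf_neq0 ?oner_neq0|apply: ccvgX; exact: cd].
Qed.

Lemma ccvg_monomials (T : Type) (F : set_system T) {FF : Filter F} e (d : T -> R[i]) i :
  ccvg F d 1 -> ccvg F (fun x => (monomials e (d x))`_i) (monomials e 1)`_i.
Proof.
move=> cd; elim: e i => [|ce e IH] [|i]; [exact: ccvg_cst|exact: ccvg_cst| |exact: IH].
by apply: ccvgM; [exact: ccvg_cst|apply: ccvg_exprz; exact: cd].
Qed.

Lemma monomials1 e : monomials e 1 = [seq ce.1 | ce <- e].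
Proof. by apply: eq_map => ce; rewrite exp1rz mulr1. Qed.

Lemma prod_monomials e d : d != 0 -> \prod_(x <- monomials e d) x = (\prod_(ce <- e) ce.1) * d ^ (\sum_(ce <- e) ce.2).
Proof.
move=> d0; elim: e => [|ce e IH]; first by rewrite !big_nil mul1r expr0z.
by rewrite /= !big_cons IH expfzDr//; ring.
Qed.

(** Induction on m. Arbitrary parameters are limits of generic ones with the same product, along the
    fixed contour [Ct]; to the generic ones [generic_value] applies, with the induction hypothesis
    for its shorter list. *)
Theorem clean_value m p q t Ct : nome p -> nome q -> all (fun x => x != 0) t -> size t = (2 * m + 4)%N ->
  \prod_(x <- t) x = p * q -> adm p q t Ct ->
  clean_int m p q t Ct = m`!%:R * (2 / (qp p p * qp q q)) ^+ m * pair_prod p q t.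
Proof.
move=> np nq; elim: m t Ct => [|m IH] t Ct.
  move=> tn st tp ad; rewrite (value0 np nq tn st tp ad) /clean_int /= /clean !big_ord0.
  by rewrite fact0 expr0 !mulr1.
move=> tn st; have : (3 < size t)%N by rewrite st; lia.
case: t tn st => [//|t0 [//|t1 [//|t2 [//|t3 s]]]] tn st _ tp ad.
set t := [:: t0, t1, t2, t3 & s] in tn st tp ad *.
have ss : size s = (2 * m.+1)%N by move: st; rewrite /= => st; lia.
have [t00 t10 t20 t30 s0] : [/\ t0 != 0, t1 != 0, t2 != 0, t3 != 0 & all (fun x => x != 0) s] by move: tn => /= /and5P.
set c := _ * _ ^+ m.+1.
have cE : c = m`!%:R * (2 / (qp p p * qp q q)) ^+ m * (2 * m.+1%:R / (qp p p * qp q q)).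
  by rewrite /c factS natrM exprS; move: (qp p p * qp q q)^-1 => w; ring.
(* The exponents 1, 2, 2, - N and 2 m + 2 times 1 add up to 0. *)
pose N := (2 * m.+1 + 5)%N.
pose e3 := (t3, - N%:Z) :: [seq (x, 1%:Z) | x <- s].
(* No two exponents add up to 0, and the exponent of t2 differs from those of t3 and [s], so that
   quotients by t2 are perturbed too. *)
pose e := [:: (t0, 1%:Z), (t1, 2%:Z), (t2, 2%:Z) & e3].
pose P2 := (t0 * t1 * t2, 5%:Z).
(* The genericity hypotheses of [generic_value]: products of two parameters, products with t0 t1 t2,
   and quotients by t2. *)
pose L := [seq (x.1 * y.1, x.2 + y.2) | x <- e, y <- e] ++
  ([seq (P2.1 * y.1, P2.2 + y.2) | y <- [:: P2, (t2, 2%:Z) & e3]] ++ [seq (y.1 / t2, y.2 - 2%:Z) | y <- e3]).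
have eT : monomials e 1 = t.
  by rewrite monomials1 /e /e3 /t /= -map_comp; congr [:: _, _, _, _ & _]; rewrite -[RHS]map_id.
have e3h x : x \in e3 -> x.1 != 0 /\ (x.2 = 1 \/ x.2 = - N%:Z).
  rewrite inE => /predU1P[->|/mapP[y ys ->]]; first by split; [exact: t30|right].
  by split; [exact: (allP s0)|left].
have eh x : x \in e -> x.1 != 0 /\ [\/ x.2 = 1, x.2 = 2 | x.2 = - N%:Z].
  rewrite 3!inE => /predU1P[->|/predU1P[->|/predU1P[->|/e3h[h1 [h2|h2]]]]]; split=> //.
  - by constructor 1.
  - by constructor 2.
  - by constructor 2.
  - by constructor 1.
  - by constructor 3.
have hL ce : ce \in L -> ce.1 != 0 /\ ce.2 != 0.
  rewrite /L mem_cat => /orP[/allpairsP[[x y] /= [hx hy ->]]|]; last rewrite mem_cat => /orP[/mapP[y hy ->]|/mapP[y hy ->]].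
  - have [x0 xe] := eh _ hx; have [y0 ye] := eh _ hy.
    split=> /=; first exact: mulf_neq0.
    by clear -xe ye; case: xe => ->; case: ye => ->; apply/eqP; rewrite /N; lia.
  - have [y0 ye] : y.1 != 0 /\ [\/ y.2 = 5, y.2 = 2, y.2 = 1 | y.2 = - N%:Z].
      move: hy; rewrite 2!inE => /predU1P[->|/predU1P[->|/e3h[h1 [h2|h2]]]]; split=> //.
      + by rewrite !mulf_neq0.
      + by constructor 1.
      + by constructor 2.
      + by constructor 3.
      + by constructor 4.
    split=> /=; first by rewrite !mulf_neq0.
    by clear -ye; case: ye => ->; apply/eqP; rewrite /N; lia.
  - have [y0 ye] := e3h _ hy; split=> /=; first by rewrite mulf_neq0 ?invr_eq0.
    by clear -ye; case: ye => ->; apply/eqP; rewrite /N; lia.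
have hx k : exists d : R, 0 < d < k.+1%:R^-1 /\ forall ce, ce \in L -> ~ pqZ p q (ce.1 * (1 + d)%:C ^ ce.2).
  have k0 : 0 < k.+1%:R^-1 :> R by rewrite invr_gt0 ltr0Sn.
  by have [d dk hd] := generic_perturbation np nq k0 hL; exists d.
have [d_ hd] := choice hx.
have cd : ccvg \oo (fun k => (1 + d_ k)%:C) (1 : R[i]) by apply: ccvg_shrink => k; case: (hd k).
pose t_ k := monomials e (1 + d_ k)%:C.
have cp : ccvg \oo (fun _ : nat => p) p by exact: ccvg_cst.
have cq : ccvg \oo (fun _ : nat => q) q by exact: ccvg_cst.
have szt k : size (t_ k) = size t.
  have h : size (t_ k) = size (monomials e 1) by rewrite [LHS]size_map [RHS]size_map.
  exact: etrans h (f_equal size eT).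
have ct i : (i < size t)%N -> ccvg \oo (fun k => (t_ k)`_i) t`_i.
  move=> _; have ei : (monomials e 1)`_i = t`_i by exact: (f_equal (fun r => r`_i) eT).
  exact: (eq_ind _ (fun l => ccvg \oo (fun k => (t_ k)`_i) l) (@ccvg_monomials _ \oo _ e _ i cd) _ ei).
have tne : t != [::] by [].
have adn : \forall k \near \oo, adm p q (t_ k) Ct by exact: (adm_near np nq tn cp cq szt ct tne ad).
apply: (@ccvg_uniq _ _ \oo _ (fun k => clean_int m.+1 p q (t_ k) Ct)).
  exact: (@ccvg_clean_int R nat \oo _ (fun _ => p) (fun _ => q) t_ p q t np nq tn cp cq szt ct Ct m.+1 tne ad).
apply: (@ccvg_eq _ _ \oo _ (fun k => c * pair_prod p q (t_ k))); last first.
  apply: ccvgM; first exact: ccvg_cst.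
  exact: (@ccvg_pair_prod R nat \oo _ (fun _ => p) (fun _ => q) t_ p q t np nq tn cp cq szt ct (adm_gen np nq tn ad)).
apply: filterS adn => k adk; have [dk dL] := hd k.
have d0 : (1 + d_ k)%:C != 0 :> R[i] by apply: real_1D_neq0; case/andP: dk.
move: adk; rewrite /t_; move: (1 + d_ k)%:C d0 dL => d d0 dL adk.
have mn r : (forall x, x \in r -> x.1 != 0) -> all (fun x => x != 0) (monomials r d).
  by move=> h; apply/allP => _ /mapP[x xr ->]; rewrite mulf_neq0 ?h// expfz_neq0.
have e3n x : x \in e3 -> x.1 != 0 by move=> /e3h[].
have s3 : size (monomials e3 d) = (2 * m.+1).+1 by rewrite !size_map /= size_map ss.
have hprod : \prod_(x <- monomials e d) x = p * q.
  have e1 : \prod_(ce <- e) ce.1 = p * q.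
    by rewrite -tp -eT monomials1 big_map.
  have e2 : \sum_(ce <- e) ce.2 = 0.
    rewrite !big_cons big_map big_const_seq count_predT ss iter_addr_0 /N /=.
    by clear; lia.
  by rewrite prod_monomials// e1 e2 expr0z mulr1.
have mulm x y : x.1 * d ^ x.2 * (y.1 * d ^ y.2) = x.1 * y.1 * d ^ (x.2 + y.2) by rewrite expfzDr//; ring.
have PE : t0 * d ^ 1%:Z * (t1 * d ^ 2%:Z) * (t2 * d ^ 2%:Z) = P2.1 * d ^ P2.2.
  by rewrite (_ : P2.2 = 1%:Z + 2%:Z + 2%:Z)// !expfzDr//=; ring.
have hu : has_ratio m p q [:: t0 * d ^ 1%:Z * (t1 * d ^ 2%:Z) * (t2 * d ^ 2%:Z) & monomials e3 d]
    (m`!%:R * (2 / (qp p p * qp q q)) ^+ m).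
  move=> C' ad'; apply: IH => //.
  - by rewrite PE; apply: (mn (P2 :: e3)) => x; rewrite inE => /predU1P[->|/e3n//]; rewrite !mulf_neq0.
  - transitivity (size (monomials e3 d)).+1; first by [].
    by rewrite s3; clear; lia.
  - by rewrite -hprod /monomials /e /= !big_cons !mulrA.
have eM : monomials e d = [:: t0 * d ^ 1%:Z, t1 * d ^ 2%:Z, t2 * d ^ 2%:Z, t3 * d ^ (- N%:Z) & monomials [seq (x, 1%:Z) | x <- s] d] by [].
rewrite cE eM; rewrite eM in adk; apply/esym; apply: (generic_value np nq _ _ _ hu _ _ _ adk).
- by apply: (mn e) => x /eh[].
- by rewrite !size_map ss.
- by rewrite -hprod /monomials /e /= !big_cons !mulrA.
- move=> _ _ /(@mapP _ _ _ e)[x xe ->] /(@mapP _ _ _ e)[y ye ->]; rewrite mulm.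
  by apply: (dL (x.1 * y.1, x.2 + y.2)); rewrite /L mem_cat; apply/orP; left; apply/allpairsP; exists (x, y).
- rewrite PE => _ /(@mapP _ _ _ [:: P2, (t2, 2%:Z) & e3])[y ye ->]; rewrite mulm.
  by apply: (dL (P2.1 * y.1, P2.2 + y.2)); rewrite /L mem_cat; apply/orP; right; rewrite mem_cat (map_f (fun y => (P2.1 * y.1, P2.2 + y.2)) ye).
- move=> _ /(@mapP _ _ _ e3)[y ye ->].
  have -> : y.1 * d ^ y.2 / (t2 * d ^ 2%:Z) = y.1 / t2 * d ^ (y.2 - 2%:Z).
    by rewrite expfzDr// -exprnN invfM; move: (d ^ y.2) => w; rewrite [d ^ 2%:Z]/(d ^+ 2); ring.
  by apply: (dL (y.1 / t2, y.2 - 2%:Z)); rewrite /L mem_cat; apply/orP; right; rewrite mem_cat (map_f (fun y => (y.1 / t2, y.2 - 2%:Z)) ye) orbT.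
Qed.

End CleanValue.

(** * The meromorphic identity *)

Section Link.
Variables (R : realType) (n : nat).
Notation C := (R[i])^o.
Local Opaque dp Th.
Implicit Types (x : params R n) (Ct : contour R).

Definition par_seq x : seq R[i] := [seq par_t x r | r <- enum 'I_(2 * n + 4)].

Lemma size_par_seq x : size (par_seq x) = (2 * n + 4)%N.
Proof. by rewrite size_map size_enum_ord. Qed.

Lemma mem_par_seq x r : par_t x r \in par_seq x.
Proof. by apply: map_f; rewrite mem_enum. Qed.

Lemma prod_par_seq x (F : R[i] -> R[i]) :
  \prod_(y <- par_seq x) F y = \prod_(r < 2 * n + 4) F (par_t x r).
Proof. by rewrite big_map big_enum. Qed.

Lemma nth_par_seq x (r : 'I_(2 * n + 4)) : (par_seq x)`_r = par_t x r.
Proof. by rewrite (nth_map r) ?size_enum_ord// nth_ord_enum. Qed.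

Lemma nome_cabs (p : R[i]) : 0 < `|p| < 1 -> nome p.
Proof. by rewrite normcE_cabs !ltcR cabs_gt0 => /andP[]. Qed.

Lemma param_setP x : param_set x -> [/\ nome (par_p x), nome (par_q x),
  \prod_(y <- par_seq x) y = par_p x * par_q x & all (fun y => y != 0) (par_seq x)].
Proof.
move=> [/nome_cabs np /nome_cabs nq tp].
have e : \prod_(y <- par_seq x) y = par_p x * par_q x by rewrite prod_par_seq.
split=> //; have := mulf_neq0 np.1 nq.1; rewrite -e prodf_seq_neq0.
by apply: sub_all => y.
Qed.

Lemma admissibleP x Ct : admissible x Ct <-> adm (par_p x) (par_q x) (par_seq x) Ct.
Proof.
split=> [[S0 h]|[S0 h]]; split=> //.
  by move=> _ [_ [i [j [/mapP[r _ ->] ->]]]]; exact: h.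
by move=> r i j; apply: h; exists (par_t x r), i, j; split=> //; exact: mem_par_seq.
Qed.

Lemma ellGamma_Gam (p q y : R[i]) : nome p -> nome q -> y != 0 -> dp y p q != 0 -> ellGamma y p q = Gam y p q.
Proof. by move=> [_ p1] [_ q1]; exact: ellGammaE. Qed.

Lemma prod_ellGamma x : param_set x -> gen (par_p x) (par_q x) (par_seq x) ->
  \prod_(r < 2 * n + 4) \prod_(s < 2 * n + 4 | (r < s)%N) ellGamma (par_t x r * par_t x s) (par_p x) (par_q x) =
  pair_prod (par_p x) (par_q x) (par_seq x).
Proof.
move=> /param_setP[np nq tp /allP tn] g; rewrite pair_prodE size_par_seq.
apply: eq_bigr => r _; apply: eq_bigr => s _; rewrite !nth_par_seq.
apply: ellGamma_Gam => //; first by rewrite mulf_neq0 ?tn ?mem_par_seq.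
by apply: dp_neq0 => [||i j]; [case: np|case: nq|apply: g; exact: mem_par_seq].
Qed.

(** The hypotheses on squares, products and quotients of the variables keep all gamma factors in the
    denominator away from their poles, so that no default value of [ellGamma] occurs. *)
Lemma BC_integrandE x (zs : n.-tuple R[i]) Ct : param_set x -> adm (par_p x) (par_q x) (par_seq x) Ct ->
  (forall i, contour_support Ct (tnth zs i) /\ ~ pqZ (par_p x) (par_q x) (tnth zs i ^+ 2)) ->
  (forall i j : 'I_n, (i < j)%N -> ~ pqZ (par_p x) (par_q x) (tnth zs i * tnth zs j) /\
     ~ pqZ (par_p x) (par_q x) (tnth zs i / tnth zs j)) ->
  BC_integrand x zs = clean (par_p x) (par_q x) (par_seq x) zs.
Proof.
move=> /param_setP[np nq tp tn] ad hz hQ; rewrite /BC_integrand.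
set p := par_p x in np nq tp ad hz hQ *; set q := par_q x in nq tp ad hz hQ *.
have z0 i : tnth zs i != 0.
  by apply/eqP => e; have [h _] := hz i; apply: ad.1; rewrite -e.
have GV y : y != 0 -> ~ pqZ p q y -> [/\ dp y p q != 0, dp y^-1 p q != 0, ellGamma y p q = Gam y p q & ellGamma y^-1 p q = Gam y^-1 p q].
  move=> y0 hy; have h1 : dp y p q != 0 by exact: dp_pqZ.
  have h2 : dp y^-1 p q != 0.
    by apply: dp_pqZ => // h; apply: hy; rewrite -[y]invrK; apply: pqZV; rewrite ?invr_eq0.
  by split=> //; apply: ellGamma_Gam; rewrite ?invr_eq0.
have e1 : \prod_(i < n) \prod_(r < 2 * n + 4) (ellGamma (par_t x r * tnth zs i) p q * ellGamma (par_t x r / tnth zs i) p q) =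
    \prod_(i < n) \prod_(y <- par_seq x) (Gam (y * tnth zs i) p q * Gam (y / tnth zs i) p q).
  apply: eq_bigr => i _; rewrite prod_par_seq; apply: eq_bigr => r _.
  have t0 : par_t x r != 0 by apply: (allP tn); exact: mem_par_seq.
  have [h1 h2] := dp_support np nq (adm_avoids ad) t0 (mem_par_seq x r) (hz i).1.
  have a1 : par_t x r * tnth zs i != 0 by rewrite mulf_neq0.
  have a2 : par_t x r / tnth zs i != 0 by rewrite mulf_neq0 ?invr_eq0.
  exact: f_equal2 (ellGamma_Gam np nq a1 h1) (ellGamma_Gam np nq a2 h2).
have e2 : \prod_(i < n) \prod_(j < n | (i < j)%N) ellGamma4 (tnth zs i) (tnth zs j) p q =
    (\prod_(i < n) \prod_(j < n | (i < j)%N) (Th (tnth zs i) (tnth zs j) p * Th (tnth zs i) (tnth zs j) q))^-1.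
  rewrite -prodfV; apply: eq_bigr => i _; rewrite -prodfV; apply: eq_bigr => j ij.
  have [h1 h2] := hQ i j ij.
  set z := tnth zs i; set w := tnth zs j.
  have [d1 d2 g1 g2] := GV _ (mulf_neq0 (z0 i) (z0 j)) h1.
  have [d3 d4 g3 g4] := GV _ (mulf_neq0 (z0 i) (invr_neq0 (z0 j))) h2.
  rewrite -/z -/w in d1 d2 d3 d4 g1 g2 g3 g4.
  have w1 : w * z = z * w by rewrite mulrC.
  have w2 : w / z = (z / w)^-1 by rewrite invfM invrK mulrC.
  have w3 : w^-1 * z = z / w by rewrite mulrC.
  have w4 : w^-1 / z = (z * w)^-1 by rewrite invfM mulrC.
  have key := Th_Gam np nq (z0 j) (z0 i); rewrite -/z -/w w1 w2 w3 w4 in key.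
  have {}key := key d1 d4 d3 d2.
  rewrite /ellGamma4 (mulrC z^-1 w) w2 -invfM g1 g2 g3 g4.
  apply: (mulIf (x := Th z w p * Th z w q)).
    by apply/eqP => e0; move: key; rewrite e0 !mul0r => /esym/eqP; rewrite oner_eq0.
  rewrite mulVf; last by apply/eqP => e0; move: key; rewrite e0 !mul0r => /esym/eqP; rewrite oner_eq0.
  rewrite -[RHS]key; move: (Gam _ _ _) (Gam _ _ _) (Gam _ _ _) (Gam _ _ _) (Th _ _ _) (Th _ _ _) => *; ring.
have e3 : \prod_(i < n) (ellGamma (tnth zs i ^+ 2) p q * ellGamma (tnth zs i ^- 2) p q) =
    (\prod_(i < n) (th (tnth zs i ^+ 2) p * th (tnth zs i ^- 2) q))^-1.
  rewrite -prodfV; apply: eq_bigr => i _.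
  have z2 : tnth zs i ^+ 2 != 0 by rewrite expf_neq0.
  have [d1 d2 g1 g2] := GV _ z2 (hz i).2.
  have key := Gam_inv np nq d1 d2.
  rewrite g1 g2; move: (Gam _ _ _ * Gam _ _ _) (th _ _ * th _ _) key => u v key.
  have v0 : v != 0 by apply/eqP => e0; move: key; rewrite e0 mulr0 => /esym/eqP; rewrite oner_eq0.
  by apply: (mulIf v0); rewrite key mulVf.
rewrite e1 e2 e3 /clean /weight invfM !invrK.
rewrite [X in _ = _ * X]big_split /= [X in _ = _ * (X * _)]big_split /=.
move: (\prod_(i < n) \prod_(y <- _) _) (\prod_(i < n) \prod_(j < n | _) _) (\prod_(i < n) (th _ _ * _)) (\prod_(i < n) (_^-1)) => a b c d.
by ring.
Qed.

Lemma BC_contour_integralE x Ct : param_set x -> admissible x Ct ->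
  BC_contour_integral x Ct = pair_prod (par_p x) (par_q x) (par_seq x).
Proof.
move=> px /admissibleP ad; have [np nq tp tn] := param_setP px.
set p := par_p x in np nq tp ad *; set q := par_q x in nq tp ad *.
pose B : set R[i] := [set z | pqZ p q (z ^+ 2)].
pose Q (z : R[i]) : set R[i] := [set w | z != 0 /\ (pqZ p q (z * w) \/ pqZ p q (z / w))].
have cB : countable B by apply: countable_pqZ => [||c]; [case: np|case: nq|exact: countable_fib2].
have cQ z : countable (Q z).
  have [->|z0] := eqVneq z 0.
    by apply: (@sub_countable _ _ _ set0) => //; apply: subset_card_le => w [/eqP].
  apply: (@sub_countable _ _ _ ([set w | pqZ p q (z * w)] `|` [set w | pqZ p q (z / w)])).
    by apply: subset_card_le => w [_ [h|h]]; [left|right].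
  apply: countable_U; apply: countable_pqZ => [||c]; try by [case: np|case: nq].
    by under eq_fun do rewrite mulrC; exact: countable_fib_mul.
  apply: (@sub_countable _ _ _ [set z / c]); last exact: countable1.
  apply: subset_card_le => w /= <-; have [->|w0] := eqVneq w 0; first by rewrite invr0 mulr0 invr0 mulr0.
  by rewrite invfM invrK mulrA mulfV// mul1r.
rewrite /BC_contour_integral -/p -/q.
have -> : contour_integral_n Ct (BC_integrand x) = clean_int n p q (par_seq x) Ct.
  apply: (eq_clean_int np nq ad cB cQ) => zs hz hQ; apply: (BC_integrandE px ad hz) => i j ij.
  have z0 : tnth zs i != 0.
    by apply/eqP => e; have [h _] := hz i; apply: ad.1; rewrite -e.
  by split=> h; apply: (hQ i j ij); split=> //; [left|right].
rewrite (clean_value np nq tn (size_par_seq x) tp ad) qpochE ?np.2// qpochE ?nq.2//.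
have qn (r : R[i]) : nome r -> qp r r != 0.
  move=> [r0 r1]; apply: qp_neq0 => // j; rewrite -exprSr; apply/eqP => e.
  have h : cabs (r ^+ j.+1) < 1 by rewrite cabsX exprn_ilt1 ?cabs_ge0.
  by rewrite e cabs1 ltxx in h.
move: (qp p p) (qp q q) (pair_prod _ _ _) (qn p np) (qn q nq) => a b c a0 b0.
have n0 : n`!%:R != 0 :> R[i] by rewrite pnatr_eq0 -lt0n fact_gt0.
rewrite expr_div_n exprMn; field.
by rewrite !expf_neq0 ?n0 ?pnatr_eq0.
Qed.

(** For n = 0 the integral is 1 by definition, and [value0] is needed. Otherwise [xget] returns the
    integral over some admissible contour, and all of them give the same value. *)
Lemma I_BC_value x : param_set x -> gen (par_p x) (par_q x) (par_seq x) ->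
  I_BC x = pair_prod (par_p x) (par_q x) (par_seq x).
Proof.
move=> px g; have [np nq tp tn] := param_setP px.
have [Ct ad] := exists_adm np nq tn g; rewrite /I_BC.
case: eqP => [n0|_].
  have st : size (par_seq x) = 4%N by rewrite size_par_seq n0.
  by rewrite (value0 np nq tn st tp ad).
have [|C2 ad2 ->] := @xgetPex _ 0 [set v | exists2 C, admissible x C & v = BC_contour_integral x C].
  by exists (BC_contour_integral x Ct), Ct => //; apply/admissibleP.
exact: BC_contour_integralE.
Qed.

End Link.

(** * Numerator and denominator on the parameter space *)

Section Meromorphy.
Variables (R : realType) (n : nat).
Notation C := (R[i])^o.
Notation N := (2 * n + 4)%N.
Local Opaque dp Th.
Implicit Types (x y : params R n).

Lemma ball_params x y (e : R[i]) : 0 < e -> ball x e y <->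
  [/\ forall r, ball (par_t x r : C) e (par_t y r), ball (par_p x : C) e (par_p y) & ball (par_q x : C) e (par_q y)].
Proof.
move=> e0; split=> [[[[h0 h1] h2] h3]|[h1 h2 h3]]; first by split=> // r; exact: h1.
split; first split; [split|exact: h2|exact: h3]; first exact: e0.
by move=> i j; rewrite (ord1 i); exact: h1.
Qed.

Lemma ballC (a b : R[i]) (e : R) : ball (a : C) e%:C (b : C) <-> cabs (a - b) < e.
Proof. by rewrite -ball_normE /ball_ /= normcE_cabs ltcR. Qed.

(** Otherwise [h] would lie in the ball of radius |l h| around 0, against the hypothesis on
    balls. *)
Lemma coord_le (l : params R n -> R[i]) : l 0 = 0 ->
  (forall x y (e : R), 0 < e -> ball x e%:C y -> cabs (l x - l y) < e) -> forall h, cabs (l h) <= vabs h.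
Proof.
move=> l0 lb h; rewrite leNgt; apply/negP => lt.
have c0 : 0 < cabs (l h) by apply: le_lt_trans lt; exact: vabs_ge0.
have : ball (0 : params R n) (cabs (l h))%:C h.
  by rewrite -ball_normE /ball_ /= sub0r normrN normE_vabs ltcR.
by move=> /(lb _ _ _ c0); rewrite l0 sub0r cabsN ltxx.
Qed.

Lemma par_t_le r (h : params R n) : cabs (par_t h r) <= vabs h.
Proof.
apply: (@coord_le (fun x => par_t x r)); first by rewrite /par_t /= mxE.
by move=> x y e e0 /ball_params[]; rewrite ?ltcR// => /(_ r)/ballC.
Qed.

Lemma par_p_le (h : params R n) : cabs (par_p h) <= vabs h.
Proof.
by apply: (@coord_le (@par_p R n)) => // x y e e0 /ball_params[]; rewrite ?ltcR// => _ /ballC.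
Qed.

Lemma par_q_le (h : params R n) : cabs (par_q h) <= vabs h.
Proof.
by apply: (@coord_le (@par_q R n)) => // x y e e0 /ball_params[]; rewrite ?ltcR// => _ _ /ballC.
Qed.

(** The pairs with r = s are included although the gamma product has none: off the zeros of this
    function an admissible contour exists ([den_gen]). The numerator carries the same additional
    factors. *)
Definition den y : R[i] := \prod_(r < N) \prod_(s < N | (r <= s)%N) dp (par_t y r * par_t y s) (par_p y) (par_q y).

(* On the parameter space the omitted product is pq/(t_r t_s); written this way it is entire. *)
Definition num y : R[i] :=
  (\prod_(r < N) \prod_(s < N | (r < s)%N) dp (\prod_(u < N | (u != r) && (u != s)) par_t y u) (par_p y) (par_q y)) *
  \prod_(r < N) dp (par_t y r * par_t y r) (par_p y) (par_q y).

Lemma differentiable_num_den y : cabs (par_p y) < 1 -> cabs (par_q y) < 1 ->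
  differentiable (num : _ -> C) y /\ differentiable (den : _ -> C) y.
Proof.
move=> p1 q1; have [r [pr qr] r1] := mid_lt1 p1 q1.
(* With [l] both as radius and as weight, the jet norm of [p] is at most |p| + 2 l < 1, because |p|
   < r; the same holds for [q]. *)
pose l := (1 - r) / 2; have l0 : 0 < l by rewrite divr_gt0// subr_gt0.
have jt s : isjet y l l (fun x => par_t x s) (cabs (par_t y s) + l + l).
  apply: (isjet_lin y l0 l0); last exact: par_t_le.
  by move=> a u v; rewrite /par_t /= !mxE.
have jp : isjet y l l (@par_p R n) (cabs (par_p y) + l + l).
  by apply: (isjet_lin y l0 l0); last exact: par_p_le.
have jq : isjet y l l (@par_q R n) (cabs (par_q y) + l + l).
  by apply: (isjet_lin y l0 l0); last exact: par_q_le.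
have Kp : cabs (par_p y) + l + l < 1 by rewrite /l; lra.
have Kq : cabs (par_q y) + l + l < 1 by rewrite /l; lra.
have jdp (f : params R n -> R[i]) : (exists K, isjet y l l f K) -> exists K, isjet y l l (fun x => dp (f x) (par_p x) (par_q x)) K.
  by move=> [K jf]; exact: (isjet_dp l0 l0 jf jp jq Kp Kq).
have jtt r' s : exists K, isjet y l l (fun x => par_t x r' * par_t x s) K.
  by eexists; exact: (isjetM l0 (jt r') (jt s)).
have [Kn jn] : exists K, isjet y l l num K.
  have [K1 j1] : exists K, isjet y l l (fun y => \prod_(r < N) \prod_(s < N | (r < s)%N)
      dp (\prod_(u < N | (u != r) && (u != s)) par_t y u) (par_p y) (par_q y)) K.
    apply: (isjet_prod l0) => i _; apply: (isjet_prod l0) => j _; apply: jdp.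
    by apply: (isjet_prod l0) => u _; eexists; exact: jt.
  have [K2 j2] : exists K, isjet y l l (fun y => \prod_(r < N) dp (par_t y r * par_t y r) (par_p y) (par_q y)) K.
    by apply: (isjet_prod l0) => i _; apply: jdp; exact: jtt.
  by eexists; exact: (isjetM l0 j1 j2).
have [Kd jd] : exists K, isjet y l l den K.
  by apply: (isjet_prod l0) => i _; apply: (isjet_prod l0) => j _; apply: jdp; exact: jtt.
by split; [exact: (isjet_differentiable l0 l0 jn)|exact: (isjet_differentiable l0 l0 jd)].
Qed.

Lemma den_neq0 y r s : den y != 0 -> dp (par_t y r * par_t y s) (par_p y) (par_q y) != 0.
Proof.
rewrite /den => /prodf_neq0 h; have [rs|sr] := leqP r s.
  by have /prodf_neq0/(_ s rs) := h r isT.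
by rewrite mulrC; have /prodf_neq0/(_ r (ltnW sr)) := h s isT.
Qed.

Lemma den_gen y : param_set y -> den y != 0 -> gen (par_p y) (par_q y) (par_seq y).
Proof.
move=> /param_setP[np nq _ _] dn _ _ i j /mapP[r _ ->] /mapP[s _ ->]; apply/eqP => e.
by have /eqP := den_neq0 r s dn; apply; apply: (@dp_eq0 _ _ _ _ i j) => //; [case: np|case: nq].
Qed.

Lemma num_den y : param_set y -> den y != 0 ->
  \prod_(r < N) \prod_(s < N | (r < s)%N) ellGamma (par_t y r * par_t y s) (par_p y) (par_q y) = num y / den y.
Proof.
move=> py dn; have [np nq tp /allP tn] := param_setP py.
have t0 r : par_t y r != 0 by apply: tn; exact: mem_par_seq.
have e1 : den y = \prod_(r < N) \prod_(s < N | (r < s)%N) dp (par_t y r * par_t y s) (par_p y) (par_q y) *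
    \prod_(r < N) dp (par_t y r * par_t y r) (par_p y) (par_q y).
  rewrite /den -big_split /=; apply: eq_bigr => r _; rewrite (bigD1 r)//= mulrC.
  by congr (_ * _); apply: eq_bigl => s; rewrite ltn_neqAle andbC eq_sym.
have e2 : \prod_(r < N) \prod_(s < N | (r < s)%N) dp (\prod_(u < N | (u != r) && (u != s)) par_t y u) (par_p y) (par_q y) =
    \prod_(r < N) \prod_(s < N | (r < s)%N) dp (par_p y * par_q y / (par_t y r * par_t y s)) (par_p y) (par_q y).
  apply: eq_bigr => r _; apply: eq_bigr => s rs; apply: (f_equal (fun w => dp w (par_p y) (par_q y))).
  rewrite -tp prod_par_seq [in RHS](bigD1 r)//= [in RHS](bigD1 s)/=; last by rewrite eq_sym neq_ltn rs.
  by move: (\prod_(_ < _ | _) _) => w; field; rewrite !t0.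
have e3 : \prod_(r < N) \prod_(s < N | (r < s)%N) ellGamma (par_t y r * par_t y s) (par_p y) (par_q y) =
    (\prod_(r < N) \prod_(s < N | (r < s)%N) dp (par_p y * par_q y / (par_t y r * par_t y s)) (par_p y) (par_q y)) /
    (\prod_(r < N) \prod_(s < N | (r < s)%N) dp (par_t y r * par_t y s) (par_p y) (par_q y)).
  rewrite -prodf_div; apply: eq_bigr => r _; rewrite -prodf_div; apply: eq_bigr => s _.
  by rewrite ellGamma_Gam// ?mulf_neq0 ?t0//; exact: den_neq0.
have n0 : \prod_(r < N) dp (par_t y r * par_t y r) (par_p y) (par_q y) != 0.
  by apply/prodf_neq0 => r _; exact: den_neq0.
have al (a b c : R[i]) : c != 0 -> a / b = a * c / (b * c).
  by move=> c0; rewrite invfM mulrACA mulfV// mulr1.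
by rewrite e3 e1 /num e2; exact: al.
Qed.

(** Multiplying the parameters by powers of 1 + d with exponents of sum 0 stays on the hypersurface,
    and for suitable small d no product of two parameters, squares included, lies in the group
    generated by [p] and [q]. *)
Lemma closure_den x : param_set x -> closure (@param_set R n `&` [set y | (den y : C) != 0]) x.
Proof.
move=> px; have [np nq tp /allP tn] := param_setP px.
have t0 r : par_t x r != 0 by apply: tn; exact: mem_par_seq.
have lt3 : (2 * n + 3 < N)%N by rewrite ltn_add2l.
pose r0 := Ordinal lt3.
(* One exponent balances the 2 n + 3 others, and no two of them add up to 0, even if they are
   equal. *)
pose e (r : 'I_N) : int := if r == r0 then - (2 * n + 3)%N%:Z else 1.
have e_sum : \sum_(r < N) e r = 0.
  rewrite (bigD1 r0)//= {1}/e eqxx (eq_bigr (fun=> 1)); last by move=> r /negPf h; rewrite /e h.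
  by rewrite sumr_const cardC1 card_ord addn4 -addn3 /=; lia.
have e_neq r s : e r + e s != 0 by rewrite /e; case: ifP => _; case: ifP => _; apply/eqP; lia.
pose L := [seq (par_t x r * par_t x s, e r + e s) | r <- enum 'I_N, s <- enum 'I_N].
have hL ce : ce \in L -> ce.1 != 0 /\ ce.2 != 0.
  by move=> /allpairsP[[r s] /= [_ _ ->]]; split; [rewrite mulf_neq0|exact: e_neq].
have hd k : exists d : R, 0 < d < k.+1%:R^-1 /\ forall r s, ~ pqZ (par_p x) (par_q x) (par_t x r * par_t x s * (1 + d)%:C ^ (e r + e s)).
  have k0 : 0 < k.+1%:R^-1 :> R by rewrite invr_gt0 ltr0Sn.
  have [d dk dL] := generic_perturbation np nq k0 hL; exists d; split=> // r s.
  by apply: (dL (_, _)); apply/allpairsP; exists (r, s); rewrite !mem_enum.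
have [d_ dP] := choice hd.
have cd : ccvg \oo (fun k => (1 + d_ k)%:C) (1 : R[i]) by apply: ccvg_shrink => k; case: (dP k).
pose yt k : 'rV[R[i]]_N := \row_r (par_t x r * (1 + d_ k)%:C ^ e r).
pose y_ k : params R n := (yt k, par_p x, par_q x).
have ytE k r : par_t (y_ k) r = par_t x r * (1 + d_ k)%:C ^ e r by rewrite /par_t /= mxE.
have d0 k : (1 + d_ k)%:C != 0 :> R[i] by apply: real_1D_neq0; case: (dP k) => /andP[].
have cy : y_ @ \oo --> x.
  apply/cvg_ballP => eps eps0.
  have epsE : eps = (complex.Re eps)%:C by have /ger0_Im := ltW eps0; case: (eps) => a b /= ->.
  have er0 : 0 < complex.Re eps by move: eps0; rewrite epsE ltcR.
  have ct r : ccvg \oo (fun k => par_t x r * (1 + d_ k)%:C ^ e r) (par_t x r).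
    have := @ccvg_exprz R nat \oo _ _ (e r) cd; rewrite exp1rz => h.
    by rewrite -[X in ccvg _ _ X]mulr1; apply: ccvgM; [exact: ccvg_cst|exact: h].
  have h : \forall k \near \oo, forall i, (i < N)%N -> forall r : 'I_N, r = i :> nat -> cabs (par_t x r - par_t (y_ k) r) < complex.Re eps.
    apply: near_ltn => i iN; have /ccvgP/(_ _ er0) := ct (Ordinal iN); apply: filterS => k hk r ri.
    have -> : r = Ordinal iN by exact: val_inj.
    by rewrite ytE; move: hk; rewrite cabsB.
  apply: filterS h => k hk; rewrite epsE; apply/ball_params; first by rewrite ltcR.
  by split=> [r| |]; apply/ballC; [exact: hk|rewrite subrr cabs0|rewrite subrr cabs0].
move=> B nB; have : \forall k \near \oo, B (y_ k) := cy _ nB.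
move=> [k _ /(_ k (leqnn k)) Bk]; exists (y_ k); split=> //; split.
  have [h1 h2 h3] := px; split=> //.
  rewrite -h3; under eq_bigr do rewrite ytE.
  rewrite big_split /= -[RHS]mulr1; congr (_ * _).
  have -> : \prod_(r < N) (1 + d_ k)%:C ^ e r = (1 + d_ k)%:C ^ (\sum_(r < N) e r).
    by elim/big_rec2: _ => [|i a b _ ->]; rewrite ?expr0z// expfzDr.
  by rewrite e_sum expr0z.
rewrite /= /den; apply/prodf_neq0 => r _; apply/prodf_neq0 => s _.
apply: dp_pqZ => //; rewrite !ytE; have [_ /(_ r s)] := dP k.
by rewrite mulrACA -expfzDr.
Qed.

End Meromorphy.

Theorem corollary3p2 (R : realType) (n : nat) :
  meromorphic_identity (@param_set R n) (@I_BC R n)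
    (fun x : params R n =>
       \prod_(r < 2 * n + 4) \prod_(s < 2 * n + 4 | (r < s)%N)
          ellGamma (par_t x r * par_t x s) (par_p x) (par_q x)).
Proof.
move=> x px; exists (@num R n), (@den R n); split; first exact: closure_den.
have [np nq _ _] := param_setP px; have [r [pr qr] r1] := mid_lt1 np.2 nq.2.
pose m := Num.min (r - cabs (par_p x)) (r - cabs (par_q x)).
have m0 : 0 < m by rewrite lt_min !subr_gt0 pr.
have m0c : 0 < m%:C :> R[i] by rewrite ltcR.
apply: filterS (nbhsx_ballx x m%:C m0c) => y /(ball_params x y m0c)[_ /ballC hp /ballC hq].
have m1 : m <= r - cabs (par_p x) by rewrite ge_min lexx.
have m2 : m <= r - cabs (par_q x) by rewrite ge_min lexx orbT.
have p1 : cabs (par_p y) < 1 by have := cabs_sub_le (par_p y) (par_p x); rewrite cabsB; lra.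
have q1 : cabs (par_q y) < 1 by have := cabs_sub_le (par_q y) (par_q x); rewrite cabsB; lra.
have [dn dd] := differentiable_num_den p1 q1; split=> // py dy.
split; last exact: num_den.
by rewrite (I_BC_value py (den_gen py dy)) -(prod_ellGamma py (den_gen py dy)); exact: num_den.
Qed.
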